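(* Let $\mathfrak h=\mathbb C^{n-1}$ be the reflection representation of $S_n$, and let $c=-r/m$ with integers $2\le m\le n$, $1\le r\le m-1$, $\gcd(r,m)=1$. For a partition $\lambda$ of $n$, the irreducible representation $L_c(\lambda)$ of $H_c(S_n,\mathfrak h)$ is aspherical if and only if $\lambda$ is not $m$-regular, i.e. if and only if $\lambda$ contains some (nonzero) part at least $m$ times.
   Context: Let $S$ be the set of reflections (transpositions) of $S_n$ in $\mathfrak h$; for $s\in S$, $\alpha_s\in\mathfrak h^*$, $\alpha_s^\vee\in\mathfrak h$ span the $-1$-eigenspaces of $s$, with $(\alpha_s,\alpha_s^\vee)=2$. $H_c(S_n,\mathfrak h)$ is the quotient of $\mathbb C[S_n]\ltimes T(\mathfrak h\oplus\mathfrak h^* )$ by $[x,x']=0$, $[y,y']=0$, $[y,x]=(y,x)-c\sum_{s\in S}(y,\alpha_s)(x,\alpha_s^\vee)s$ ($x,x'\in\mathfrak h^*$, $y,y'\in\mathfrak h$). $L_c(\lambda)$ is the unique irreducible quotient of the standard module $M_c(\lambda)=H_c(S_n,\mathfrak h)\otimes_{\mathbb C[S_n]\ltimes\mathbb C[\mathfrak h^*]}\pi_\lambda$, where $\pi_\lambda$ is the irreducible representation of $S_n$ attached to $\lambda$ (with $(n)$ corresponding to the trivial representation and $(1^n)$ to the sign representation), with $\mathfrak h$ acting on $\pi_\lambda$ by $0$. A nonzero module $M$ is aspherical if $e_{S_n}M=0$, where $e_{S_n}=\frac1{n!}\sum_{w\in S_n}w$. *)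

(* Defs.v *)
From HB Require Import structures.
From mathcomp Require Import all_boot all_order all_fingroup all_algebra.
From mathcomp Require Import boolp reals complex ring generic_quotient.

Set Implicit Arguments.
Unset Strict Implicit.
Unset Printing Implicit Defensive.

Import GRing.Theory.
Local Open Scope ring_scope.
Local Open Scope quotient_scope.

(******************************************************************************)
(* Quotients of K[G] |>< T(V), where T(V) is the tensor algebra of a          *)
(* G-module V: the algebra is presented by scalars, group elements and        *)
(* vectors, and [extra] is the set of additional relations.                     *)
(******************************************************************************)

Inductive term (K : Type) (G : Type) (V : Type) : Type :=
| Scal of K
| Grp of G
| Vec of V
| Add of term K G V & term K G V
| Mul of term K G V & term K G V.
Arguments Scal {K G V}.
Arguments Grp {K G V}.
Arguments Vec {K G V}.

HB.instance Definition _ K G V := gen_eqMixin (term K G V).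
HB.instance Definition _ K G V := gen_choiceMixin (term K G V).

Section SmashAlgebra.
Variables (K : fieldType) (G : finGroupType) (V : lmodType K).
Variable act : G -> V -> V.
Variable extra : term K G V -> term K G V -> Prop.
Implicit Types (s t u : term K G V).

Inductive cong : term K G V -> term K G V -> Prop :=
| cong_refl t : cong t t
| cong_sym s t : cong s t -> cong t s
| cong_trans s t u : cong s t -> cong t u -> cong s u
| cong_add s s' t t' : cong s s' -> cong t t' -> cong (Add s t) (Add s' t')
| cong_mul s s' t t' : cong s s' -> cong t t' -> cong (Mul s t) (Mul s' t')
| cong_addA s t u : cong (Add s (Add t u)) (Add (Add s t) u)
| cong_addC s t : cong (Add s t) (Add t s)
| cong_add0 t : cong (Add (Scal 0) t) t
| cong_addN t : cong (Add (Mul (Scal (-1)) t) t) (Scal 0)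
| cong_mulA s t u : cong (Mul s (Mul t u)) (Mul (Mul s t) u)
| cong_mul1l t : cong (Mul (Scal 1) t) t
| cong_mul1r t : cong (Mul t (Scal 1)) t
| cong_mulDl s t u : cong (Mul (Add s t) u) (Add (Mul s u) (Mul t u))
| cong_mulDr s t u : cong (Mul s (Add t u)) (Add (Mul s t) (Mul s u))
| cong_scalD a b : cong (Scal (a + b)) (Add (Scal a) (Scal b))
| cong_scalM a b : cong (Scal (a * b)) (Mul (Scal a) (Scal b))
| cong_scalC a t : cong (Mul (Scal a) t) (Mul t (Scal a))
| cong_grp1 : cong (Grp 1%g) (Scal 1)
| cong_grpM g h : cong (Grp (g * h)%g) (Mul (Grp g) (Grp h))
| cong_vec a v w : cong (Vec (a *: v + w)) (Add (Mul (Scal a) (Vec v)) (Vec w))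
| cong_smash g v : cong (Mul (Grp g) (Vec v)) (Mul (Vec (act g v)) (Grp g))
| cong_extra s t : extra s t -> cong s t.

Definition congb : rel (term K G V) := fun s t => `[< cong s t >].

Lemma congb_equiv : equiv_class_of congb.
Proof.
split=> [t|s t|t s u].
- by apply/asboolP/cong_refl.
- by apply/asboolP/asboolP; apply: cong_sym.
- by move=> /asboolP st /asboolP tu; apply/asboolP; apply: cong_trans st tu.
Qed.

Canonical congb_equiv_rel := EquivRelPack congb_equiv.

Definition smash_alg : Type := {eq_quot congb_equiv_rel}.
HB.instance Definition _ := EqQuotient.on smash_alg.
HB.instance Definition _ := Choice.on smash_alg.

Definition cls (t : term K G V) : smash_alg := \pi_({eq_quot congb_equiv_rel}) t.
Definition rep (x : smash_alg) : term K G V :=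
  repr (x : {eq_quot congb_equiv_rel}).

Lemma clsP s t : cls s = cls t <-> cong s t.
Proof.
split=> [/eqquotP/asboolP //|st].
by apply/eqquotP/asboolP.
Qed.

Lemma repK : cancel rep cls. Proof. exact: reprK. Qed.

Lemma rep_cls t : cong (rep (cls t)) t.
Proof. by apply/clsP; rewrite repK. Qed.

Definition sadd (x y : smash_alg) := cls (Add (rep x) (rep y)).
Definition smul (x y : smash_alg) := cls (Mul (rep x) (rep y)).
Definition sopp (x : smash_alg) := cls (Mul (Scal (-1)) (rep x)).

Lemma cls_add s t : sadd (cls s) (cls t) = cls (Add s t).
Proof. by apply/clsP; apply: cong_add; apply: rep_cls. Qed.
Lemma cls_mul s t : smul (cls s) (cls t) = cls (Mul s t).
Proof. by apply/clsP; apply: cong_mul; apply: rep_cls. Qed.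
Lemma cls_opp t : sopp (cls t) = cls (Mul (Scal (-1)) t).
Proof. by apply/clsP; apply: cong_mul; [apply: cong_refl | apply: rep_cls]. Qed.

Lemma saddA : associative sadd.
Proof.
move=> x y z; rewrite -(repK x) -(repK y) -(repK z) !cls_add.
exact/clsP/cong_addA.
Qed.
Lemma saddC : commutative sadd.
Proof. by move=> x y; apply/clsP/cong_addC. Qed.
Lemma sadd0 : left_id (cls (Scal 0)) sadd.
Proof. by move=> x; rewrite -(repK x) cls_add; apply/clsP/cong_add0. Qed.
Lemma saddN : left_inverse (cls (Scal 0)) sopp sadd.
Proof. by move=> x; rewrite -(repK x) cls_opp cls_add; apply/clsP/cong_addN. Qed.

HB.instance Definition _ := GRing.isZmodule.Build smash_alg saddA saddC sadd0 saddN.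

Lemma smulA : associative smul.
Proof.
move=> x y z; rewrite -(repK x) -(repK y) -(repK z) !cls_mul.
exact/clsP/cong_mulA.
Qed.
Lemma smul1r : left_id (cls (Scal 1)) smul.
Proof. by move=> x; rewrite -(repK x) cls_mul; apply/clsP/cong_mul1l. Qed.
Lemma smulr1 : right_id (cls (Scal 1)) smul.
Proof. by move=> x; rewrite -(repK x) cls_mul; apply/clsP/cong_mul1r. Qed.
Lemma smulDl : left_distributive smul +%R.
Proof.
move=> x y z; rewrite -(repK x) -(repK y) -(repK z) /GRing.add /=.
by rewrite !(cls_add, cls_mul); apply/clsP/cong_mulDl.
Qed.
Lemma smulDr : right_distributive smul +%R.
Proof.
move=> x y z; rewrite -(repK x) -(repK y) -(repK z) /GRing.add /=.
by rewrite !(cls_add, cls_mul); apply/clsP/cong_mulDr.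
Qed.

HB.instance Definition _ :=
  GRing.Zmodule_isPzRing.Build smash_alg smulA smul1r smulr1 smulDl smulDr.

Lemma clsD s t : cls (Add s t) = cls s + cls t.
Proof. by rewrite -cls_add. Qed.
Lemma clsM s t : cls (Mul s t) = cls s * cls t.
Proof. by rewrite -cls_mul. Qed.

Definition sscal (a : K) : smash_alg := cls (Scal a).
Definition sgrp (g : G) : smash_alg := cls (Grp g).
Definition svec (v : V) : smash_alg := cls (Vec v).

End SmashAlgebra.

Fixpoint term_map K G V W (f : V -> W) (t : term K G V) : term K G W :=
  match t with
  | Scal a => Scal a
  | Grp g => Grp g
  | Vec v => Vec (f v)
  | Add s t => Add (term_map f s) (term_map f t)
  | Mul s t => Mul (term_map f s) (term_map f t)
  end.

Lemma cong_map (K : fieldType) (G : finGroupType) (V W : lmodType K)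
    (actV : G -> V -> V) (actW : G -> W -> W) extraV extraW (f : V -> W) :
    linear f -> (forall g v, f (actV g v) = actW g (f v)) ->
    (forall s t, extraV s t -> extraW (term_map f s) (term_map f t)) ->
  forall s t, cong actV extraV s t ->
    cong actW extraW (term_map f s) (term_map f t).
Proof.
move=> f_lin f_act f_rel s t; elim=> /=; intros;
  rewrite ?f_lin -?f_act; try by constructor; auto.
- exact: cong_trans H0 H2.
- by rewrite f_act; apply: cong_smash.
Qed.

(******************************************************************************)
(* Extension of scalars: for phi : B -> A and a left B-module N, the left     *)
(* A-module A (x)_B N.                                                        *)
(******************************************************************************)

Inductive tterm (A N : Type) : Type :=
| TZero
| TOpp of tterm A N
| TAdd of tterm A N & tterm A N
| TPure of A & N.
Arguments TZero {A N}.

HB.instance Definition _ A N := gen_eqMixin (tterm A N).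
HB.instance Definition _ A N := gen_choiceMixin (tterm A N).

Section ExtendScalars.
Variables (B A : pzRingType) (phi : B -> A) (N : lmodType B).
Implicit Types (s t u : tterm A N).

Inductive tcong : tterm A N -> tterm A N -> Prop :=
| tcong_refl t : tcong t t
| tcong_sym s t : tcong s t -> tcong t s
| tcong_trans s t u : tcong s t -> tcong t u -> tcong s u
| tcong_add s s' t t' : tcong s s' -> tcong t t' -> tcong (TAdd s t) (TAdd s' t')
| tcong_opp s t : tcong s t -> tcong (TOpp s) (TOpp t)
| tcong_addA s t u : tcong (TAdd s (TAdd t u)) (TAdd (TAdd s t) u)
| tcong_addC s t : tcong (TAdd s t) (TAdd t s)
| tcong_add0 t : tcong (TAdd TZero t) t
| tcong_addN t : tcong (TAdd (TOpp t) t) TZero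
| tcong_pureDl a b v : tcong (TPure (a + b) v) (TAdd (TPure a v) (TPure b v))
| tcong_pureDr a v w : tcong (TPure a (v + w)) (TAdd (TPure a v) (TPure a w))
| tcong_bal a b v : tcong (TPure (a * phi b) v) (TPure a (b *: v)).

Definition tcongb : rel (tterm A N) := fun s t => `[< tcong s t >].

Lemma tcongb_equiv : equiv_class_of tcongb.
Proof.
split=> [t|s t|t s u].
- by apply/asboolP/tcong_refl.
- by apply/asboolP/asboolP; apply: tcong_sym.
- by move=> /asboolP st /asboolP tu; apply/asboolP; apply: tcong_trans st tu.
Qed.

Canonical tcongb_equiv_rel := EquivRelPack tcongb_equiv.

Definition ext_scalars : Type := {eq_quot tcongb_equiv_rel}.
HB.instance Definition _ := Choice.on ext_scalars.

Definition tcls (t : tterm A N) : ext_scalars :=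
  \pi_({eq_quot tcongb_equiv_rel}) t.
Definition trep (x : ext_scalars) : tterm A N :=
  repr (x : {eq_quot tcongb_equiv_rel}).

Lemma tclsP s t : tcls s = tcls t <-> tcong s t.
Proof.
split=> [/eqquotP/asboolP //|st].
by apply/eqquotP/asboolP.
Qed.

Lemma trepK : cancel trep tcls. Proof. exact: reprK. Qed.

Lemma trep_cls t : tcong (trep (tcls t)) t.
Proof. by apply/tclsP; rewrite trepK. Qed.

Fixpoint tscale (a : A) (t : tterm A N) : tterm A N :=
  match t with
  | TZero => TZero
  | TOpp t => TOpp (tscale a t)
  | TAdd s t => TAdd (tscale a s) (tscale a t)
  | TPure b v => TPure (a * b) v
  end.

Lemma tcong_scale a s t : tcong s t -> tcong (tscale a s) (tscale a t).
Proof.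
elim=> /=; intros; rewrite ?mulrDr ?mulrA; try by constructor.
exact: tcong_trans H0 H2.
Qed.

Definition tadd (x y : ext_scalars) := tcls (TAdd (trep x) (trep y)).
Definition topp (x : ext_scalars) := tcls (TOpp (trep x)).
Definition tscal (a : A) (x : ext_scalars) := tcls (tscale a (trep x)).

Lemma tcls_add s t : tadd (tcls s) (tcls t) = tcls (TAdd s t).
Proof. by apply/tclsP; apply: tcong_add; apply: trep_cls. Qed.
Lemma tcls_opp t : topp (tcls t) = tcls (TOpp t).
Proof. by apply/tclsP; apply: tcong_opp; apply: trep_cls. Qed.
Lemma tcls_scal a t : tscal a (tcls t) = tcls (tscale a t).
Proof. by apply/tclsP; apply: tcong_scale; apply: trep_cls. Qed.

Lemma taddA : associative tadd.
Proof.
move=> x y z; rewrite -(trepK x) -(trepK y) -(trepK z) !tcls_add.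
exact/tclsP/tcong_addA.
Qed.
Lemma taddC : commutative tadd.
Proof. by move=> x y; apply/tclsP/tcong_addC. Qed.
Lemma tadd0 : left_id (tcls TZero) tadd.
Proof. by move=> x; rewrite -(trepK x) tcls_add; apply/tclsP/tcong_add0. Qed.
Lemma taddN : left_inverse (tcls TZero) topp tadd.
Proof. by move=> x; rewrite -(trepK x) tcls_opp tcls_add; apply/tclsP/tcong_addN. Qed.

HB.instance Definition _ := GRing.isZmodule.Build ext_scalars taddA taddC tadd0 taddN.

Lemma tscalA a b x : tscal a (tscal b x) = tscal (a * b) x.
Proof.
rewrite -(trepK x) !tcls_scal; congr tcls.
by elim: (trep x) => //= [t ->|s -> t ->|c v]; rewrite ?mulrA.
Qed.
Lemma tscal1 : left_id 1 tscal.
Proof.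
move=> x; rewrite -(trepK x) !tcls_scal; congr tcls.
by elim: (trep x) => //= [t ->|s -> t ->|c v]; rewrite ?mul1r.
Qed.
Lemma tscalDr : right_distributive tscal +%R.
Proof.
move=> a x y; rewrite -(trepK x) -(trepK y) /GRing.add /=.
by rewrite !(tcls_add, tcls_scal).
Qed.
Lemma tscalDl x : {morph tscal^~ x : a b / a + b}.
Proof.
have tclsD s t : tcls (TAdd s t) = tcls s + tcls t by rewrite -tcls_add.
have tclsN t : tcls (TOpp t) = - tcls t by rewrite -tcls_opp.
move=> a b; rewrite -(trepK x) !tcls_scal.
elim: (trep x) => /= [|t|s IHs t IHt|c v].
- by rewrite (_ : tcls TZero = 0) ?addr0.
- by rewrite !tclsN => ->; rewrite opprD.
- by rewrite !tclsD IHs IHt addrACA.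
- by rewrite mulrDl -tclsD; apply/tclsP/tcong_pureDl.
Qed.

HB.instance Definition _ :=
  GRing.Zmodule_isLmodule.Build A ext_scalars tscalA tscal1 tscalDr tscalDl.

End ExtendScalars.

(******************************************************************************)
(* In MathComp (s * t) i = t (s i), so that (w v)_i = v_(w i) is a left       *)
(* action; it is v |-> perm_mx w *m v.                                        *)
(******************************************************************************)

Section Reflection.
Variables (K : fieldType) (n : nat).

Definition sum_zero : {vspace 'cV[K]_n} :=
  lker (linfun (mulmx (const_mx 1 : 'rV[K]_n) : 'cV[K]_n -> 'cV[K]_1)).

Definition hh : vectType K := subvs_of sum_zero.
Definition hdual : vectType K := 'Hom(hh, K^o).

Definition hact (w : 'S_n) : 'End(hh) :=
  linfun (vsproj sum_zero \o mulmx (perm_mx w) \o vsval).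
Definition hdual_act (w : 'S_n) (x : hdual) : hdual := (x \o hact w^-1)%VF.

Lemma sum_zeroP (v : 'cV[K]_n) : (v \in sum_zero) = (\sum_i v i ord0 == 0).
Proof.
rewrite memv_ker lfunE /=; apply/eqP/eqP => [/matrixP/(_ ord0 ord0)|v0].
  by rewrite !mxE => v0; rewrite -[RHS]v0; apply: eq_bigr => i _; rewrite mxE mul1r.
apply/matrixP=> i j; rewrite !mxE (ord1 j) -[RHS]v0.
by apply: eq_bigr => k _; rewrite mxE mul1r.
Qed.

Lemma hactE w (y : hh) i : vsval (hact w y) i ord0 = vsval y (w i) ord0.
Proof.
rewrite lfunE /= vsprojK -row_permE ?mxE //.
rewrite sum_zeroP; have := subvsP y; rewrite sum_zeroP => /eqP y0; apply/eqP.
by rewrite -[RHS]y0 [RHS](reindex_perm w) /=; apply: eq_bigr => j _; rewrite mxE.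
Qed.

(* For s = (i j), alpha_s = x_i - x_j and alpha_s^vee = e_i - e_j. *)
Definition root_fun (i j : 'I_n) (y : hh) : K^o :=
  vsval y i ord0 - vsval y j ord0.
Fact root_fun_is_linear i j : linear (root_fun i j).
Proof. by move=> a y z; rewrite /root_fun linearP !mxE /GRing.scale /=; ring. Qed.
HB.instance Definition _ i j :=
  GRing.isLinear.Build K hh K^o *:%R (root_fun i j) (root_fun_is_linear i j).

Definition root (i j : 'I_n) : hdual := linfun (root_fun i j).
Lemma rootE i j y : root i j y = vsval y i ord0 - vsval y j ord0.
Proof. by rewrite lfunE. Qed.

Definition coroot (i j : 'I_n) : hh :=
  vsproj sum_zero (delta_mx i ord0 - delta_mx j ord0).

Lemma corootE i j : vsval (coroot i j) = delta_mx i ord0 - delta_mx j ord0.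
Proof.
have sum1 (l : 'I_n) : \sum_k (k == l)%:R = 1 :> K.
  by rewrite (bigD1 l) //= eqxx big1 ?addr0 // => k /negPf ->.
rewrite vsprojK // sum_zeroP.
under eq_bigr do rewrite !mxE !andbT.
by rewrite sumrB !sum1 subrr.
Qed.

Lemma root_coroot i j : i != j -> root i j (coroot i j) = 2.
Proof.
move=> /negPf ij; rewrite rootE corootE !mxE !eqxx (eq_sym j i) ij /=.
by rewrite subr0 sub0r opprK.
Qed.

Lemma hact_coroot i j : hact (tperm i j) (coroot i j) = - coroot i j.
Proof.
apply: val_inj; apply/matrixP=> k l; rewrite (ord1 l) hactE linearN /=.
rewrite corootE !mxE !andbT opprB.
have tE a : (tperm i j k == a) = (k == tperm i j a).
  by rewrite -(inj_eq (@perm_inj _ (tperm i j))) tpermK.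
by rewrite !tE tpermL tpermR.
Qed.

Lemma hdual_act_root i j : hdual_act (tperm i j) (root i j) = - root i j.
Proof.
apply/lfunP=> y; rewrite comp_lfunE opp_lfunE !rootE tpermV !hactE.
by rewrite tpermL tpermR opprB.
Qed.

End Reflection.
Arguments hact {K n}.
Arguments hdual_act {K n}.
Arguments root {K n}.
Arguments coroot {K n}.

Section Cherednik.
Variables (K : fieldType) (n : nat).
Local Notation h := (hh K n).
Local Notation hd := (hdual K n).

Definition tcomm G V (s t : term K G V) : term K G V :=
  Add (Mul s t) (Mul (Scal (-1)) (Mul t s)).

Definition hsum : lmodType K := (h * hd)%type.
Definition hsum_act (w : 'S_n) (v : hsum) : hsum :=
  (hact w v.1, hdual_act w v.2).

Local Notation hterm := (term K 'S_n hsum).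
Definition ygen (y : h) : hterm := Vec (y, 0).
Definition xgen (x : hd) : hterm := Vec (0, x).

(* The sum over reflections runs over the pairs i < j, with s = (i j). *)
Inductive cherednik_rel (c : K) : hterm -> hterm -> Prop :=
| rel_xx x x' : cherednik_rel c (tcomm (xgen x) (xgen x')) (Scal 0)
| rel_yy y y' : cherednik_rel c (tcomm (ygen y) (ygen y')) (Scal 0)
| rel_yx y x : cherednik_rel c (tcomm (ygen y) (xgen x))
    (Add (Scal (x y))
      (Mul (Scal (- c))
        (\big[@Add _ _ _/Scal 0]_(ij : 'I_n * 'I_n | (ij.1 < ij.2)%N)
           Mul (Scal (root ij.1 ij.2 y * x (coroot ij.1 ij.2)))
               (Grp (tperm ij.1 ij.2))))).

Definition cherednik (c : K) : pzRingType :=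
  smash_alg hsum_act (cherednik_rel c).

Definition sym_idem (c : K) : cherednik c :=
  sscal _ _ (n`!%:R^-1) * \sum_(w : 'S_n) sgrp _ _ w.

(* C[S_n] |>< C[h^*], where C[h^*] = Sym(h). *)
Inductive borel_rel : term K 'S_n h -> term K 'S_n h -> Prop :=
| borel_yy y y' : borel_rel (tcomm (Vec y) (Vec y')) (Scal 0).

Definition borel_act (w : 'S_n) (y : h) : h := hact w y.
Definition borel : pzRingType := smash_alg borel_act borel_rel.

Definition borel_incl (c : K) (b : borel) : cherednik c :=
  cls _ _ (term_map (fun y : h => (y, 0) : hsum) (rep b)).

Lemma borel_inclE c t : borel_incl c (cls _ _ t) =
  cls _ _ (term_map (fun y : h => (y, 0) : hsum) t).
Proof.
apply/clsP; apply: cong_map (rep_cls _ _ t).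
- by move=> a y z; congr pair; rewrite /= scaler0 addr0.
- by move=> w y; rewrite /hsum_act /= /hdual_act comp_lfun0l.
- by move=> _ _ [y y'] /=; apply: rel_yy.
Qed.

End Cherednik.

(******************************************************************************)
(* The irreducible representation pi_lam = K[S_n] a_lam b_lam of S_n, where   *)
(* a_lam (resp. b_lam) is the sum (resp. signed sum) over the row (resp.      *)
(* column) stabilizer of the tableau of shape lam whose entries are           *)
(* 0, ..., n-1 in reading order: k sits in row [reshape_index lam k] and      *)
(* column [reshape_offset lam k]. Thus (n) gives the trivial representation   *)
(* and (1^n) the sign representation.                                         *)
(******************************************************************************)

Definition is_partition (n : nat) (lam : seq nat) : bool :=
  [&& sorted geq lam, 0%N \notin lam & sumn lam == n].

Definition m_regular (m : nat) (lam : seq nat) : bool :=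
  all (fun k => (k == 0%N) || (count_mem k lam < m)%N) lam.

Section Specht.
Variables (K : fieldType) (n : nat) (lam : seq nat).

Definition row_stab : {set 'S_n} :=
  [set w : 'S_n | [forall k, reshape_index lam (w k) == reshape_index lam k]].
Definition col_stab : {set 'S_n} :=
  [set w : 'S_n | [forall k, reshape_offset lam (w k) == reshape_offset lam k]].

Local Notation grp_alg := {ffun 'S_n -> K^o}.

Definition young_symmetrizer : grp_alg :=
  [ffun u => \sum_(p in row_stab) \sum_(q in col_stab)
               (-1) ^+ q * (u == (p * q)%g)%:R].

Definition ltrans (w : 'S_n) (f : grp_alg) : grp_alg :=
  [ffun u => f (w^-1 * u)%g].

Fact ltrans_is_linear w : linear (ltrans w).
Proof. by move=> a f g; apply/ffunP=> u; rewrite !ffunE. Qed.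
HB.instance Definition _ w :=
  GRing.isLinear.Build K grp_alg grp_alg *:%R (ltrans w) (ltrans_is_linear w).

Lemma ltrans1 f : ltrans 1 f = f.
Proof. by apply/ffunP=> u; rewrite ffunE invg1 mul1g. Qed.
Lemma ltransM v w f : ltrans (v * w) f = ltrans v (ltrans w f).
Proof. by apply/ffunP=> u; rewrite !ffunE invMg mulgA. Qed.

Definition specht : {vspace grp_alg} :=
  <<[seq ltrans w young_symmetrizer | w : 'S_n]>>%VS.

Lemma ltrans_specht w f : f \in specht -> ltrans w f \in specht.
Proof.
move=> /(memv_img (linfun (ltrans w))); rewrite lfunE; apply/subvP.
rewrite limg_span; apply/span_subvP=> _ /mapP[_ /imageP[v _ ->] ->].
by rewrite lfunE /= -ltransM; apply/memv_span/image_f.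
Qed.

(* pi_lam as a module over C[S_n] |>< C[h^*], with h acting by 0. *)
Definition pi_rep : Type := subvs_of specht.
HB.instance Definition _ := GRing.Zmodule.on pi_rep.

Definition pi_scale (a : K) (v : pi_rep) : pi_rep := a *: (v : subvs_of specht).
Definition pi_grp (w : 'S_n) (v : pi_rep) : pi_rep :=
  vsproj specht (ltrans w (vsval v)).

Fixpoint pi_eval (t : term K 'S_n (hh K n)) (v : pi_rep) : pi_rep :=
  match t with
  | Scal a => pi_scale a v
  | Grp w => pi_grp w v
  | Vec _ => 0
  | Add s t => pi_eval s v + pi_eval t v
  | Mul s t => pi_eval s (pi_eval t v)
  end.

Lemma pi_grpE w v : vsval (pi_grp w v) = ltrans w (vsval v).
Proof. by rewrite vsprojK // ltrans_specht // subvsP. Qed.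

Lemma pi_eval_linear t (a : K) (v w : subvs_of specht) :
  pi_eval t (a *: v + w : subvs_of specht)
  = (a *: (pi_eval t v : subvs_of specht) + pi_eval t w : subvs_of specht).
Proof.
elim: t v w => [b|g|y|s IHs t IHt|s IHs t IHt] v w /=.
- by rewrite /pi_scale scalerDr !scalerA mulrC.
- by rewrite /pi_grp !linearP.
- by rewrite scaler0 addr0.
- by rewrite IHs IHt scalerDr addrACA.
- by rewrite IHt IHs.
Qed.

Lemma pi_evalD t v w : pi_eval t (v + w) = pi_eval t v + pi_eval t w.
Proof. by have := pi_eval_linear t 1 v w; rewrite !scale1r. Qed.
Lemma pi_eval0 t : pi_eval t 0 = 0.
Proof. by apply: (addrI (pi_eval t 0)); rewrite -pi_evalD !addr0. Qed.
Lemma pi_evalZ t a v : pi_eval t (pi_scale a v) = pi_scale a (pi_eval t v).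
Proof.
have := pi_eval_linear t a v (0 : subvs_of specht).
by rewrite [pi_eval t (0 : subvs_of _)]pi_eval0 !addr0.
Qed.

Lemma pi_eval_cong s t : cong (@borel_act K n) (@borel_rel K n) s t ->
  forall v, pi_eval s v = pi_eval t v.
Proof.
elim=> /=; rewrite /pi_scale; intros.
- by [].
- by rewrite H0.
- by rewrite H0 H2.
- by rewrite H0 H2.
- by rewrite H2 H0.
- by rewrite addrA.
- by rewrite addrC.
- by rewrite scale0r add0r.
- by rewrite scaleN1r addNr scale0r.
- by [].
- by rewrite scale1r.
- by rewrite scale1r.
- by [].
- by rewrite pi_evalD.
- by rewrite scalerDl.
- by rewrite scalerA.
- by symmetry; apply: pi_evalZ.
- by rewrite scale1r; apply: val_inj; rewrite [LHS]pi_grpE ltrans1.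
- apply: val_inj; rewrite [LHS]pi_grpE [RHS]pi_grpE ltransM; congr ltrans.
  by symmetry; apply: pi_grpE.
- by rewrite scaler0 addr0.
- by rewrite /pi_grp !linear0.
- by case: H => y y' /=; rewrite /pi_scale scale0r scaler0 addr0.
Qed.

Definition pi_act (b : borel K n) (v : pi_rep) : pi_rep := pi_eval (rep b) v.

Lemma pi_actE t v : pi_act (cls _ _ t) v = pi_eval t v.
Proof. by apply: pi_eval_cong; apply: rep_cls. Qed.

Lemma pi_actA a b v : pi_act a (pi_act b v) = pi_act (a * b) v.
Proof. by rewrite -(repK a) -(repK b) -clsM !pi_actE. Qed.
Lemma pi_act1 : left_id 1 pi_act.
Proof. by move=> v; rewrite [LHS]pi_actE /= /pi_scale scale1r. Qed.
Lemma pi_actDr : right_distributive pi_act +%R.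
Proof. by move=> a v w; apply: pi_evalD. Qed.
Lemma pi_actDl v : {morph pi_act^~ v : a b / a + b}.
Proof. by move=> a b; rewrite -(repK a) -(repK b) -clsD !pi_actE. Qed.

HB.instance Definition _ := GRing.Zmodule_isLmodule.Build (borel K n) pi_rep
  pi_actA pi_act1 pi_actDr pi_actDl.

Definition standard_module (c : K) : lmodType (cherednik n c) :=
  ext_scalars (@borel_incl K n c) pi_rep.

End Specht.

Definition irreducible_module (A : pzRingType) (L : lmodType A) : Prop :=
  (exists v : L, v != 0) /\
  forall S : {pred L}, submod_closed S -> S =i pred1 0 \/ S =i predT.

Definition irreducible_quotient (A : pzRingType) (M L : lmodType A) : Prop :=
  irreducible_module L /\
  exists f : {linear M -> L}, forall v : L, exists u : M, f u = v.

Definition aspherical (K : fieldType) (n : nat) (c : K)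
    (L : lmodType (cherednik n c)) : Prop :=
  (exists v : L, v != 0) /\ forall v : L, sym_idem n c *: v = 0.

(* Main.v *)
From HB Require Import structures.
Require Import Defs.
From mathcomp Require Import all_boot all_order all_fingroup all_algebra.
From mathcomp Require Import boolp functions spectral reals complex.
From mathcomp Require Import zify ring lra.
Set Implicit Arguments.
Unset Strict Implicit.
Unset Printing Implicit Defensive.
Import Order.TTheory GRing.Theory Num.Theory.
Local Open Scope ring_scope.

(* Put b = r/m, so that c = -b. The simple module L_c(lambda) embeds in the costandard module of
   pi_lambda, realized as the functions F(U) from multi-indices to U (coefficient functions of
   polynomials) with the shifts as Dunkl operators; its graded pieces Lg are spanned by monomials in
   the X_i applied to constants, and asphericity says that no Lg piece has a nonzero invariant.

   The symmetric polynomials in the commuting operators z_i = X_i Y_i + b sum_{j > i} s_ij act on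
   invariants. They are triangular for the sum of squares of the degrees, so that their joint
   eigenvalues on the invariants of F(U) are the multisets of codes m beta_i + r w_i, where beta is
   weakly increasing and w is a weight of the Jucys-Murphy elements on U, i.e. the word of contents of
   a standard tableau, increasing on the blocks of beta. Counting them over a composition series of
   F(U) compares the invariants of the simple factors; simple modules with nonzero invariants have
   independent spherical characters because their lowest invariants have distinct eigenvalues.

   If lambda is m-regular, reading its boxes along the ladders row + (m-1) col = const gives a code
   such that any other factor contributing it would have a larger content sum, whereas the ladder
   words maximize the content sum among the words with these residues. Hence the invariants with this
   code already live in L_c(lambda).

   If some part q of lambda occurs m times, remove m boxes from each of the first q columns and let
   gamma be the beta-numbers of the column lengths. The slots of the codes are invariant under the
   translation (beta, w) -> (beta + r, w - m), so the product of the transfer matrices commutes with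
   the shift by m, and det (1 + x D) = 1 for the nilpotent shift D gives
   sum_{|S| = q} det M[gamma + m 1_S] = 0. Its coefficients express the spherical character attached to
   lambda by those of partitions with larger content sum, so by independence the invariants of
   L_c(lambda) vanish. *)

(** * Dunkl operators on functions of multi-indices *)

(** The algebra of the statement has h of dimension n - 1, while the z_i need all n coordinates. The
    model is therefore built for C^n, and the sum of the coordinates is split off at the end by the
    Heisenberg pair formed by the sums of the X_i and of the Y_i. The abstract quotient L has no
    grading and no given map to the model: a relation between expressions in the two modules
    replaces it, and an Euler element shows that its kernel is trivial. The lowest weight space is
    an irreducible constituent of the Specht space that survives in L; every constituent contains
    the weight of the row-reading tableau. Weight-space dimensions enter as positive integers,
    cleared by a common multiple. Characters are cut at a degree D, where one polynomial p with
    values (n+1)^e on codes separates all multisets of codes. The z_i may act with Jordan blocks, so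
    multiplicities are ranks of a spectral idempotent composed with the symmetrizer, which are
    additive. The bound r < m makes the transfer over r times unable to lift a position by m, hence
    the shift nilpotent; coprimality lets codes see contents modulo m. *)

Section Multiindex.
Variable n : nat.

Definition mi := {ffun 'I_n -> nat}.
Implicit Types (a : mi) (g : 'S_n).

Definition minc a k : mi := [ffun i => (a i + (i == k))%N].
Definition mdec a k : mi := [ffun i => (a i - (i == k))%N].
Definition mupd a j l x y : mi :=
  [ffun i => if i == j then x else if i == l then y else a i].
Definition mact g a : mi := [ffun i => a ((g^-1)%g i)].
Definition mzero : mi := [ffun => 0%N].
Definition mdg a := (\sum_i a i)%N.
Definition madd a a' : mi := [ffun i => (a i + a' i)%N].

Lemma mactM g h a : mact (g * h)%g a = mact h (mact g a).
Proof. by apply/ffunP=> i; rewrite !ffunE invMg permM. Qed.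

Lemma mact1 a : mact 1%g a = a.
Proof. by apply/ffunP=> i; rewrite ffunE invg1 perm1. Qed.

Lemma mact_minc g a k : mact g (minc a k) = minc (mact g a) (g k).
Proof.
by apply/ffunP=> i; rewrite !ffunE -(inj_eq (@perm_inj _ g)) permKV.
Qed.

Lemma mact0 g : mact g mzero = mzero.
Proof. by apply/ffunP=> i; rewrite !ffunE. Qed.

Lemma mdg_minc a k : mdg (minc a k) = (mdg a).+1.
Proof.
rewrite /mdg (eq_bigr (fun i => a i + (i == k))%N); last by move=> i _; rewrite ffunE.
rewrite big_split /= (bigD1 k) //= [X in (_ + X)%N](bigD1 k) //= eqxx.
by rewrite [X in (_ + (1 + X))%N]big1 ?addn0 ?addn1 // => i /negPf->.
Qed.

Lemma mdg0 : mdg mzero = 0%N.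
Proof. by rewrite /mdg big1 // => i _; rewrite ffunE. Qed.

Lemma mdg_mact g a : mdg (mact g a) = mdg a.
Proof.
rewrite /mdg [RHS](reindex_perm (g^-1)%g) /=.
by apply: eq_bigr => i _; rewrite ffunE.
Qed.

Lemma mdg_madd a a' : mdg (madd a a') = (mdg a + mdg a')%N.
Proof. by rewrite /mdg -big_split; apply: eq_bigr => i _; rewrite ffunE. Qed.

Lemma mincC a k l : minc (minc a k) l = minc (minc a l) k.
Proof. by apply/ffunP=> i; rewrite !ffunE addnAC. Qed.

Lemma mincK a k : mdec (minc a k) k = a.
Proof. by apply/ffunP=> i; rewrite !ffunE addnK. Qed.

Lemma mdecK a k : (0 < a k)%N -> minc (mdec a k) k = a.
Proof.
by move=> ak; apply/ffunP=> i; rewrite !ffunE; case: eqP => [->|_]; rewrite ?subn0 ?addn0 ?subnK.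
Qed.

(** Increments are what the operators [Yop k] probe, so this is the induction behind the operator
    identities below: compare the values at [mzero], then apply each [Yop k]. *)
Lemma mi_ind (P : mi -> Prop) :
  P mzero -> (forall a k, P a -> P (minc a k)) -> forall a, P a.
Proof.
move=> P0 PS a; have [d] := ubnP (mdg a); elim: d a => // d IH a ad.
have [/eqP a0|] := boolP (mdg a == 0%N).
  suff -> : a = mzero by [].
  apply/ffunP=> i; rewrite ffunE; move/eqP: a0; rewrite /mdg sum_nat_eq0.
  by move=> /forallP/(_ i)/eqP.
rewrite /mdg sum_nat_eq0 negb_forall => /existsP[k]; rewrite implyTb -lt0n => ak.
rewrite -(mdecK ak); apply: PS; apply: IH.
by move: ad; rewrite -[in X in X -> _](mdecK ak) mdg_minc.
Qed.

Lemma mact_tperm_upd j l a : mact (tperm j l) a = mupd a j l (a l) (a j).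
Proof.
apply/ffunP=> i; rewrite !ffunE tpermV.
by case: tpermP => [->|->|/eqP/negPf-> /eqP/negPf->//]; rewrite eqxx //; case: eqP => [->|].
Qed.

End Multiindex.

Section Reps.
Variables (K : fieldType) (n : nat).

Record srep := SRep {
  sU :> vectType K;
  sact : 'S_n -> 'End(sU);
  sact1 : forall v, sact 1%g v = v;
  sactM : forall g h v, sact (g * h)%g v = sact g (sact h v) }.

Lemma sactK (U : srep) g : cancel (sact U g) (sact U (g^-1)%g).
Proof. by move=> v; rewrite -sactM mulVg sact1. Qed.
Lemma sactKV (U : srep) g : cancel (sact U (g^-1)%g) (sact U g).
Proof. by move=> v; rewrite -sactM mulgV sact1. Qed.
End Reps.

Section Model.
Variables (K : fieldType) (n : nat) (b : K) (U : srep K n).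
Local Notation mi := (mi n).

(** The value at [a] stands for the constant term of Y^a applied to the vector: the module is
    coinduced, and the Y_k commute by construction. Supports are unrestricted; finite dimension
    returns through [hom]. *)
Definition F : lmodType K := (mi -> U).
Implicit Types (f h : F) (a : mi) (g : 'S_n).

(* The operators are sealed: F is a function type, so unification would
   otherwise unfold them when matching sums. *)
Definition gop_def g f : F := fun a => sact U g (f (mact g a)).
Fact gop_key : {T : 'S_n -> F -> F | T = gop_def}. Proof. by exists gop_def. Qed.
Definition gop := sval gop_key.
Lemma gopE g f a : gop g f a = sact U g (f (mact g a)).
Proof. by rewrite /gop (svalP gop_key). Qed.

Definition Yop_def k f : F := fun a => f (minc a k).
Fact Yop_key : {T : 'I_n -> F -> F | T = Yop_def}. Proof. by exists Yop_def. Qed.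
Definition Yop := sval Yop_key.
Lemma YopE k f a : Yop k f a = f (minc a k).
Proof. by rewrite /Yop (svalP Yop_key). Qed.

Definition Xterm (f : F) a j l (t : nat) : U :=
  sact U (tperm j l) (f (mupd a j l (a j + a l - t.+1)%N t)).

(** The transpose of a Dunkl operator on the monomials Y^a. The two inner sums together run through
    the monomials of the divided difference (Y^a - s_jl Y^a)/(Y_j - Y_l); a difference of two full
    sums avoids comparing [a j] with [a l]. At [a j = 0] the truncated [mdec] is harmless because of
    the factor [a j]. *)
Definition Xop_def j f : F := fun a =>
  f (mdec a j) *+ a j +
  b *: \sum_(l | l != j) (\sum_(t < a j) Xterm f a j l t - \sum_(t < a l) Xterm f a j l t).
Fact Xop_key : {T : 'I_n -> F -> F | T = Xop_def}. Proof. by exists Xop_def. Qed.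
Definition Xop := sval Xop_key.
Lemma XopE j f a : Xop j f a = f (mdec a j) *+ a j +
  b *: \sum_(l | l != j) (\sum_(t < a j) Xterm f a j l t - \sum_(t < a l) Xterm f a j l t).
Proof. by rewrite /Xop (svalP Xop_key). Qed.

Lemma FD f h a : (f + h) a = f a + h a. Proof. by []. Qed.
Lemma FN f a : (- f) a = - f a. Proof. by []. Qed.
Lemma FZ c f a : (c *: f) a = c *: f a. Proof. by []. Qed.
Lemma F0 a : (0 : F) a = 0. Proof. by []. Qed.
Lemma fsumE (I : Type) (r : seq I) (P : pred I) (G : I -> F) a :
  (\sum_(i <- r | P i) G i) a = \sum_(i <- r | P i) G i a.
Proof. exact: (big_morph (fun f : F => f a)). Qed.

Fact gop_is_linear g : linear (gop g).
Proof. by move=> c f h; apply/funext=> a; rewrite !(FD, FZ, gopE) linearP. Qed.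
HB.instance Definition _ g := GRing.isLinear.Build K F F *:%R (gop g) (gop_is_linear g).

Fact Yop_is_linear k : linear (Yop k).
Proof. by move=> c f h; apply/funext=> a; rewrite !(FD, FZ, YopE). Qed.
HB.instance Definition _ k := GRing.isLinear.Build K F F *:%R (Yop k) (Yop_is_linear k).

Lemma XtermP c f h a j l t :
  Xterm (c *: f + h) a j l t = c *: Xterm f a j l t + Xterm h a j l t.
Proof. by rewrite /Xterm !(FD, FZ) linearP. Qed.

Fact Xop_is_linear j : linear (Xop j).
Proof.
move=> c f h; apply/funext=> a; rewrite FD FZ !XopE FD FZ.
under eq_bigr => l _.
  under eq_bigr do rewrite XtermP.
  under [X in _ - X]eq_bigr do rewrite XtermP.
  rewrite !big_split /= -!scaler_sumr opprD addrACA -scalerBr.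
  over.
rewrite big_split /= -scaler_sumr scalerDr (scalerDr c) !scalerA (mulrC c) addrACA.
by congr (_ + _); rewrite mulrnDl -scalerMnr.
Qed.
HB.instance Definition _ j := GRing.isLinear.Build K F F *:%R (Xop j) (Xop_is_linear j).

(** The commutator [Y_k, X_j] prescribed by the algebra of C^n with parameter c = -b. *)
Definition Cop_def k j f : F :=
  if k == j then f + b *: \sum_(l | l != k) gop (tperm k l) f
  else - (b *: gop (tperm k j) f).
Fact Cop_key : {T : 'I_n -> 'I_n -> F -> F | T = Cop_def}. Proof. by exists Cop_def. Qed.
Definition Cop := sval Cop_key.
Lemma CopE k j f : Cop k j f = if k == j then f + b *: \sum_(l | l != k) gop (tperm k l) f
  else - (b *: gop (tperm k j) f).
Proof. by rewrite /Cop (svalP Cop_key). Qed.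

Fact Cop_is_linear k j : linear (Cop k j).
Proof.
move=> c f h; rewrite !CopE; case: ifP => _.
  under eq_bigr do rewrite linearP.
  by rewrite big_split /= -scaler_sumr !scalerDr !scalerA (mulrC c) addrACA.
by rewrite linearP scalerDr opprD scalerN !scalerA mulrC.
Qed.
HB.instance Definition _ k j := GRing.isLinear.Build K F F *:%R (Cop k j) (Cop_is_linear k j).

Lemma XD (j : 'I_n) f h : Xop j (f + h) = Xop j f + Xop j h.
Proof. exact: linearD. Qed.
Lemma XN (j : 'I_n) f : Xop j (- f) = - Xop j f.
Proof. exact: linearN. Qed.
Lemma XZ (j : 'I_n) c f : Xop j (c *: f) = c *: Xop j f.
Proof. exact: linearZ. Qed.
Lemma X0 (j : 'I_n) : Xop j 0 = 0.
Proof. exact: linear0. Qed.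
Lemma Xsum (j : 'I_n) (I : Type) (r : seq I) (P : pred I) (G : I -> F) :
  Xop j (\sum_(i <- r | P i) G i) = \sum_(i <- r | P i) Xop j (G i).
Proof. exact: linear_sum. Qed.
Lemma YD (j : 'I_n) f h : Yop j (f + h) = Yop j f + Yop j h.
Proof. exact: linearD. Qed.
Lemma YN (j : 'I_n) f : Yop j (- f) = - Yop j f.
Proof. exact: linearN. Qed.
Lemma YZ (j : 'I_n) c f : Yop j (c *: f) = c *: Yop j f.
Proof. exact: linearZ. Qed.
Lemma Y0 (j : 'I_n) : Yop j 0 = 0.
Proof. exact: linear0. Qed.
Lemma Ysum (j : 'I_n) (I : Type) (r : seq I) (P : pred I) (G : I -> F) :
  Yop j (\sum_(i <- r | P i) G i) = \sum_(i <- r | P i) Yop j (G i).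
Proof. exact: linear_sum. Qed.
Lemma gD g f h : gop g (f + h) = gop g f + gop g h.
Proof. exact: linearD. Qed.
Lemma gN g f : gop g (- f) = - gop g f.
Proof. exact: linearN. Qed.
Lemma gZ g c f : gop g (c *: f) = c *: gop g f.
Proof. exact: linearZ. Qed.
Lemma g0 g : gop g 0 = 0.
Proof. exact: linear0. Qed.
Lemma gsum g (I : Type) (r : seq I) (P : pred I) (G : I -> F) :
  gop g (\sum_(i <- r | P i) G i) = \sum_(i <- r | P i) gop g (G i).
Proof. exact: linear_sum. Qed.
Lemma CD (k j : 'I_n) f h : Cop k j (f + h) = Cop k j f + Cop k j h.
Proof. exact: linearD. Qed.
Lemma CN (k j : 'I_n) f : Cop k j (- f) = - Cop k j f.
Proof. exact: linearN. Qed.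
Lemma CZ (k j : 'I_n) c f : Cop k j (c *: f) = c *: Cop k j f.
Proof. exact: linearZ. Qed.
Lemma C0 (k j : 'I_n) : Cop k j 0 = 0.
Proof. exact: linear0. Qed.
Lemma Csum (k j : 'I_n) (I : Type) (r : seq I) (P : pred I) (G : I -> F) :
  Cop k j (\sum_(i <- r | P i) G i) = \sum_(i <- r | P i) Cop k j (G i).
Proof. exact: linear_sum. Qed.
Definition oplin := (XD, XN, XZ, X0, YD, YN, YZ, Y0, gD, gN, gZ, g0, CD, CN, CZ, C0).
Definition opsum := (Xsum, Ysum, gsum, Csum).

Lemma gop1 f : gop 1%g f = f.
Proof. by apply/funext=> a; rewrite gopE sact1 mact1. Qed.
Lemma gopM g g' f : gop (g * g')%g f = gop g (gop g' f).
Proof. by apply/funext=> a; rewrite !gopE sactM mactM. Qed.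

Lemma YopC k l f : Yop k (Yop l f) = Yop l (Yop k f).
Proof. by apply/funext=> a; rewrite !YopE mincC. Qed.

Lemma gYop g k f : gop g (Yop k f) = Yop ((g^-1)%g k) (gop g f).
Proof. by apply/funext=> a; rewrite !(gopE, YopE) mact_minc permKV. Qed.

Lemma Yop_ext f h : f (mzero n) = h (mzero n) -> (forall k, Yop k f = Yop k h) -> f = h.
Proof.
move=> f0 fY; apply/funext; elim/mi_ind => // a k _.
by have := congr1 (fun u : F => u a) (fY k); rewrite !YopE.
Qed.

Lemma YX k j f : Yop k (Xop j f) = Xop j (Yop k f) + Cop k j f.
Proof.
apply/funext=> a; rewrite FD YopE !XopE CopE.
have [<-{j}|nkj] := eqVneq k j.
  rewrite FD FZ fsumE mincK ffunE eqxx addn1 addrACA -scalerDr -big_split /=.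
  congr (_ + _ *: _).
    by rewrite mulrSr YopE; congr (_ + _); case: (posnP (a k)) => [->|/mdecK->]; rewrite ?mulr0n.
  apply: eq_bigr => l lk; rewrite ffunE (negPf lk) addn0 addrAC; congr (_ + _).
    rewrite big_ord_recr /=; congr (_ + _).
      apply: eq_bigr => t _; rewrite /Xterm YopE; congr (sact _ _ (f _)).
      apply/ffunP=> i; rewrite !ffunE eqxx (negPf lk) !addn0 addn1.
      by have [_|ik] := eqVneq i k; [have := ltn_ord t; lia | case: eqP; rewrite ?addn0].
    rewrite /Xterm gopE mact_tperm_upd; congr (sact _ _ (f _)).
    apply/ffunP=> i; rewrite !ffunE eqxx (negPf lk) !addn0.
    by have [_|ik] := eqVneq i k; [lia | case: eqP; rewrite ?addn0].
  congr (- _); apply: eq_bigr => t _; rewrite /Xterm YopE; congr (sact _ _ (f _)).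
  apply/ffunP=> i; rewrite !ffunE eqxx (negPf lk) !addn0 addn1.
  by have [_|ik] := eqVneq i k; [have := ltn_ord t; lia | case: eqP; rewrite ?addn0].
rewrite FN FZ -[- (b *: _)]scalerN YopE ffunE eq_sym (negPf nkj) addn0 -addrA -scalerDr.
congr (_ + _ *: _).
  congr (f _ *+ _); apply/ffunP=> i; rewrite !ffunE.
  by have [->|_] := eqVneq i j; [rewrite eq_sym (negPf nkj) !addn0 | rewrite !subn0].
rewrite (bigD1 k) //= [in RHS](bigD1 k) //= -addrA addrCA [RHS]addrC.
rewrite !addrA; congr (_ + _); last first.
  apply: eq_bigr => l /andP[lj lk]; rewrite ffunE (negPf lk) addn0.
  by congr (_ - _); apply: eq_bigr => t _; rewrite /Xterm YopE; congr (sact _ _ (f _));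
    apply/ffunP=> i; rewrite !ffunE (eq_sym j k) (negPf nkj) ?addn0;
    case: (eqVneq i j) => [E|_]; rewrite ?E ?(eq_sym j k) ?(negPf nkj) ?addn0 //;
    case: (eqVneq i l) => [E2|_]; rewrite ?E2 ?(negPf lk) ?addn0.
(* For k different from j only the summand l = k changes. Raising [a k] shifts its index t by one,
   and the telescoping leaves the single term t = [a j], which is the value of the reflection. *)
pose G t := Xterm f (minc a k) j k t.
have GE t : Xterm (Yop k f) a j k t = G t.+1.
  rewrite /G /Xterm YopE; congr (sact _ _ (f _)); apply/ffunP=> i; rewrite !ffunE eqxx (eq_sym j) (negPf nkj) addn0.
  case: (eqVneq i j) => [E|_]; first by rewrite ?E (eq_sym j) (negPf nkj); lia.
  by case: eqP => _; lia.
under [in RHS]eq_bigr do rewrite GE.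
under [X in _ - X]eq_bigr do rewrite GE.
rewrite -/(G _) ffunE eqxx addn1.
have Gj : gop (tperm k j) f a = G (a j).
  rewrite /G /Xterm tpermC gopE mact_tperm_upd; congr (sact _ _ (f _)).
  apply/ffunP=> i; rewrite !ffunE eqxx (eq_sym j) (negPf nkj) addn0.
  case: (eqVneq i k) => [->|ik]; first by rewrite (negPf nkj).
  by rewrite ?(negPf ik) ?addn0; case: eqP => // _; lia.
rewrite Gj; have E : \sum_(t < a j) G t + G (a j) = G 0%N + \sum_(t < a j) G t.+1.
  by rewrite -(big_ord_recr (a j) (fun t : 'I__ => G t)) big_ord_recl.
have S1 : \sum_(t < a j) G t = (G 0%N + \sum_(t < a j) G t.+1) - G (a j).
  by apply/eqP; rewrite eq_sym subr_eq E.
rewrite S1 big_ord_recl /= addrC opprD -(addrA (G 0%N)) addrACA subrr add0r.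
by rewrite (addrC _ (- G (a j))).
Qed.

Lemma Xop0 j f : Xop j f (mzero n) = 0.
Proof.
have E i : mzero n i = 0%N by rewrite ffunE.
rewrite XopE E mulr0n add0r big1 ?scaler0 // => l _.
by rewrite !E !big_ord0 subrr.
Qed.

Lemma gopC g k j f : gop g (Cop k j f) = Cop ((g^-1)%g k) ((g^-1)%g j) (gop g f).
Proof.
have gtp l l' h : gop g (gop (tperm l l') h)
    = gop (tperm ((g^-1)%g l) ((g^-1)%g l')) (gop g h).
  by rewrite -!gopM -tpermJ conjgE invgK -!mulgA mulVg mulg1.
rewrite !CopE (inj_eq (@perm_inj _ _)); case: ifP => _; last first.
  by rewrite !linearN !linearZ /= gtp.
rewrite linearD linearZ linear_sum /=; congr (_ + _ *: _).
rewrite [RHS](reindex_perm (g^-1)%g) /=.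
by apply: eq_big => [l|l _]; rewrite ?(inj_eq (@perm_inj _ _)) ?gtp.
Qed.

Lemma gopX g j f : gop g (Xop j f) = Xop ((g^-1)%g j) (gop g f).
Proof.
apply/funext=> a; move: g j f; elim/mi_ind: a => [|a k IH] g j f.
  by rewrite gopE mact0 !Xop0 linear0.
rewrite -!YopE [in RHS]YX.
have -> : Yop k (gop g (Xop j f)) = gop g (Xop j (Yop (g k) f)) + gop g (Cop (g k) j f).
  by rewrite -[k in LHS](permK g) -gYop YX linearD.
by rewrite !FD IH gopC gYop permK.
Qed.

(** Commutativity is invisible in the formula for [Xop]. Both sides vanish at [mzero]; after
    applying Y_k, the relation [YX] reduces them to the induction hypothesis and an identity between
    the commutators [Cop]. *)
Lemma XopC i j f : Xop i (Xop j f) = Xop j (Xop i f).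
Proof.
have [->//|nij] := eqVneq i j.
apply/funext=> a; move: f; elim/mi_ind: a => [|a k IH] f; first by rewrite !Xop0.
rewrite -!YopE !YX !linearD !FD /= IH -!addrA; congr (_ + _).
suff E : Xop i (Cop k j f) + Cop k i (Xop j f) = Xop j (Cop k i f) + Cop k j (Xop i f).
  by have := congr1 (fun u : F => u a) E; rewrite !FD.
have off i' j' (h : F) : k != i' -> k != j' -> i' != j' -> Cop k i' (Xop j' h) = Xop j' (Cop k i' h).
  by move=> ki kj ij; rewrite !CopE (negPf ki) gopX tpermV tpermD //= [RHS]linearN [in RHS]linearZ.
(* When k is one of the two indices, neither commutator can be moved past the X alone; only the sum
   of the two is symmetric. *)
have diag j' (h : F) : k != j' -> Cop k k (Xop j' h) + Xop k (Cop k j' h)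
    = Xop j' (Cop k k h) + Cop k j' (Xop k h).
  move=> kj; have jk : j' != k by rewrite eq_sym.
  rewrite !CopE eqxx (negPf kj) (bigD1 j' jk) /= [in RHS](bigD1 j' jk) /=.
  rewrite !(oplin, opsum) !gopX !tpermV tpermL tpermR -!addrA; congr (_ + _).
  rewrite !scalerDr -!addrA addrCA [RHS]addrC -!addrA [RHS]addrC -!addrA addrN.
  rewrite addr0 addKr; congr (_ *: _); apply: eq_bigr => l /andP[lk lj].
  by rewrite gopX tpermV tpermD // eq_sym.
have [Ei|ki] := eqVneq k i.
  by subst i; rewrite addrC diag // addrC.
have [Ej|kj] := eqVneq k j.
  by subst j; rewrite -diag // addrC.
by rewrite !off 1?(eq_sym j) // addrC.
Qed.

End Model.

Section AdjacentGeneration.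
Variable n : nat.
Implicit Types (g h : 'S_n) (i j : 'I_n).

Lemma adjacent_gen (P : 'S_n -> Prop) : P 1%g ->
    (forall g h, P g -> P h -> P (g * h)%g) ->
    (forall i j, j = i.+1 :> nat -> P (tperm i j)) ->
  forall g, P g.
Proof.
move=> P1 PM Padj.
have Pt d i j : j = (i + d.+1)%N :> nat -> P (tperm i j).
  elim: d j => [|d IH] j ij; first by apply: Padj; rewrite ij addn1.
  have lt_jn : (i + d.+1 < n)%N by have := ltn_ord j; lia.
  pose l := Ordinal lt_jn.
  have lj : j = l.+1 :> nat by rewrite /= ij; lia.
  have -> : tperm i j = (tperm l j * tperm i l * tperm l j)%g.
    have := tpermJ i l (tperm l j); rewrite tpermL tpermD; last 2 first.
    - by apply/eqP => /(congr1 val) /=; lia.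
    - by apply/eqP => /(congr1 val) /=; lia.
    by move=> <-; rewrite conjgE tpermV mulgA.
  by apply: (PM _ _ (PM _ _ _ _)); [exact: Padj | exact: IH | exact: Padj].
move=> g; have [ts -> _] := prod_tpermP g; elim: ts => [|[i j] ts IH]; first by rewrite big_nil.
rewrite big_cons; apply: PM => //=.
have [ij|ji|/val_inj->] := ltngtP i j.
- by apply: (Pt (j - i).-1); lia.
- by rewrite tpermC; apply: (Pt (i - j).-1); lia.
- by rewrite tperm1.
Qed.

End AdjacentGeneration.

(** * Polynomials in one operator *)

Section OperatorPolynomials.
Variables (K : fieldType) (V : lmodType K).
Implicit Types (A B : V -> V) (p q : {poly K}) (v : V).

(** [F] is infinite-dimensional and its operators are bare functions, so polynomials are evaluated
    by iteration and not through matrices. *)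
Definition opoly A p v := \sum_(k < size p) p`_k *: iter k A v.

Lemma opoly_wide N A p v : (size p <= N)%N -> opoly A p v = \sum_(k < N) p`_k *: iter k A v.
Proof.
move=> pN; rewrite /opoly (big_ord_widen N (fun k => p`_k *: iter k A v) pN) big_mkcond /=.
by apply: eq_bigr => k _; case: ltnP => // pk; rewrite nth_default ?scale0r.
Qed.

Lemma opolyD A p q v : opoly A (p + q) v = opoly A p v + opoly A q v.
Proof.
pose N := maxn (size p) (size q).
rewrite !(@opoly_wide N) ?leq_maxl ?leq_maxr ?size_polyD //.
by rewrite -big_split; apply: eq_bigr => k _; rewrite coefD scalerDl.
Qed.

Lemma opolyZ A c p v : opoly A (c *: p) v = c *: opoly A p v.
Proof.
rewrite !(@opoly_wide (size p)) ?size_scale_leq // scaler_sumr.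
by apply: eq_bigr => k _; rewrite coefZ scalerA.
Qed.

Lemma opolyC A c v : opoly A c%:P v = c *: v.
Proof. by rewrite (@opoly_wide 1) ?size_polyC ?leq_b1 // big_ord1 coefC. Qed.

Lemma opolyMX A p v : opoly A (p * 'X) v = opoly A p (A v).
Proof.
rewrite (@opoly_wide (size p).+1); last first.
  by rewrite (leq_trans (size_polyMleq _ _)) // size_polyX addn2.
rewrite big_ord_recl coefMX eqxx scale0r add0r; apply: eq_bigr => k _.
by rewrite coefMX /= -iterSr.
Qed.

Lemma opolyXn A k v : opoly A 'X^k v = iter k A v.
Proof.
elim: k v => [|k IH] v; first by rewrite expr0 -polyC1 opolyC scale1r.
by rewrite exprSr opolyMX IH iterSr.
Qed.

Lemma opoly_comm A B p v : linear B -> (forall u, B (A u) = A (B u)) ->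
  B (opoly A p v) = opoly A p (B v).
Proof.
move=> Blin BA; have [B0 BD BZ] : [/\ B 0 = 0, {morph B : u w / u + w} & forall c u, B (c *: u) = c *: B u].
  have B0 : B 0 = 0 by have := Blin (-1) 0 0; rewrite scaler0 add0r scaleN1r addNr.
  by split=> // [u w|c u]; [have := Blin 1 u w; rewrite !scale1r | have := Blin c u 0; rewrite B0 !addr0].
rewrite /opoly (big_morph B BD B0); apply: eq_bigr => k _.
by rewrite BZ; congr (_ *: _); elim: (k : nat) => //= l IH; rewrite BA IH.
Qed.

Fact opoly_is_linear A p : linear A -> linear (opoly A p).
Proof.
move=> Alin c u w; rewrite /opoly scaler_sumr -big_split; apply: eq_bigr => k _ /=.
suff -> : iter k A (c *: u + w) = c *: iter k A u + iter k A w.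
  by rewrite scalerDr !scalerA mulrC.
by elim: (k : nat) => //= l ->; rewrite Alin.
Qed.

Lemma opolyM A p q v : linear A -> opoly A (p * q) v = opoly A p (opoly A q v).
Proof.
move=> Alin; elim/poly_ind: p v => [|p c IH] v.
  by rewrite mul0r /opoly !size_poly0 !big_ord0.
rewrite mulrDl (mulrAC p 'X q) !opolyD !opolyMX IH mul_polyC opolyZ opolyC; congr (opoly A p _ + _).
by rewrite (@opoly_comm A A).
Qed.

Lemma opoly_eigen A p v c : linear A -> A v = c *: v -> opoly A p v = p.[c] *: v.
Proof.
move=> Alin Av; elim/poly_ind: p => [|p d IH].
  by rewrite horner0 scale0r /opoly size_poly0 big_ord0.
rewrite opolyD opolyC opolyMX Av hornerMXaddC scalerDl; congr (_ + _).
have [B0 BZ] : opoly A p 0 = 0 /\ forall a u, opoly A p (a *: u) = a *: opoly A p u.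
  have L := opoly_is_linear p Alin.
  have B0 : opoly A p 0 = 0 by have := L (-1) 0 0; rewrite scaler0 add0r scaleN1r addNr.
  by split=> // a u; have := L a u 0; rewrite B0 !addr0.
by rewrite BZ IH scalerA mulrC.
Qed.

(* Two-step recursion for the power sums z^k + z'^k. *)
Lemma opoly_sum2_comm (S z z' : V -> V) (b : K) p v :
    linear S -> linear z -> linear z' ->
    (forall u, z (z' u) = z' (z u)) ->
    (forall u, S (z u) = z' (S u) + b *: u) ->
    (forall u, S (z' u) = z (S u) - b *: u) ->
  S (opoly z p v + opoly z' p v) = opoly z p (S v) + opoly z' p (S v).
Proof.
move=> Sl zl z'l zz Sz Sz'.
have lin0 (L : V -> V) : linear L -> [/\ L 0 = 0, {morph L : u w / u + w}, forall c u, L (c *: u) = c *: L u & forall u, L (- u) = - L u].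
  move=> Ll; have L0 : L 0 = 0 by have := Ll (-1) 0 0; rewrite scaler0 add0r scaleN1r addNr.
  split=> // [u w|c u|u]; [have := Ll 1 u w; rewrite !scale1r // | have := Ll c u 0; rewrite L0 !addr0 // |].
  by have := Ll (-1) u 0; rewrite L0 !addr0 !scaleN1r.
have [S0 SD SZ SN] := lin0 _ Sl; have [z0 zD zZ zN] := lin0 _ zl; have [z'0 z'D z'Z z'N] := lin0 _ z'l.
suff it k u : S (iter k z u + iter k z' u) = iter k z (S u) + iter k z' (S u).
  rewrite /opoly -!big_split (big_morph S SD S0); apply: eq_bigr => k _ /=.
  by rewrite -!scalerDr SZ it.
have [m] := ubnP k; elim: m k => // m IH [|[|k]] km; first by rewrite /= SD.
  by rewrite /= SD Sz Sz' addrC addrACA addNr addr0.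
have step w : iter k.+2 z w + iter k.+2 z' w
    = z (iter k.+1 z w + iter k.+1 z' w) + z' (iter k.+1 z w + iter k.+1 z' w)
      - z (z' (iter k z w + iter k z' w)).
  rewrite !zD !z'D !zD /= -(zz (iter k z w)).
  set a1 := z (z _); set a2 := z (z' (iter k z' w)); set a3 := z (z' _); set a4 := z' (z' _).
  by rewrite [a3 + a4]addrC addrACA [a2 + a3]addrC addrK.
have s1 w : S (z w + z' w) = z (S w) + z' (S w).
  by rewrite SD Sz Sz' addrC addrACA addNr addr0.
have s2 w : S (z (z' w)) = z (z' (S w)).
  by rewrite Sz Sz' z'D z'N z'Z subrK zz.
by rewrite !step SD SN s1 s2 !IH //; lia.
Qed.

End OperatorPolynomials.

(** * The commuting operators z_i and their symmetric polynomials *)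

Section ZOperators.
Variables (K : fieldType) (n : nat) (b : K) (U : srep K n).
Local Notation F := (F U).
Local Notation Xop := (@Xop K n b U).
Local Notation Yop := (@Yop K n U).
Local Notation gop := (@gop K n U).
Implicit Types (f h : F) (g : 'S_n) (i j k l : 'I_n).

Definition pop i f : F := Xop i (Yop i f).
Definition zop i f : F := pop i f + b *: \sum_(j : 'I_n | (i < j)%N) gop (tperm i j) f.

Lemma pop_linear i : linear (pop i).
Proof. by move=> c f h; rewrite /pop !oplin. Qed.

Lemma zop_linear i : linear (zop i).
Proof.
move=> c f h; rewrite /zop pop_linear; under eq_bigr do rewrite !oplin.
by rewrite big_split /= -scaler_sumr !scalerDr !scalerA (mulrC c) addrACA.
Qed.

Lemma zop0 i : zop i 0 = 0.
Proof. by have := zop_linear i (-1) 0 0; rewrite scaler0 add0r scaleN1r addNr. Qed.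
Lemma zopD i f h : zop i (f + h) = zop i f + zop i h.
Proof. by have := zop_linear i 1 f h; rewrite !scale1r. Qed.
Lemma zopZ i c f : zop i (c *: f) = c *: zop i f.
Proof. by have := zop_linear i c f 0; rewrite zop0 !addr0. Qed.

Lemma gpop g i f : gop g (pop i f) = pop ((g^-1)%g i) (gop g f).
Proof. by rewrite /pop gopX gYop. Qed.

Lemma pop_comm i k f : i != k ->
  pop i (pop k f) - pop k (pop i f) = - (b *: (pop i (gop (tperm i k) f) - pop k (gop (tperm i k) f))).
Proof.
move=> ik; rewrite /pop !YX !CopE (negPf ik) eq_sym (negPf ik) !oplin.
rewrite !gYop !tpermV !tpermR (tpermC k i) [Xop i (Xop k _)]XopC (YopC i k).
by rewrite opprD addrACA subrr add0r opprK scalerBr opprB addrC.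
Qed.

Lemma gtperm i k l j f : l != i -> l != k ->
  gop (tperm i k) (gop (tperm l j) f) = gop (tperm l (tperm i k j)) (gop (tperm i k) f).
Proof.
move=> li lk; rewrite -!gopM; congr gop.
have := tpermJ l j (tperm i k); rewrite tpermD 1?eq_sym // => <-.
by rewrite conjgE tpermV -!mulgA tperm2 mulg1.
Qed.

Lemma gtperm_sum (P : pred 'I_n) i k l f : l != i -> l != k -> P i = P k ->
  gop (tperm i k) (\sum_(j | P j) gop (tperm l j) f)
  = \sum_(j | P j) gop (tperm l j) (gop (tperm i k) f).
Proof.
move=> li lk Pik; rewrite gsum [RHS](reindex_perm (tperm i k)) /=.
apply: eq_big => [j|j _]; last exact: gtperm.
by case: tpermP => [->|->|].
Qed.

(** The operators X_i Y_i do not commute: for i < k their commutator is a multiple of (X_i Y_i - X_k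
    Y_k) s_ik. The summand j = k in the tail of z_i fails to commute with X_k Y_k by the same
    expression, and the two defects cancel. *)
Lemma zopC i k f : zop i (zop k f) = zop k (zop i f).
Proof.
wlog lt_ik : i k / (i < k)%N => [hw|].
  case: (ltngtP i k) => [ik|ki|/val_inj->].
  - exact: hw.
  - exact/esym/hw.
  - by [].
have ik : i != k by apply/eqP => E; rewrite E ltnn in lt_ik.
pose B l h := \sum_(j : 'I_n | (l < j)%N) gop (tperm l j) h.
have zE l h : zop l h = pop l h + b *: B l h by [].
have popD l h1 h2 : pop l (h1 + h2) = pop l h1 + pop l h2 by rewrite /pop !oplin.
have popZ l c h1 : pop l (c *: h1) = c *: pop l h1 by rewrite /pop !oplin.
have popsum l (P : pred 'I_n) G : pop l (\sum_(j | P j) G j) = \sum_(j | P j) pop l (G j).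
  by rewrite /pop !opsum.
have BD l h1 h2 : B l (h1 + h2) = B l h1 + B l h2.
  by rewrite /B -big_split; apply: eq_bigr => j _; rewrite oplin.
have BZ l c h1 : B l (c *: h1) = c *: B l h1.
  by rewrite /B scaler_sumr; apply: eq_bigr => j _; rewrite oplin.
have piBk h : pop i (B k h) = B k (pop i h).
  rewrite /B popsum; apply: eq_bigr => j kj; rewrite gpop tpermV tpermD // 1?eq_sym //.
  by apply/eqP => E; move: kj; rewrite -E ltnNge ltnW.
have Bipk h : B i (pop k h) = pop k (B i h) + (pop i (gop (tperm i k) h) - pop k (gop (tperm i k) h)).
  rewrite /B (bigD1 k) //= [in RHS](bigD1 k) //= popD gpop tpermV tpermR popsum.
  rewrite [RHS]addrC addrA subrK; congr (_ + _); apply: eq_bigr => j /andP[_ jk].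
  by rewrite gpop tpermV tpermD.
have BB h : B i (B k h) = B k (B i h).
  have Bsum (P : pred 'I_n) G : B i (\sum_(j | P j) G j) = \sum_(j | P j) B i (G j).
    by rewrite /B exchange_big; apply: eq_bigr => j _; rewrite gsum.
  rewrite {2}/B Bsum; apply: eq_bigr => l kl; rewrite [in RHS]/B gtperm_sum //.
    by apply/eqP => E; move: kl; rewrite -E ltnNge ltnW.
  by rewrite lt_ik (ltn_trans lt_ik kl).
rewrite !zE !(popD, popZ, BD, BZ) piBk Bipk BB.
have := pop_comm f ik; move/eqP; rewrite subr_eq => /eqP->.
rewrite scalerBr opprB !scalerDr scalerN.
have zmod (V : zmodType) (E A B' C D : V) : - E + A + B' + (C + E + D) = A + C + (B' + D).
  by rewrite -(addrA (- E)) (addrC C) -(addrA E) addrACA addNr add0r addrACA.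
by rewrite -[b *: pop k _ - _]opprB zmod.
Qed.

(* zop i' s = s zop i - b for consecutive i < i' and s = (i i'). *)
Lemma gzop_adj i k f : k = i.+1 :> nat ->
  gop (tperm i k) (zop i f) = zop k (gop (tperm i k) f) + b *: f.
Proof.
move=> ki; have ik : i != k by apply/eqP => E; move: ki; rewrite E => /eqP; rewrite ltn_eqF.
rewrite /zop gD gpop tpermV tpermL gZ -addrA; congr (_ + _); rewrite -scalerDr; congr (_ *: _).
have lt_ik : (i < k)%N by rewrite ki.
rewrite (bigD1 k) //= gD -gopM tperm2 gop1 addrC; congr (_ + _).
rewrite gsum; apply: eq_big => j.
  by rewrite ki -(inj_eq val_inj) /= ki; lia.
move=> /andP[ij jk]; rewrite -!gopM; congr gop.
have nij : i != j by rewrite -(inj_eq val_inj) /= ltn_eqF.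
have := tpermJ i j (tperm i k); rewrite tpermL tpermD // 1?eq_sym // => <-.
by rewrite conjgE tpermV -!mulgA tperm2 mulg1.
Qed.

Lemma gzop_adj' i k f : k = i.+1 :> nat ->
  gop (tperm i k) (zop k f) = zop i (gop (tperm i k) f) - b *: f.
Proof.
move=> ki; have := gzop_adj (gop (tperm i k) f) ki; rewrite -gopM tperm2 gop1.
move=> /(congr1 (gop (tperm i k))); rewrite gD gZ -!gopM !tperm2 !gop1 => ->.
by rewrite addrK.
Qed.

Lemma gzop_off i k j f : k = i.+1 :> nat -> j != i -> j != k ->
  gop (tperm i k) (zop j f) = zop j (gop (tperm i k) f).
Proof.
move=> ki ji jk; rewrite /zop gD gpop tpermV tpermD 1?eq_sym // gZ gtperm_sum //.
by move: ji jk; rewrite -!(inj_eq val_inj) /= ki; lia.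
Qed.

Definition Psym (p : {poly K}) f : F := \sum_i opoly (zop i) p f.

Lemma Psym_linear p : linear (Psym p).
Proof.
move=> c f h; rewrite /Psym scaler_sumr -big_split; apply: eq_bigr => i _.
exact: opoly_is_linear (zop_linear i) c f h.
Qed.

(** A transposition s of neighbours i and k = i + 1 does not permute the z's, but s z_i = z_k s + b
    and s z_k = z_i s - b make it commute with z_i^e + z_k^e for every e, and it commutes with the
    other z_j. *)
Lemma gPsym p g f : gop g (Psym p f) = Psym p (gop g f).
Proof.
move: f; elim/adjacent_gen: g => [f|g g' IH IH' f|i k ki f]; first by rewrite !gop1.
  by rewrite !gopM IH' IH.
have ik : k != i by apply/eqP => E; move: ki; rewrite E => /eqP; rewrite ltn_eqF.
rewrite /Psym gsum (bigD1 i) //= (bigD1 k) //= [in RHS](bigD1 i) //= [in RHS](bigD1 k) //=.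
rewrite !addrA -gD; congr (_ + _).
  apply: (@opoly_sum2_comm K F (gop (tperm i k)) (zop i) (zop k) b).
  - by move=> c u v; rewrite !oplin.
  - exact: zop_linear.
  - exact: zop_linear.
  - by move=> u; apply: zopC.
  - by move=> u; apply: gzop_adj.
  - by move=> u; apply: gzop_adj'.
apply: eq_bigr => j /andP[ji jk].
apply: (@opoly_comm K F (zop j) (gop (tperm i k))); first by move=> c u v; rewrite !oplin.
by move=> u; apply: gzop_off.
Qed.

Lemma PsymC p q f : Psym p (Psym q f) = Psym q (Psym p f).
Proof.
have D A r : linear A -> {morph opoly (V := F) A r : u v / u + v}.
  by move=> Al u v; have := opoly_is_linear r Al 1 u v; rewrite !scale1r.
have D0 A r : linear A -> opoly (V := F) A r 0 = 0.
  by move=> Al; have := opoly_is_linear r Al (-1) 0 0; rewrite scaler0 add0r scaleN1r addNr.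
rewrite /Psym; under eq_bigr => i _ do
  rewrite (big_morph _ (D _ _ (zop_linear i)) (D0 _ _ (zop_linear i))).
under [RHS]eq_bigr => i _ do
  rewrite (big_morph _ (D _ _ (zop_linear i)) (D0 _ _ (zop_linear i))).
rewrite exchange_big; apply: eq_bigr => i _; apply: eq_bigr => j _.
apply: (@opoly_comm K F (zop i) (opoly (zop j) p)); first exact/opoly_is_linear/zop_linear.
by move=> u; apply/esym/opoly_comm => [|w]; [apply: zop_linear | apply: zopC].
Qed.

End ZOperators.

(** * Triangularity for the sum of squares of the exponents *)

Section Triangularity.
Variables (K : fieldType) (n : nat) (b : K) (U : srep K n).
Local Notation F := (F U).
Local Notation mi := (mi n).
Local Notation zo := (@zop K n b U).
Local Notation gop := (@gop K n U).
Local Notation Ps := (@Psym K n b U).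
Implicit Types (f h : F) (a : mi) (g : 'S_n) (i j l : 'I_n) (d k : nat).

Definition msq a := (\sum_i a i * a i)%N.

Lemma msq_mact g a : msq (mact g a) = msq a.
Proof.
rewrite /msq [RHS](reindex_perm (g^-1)%g) /=.
by apply: eq_bigr => i _; rewrite ffunE.
Qed.

Lemma msum_upd (w : nat -> nat) a i l x y : i != l ->
  (\sum_j w (mupd a i l x y j) + (w (a i) + w (a l)) = \sum_j w (a j) + (w x + w y))%N.
Proof.
move=> il; have li : l != i by rewrite eq_sym.
rewrite (bigD1 i) //= (bigD1 l) //= [in RHS](bigD1 i) //= [in RHS](bigD1 l) //= !ffunE !eqxx (negPf li).
rewrite (eq_bigr (fun j => w (a j))); first by lia.
by move=> j /andP[ji jl]; rewrite ffunE (negPf ji) (negPf jl).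
Qed.

Lemma mdg_upd a i l x y : i != l -> (x + y = a i + a l)%N -> mdg (mupd a i l x y) = mdg a.
Proof. by move=> il xy; have := msum_upd id a x y il; rewrite /mdg; lia. Qed.

Lemma msq_upd a i l x y : i != l ->
  (msq (mupd a i l x y) + (a i * a i + a l * a l) = msq a + (x * x + y * y))%N.
Proof. exact: (msum_upd (fun x => (x * x)%N)). Qed.

(** A filtration of degree d that the z_i preserve; [vanish d (msq a) f] makes [f a] a leading
    coefficient. *)
Definition vanish d k f := forall a, mdg a = d -> (msq a < k)%N -> f a = 0.

(* The weighted lines of the Dunkl sums meet the level set of msq only in the
   multi-index itself and its transposes; all other terms are more balanced. *)
Lemma pop_leading d k f a i : vanish d k f -> mdg a = d -> (msq a <= k)%N ->
  pop b i f a = (a i)%:R *: f a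
    + b *: (\sum_(l | (a l < a i)%N) sact U (tperm i l) (f a)
            - \sum_(l | (a i < a l)%N) gop (tperm i l) f a).
Proof.
move=> van ad ak; rewrite /pop XopE YopE; congr (_ + _ *: _).
  by rewrite scaler_nat; case: (posnP (a i)) => [->|/mdecK->]; rewrite ?mulr0n.
rewrite (big_mkcond (fun l => a l < a i)%N) (big_mkcond (fun l => a i < a l)%N) /= -sumrB.
rewrite [RHS](bigD1 i) //= ltnn subr0 add0r; apply: eq_bigr => l li.
have il : i != l by rewrite eq_sym.
pose T t : U := sact U (tperm i l) (f (mupd a i l (a i + a l - t)%N t)).
have TE t : (t < a i + a l)%N -> Xterm (Yop i f) a i l t = T t.
  move=> ta; rewrite /Xterm YopE /T; congr (sact _ _ (f _)); apply/ffunP=> j; rewrite !ffunE.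
  by case: (eqVneq j i) => [_|ji]; [lia | case: eqP; rewrite addn0].
have T0 t : (minn (a i) (a l) < t < maxn (a i) (a l))%N -> T t = 0.
  move=> tb; rewrite /T van ?linear0 //; first by rewrite mdg_upd //; lia.
  by have := msq_upd a (a i + a l - t) t il; nia.
rewrite (eq_bigr (fun t : 'I__ => T t)); last by move=> t _; apply: TE; have := ltn_ord t; lia.
rewrite [X in _ - X](eq_bigr (fun t : 'I__ => T t)); last by move=> t _; apply: TE; have := ltn_ord t; lia.
have cat p q : (p < q)%N -> (forall t, (p < t < q)%N -> T t = 0) ->
    \sum_(t < q) T t = \sum_(t < p) T t + T p.
  move=> pq Tpq; rewrite -!(big_mkord xpredT T) (@big_cat_nat _ _ _ p 0 q) ?(ltnW pq) //=.
  have -> : \sum_(p <= t < q) T t = T p + 0; last by rewrite addr0.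
  by rewrite (big_ltn pq) big_nat; congr (_ + _); apply: big1.
have [lt_il|lt_li|E] := ltngtP (a i) (a l); last by rewrite E !subrr.
- have T0' t : (a i < t < a l)%N -> T t = 0 by move=> tb; apply: T0; lia.
  rewrite (cat _ _ lt_il T0').
  by rewrite opprD addrA subrr gopE mact_tperm_upd /T addKn.
- have T0' t : (a l < t < a i)%N -> T t = 0 by move=> tb; apply: T0; lia.
  rewrite (cat _ _ lt_li T0').
  rewrite addrAC subrr add0r subr0 /T addnK; congr (sact _ _ (f _)); apply/ffunP=> j; rewrite !ffunE.
  by case: eqP => [->//|_]; case: eqP => [->|].
Qed.

Definition mincr a := forall i j, (i <= j)%N -> (a i <= a j)%N.

Definition Aop a i (v : U) : U :=
  \sum_(l | (a l < a i)%N) sact U (tperm i l) v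
  + \sum_(l : 'I_n | (i < l)%N && (a l == a i)) sact U (tperm i l) v.

(** For increasing [a] the indices l with [a i < a l] all lie to the right of i, so the tail of z_i
    cancels the negative sum of [pop_leading], and from the tail only the reflections inside the
    block of i survive. *)
Lemma zop_leading d k f a i : vanish d k f -> mdg a = d -> (msq a <= k)%N -> mincr a ->
  zo i f a = (a i)%:R *: f a + b *: Aop a i (f a).
Proof.
move=> van ad ak inc; rewrite /zop FD (pop_leading i van ad ak) FZ fsumE -addrA -scalerDr.
congr (_ + _ *: _); rewrite -addrA; congr (_ + _).
rewrite addrC (bigID (fun l => a l == a i)) /= -addrA [X in _ + X](_ : _ = 0) ?addr0.
  apply: eq_bigr => l /andP[_ /eqP al]; rewrite gopE mact_tperm_upd al.
  congr (sact _ _ (f _)); apply/ffunP=> j; rewrite !ffunE.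
  by case: eqP => [->//|_]; case: eqP => [->|].
apply/eqP; rewrite subr_eq0; apply/eqP/eq_bigl => l; apply/andP/idP => [[il ali]|ail].
  by rewrite ltn_neqAle eq_sym ali inc // ltnW.
by split; rewrite ?gtn_eqF // ltnNge; apply: contraTN ail => /inc; rewrite -leqNgt.
Qed.

Lemma zop_vanish d k i f : vanish d k f -> vanish d k (zo i f).
Proof.
move=> van a ad ak; have van' : vanish d (msq a) f.
  by move=> a' a'd a'k; apply: van => //; apply: ltn_trans ak.
have f0 g : f (mact g a) = 0 by apply: van; rewrite ?mdg_mact ?msq_mact.
have g0 g : gop g f a = 0 by rewrite gopE f0 linear0.
rewrite /zop FD (pop_leading i van' ad (leqnn _)) FZ fsumE.
have fa : f a = 0 by rewrite -(mact1 a).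
rewrite fa scaler0 add0r.
have S0 (P : pred 'I_n) : \sum_(l | P l) gop (tperm i l) f a = 0 by apply: big1.
by rewrite !S0 big1 ?subrr ?scaler0 ?addr0 // => l _; rewrite linear0.
Qed.

Lemma vanish_sum d k (I : Type) (r : seq I) (P : pred I) (f : I -> F) :
  (forall x, vanish d k (f x)) -> vanish d k (\sum_(x <- r | P x) f x).
Proof. by move=> van a ad ak; rewrite fsumE big1 // => i _; apply: van. Qed.

Lemma vanishZ d k c f : vanish d k f -> vanish d k (c *: f).
Proof. by move=> van a ad ak; rewrite FZ van ?scaler0. Qed.

Lemma opoly_zop_vanish d k i p f : vanish d k f -> vanish d k (opoly (zo i) p f).
Proof.
move=> van; apply: vanish_sum => t; apply: vanishZ.
by elim: (t : nat) => //= t' IH; apply: zop_vanish.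
Qed.

Lemma Psym_vanish d k p f : vanish d k f -> vanish d k (Ps p f).
Proof. by move=> van; apply: vanish_sum => i; apply: opoly_zop_vanish. Qed.

Lemma Psym_leading d k p f a : vanish d k f -> mdg a = d -> (msq a <= k)%N -> mincr a ->
  Ps p f a = \sum_i opoly (fun v : U => (a i)%:R *: v + b *: Aop a i v) p (f a).
Proof.
move=> van ad ak inc; rewrite /Psym fsumE; apply: eq_bigr => i _.
rewrite /opoly fsumE; apply: eq_bigr => t _; rewrite FZ; congr (_ *: _).
elim: (t : nat) => //= t' IH; rewrite (@zop_leading d k) ?IH //.
by elim: t' {IH} => //= t'' IH; apply: zop_vanish.
Qed.

End Triangularity.

(** * Content words *)

(* A Young diagram is encoded by the multiset of contents of its boxes; a standard
   tableau is the word of contents of the successively added boxes. *)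
Section ContentWords.
Implicit Types (w u : seq int) (a e : int).

Definition cnt w a := count_mem a w.

(** A box fits on diagonal [a] exactly when its left and upper neighbours are present, that is, when
    the two adjacent diagonals have the largest lengths that interlacing allows. The Boolean terms
    record on which side of the main diagonal a neighbour is one box longer. *)
Definition addable w a :=
  (cnt w (a + 1) == cnt w a + (a < 0)) && (cnt w (a - 1) == cnt w a + (0 < a)%R)%N.

Definition valid w := all (fun i => addable (take i w) (nth 0 w i)) (iota 0 (size w)).

Definition far a e := (a < e - 1) || (e + 1 < a).

Lemma farC a e : far a e = far e a.
Proof. by rewrite /far; lia. Qed.

Lemma cnt_rcons w a e : cnt (rcons w a) e = (cnt w e + (a == e))%N.
Proof. by rewrite /cnt -cats1 count_cat /= addn0. Qed.

Lemma cnt_cat w u e : cnt (w ++ u) e = (cnt w e + cnt u e)%N.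
Proof. exact: count_cat. Qed.

Lemma addable_eq w u a : cnt w =1 cnt u -> addable w a = addable u a.
Proof. by move=> wu; rewrite /addable !wu. Qed.

Lemma valid_rcons w a : valid (rcons w a) = valid w && addable w a.
Proof.
rewrite /valid size_rcons -[(size w).+1]addn1 iotaD all_cat /= andbT add0n.
rewrite -cats1 take_size_cat // nth_cat ltnn subnn /=; congr (_ && _).
by apply: eq_in_all => i; rewrite mem_iota /= => iw; rewrite takel_cat 1?ltnW // nth_cat iw.
Qed.

Lemma valid_catl w u : valid (w ++ u) -> valid w.
Proof.
by elim/last_ind: u => [|u a IH]; rewrite ?cats0 // -rcons_cat valid_rcons => /andP[/IH].
Qed.

Lemma addable_far w a e : far a e -> addable (rcons w e) a = addable w a.
Proof. by rewrite /far /addable !cnt_rcons => ae; congr (_ && _); lia. Qed.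

Fixpoint run a k := if k is k'.+1 then a + k%:Z :: run a k' else [:: a].

Lemma run_split a k (e : int) : a <= e < a + k%:Z ->
  exists u1 u2, run a k = u1 ++ [:: e + 1, e & u2] /\ all (far e) u1.
Proof.
elim: k => [|k IH] /=; first by lia.
have [ek|ek] := eqVneq e (a + k%:Z).
  move=> _; exists [::]; case: k {IH} ek => [|k] ek.
    by exists [::]; split; rewrite // ek; congr [:: _; _]; lia.
  by exists (run a k); split; rewrite // ek /=; congr [:: _, _ & _]; lia.
move=> ae; case: IH => [|u1 [u2 [-> fu]]]; first lia.
by exists (a + k.+1%:Z :: u1), u2; split=> //=; rewrite fu andbT /far; lia.
Qed.

Lemma run_far a k e : (e < a - 1) || (a + k%:Z + 1 < e) -> all (far e) (run a k).
Proof.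
elim: k => [|k IH] /= ae; first by rewrite andbT /far; lia.
by rewrite IH ?andbT /far; lia.
Qed.

(** * Words obeying the exchange rules of Jucys-Murphy weights *)

Section Rules.
Variable Wt : seq int -> Prop.
Hypothesis Wt_prefix : forall w u, Wt (w ++ u) -> Wt w.
Hypothesis Wt_head : forall a, Wt [:: a] -> a = 0.
Hypothesis Wt_eq : forall w a, ~ Wt (w ++ [:: a; a]).
Hypothesis Wt_swap : forall w a e u, far a e -> Wt (w ++ [:: a, e & u]) -> Wt (w ++ [:: e, a & u]).
Hypothesis Wt_triple : forall w a e, `|a - e| = 1 -> ~ Wt (w ++ [:: a; e; a]).

Lemma Wt_move w e u u' : all (far e) u -> Wt (w ++ e :: u ++ u') -> Wt (w ++ u ++ e :: u').
Proof.
elim: u w => //= x u IH w /andP[ex eu] /(Wt_swap ex).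
by rewrite -cat_rcons => /(IH _ eu); rewrite cat_rcons.
Qed.

Lemma run_count w a k : (forall u, Wt u -> (size u <= size w)%N -> valid u) ->
  Wt (w ++ run a k.+1) -> cnt w (a - 1) = (cnt w a + (0 < a)%R)%N.
Proof.
have [N] := ubnP (size w); elim: N w k => // N IH w k wN V.
case/lastP: w wN V => [|w e] wN V Ww.
  have /Wt_head : Wt [:: a + k.+1%:Z] by apply: (@Wt_prefix _ (run a k)).
  by move=> a0; rewrite /cnt /=; lia.
have We : Wt (rcons w e) := Wt_prefix Ww.
have V' u : Wt u -> (size u <= size w)%N -> valid u.
  by move=> Wu uw; apply: V => //; rewrite size_rcons ltnW.
rewrite size_rcons ltnS in wN; rewrite cat_rcons in Ww.
have [e1|e1] := eqVneq e (a + k.+2%:Z).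
  have := IH w k.+1 wN V'; rewrite -[run a k.+2]/(a + k.+2%:Z :: run a k.+1) -e1 => /(_ Ww).
  by rewrite !cnt_rcons; lia.
have [e2|e2] := eqVneq e (a + k.+1%:Z).
  by case: (@Wt_eq w e); apply: (@Wt_prefix _ (run a k)); rewrite -catA /= {2}e2.
have [e3|e3] := boolP (a <= e < a + k.+1%:Z).
  have [u1 [u2 [E fu]]] := run_split e3.
  move: Ww; rewrite E => /(Wt_move fu) Ww.
  case: (@Wt_triple (w ++ u1) e (e + 1)); first by lia.
  by apply: (@Wt_prefix _ u2); rewrite -!catA.
have [e4|e4] := eqVneq e (a - 1).
  have := V _ We (leqnn _); rewrite valid_rcons => /andP[_]; rewrite /addable !cnt_rcons => /andP[/eqP + _].
  by rewrite e4 (_ : a - 1 + 1 = a); [lia | rewrite subrK].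
have fe : all (far e) (run a k.+1) by apply: run_far; lia.
have Ww2 : Wt (w ++ run a k.+1).
  apply: (@Wt_prefix _ [:: e]); rewrite -catA; apply: Wt_move => //.
  by rewrite cats0.
by have := IH w k wN V' Ww2; rewrite !cnt_rcons; lia.
Qed.
End Rules.

Lemma valid_eq w w' u : cnt w =1 cnt w' -> valid w -> valid w' -> valid (w ++ u) = valid (w' ++ u).
Proof.
move=> ww' vw vw'; elim/last_ind: u => [|u a IH]; first by rewrite !cats0 vw vw'.
rewrite -!rcons_cat !valid_rcons IH; congr (_ && _); apply: addable_eq => e.
by rewrite !cnt_cat ww'.
Qed.

Lemma valid_swap w a e u : far a e -> valid (w ++ [:: a, e & u]) -> valid (w ++ [:: e, a & u]).
Proof.
move=> ae; have E x y : w ++ [:: x, y & u] = rcons (rcons w x) y ++ u by rewrite !cat_rcons.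
have ea : far e a by rewrite farC.
rewrite !E => v; have := valid_catl v; rewrite !valid_rcons addable_far // => /andP[/andP[vw wa] we].
rewrite (@valid_eq _ (rcons (rcons w a) e)) // ?valid_rcons ?addable_far ?vw ?wa ?we //.
by move=> x; rewrite !cnt_rcons addnAC.
Qed.

Definition swap_closed (P : seq int -> Prop) :=
  forall w a e u, far a e -> P (w ++ [:: a, e & u]) -> P (w ++ [:: e, a & u]).

Lemma swap_move P w e u u' : swap_closed P -> all (far e) u ->
  P (w ++ e :: u ++ u') -> P (w ++ u ++ e :: u').
Proof.
move=> sw; elim: u w => //= x u IH w /andP[ex eu] /(sw _ _ _ _ ex).
by rewrite -cat_rcons => /(IH _ eu); rewrite cat_rcons.
Qed.

(** When the last [a] is added, the adjacent diagonals already have the lengths that they have in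
    the final diagram, so no neighbour of [a] can follow. *)
Lemma removable_last w u a : valid w -> valid (rcons u a) -> cnt w =1 cnt (rcons u a) ->
  exists w1 w2, w = w1 ++ a :: w2 /\ all (far a) w2.
Proof.
move=> vw; rewrite valid_rcons => /andP[vu /andP[/eqP u1 /eqP u2]] E.
have [w1 [w2 [Ew aw2]]] : exists w1 w2, w = w1 ++ a :: w2 /\ a \notin w2.
  have : a \in w by have := E a; rewrite cnt_rcons eqxx /cnt => h; rewrite -has_pred1 has_count h addn1.
  elim: w {vw E} => // x w IH; have [aw _|aw] := boolP (a \in w).
    by have [w1 [w2 [-> ?]]] := IH aw; exists (x :: w1), w2.
  by rewrite inE (negPf aw) orbF => /eqP<-; exists [::], w.
exists w1, w2; split=> //; move: vw; rewrite Ew -cat_rcons => vw.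
have := valid_catl vw; rewrite valid_rcons => /andP[_ /andP[/eqP v1 /eqP v2]].
have c0 : cnt w2 a = 0%N by apply/eqP; rewrite /cnt -leqn0 leqNgt -has_count has_pred1.
have Ec e : (cnt w1 e + (a == e) + cnt w2 e = cnt u e + (a == e))%N.
  by have := E e; rewrite Ew -cat_rcons cnt_cat !cnt_rcons.
apply/allP => e ew2; have cpos : (0 < cnt w2 e)%N by rewrite /cnt -has_count has_pred1.
have := Ec a; have := Ec (a + 1); have := Ec (a - 1); rewrite /far.
have [ea|ne] := eqVneq e a; first by rewrite ea c0 in cpos.
have [e1|n1] := eqVneq e (a + 1); first by rewrite e1 in cpos; lia.
have [e2|n2] := eqVneq e (a - 1); first by rewrite e2 in cpos; lia.
by lia.
Qed.

(** Far swaps bring the last letter of [u] to the end of [w], and the prefixes are treated by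
    induction. This is the connectedness of the standard tableaux of one shape under admissible
    transpositions. *)
Lemma valid_connected (P : seq int -> Prop) w u : swap_closed P ->
  valid w -> valid u -> cnt w =1 cnt u -> P w -> P u.
Proof.
elim/last_ind: u P w => [|u a IH] P w sw vw vu E Pw.
  have w0 : w = [::] by case: w {vw Pw} E => // x w E; have := E x; rewrite /cnt /= eqxx.
  by rewrite w0 in Pw.
have [w1 [w2 [Ew fa]]] := removable_last vw vu E.
have vu' : valid u by move: vu; rewrite valid_rcons => /andP[].
have Pw' : P (rcons (w1 ++ w2) a).
  by rewrite rcons_cat -cats1; apply: swap_move => //; rewrite cats0 -Ew.
have vw' : valid (rcons (w1 ++ w2) a).
  by rewrite rcons_cat -cats1; apply: (@swap_move valid); [exact: valid_swap | | rewrite cats0 -Ew].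
apply: (IH (fun v => P (rcons v a)) (w1 ++ w2)) => //.
- by move=> v x y z xy; rewrite !rcons_cat /=; apply: sw.
- by move: vw'; rewrite valid_rcons => /andP[].
- move=> e; have := E e; rewrite Ew -cat_rcons !(cnt_rcons, cnt_cat); lia.
Qed.

End ContentWords.

Section WeightsAreValid.
Variables (K : numDomainType) (Wt : seq K -> Prop).
Hypothesis Wt_prefix : forall w u, Wt (w ++ u) -> Wt w.
Hypothesis Wt_head : forall a, Wt [:: a] -> a = 0.
Hypothesis Wt_eq : forall w a, ~ Wt (w ++ [:: a; a]).
Hypothesis Wt_swap : forall w a e u, a != e -> a != e + 1 -> e != a + 1 ->
  Wt (w ++ [:: a, e & u]) -> Wt (w ++ [:: e, a & u]).
Hypothesis Wt_triple : forall w a e, (a == e + 1) || (e == a + 1) -> ~ Wt (w ++ [:: a; e; a]).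

Let toK (w : seq int) : seq K := map (fun x => x%:~R) w.

(** Induction on the length, comparing the last letter c with the one before it, d. Equality is
    excluded, d = c + 1 is settled by [run_count], c = d + 1 by its mirror image, and otherwise the
    two letters can be exchanged. *)
Lemma weights_valid w : Wt w -> exists2 u, w = toK u & valid u.
Proof.
have [N] := ubnP (size w); elim: N w => // N IH w.
case/lastP: w => [|w c] wN Ww; first by exists [::].
rewrite size_rcons ltnS in wN.
have intE (x y : int) : (x%:~R == y%:~R :> K) = (x == y) by rewrite eqr_int.
have intS (x : int) : x%:~R + 1 = (x + 1)%:~R :> K by rewrite intrD.
have [Wp0 We0 Ws0 Wt0] : [/\ forall x y, Wt (toK (x ++ y)) -> Wt (toK x),
    forall x a, ~ Wt (toK (x ++ [:: a; a])),
    forall x a e y, far a e -> Wt (toK (x ++ [:: a, e & y])) -> Wt (toK (x ++ [:: e, a & y]))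
  & forall x a e, `|a - e| = 1 -> ~ Wt (toK (x ++ [:: a; e; a]))].
  split=> [x y|x a|x a e y|x a e].
  - by rewrite /toK map_cat; apply: Wt_prefix.
  - by rewrite /toK map_cat; apply: Wt_eq.
  - by rewrite /toK !map_cat /= /far => fae; apply: Wt_swap; rewrite ?intS intE; lia.
  - by rewrite /toK !map_cat /= => ae; apply: Wt_triple; rewrite !intS !intE; lia.
have Wh0 a : Wt (toK [:: a]) -> a = 0 by move=> /Wt_head/eqP; rewrite (intE a 0) => /eqP.
have VN u : Wt (toK u) -> (size u < N)%N -> valid u.
  move=> Wu uN; have [||u' E vu'] := IH (toK u); rewrite ?size_map //.
  suff -> : u = u' by [].
  by apply: (@inj_map _ _ (fun x : int => x%:~R : K)) E => x y /eqP; rewrite intE => /eqP.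
have [u Eu vu] := IH w wN (Wt_prefix (eq_ind _ Wt Ww _ (esym (cats1 _ _)))).
case/lastP: u Eu vu => [|u d] Eu vu.
  by exists [:: 0] => //; rewrite Eu /= in Ww *; rewrite (Wt_head Ww).
have uN1 : ((size u).+1 < N)%N by move: wN; rewrite Eu size_map size_rcons.
have uN := ltnW uN1.
rewrite Eu /toK map_rcons -/(toK _) in Ww *.
have Ww' : Wt (toK u ++ [:: d%:~R; c]) by move: Ww; rewrite -!cats1 -catA.
have [E|n0] := eqVneq d%:~R c; first by case: (@Wt_eq (toK u) c); rewrite {1}E in Ww'.
have [E1|n1] := eqVneq d%:~R (c + 1).
  have Ec : c = (d - 1)%:~R by rewrite intrB E1 addrK.
  exists (rcons (rcons u d) (d - 1)); first by rewrite /toK !map_rcons Ec.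
  rewrite valid_rcons vu /=; move: vu; rewrite valid_rcons => /andP[vu /andP[_ /eqP ud]].
  have := @run_count (fun x => Wt (toK x)) Wp0 Wh0 We0 Ws0 Wt0 u (d - 1) 0.
  rewrite /= (_ : d - 1 + 1%:Z = d); last by lia.
  move=> /(_ (fun v Wv vu' => VN v Wv (leq_ltn_trans vu' uN))).
  rewrite /toK map_cat /= -/(toK _) -Ec => /(_ Ww') R.
  by rewrite /addable !cnt_rcons (_ : d - 1 + 1 = d); lia.
have [E2|n2] := eqVneq c (d%:~R + 1).
  have Ec : c = (d + 1)%:~R by rewrite intrD E2.
  exists (rcons (rcons u d) (d + 1)); first by rewrite /toK !map_rcons Ec.
  rewrite valid_rcons vu /=; move: vu; rewrite valid_rcons => /andP[vu /andP[/eqP ud _]].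
  (* Negating the contents transposes the diagrams and turns a rise d, d + 1 into a run to which
     [run_count] applies. *)
  pose neg := map (@GRing.opp int).
  have negK : involutive neg by move=> x; rewrite /neg -map_comp map_id_in // => y _; apply: opprK.
  have cneg x e : cnt (neg x) e = cnt x (- e).
    by rewrite /cnt count_map; apply: eq_count => y /=; rewrite eqr_oppLR.
  have vneg x : valid (neg x) = valid x.
    elim/last_ind: x => // x e IHx; rewrite /neg map_rcons -/(neg x) !valid_rcons IHx; congr (_ && _).
    rewrite /addable !cneg opprK (_ : - (- e + 1) = e - 1); last by lia.
    rewrite (_ : - (- e - 1) = e + 1); last by lia.
    by rewrite andbC; congr ((_ == (_ + nat_of_bool _)%N) && (_ == (_ + nat_of_bool _)%N)); lia.
  have := @run_count (fun x => Wt (toK (neg x))) _ _ _ _ _ (neg u) (- (d + 1)) 0.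
  move=> R; have {}R : cnt (neg u) (- (d + 1) - 1) = (cnt (neg u) (- (d + 1)) + (0 < - (d + 1))%R)%N.
    apply: R.
    - by move=> x y; rewrite /neg map_cat; apply: Wp0.
    - by move=> a /Wh0; lia.
    - by move=> x a; rewrite /neg map_cat; apply: We0.
    - by move=> x a e y ae; rewrite /neg !map_cat; apply: Ws0; move: ae; rewrite /far; lia.
    - by move=> x a e ae; rewrite /neg !map_cat; apply: Wt0; lia.
    - move=> x Wx xu; rewrite -[x]negK vneg; apply: VN => //.
      by move: xu; rewrite !size_map => xu; apply: leq_ltn_trans uN.
    - rewrite /neg map_cat -/neg /= -/(neg u) -/(neg (neg u)) negK /toK map_cat /= -/(toK _).
      have E3 : - (- (d + 1) + 1%:Z) = d by lia.
      by rewrite opprK E3 -Ec.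
  rewrite !cneg opprK (_ : - (- (d + 1) - 1) = d + 1 + 1) in R; last by lia.
  by rewrite /addable !cnt_rcons (_ : d + 1 - 1 = d); lia.
(* Here c may be exchanged with d; the shorter weight u c then shows that c is an integer addable
   after u, and farness carries this over to the word u d. *)
have Ws : Wt (toK u ++ [:: c; d%:~R]) by apply: Wt_swap Ww'; rewrite // eq_sym.
have [||u' E' vu'] := IH (rcons (toK u) c).
- by rewrite size_rcons size_map.
- by apply: (@Wt_prefix _ [:: d%:~R]); rewrite cat_rcons.
case/lastP: u' E' vu' => [|u' c'] E' vu'; first by case: (toK u) E'.
move: E'; rewrite /toK map_rcons => /eqP; rewrite eqseq_rcons => /andP[/eqP Eu' /eqP Ec].
have uu' : u = u'.
  by apply: (@inj_map _ _ (fun x : int => x%:~R : K)) Eu' => x y /eqP; rewrite intE => /eqP.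
exists (rcons (rcons u d) c'); first by rewrite /toK !map_rcons Ec.
rewrite valid_rcons vu /= addable_far; first by move: vu'; rewrite valid_rcons -uu' => /andP[].
move: n0 n1 n2; rewrite Ec !intS !intE /far; lia.
Qed.

End WeightsAreValid.

(** * Jucys-Murphy weights *)

Section LinearAlgebra.
Variables (K : fieldType) (V : vectType K).
Implicit Types (A B : 'End(V)) (S : {vspace V}).

HB.instance Definition _ A p :=
  GRing.isLinear.Build K V V *:%R (opoly A p) (opoly_is_linear p (@linearP _ _ _ _ A)).

Lemma mem_eig A c v : (v \in lker (A - c *: \1%VF)) = (A v == c *: v).
Proof. by rewrite memv_ker add_lfunE opp_lfunE scale_lfunE id_lfunE subr_eq0. Qed.

Definition lpoly A p : 'End(V) := linfun (opoly A p).
Lemma lpolyE A p v : lpoly A p v = opoly A p v. Proof. exact: lfunE. Qed.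
Lemma lpoly_eigen A p v c : A v = c *: v -> lpoly A p v = p.[c] *: v.
Proof. by move=> Av; rewrite lpolyE; apply: opoly_eigen => //; apply: linearP. Qed.

(* Applying successively A i - c to a sum of joint eigenvectors kills all terms but one. *)
Lemma joint_indep (T : finType) (I : Type) (A : I -> 'End(V)) (c : T -> I -> K) (u : T -> V) (P : pred T) :
  (forall s t, P s -> P t -> c s =1 c t -> s = t) ->
  (forall t i, P t -> A i (u t) = c t i *: u t) ->
  \sum_(t | P t) u t = 0 -> forall t, P t -> u t = 0.
Proof.
move=> cinj Au S0 t0 Pt0.
pose sep t : option I := if pselect (exists i, c t i != c t0 i) is left E then Some (sval (cid E)) else None.
have sepP t : P t -> t != t0 -> exists2 i, sep t = Some i & c t i != c t0 i.
  rewrite /sep => Pt tt0; case: pselect => [E|nE]; first by exists (sval (cid E)) => //; case: cid.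
  by case/eqP: tt0; apply: cinj => // i; apply/eqP/negbNE/negP => ci; apply: nE; exists i.
pose B (s : seq T) (v : V) := foldr (fun t v => if sep t is Some i then A i v - c t i *: v else v) v s.
pose k (s : seq T) t := \prod_(x <- s) (if sep x is Some i then c t i - c x i else 1).
have BS x s v : B (x :: s) v = if sep x is Some i then A i (B s v) - c x i *: B s v else B s v by [].
have Bu s t : P t -> B s (u t) = k s t *: u t.
  move=> Pt; rewrite /k; elim: s => [|x s IH] /=; first by rewrite big_nil scale1r.
  by rewrite big_cons IH; case: (sep x) => [i|]; rewrite ?mul1r // linearZ /= Au // !scalerA -scalerBl mulrBl mulrC.
have B0 s : B s 0 = 0.
  by elim: s => //= x s ->; case: (sep x) => [i|//]; rewrite linear0 scaler0 subrr.
have BD s : {morph B s : v w / v + w}.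
  elim: s => // x s IH v w; rewrite !BS IH; case: (sep x) => [i|//].
  by rewrite linearD /= scalerDr opprD addrACA.
pose s := [seq t <- enum T | P t && (t != t0)].
have := congr1 (B s) S0; rewrite (big_morph _ (BD s) (B0 s)) B0 (bigD1 t0) //= big1 ?addr0.
  rewrite Bu // => /eqP; rewrite scaler_eq0 => /orP[|/eqP//].
  rewrite /k prodf_seq_eq0 => /hasP[t]; rewrite mem_filter => /andP[/andP[Pt /(sepP _ Pt)[i -> ci]] _].
  by rewrite /= subr_eq0 eq_sym (negPf ci).
move=> t /andP[Pt tt0]; rewrite Bu // /k (big_rem t) /=; last by rewrite mem_filter Pt tt0 mem_enum.
by have [i -> _] := sepP t Pt tt0; rewrite subrr mul0r scale0r.
Qed.

Lemma dim_sum_indep (T : finType) (P : pred T) (S : T -> {vspace V}) :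
  (forall u : T -> V, (forall t, P t -> u t \in S t) -> \sum_(t | P t) u t = 0 -> forall t, P t -> u t = 0) ->
  \dim (\sum_(t | P t) S t)%VS = \sum_(t | P t) \dim (S t).
Proof. by move=> ind; apply/eqP; have /directvP/= -> := introT directv_sum_independent ind. Qed.

End LinearAlgebra.

Section EigenvectorIn.
Import VectorInternalTheory.

Lemma eigen_in (C : numClosedFieldType) (V : vectType C) (A : 'End(V)) (S : {vspace V}) :
  S != 0%VS -> (A @: S <= S)%VS -> exists2 v, v \in S & v != 0 /\ exists c, A v = c *: v.
Proof.
move=> S0 AS; pose f : 'End(subvs_of S) := linfun (vsproj S \o A \o vsval).
have d0 : (0 < dim (subvs_of S))%N.
  by rewrite (_ : dim (subvs_of S) = \dim S) // lt0n dimv_eq0.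
have [c /eigenvalueP[u uc u0]] := eigenvalue_closed (f2mx f) d0.
pose w : subvs_of S := r2v u.
have fw : f w = c *: w.
  have -> : f w = r2v (u *m f2mx f).
    by rewrite unlock /= r2vK.
  by rewrite uc linearZ.
exists (vsval w); first exact: subvsP.
split.
  apply: contra_neq u0 => w0; rewrite -[u]r2vK -/w.
  have -> : w = 0 by apply: val_inj.
  by rewrite linear0.
exists c; have := congr1 vsval fw; rewrite lfunE /= vsprojK //.
by apply: (subvP AS); apply: memv_img; apply: subvsP.
Qed.

End EigenvectorIn.

(** * An invariant Hermitian form *)

Section Averaging.
Variables (C : numClosedFieldType) (n : nat) (U : srep C n).
Implicit Types (u v w : U) (g h : 'S_n).

(** Averaging over the group makes the action unitary, so that transpositions, and with them the
    Jucys-Murphy elements, are self-adjoint. *)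
Definition hform v w : C :=
  \sum_(g : 'S_n) \sum_(t < \dim {:U}) coord (vbasis fullv) t (sact U g v) * (coord (vbasis fullv) t (sact U g w))^*.

Lemma hformP c u v w : hform (c *: u + v) w = c * hform u w + hform v w.
Proof.
rewrite /hform mulr_sumr -big_split; apply: eq_bigr => g _ /=.
rewrite mulr_sumr -big_split; apply: eq_bigr => t _ /=.
by rewrite !linearP /= mulrDl mulrA.
Qed.
Lemma hformC v w : hform w v = (hform v w)^*.
Proof.
rewrite /hform rmorph_sum; apply: eq_bigr => g _; rewrite rmorph_sum; apply: eq_bigr => t _.
by rewrite rmorphM /= conjCK mulrC.
Qed.
Lemma hform0 w : hform 0 w = 0.
Proof. by have := hformP (-1) 0 0 w; rewrite scaler0 add0r mulN1r addNr. Qed.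
Lemma hformZ c u w : hform (c *: u) w = c * hform u w.
Proof. by have := hformP c u 0 w; rewrite hform0 !addr0. Qed.
Lemma hformD u v w : hform (u + v) w = hform u w + hform v w.
Proof. by have := hformP 1 u v w; rewrite scale1r mul1r. Qed.

Lemma hform_eq0 v : hform v v = 0 -> v = 0.
Proof.
have pos g (t : 'I_(\dim {:U})) : 0 <= coord (vbasis fullv) t (sact U g v) * (coord (vbasis fullv) t (sact U g v))^*.
  by rewrite -normCK exprn_ge0.
move=> /eqP; rewrite psumr_eq0 => [|g _]; last by apply: sumr_ge0.
move=> /allP/(_ 1%g); rewrite mem_index_enum => /(_ isT)/=.
rewrite psumr_eq0 // => /allP z; rewrite (coord_vbasis (memvf v)) big1 // => t _.
have := z t; rewrite mem_index_enum => /(_ isT)/=.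
by rewrite sact1 -normCK expf_eq0 /= normr_eq0 => /eqP->; rewrite scale0r.
Qed.

Lemma hform_act g v w : hform (sact U g v) w = hform v (sact U (g^-1)%g w).
Proof.
rewrite {1}/hform (reindex_inj (mulIg (g^-1)%g)); apply: eq_bigr => h _.
apply: eq_bigr => t _; by rewrite -!sactM mulgKV.
Qed.

End Averaging.

Section JucysMurphy.
Variables (C : numClosedFieldType) (n : nat) (U : srep C n).
Implicit Types (u v w : U) (g h : 'S_n) (i j k l : 'I_n).
Local Notation s_ i j := (sact U (tperm i j)).

Definition JM i : 'End(U) := \sum_(j : 'I_n | (j < i)%N) s_ i j.
Lemma JME i v : JM i v = \sum_(j : 'I_n | (j < i)%N) s_ i j v.
Proof. by rewrite /JM sum_lfunE. Qed.

Lemma sK i j v : s_ i j (s_ i j v) = v.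
Proof. by rewrite -sactM tperm2 sact1. Qed.

Lemma sact_tperm g i j v : sact U g (s_ i j v) = s_ ((g^-1)%g i) ((g^-1)%g j) (sact U g v).
Proof. by rewrite -!sactM -tpermJ conjgE invgK -!mulgA mulVg mulg1. Qed.

Lemma s_JM i k v : k = i.+1 :> nat -> s_ i k (JM i v) = JM k (s_ i k v) - v.
Proof.
move=> ki; rewrite !JME linear_sum [in RHS](bigD1 i) /= ?ki // (tpermC k i) sK addrC addrK.
apply: eq_big => [l|l li]; first by rewrite ltnS ltn_neqAle andbC.
rewrite sact_tperm tpermV tpermL tpermD //; apply/eqP=> E; move: li; rewrite -E; lia.
Qed.

Lemma s_JM' i k v : k = i.+1 :> nat -> s_ i k (JM k v) = JM i (s_ i k v) + v.
Proof.
move=> ki; apply: (can_inj (sK i k)); rewrite sK linearD /= s_JM // sK.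
by rewrite subrK.
Qed.

Lemma s_JMout i k l v : (i < l)%N = (k < l)%N -> l != i -> l != k -> s_ i k (JM l v) = JM l (s_ i k v).
Proof.
move=> ikl li lk; rewrite !JME linear_sum /= [RHS](reindex_perm (tperm i k)) /=.
apply: eq_big => [j|j jl].
  by case: tpermP => [->|->|]; rewrite ?ikl.
by rewrite sact_tperm tpermV [tperm i k l]tpermD // eq_sym.
Qed.

Lemma JMC i k v : JM i (JM k v) = JM k (JM i v).
Proof.
wlog ik : i k / (i < k)%N => [hw|].
  by case: (ltngtP i k) => [|/hw->|/val_inj->] //; apply: hw.
rewrite ![JM i _]JME linear_sum; apply: eq_bigr => j ji /=.
by rewrite s_JMout //; [lia| |]; apply/eqP=> E; move: ik ji; rewrite E; lia.
Qed.

Lemma hform_JM i v w : hform (JM i v) w = hform v (JM i w).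
Proof.
rewrite hformC [RHS]hformC; congr (_^*).
suff E x y : hform (JM i x) y = \sum_(j : 'I_n | (j < i)%N) hform x (s_ i j y).
  rewrite [RHS]E hformC E rmorph_sum; apply: eq_bigr => j _.
  by rewrite /= -hformC hform_act tpermV.
rewrite JME (big_morph (fun z => hform z y) (fun a b => hformD a b y) (hform0 y)).
by apply: eq_bigr => j _; rewrite hform_act tpermV.
Qed.

(* Self-adjointness rules out Jordan blocks. *)
Lemma JM_ss i a v x : v != 0 -> JM i x = a *: x + v -> JM i v = a *: v -> False.
Proof.
move=> v0 Jx Jv; move/eqP: v0; apply; apply: hform_eq0.
have aR : hform v v != 0 -> a^* = a.
  move=> nz; have := hform_JM i v v; rewrite Jv hformZ [in RHS]hformC hformZ rmorphM /= -hformC.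
  by move=> /(mulIf nz).
have [//|nz] := eqVneq (hform v v) 0.
have := hform_JM i x v; rewrite Jx Jv hformD hformZ [in RHS]hformC hformZ rmorphM /= -hformC aR //.
by move=> /eqP; rewrite -subr_eq0 addrC addrA addNr add0r => /eqP.
Qed.

Definition Wt (w : seq C) := (size w <= n)%N /\
  exists2 v, v != 0 & forall i, (i < size w)%N -> JM i v = w`_i *: v.

Lemma Wt_prefix (w u : seq C) : Wt (w ++ u) -> Wt w.
Proof.
move=> [sz [v v0 Jv]]; split; first by move: sz; rewrite size_cat; lia.
exists v => // i iw; rewrite Jv ?nth_cat ?iw // size_cat; lia.
Qed.



Lemma Wt_head a : Wt [:: a] -> a = 0.
Proof.
move=> [/= n0 [v v0 /(_ (Ordinal n0) isT)]]; rewrite JME big_pred0 => [|j]; last by [].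
by move=> /esym/eqP; rewrite scaler_eq0 (negPf v0) orbF => /eqP.
Qed.

Section Adjacent.
Variables (w u : seq C) (a e : C).
Hypothesis sz : (size (w ++ [:: a, e & u]) <= n)%N.
Fact posi_lt : (size w < n)%N. Proof. by move: sz; rewrite size_cat /=; lia. Qed.
Fact posk_lt : ((size w).+1 < n)%N. Proof. by move: sz; rewrite size_cat /=; lia. Qed.
Let i := Ordinal posi_lt.
Let k := Ordinal posk_lt.
Variable v : U.
Hypothesis Jv : forall l, (l < size (w ++ [:: a, e & u]))%N -> JM l v = (w ++ [:: a, e & u])`_l *: v.

Lemma Adj_Ji : JM i v = a *: v.
Proof. by rewrite Jv ?nth_cat ?ltnn ?subnn // size_cat /=; lia. Qed.
Lemma Adj_Jk : JM k v = e *: v.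
Proof.
rewrite Jv; first by rewrite nth_cat /= ltnNge leqnSn /= subSnn.
by rewrite size_cat /=; lia.
Qed.

Lemma Adj_eq : a = e -> v = 0.
Proof.
move=> ae; apply/eqP/negPn/negP => v0.
have Js : JM i (s_ i k v) = a *: s_ i k v + (- v).
  have := @s_JM' i k v erefl; rewrite Adj_Jk -ae linearZ /= => ->; by rewrite addrK.
by apply: (JM_ss _ Js); rewrite ?oppr_eq0 // linearN /= Adj_Ji scalerN.
Qed.

(** The intertwiner s + 1/(a - e) of the degenerate affine Hecke algebra. By [Adj_nz] it can kill a
    nonzero [v] only when (a - e)^2 = 1. *)
Lemma Adj_swap l : a != e -> (l < size (w ++ [:: e, a & u]))%N ->
  JM l (s_ i k v + (a - e)^-1 *: v) = (w ++ [:: e, a & u])`_l *: (s_ i k v + (a - e)^-1 *: v).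
Proof.
move=> ae ls; have nz : a - e != 0 by rewrite subr_eq0.
have Jl := Jv (l := l); rewrite !size_cat /= in ls Jl; have {}Jl := Jl ls.
rewrite linearD linearZ /=.
have [Ei|li] := eqVneq (l : nat) (size w).
  have -> : l = i by apply: val_inj.
  have -> : JM i (s_ i k v) = e *: s_ i k v - v.
    by have := @s_JM' i k v erefl; rewrite Adj_Jk linearZ /= => ->; rewrite addrK.
  rewrite Adj_Ji nth_cat ltnn subnn /= scalerDr !scalerA -addrA; congr (_ + _).
  rewrite -{1}[v]scale1r -scaleNr -scalerDl; congr (_ *: _).
  by apply: (mulIf nz); rewrite mulrDl mulrAC mulVf // -mulrA mulVf //; ring.
have [Ek|lk] := eqVneq (l : nat) (size w).+1.
  have -> : l = k by apply: val_inj.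
  have -> : JM k (s_ i k v) = a *: s_ i k v + v.
    by have := @s_JM i k v erefl; rewrite Adj_Ji linearZ /= => ->; rewrite subrK.
  rewrite Adj_Jk nth_cat /= ltnNge leqnSn /= subSnn /= scalerDr !scalerA -addrA; congr (_ + _).
  rewrite -{1}[v]scale1r -scalerDl; congr (_ *: _).
  by apply: (mulIf nz); rewrite mulrDl mulrAC mulVf // -mulrA mulVf //; ring.
have lik : (l != i) && (l != k) by rewrite -!val_eqE /= li lk.
rewrite -s_JMout; try by case/andP: lik.
  rewrite Jl linearZ /= scalerDr scalerA mulrC -scalerA.
  congr (_ *: _ + _ *: (_ *: _)); rewrite !nth_cat; case: ifP => // lw;
  by case: (l - size w)%N (subnSK (n := l) (m := size w)) li lk => [|[|x]] //=; lia.
by rewrite /=; lia.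
Qed.

Lemma Adj_nz : (a - e) ^+ 2 != 1 -> a != e -> v != 0 -> s_ i k v + (a - e)^-1 *: v != 0.
Proof.
move=> a1 ae v0; apply: contra_neq a1 => E; set c := (a - e)^-1 in E.
have sv : s_ i k v = - c *: v by rewrite scaleNr; apply/eqP; rewrite -addr_eq0 E.
have := sK i k v; rewrite sv linearZ /= sv scalerA mulrNN -[RHS]scale1r => /eqP.
rewrite -subr_eq0 -scalerBl scaler_eq0 (negPf v0) orbF subr_eq0 -invfM => /eqP c1.
by rewrite expr2 -[LHS]invrK c1 invr1.
Qed.
End Adjacent.

Lemma Wt_eq (w : seq C) a : ~ Wt (w ++ [:: a; a]).
Proof.
move=> [sz [v v0 Jv]]; move/eqP: v0; apply.
exact: (@Adj_eq w [::] a a sz v Jv).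
Qed.

Lemma Wt_swap (w : seq C) a e (u : seq C) : a != e -> a != e + 1 -> e != a + 1 ->
  Wt (w ++ [:: a, e & u]) -> Wt (w ++ [:: e, a & u]).
Proof.
move=> ae a1 e1 [sz [v v0 Jv]]; split; first by rewrite !size_cat in sz *.
exists (s_ (Ordinal (posi_lt sz)) (Ordinal (posk_lt sz)) v + (a - e)^-1 *: v); last first.
  by move=> l; apply: Adj_swap.
apply: Adj_nz => //; rewrite sqrf_eq1 negb_or subr_eq addrC a1 /=.
by apply: contra_neq e1 => E; rewrite -[LHS](subKr a) E opprK.
Qed.

(* The two simple reflections would act by opposite signs, contradicting the braid relation. *)
Lemma Wt_triple (w : seq C) a e : (a == e + 1) || (e == a + 1) -> ~ Wt (w ++ [:: a; e; a]).
Proof.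
move=> ae0 [sz [v v0 Jv]].
have ae : a != e.
  case/orP: ae0 => /eqP->; first by rewrite -subr_eq0 addrAC subrr add0r oner_eq0.
  by rewrite eq_sym -subr_eq0 addrAC subrr add0r oner_eq0.
have c2 : ((a - e)^-1) ^+ 2 = 1.
  case/orP: ae0 => /eqP->; first by rewrite addrAC subrr add0r invr1 expr1n.
  by rewrite opprD addrA subrr add0r invrN sqrrN invr1 expr1n.
have sz2 : (size ((w ++ [:: a]) ++ [:: e, a & [::]]) <= n)%N by rewrite -catA.
have Jv2 l : (l < size ((w ++ [:: a]) ++ [:: e, a & [::]]))%N -> JM l v = ((w ++ [:: a]) ++ [:: e, a & [::]])`_l *: v.
  by rewrite -catA; apply: Jv.
pose i := Ordinal (posi_lt sz); pose k := Ordinal (posk_lt sz).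
pose k' := Ordinal (posi_lt sz2); pose l := Ordinal (posk_lt sz2).
have kk' : k' = k by apply: val_inj; rewrite /= size_cat addn1.
have ea : e != a by rewrite eq_sym.
have s1 : s_ i k v = - (a - e)^-1 *: v.
  apply/eqP; rewrite scaleNr -addr_eq0; apply/negPn/negP => nz.
  apply: (@Wt_eq (w ++ [:: e]) a); rewrite -catA /=; split; first by move: (sz); rewrite !size_cat.
  by exists (s_ i k v + (a - e)^-1 *: v) => // x xs; exact: (@Adj_swap w [:: a] a e sz v Jv x ae xs).
have s2 : s_ k l v = (a - e)^-1 *: v.
  rewrite -kk'; apply/eqP; rewrite -subr_eq0 -scaleNr -invrN opprB; apply/negPn/negP => nz.
  apply: (@Wt_eq w a); apply: (@Wt_prefix _ [:: e]); rewrite -catA /=.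
  split; first by move: (sz); rewrite !size_cat.
  exists (s_ k' l v + (e - a)^-1 *: v) => // x xs.
  by have := @Adj_swap (w ++ [:: a]) [::] e a sz2 v Jv2 x ea; rewrite -catA; apply.
have br : (tperm i k * tperm k l * tperm i k = tperm k l * tperm i k * tperm k l)%g.
  have ik : i != k by rewrite -val_eqE /= neq_ltn leqnn.
  have il : i != l by rewrite -val_eqE /= size_cat /= neq_ltn; lia.
  have kl : k != l by rewrite -val_eqE /= size_cat /= neq_ltn; lia.
  have := tpermJ k l (tperm i k); rewrite tpermR (tpermD il kl) conjgE tpermV mulgA => ->.
  have := tpermJ i k (tperm k l); rewrite tpermL tpermD ?(eq_sym _ i) // conjgE tpermV mulgA => -> //.
have := congr1 (fun g => sact U g v) br; rewrite !sactM !(s1, s2, linearZ) /= !(s1, s2, linearZ) /= !(s1, s2) !scalerA.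
set c := (a - e)^-1 in c2 *; move/eqP; rewrite -subr_eq0 -scalerBl scaler_eq0 (negPf v0) orbF.
have -> : c * - c * - c - - c * c * c = c ^+ 2 * c *+ 2 by rewrite expr2; ring.
by rewrite c2 mul1r mulrn_eq0 /= invr_eq0 subr_eq0 (negPf ae).
Qed.

(** A joint eigenvector arises by intersecting with an eigenspace of one element at a time; its
    orthogonal complement in [S] for [hform] is again stable, and the dimension drops. *)
Lemma JM_span (S : {vspace U}) : (forall i, (JM i @: S <= S)%VS) ->
  exists vs : seq U, (S <= <<vs>>)%VS /\
    forall v, v \in vs -> v != 0 /\ exists w : seq C, size w = n /\ forall i, JM i v = w`_i *: v.
Proof.
have [N] := ubnP (\dim S); elim: N S => // N IH S SN JS.
have [->|S0] := eqVneq S 0%VS; first by exists [::]; rewrite sub0v.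
have J m : (m <= n)%N -> exists S' : {vspace U}, [/\ (S' <= S)%VS, S' != 0%VS,
    forall i, (JM i @: S' <= S')%VS & exists w : nat -> C, forall v i, v \in S' -> (i < m)%N -> JM i v = w i *: v].
  elim: m => [|m IHm] mn; first by exists S; split => //; exists (fun=> 0).
  have [S' [S'S S'0 JS' [w Jw]]] := IHm (ltnW mn).
  pose k := Ordinal mn; have [v vS [v0 [c vc]]] := eigen_in S'0 (JS' k).
  exists (S' :&: lker (JM k - c *: \1%VF))%VS; split.
  - exact: subv_trans (capvSl _ _) S'S.
  - apply: contra_neq v0 => E; apply/eqP; rewrite -memv0 -E memv_cap vS /=.
    by rewrite mem_eig vc.
  - move=> i; apply/subvP=> _ /memv_imgP[x + ->]; rewrite memv_cap mem_eig => /andP[xS /eqP xc].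
    rewrite memv_cap mem_eig (subvP (JS' i)) ?memv_img //=.
    by rewrite JMC xc linearZ.
  - exists (fun i : nat => if i == m then c else w i) => x i; rewrite memv_cap mem_eig => /andP[xS /eqP xc].
    rewrite ltnS leq_eqVlt; case: eqVneq => [im|_] //=; last exact: Jw.
    by rewrite -xc => _; congr (JM _ x); apply: val_inj.
have [S' [S'S S'0 _ [w Jw]]] := J n (leqnn n).
have vS' := memv_pick S'; set v := vpick S' in vS'; have v0 : v != 0 by rewrite /v vpick0.
have vS := subvP S'S _ vS'.
pose hv x : C^o := hform x v.
have hl : linear hv by move=> c x y; rewrite /hv hformP.
pose hvL := GRing.isLinear.Build C U C^o *:%R hv hl.
pose hvl : {linear U -> C^o} := HB.pack hv hvL.
have hvE x : linfun hvl x = hform x v by rewrite lfunE.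
pose S2 := (S :&: lker (linfun hvl))%VS.
have nz : hform v v != 0 by apply: contra_neq v0; apply: hform_eq0.
have [||vs [S2s vsP]] := IH S2.
- suff: (\dim S2 < \dim S)%N by move=> lt; rewrite (leq_trans lt) // -ltnS.
  rewrite ltn_neqAle dimvS ?capvSl // andbT; apply/negP => /eqP E.
  have /eqP E2 : S2 == S by rewrite eqEdim capvSl E leqnn.
  have : v \in S2 by rewrite E2.
  by rewrite memv_cap memv_ker hvE (negPf nz) andbF.
- move=> i; apply/subvP=> _ /memv_imgP[x + ->]; rewrite memv_cap memv_ker hvE => /andP[xS /eqP xv].
  rewrite memv_cap memv_ker hvE (subvP (JS i)) ?memv_img //= hform_JM (Jw _ i vS') //.
  by rewrite hformC hformZ rmorphM /= -hformC xv mulr0.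
exists (v :: vs); split; last first.
  move=> x; rewrite inE => /orP[/eqP->|/vsP//]; split=> //.
  exists (mkseq w n); rewrite size_mkseq; split => // i; rewrite nth_mkseq //; exact: Jw.
apply/subvP=> x xS; rewrite span_cons.
have -> : x = (hform x v / hform v v) *: v + (x - (hform x v / hform v v) *: v) by rewrite addrC subrK.
apply: memv_add; first exact/memvZ/memv_line.
apply: (subvP S2s); rewrite memv_cap memv_ker hvE rpredB ?rpredZ //=.
by rewrite hformD -scaleNr hformZ mulNr mulfVK // subrr.
Qed.

Lemma valid_bound (w : seq int) : valid w -> all (fun a => `|a| < (size w)%:Z) w.
Proof.
elim/last_ind: w => // w a IH; rewrite valid_rcons size_rcons all_rcons => /andP[/IH wb /andP[/eqP a1 /eqP a2]].
apply/andP; split; last by apply: sub_all wb => x; lia.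
have mem e : (0 < cnt w e)%N -> `|e| < (size w)%:Z by rewrite -has_count has_pred1 => /(allP wb).
have := mem (a + 1); have := mem (a - 1); rewrite a1 a2.
have [->//|a0] := eqVneq a 0; have [an|an] : (a < 0) \/ (0 < a) by lia.
  by rewrite an => _; rewrite [(cnt w a + _)%R]addrC => /(_ isT); lia.
by rewrite an addn1 => /(_ isT) + _; lia.
Qed.

(** Contents are below n in absolute value by [valid_bound]; shifted by n they fill a finite type
    over which words can be summed and counted. *)
Definition wtT := (n.-tuple 'I_(n.*2.+1))%type.
Definition wd (t : wtT) : seq int := map (fun x : 'I_(n.*2.+1) => (x : nat)%:Z - n%:Z) t.
Lemma size_wd t : size (wd t) = n. Proof. by rewrite size_map size_tuple. Qed.

Lemma wd_inj : injective wd.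
Proof.
move=> s t /inj_map E; apply: val_inj; apply: E => x y xy; apply: val_inj => /=; lia.
Qed.

Lemma wd_onto (w : seq int) : valid w -> size w = n -> exists t, wd t = w.
Proof.
move=> vw sw; have wb := valid_bound vw.
have sz : size (map (fun a : int => inord (absz (a + n%:Z)) : 'I_(n.*2.+1)) w) == n by rewrite size_map sw.
exists (Tuple sz); rewrite /wd /= -map_comp map_id_in // => a /(allP wb) /= ab.
by rewrite inordK; move: ab; rewrite sw; lia.
Qed.

Definition Ew (w : seq int) : {vspace U} := (\bigcap_i lker (JM i - (w`_i)%:~R *: \1%VF))%VS.

Lemma EwP (w : seq int) v : reflect (forall i, JM i v = (w`_i)%:~R *: v) (v \in Ew w).
Proof.
have -> : (v \in Ew w) = all (fun i => JM i v == (w`_i)%:~R *: v) (index_enum 'I_n).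
  rewrite /Ew; elim: (index_enum _) => [|i s IH]; first by rewrite big_nil memvf.
  by rewrite big_cons memv_cap IH mem_eig.
apply: (iffP allP) => [h i|h i _]; last by apply/eqP.
by apply/eqP/h; rewrite mem_index_enum.
Qed.

Lemma Ew_valid (w : seq int) v : size w = n -> v \in Ew w -> v != 0 -> valid w.
Proof.
move=> sw /EwP Jv v0; have W : Wt (map (fun a : int => a%:~R) w).
  split; first by rewrite size_map sw.
  by exists v => // i _; rewrite Jv (nth_map 0) ?sw.
have [u E vu] := weights_valid Wt_prefix Wt_head Wt_eq Wt_swap Wt_triple W.
suff -> : w = u by [].
by apply: inj_map E => x y /eqP; rewrite eqr_int => /eqP.
Qed.

Lemma Ew_sum : (\sum_(t : wtT) Ew (wd t))%VS = fullv.
Proof.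
apply/eqP; rewrite eqEsubv subvf /=.
have [i|vs [sub vsP]] := @JM_span fullv; first exact: subvf.
apply: subv_trans sub _; apply/span_subvP=> v /vsP[v0 [w [sw Jv]]].
have W : Wt w by split; [rewrite sw | exists v].
have [u E vu] := weights_valid Wt_prefix Wt_head Wt_eq Wt_swap Wt_triple W.
have su : size u = n by rewrite -sw E size_map.
have [t tu] := wd_onto vu su.
apply: (subvP (sumv_sup t _ (subvv _))) => //; rewrite tu; apply/EwP => i.
by rewrite Jv E (nth_map 0) ?su.
Qed.

Lemma Ew_indep (P : pred wtT) (u : wtT -> U) : (forall t, P t -> u t \in Ew (wd t)) ->
  \sum_(t | P t) u t = 0 -> forall t, P t -> u t = 0.
Proof.
move=> uE; apply: (@joint_indep _ _ _ _ JM (fun t i => ((wd t)`_i)%:~R)) => [s t _ _ E|t i Pt].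
  apply: wd_inj; apply: (@eq_from_nth _ 0); rewrite ?size_wd // => i ilt.
  by have /eqP := E (Ordinal ilt); rewrite eqr_int => /eqP.
by apply/EwP/uE.
Qed.

End JucysMurphy.

Section Interpolation.
Variable K : fieldType.
Implicit Types (x z : K) (zs : seq K).

Lemma sep_poly x zs : exists p : {poly K}, p.[x] = 1 /\ forall z, z \in zs -> z != x -> p.[z] = 0.
Proof.
exists (\prod_(z <- zs | z != x) ((x - z)^-1 *: ('X - z%:P))); split=> [|z zin zx].
  rewrite horner_prod big1 // => z zx; rewrite hornerZ hornerXsubC mulVf // subr_eq0 eq_sym //.
rewrite horner_prod; apply/eqP; rewrite prodf_seq_eq0; apply/hasP; exists z => //=.
by rewrite zx hornerZ hornerXsubC subrr mulr0 eqxx.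
Qed.
End Interpolation.

(** A polynomial equal to 1 at x and 0 at the other occurring values turns both sums into
    cardinalities, which characteristic zero lets one compare. *)
Lemma polysum_count (K : numFieldType) (I : finType) (s t : I -> K) :
  (forall p : {poly K}, \sum_i p.[s i] = \sum_i p.[t i]) ->
  forall x, #|[set i | s i == x]| = #|[set i | t i == x]|.
Proof.
move=> E x; have [p [p1 p0]] := sep_poly x (map s (enum I) ++ map t (enum I)).
have cE (u : I -> K) : (forall i, u i \in map s (enum I) ++ map t (enum I)) ->
    \sum_i p.[u i] = #|[set i | u i == x]|%:R.
  move=> uin; rewrite -sum1_card natr_sum [RHS]big_mkcond; apply: eq_bigr => i _.
  rewrite inE; case: eqVneq => [->|ux]; first by rewrite p1.
  by rewrite p0.
have := E p; rewrite !cE; first by move/eqP; rewrite eqr_nat => /eqP.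
  by move=> i; rewrite mem_cat (map_f t) ?mem_enum ?orbT.
by move=> i; rewrite mem_cat (map_f s) ?mem_enum.
Qed.

Section StabilizerGeneration.
Variable n : nat.
Implicit Types (g h : 'S_n) (i j k : 'I_n).

Lemma mact_stab (a : mi n) g i : mact g a = a -> a (g i) = a i.
Proof. by move=> {1}<-; rewrite ffunE permK. Qed.

(** The blocks of an increasing [a] are intervals, so a transposition inside a block is a product of
    transpositions of neighbours in it. Multiplying g by the transposition of x and g x fixes one
    more point. *)
Lemma stab_gen (a : mi n) (P : 'S_n -> Prop) : mincr a -> P 1%g ->
    (forall g h, P g -> P h -> P (g * h)%g) ->
    (forall i j, j = i.+1 :> nat -> a i = a j -> P (tperm i j)) ->
  forall g, mact g a = a -> P g.
Proof.
move=> ainc P1 PM Padj.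
have Pt d i j : j = (i + d.+1)%N :> nat -> a i = a j -> P (tperm i j).
  elim: d j => [|d IH] j ij aij; first by apply: Padj; rewrite // ij addn1.
  have lt_jn : (i + d.+1 < n)%N by have := ltn_ord j; lia.
  pose l := Ordinal lt_jn.
  have lj : j = l.+1 :> nat by rewrite /= ij; lia.
  have ail : a i = a l.
    by have := ainc i l; have := ainc l j; rewrite lj /= leqnSn aij; have := leq_addr d.+1 i; lia.
  have -> : tperm i j = (tperm l j * tperm i l * tperm l j)%g.
    have := tpermJ i l (tperm l j); rewrite tpermL tpermD; last 2 first.
    - by apply/eqP => /(congr1 val) /=; lia.
    - by apply/eqP => /(congr1 val) /=; lia.
    by move=> <-; rewrite conjgE tpermV mulgA.
  have alj : a l = a j by rewrite -ail.
  by apply: (PM _ _ (PM _ _ _ _)); [exact: Padj | exact: IH | exact: Padj].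
have Pt' i j : a i = a j -> P (tperm i j).
  have [ij|ji|/val_inj->] := ltngtP i j.
  - by apply: (Pt (j - i).-1); lia.
  - by rewrite tpermC => aij; apply: (Pt (i - j).-1); [lia|].
  - by rewrite tperm1.
move=> g; have [N] := ubnP #|[set x | g x != x]|; elim: N g => // N IH g gN ga.
have [x gx|/= fx] := pickP (fun x => g x != x); last first.
  suff -> : g = 1%g by [].
  by apply/permP=> x; rewrite perm1; apply/eqP/negbFE/fx.
pose t := tperm x (g x).
have at_ : mact t a = a.
  apply/ffunP=> i; rewrite ffunE tpermV; case: tpermP => [->|->|] //; by rewrite (mact_stab _ ga).
have -> : g = (g * t * t)%g by rewrite -mulgA tperm2 mulg1.
apply: PM; last by apply: Pt'; rewrite (mact_stab _ ga).
apply: IH; last by rewrite mactM ga.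
rewrite -ltnS; apply: leq_trans gN; rewrite ltnS; apply/proper_card/properP; split.
  apply/subsetP=> y; rewrite !inE permM; apply: contra_neq => gy; rewrite gy.
  rewrite tpermD // eq_sym; first by apply: contra_neq gx => <-.
  by apply: contra_neq gx => yg; rewrite yg in gy; apply: (@perm_inj _ g).
by exists x; rewrite !inE // permM tpermR eqxx.
Qed.
End StabilizerGeneration.

(** * Symmetrization over the blocks of a multi-index *)

Section BlockInvariants.
Variables (C : numClosedFieldType) (n : nat) (U : srep C n).
Implicit Types (u v : U) (g h : 'S_n) (i j k l : 'I_n) (a : mi n) (p q : {poly C}) (w : seq int).
Local Notation s_ i j := (sact U (tperm i j)).

Lemma Ew_JM w v i : v \in Ew U w -> JM U i v = (w`_i)%:~R *: v.
Proof. by move/EwP. Qed.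

(** The leading part of z_i at the component [a], up to the reversal of each block carried out in
    [Aop_sum]. *)
Definition Zc a (c : C) i : 'End(U) := ((a i)%:R *: \1 + c *: JM U i)%VF.
Lemma ZcE a c i v : Zc a c i v = (a i)%:R *: v + c *: JM U i v.
Proof. by rewrite /Zc add_lfunE !scale_lfunE id_lfunE. Qed.

Definition Dop a c p : 'End(U) := \sum_i lpoly (Zc a c i) p.
Lemma DopE a c p v : Dop a c p v = \sum_i opoly (Zc a c i) p v.
Proof. by rewrite /Dop sum_lfunE; apply: eq_bigr => i _; rewrite lpolyE. Qed.

Lemma s_Dop a c p i k v : k = i.+1 :> nat -> a i = a k -> s_ i k (Dop a c p v) = Dop a c p (s_ i k v).
Proof.
move=> ki aik; have ki' : k != i by apply/eqP=> E; rewrite E in ki; lia.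
rewrite !DopE linear_sum /= (bigD1 i) //= (bigD1 k) //= [RHS](bigD1 i) //= [in RHS](bigD1 k) //=.
rewrite !addrA; congr (_ + _); last first.
  apply: eq_bigr => l /andP[li lk]; apply: opoly_comm; first exact: linearP.
  move=> u; rewrite !ZcE linearD !linearZ /= s_JMout //.
  by move: li lk; rewrite -!val_eqE /= ki; lia.
rewrite -linearD; apply: (@opoly_sum2_comm _ _ _ _ _ (- c)); try exact: linearP.
- by move=> u; rewrite !ZcE !linearD !linearZ /= !scalerA JMC aik (mulrC c (a k)%:R) addrACA.
- by move=> u; rewrite !ZcE linearD !linearZ /= s_JM // scalerBr aik scaleNr addrA.
- by move=> u; rewrite !ZcE linearD !linearZ /= s_JM' // scalerDr aik scalerN scaleNr opprK addrA.
Qed.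

Lemma g_Dop a c p g v : mincr a -> mact g a = a -> sact U g (Dop a c p v) = Dop a c p (sact U g v).
Proof.
move=> ainc ga; move: g ga v; apply: (@stab_gen _ a (fun g => forall v, sact U g (Dop a c p v) = Dop a c p (sact U g v)) ainc).
- by move=> v; rewrite !sact1.
- by move=> g h IHg IHh v; rewrite !sactM IHh IHg.
- by move=> i j ij aij v; apply: s_Dop.
Qed.

Definition eB a : 'End(U) := (#|[set g : 'S_n | mact g a == a]|%:R)^-1 *: \sum_(g : 'S_n | mact g a == a) sact U g.
Lemma eBE a v : eB a v = (#|[set g : 'S_n | mact g a == a]|%:R)^-1 *: \sum_(g : 'S_n | mact g a == a) sact U g v.
Proof. by rewrite /eB scale_lfunE sum_lfunE. Qed.

Lemma mactV a g : mact g a = a -> mact (g^-1)%g a = a.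
Proof. by move=> ga; rewrite -{1}ga -mactM mulgV mact1. Qed.

Lemma eB_invl a g v : mact g a = a -> sact U g (eB a v) = eB a v.
Proof.
move=> ga; rewrite !eBE linearZ linear_sum /=; congr (_ *: _).
rewrite [RHS](reindex_inj (mulgI g)); apply: eq_big => [h|h _] /=; last by rewrite sactM.
by rewrite mactM ga.
Qed.
Lemma eB_invr a g v : mact g a = a -> eB a (sact U g v) = eB a v.
Proof.
move=> ga; rewrite !eBE; congr (_ *: _).
rewrite [RHS](reindex_inj (mulIg g)); apply: eq_big => [h|h _] /=; last by rewrite sactM.
by rewrite mactM; apply/eqP/eqP => [->//|E]; rewrite -[LHS](mact1) -(mulgV g) mactM E mactV.
Qed.

Lemma eB_id a v : (forall g, mact g a = a -> sact U g v = v) -> eB a v = v.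
Proof.
move=> vinv; rewrite eBE (eq_bigr (fun=> v)) => [|g /eqP/vinv//].
rewrite (eq_bigl (fun g => g \in [set g : 'S_n | mact g a == a])) => [|g]; last by rewrite inE.
rewrite sumr_const -scaler_nat scalerA mulVf ?scale1r // pnatr_eq0 -lt0n.
by apply/card_gt0P; exists 1%g; rewrite inE mact1.
Qed.


Definition VS a : {vspace U} := limg (eB a).
Lemma VSP a v : reflect (forall g, mact g a = a -> sact U g v = v) (v \in VS a).
Proof.
apply: (iffP memv_imgP) => [[u _ ->] g ga|vinv]; first exact: eB_invl.
by exists v; rewrite ?memvf ?eB_id.
Qed.

Lemma eB_comm a (A : 'End(U)) v : (forall g, mact g a = a -> forall x, sact U g (A x) = A (sact U g x)) ->
  eB a (A v) = A (eB a v).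
Proof.
move=> gA; rewrite !eBE [in RHS]linearZ [in RHS]linear_sum /=; congr (_ *: _).
by apply: eq_bigr => g /eqP ga; apply: gA.
Qed.

Lemma eB_Dop a c p v : mincr a -> eB a (Dop a c p v) = Dop a c p (eB a v).
Proof. by move=> ainc; apply: eB_comm => g ga x; apply: g_Dop. Qed.

Definition chi a c p w : C := \sum_(i : 'I_n) p.[(a i)%:R + c * (w`_i)%:~R].
Lemma Dop_eigen a c p w v : v \in Ew U w -> Dop a c p v = chi a c p w *: v.
Proof.
move=> /EwP Jv; rewrite DopE scaler_suml; apply: eq_bigr => i _.
by apply: opoly_eigen; [apply: linearP | rewrite ZcE Jv scalerA scalerDl].
Qed.

Definition bsorted a w := [forall i : 'I_n, forall k : 'I_n, (i < k)%N && (a i == a k) ==> (w`_i < w`_k)].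

Lemma bsortedP a w : reflect (forall i k, (i < k)%N -> a i = a k -> w`_i < w`_k) (bsorted a w).
Proof.
apply: (iffP forallP) => [h i k ik aik|h i]; first by have /forallP/(_ k) := h i; rewrite ik aik eqxx.
by apply/forallP=> k; apply/implyP=> /andP[ik /eqP]; apply: h.
Qed.

(** An auxiliary coefficient in place of b: for contents e with |e| <= n, the integer (2n + 1) x + e
    determines both x and e, whereas with b different pairs may collide. *)
Definition bc : C := (n.*2.+1)%:R^-1.
Lemma bc_inj (x y : nat) (e f : int) : `|e| <= n%:Z -> `|f| <= n%:Z ->
  x%:R + bc * e%:~R = y%:R + bc * f%:~R -> x = y /\ e = f.
Proof.
move=> en fn /(congr1 (fun z => (n.*2.+1)%:R * z)).
have nz : (n.*2.+1)%:R != 0 :> C by rewrite pnatr_eq0.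
rewrite /bc !mulrDr !mulVKf // -!natrM => H.
have /eqP : ((n.*2.+1 * x)%N%:Z + e)%:~R = ((n.*2.+1 * y)%N%:Z + f)%:~R :> C by rewrite !intrD; exact: H.
rewrite eqr_int => /eqP E; suff xy : x = y by split=> //; move: E; rewrite xy; lia.
by case: (ltngtP x y) => // lt; nia.
Qed.

Lemma chi_count a w w' : all (fun e => `|e| <= n%:Z) w -> all (fun e => `|e| <= n%:Z) w' ->
  (forall p, chi a bc p w = chi a bc p w') ->
  forall i, exists2 j, a j = a i & w`_j = w'`_i.
Proof.
move=> wb wb' E i; have := polysum_count E ((a i)%:R + bc * (w'`_i)%:~R) => c.
have : (0 < #|[set j : 'I_n | ((a j)%:R + bc * (w'`_j)%:~R == (a i)%:R + bc * (w'`_i)%:~R)%R]|)%N.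
  by apply/card_gt0P; exists i; rewrite inE.
rewrite -c => /card_gt0P[j]; rewrite inE => /eqP/bc_inj[||aj wj]; last by exists j.
- by have [jw|jw] := ltnP j (size w); [apply: (allP wb); apply: mem_nth | rewrite nth_default].
- by have [jw|jw] := ltnP i (size w'); [apply: (allP wb'); apply: mem_nth | rewrite nth_default].
Qed.

Lemma wd_bound (t : wtT n) : all (fun e => `|e| <= n%:Z) (wd t).
Proof. by apply/allP=> _ /mapP[x _ ->]; have := ltn_ord x; lia. Qed.

(** At the first difference the smaller letter must occur in the same block of the other word: an
    earlier place is excluded by agreement there, a later one by monotonicity. *)
Lemma bsorted_inj a (s t : wtT n) : bsorted a (wd s) -> bsorted a (wd t) ->
  (forall p, chi a bc p (wd s) = chi a bc p (wd t)) -> s = t.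
Proof.
move=> /bsortedP ss /bsortedP st E; apply: wd_inj; apply: (@eq_from_nth _ 0); rewrite ?size_wd // => x xn.
have [N] := ubnP x; elim: N x xn => // N IH x xn xN; pose i := Ordinal xn.
have half (s' t' : wtT n) : (forall i k, (i < k)%N -> a i = a k -> (wd s')`_i < (wd s')`_k) ->
    (forall i k, (i < k)%N -> a i = a k -> (wd t')`_i < (wd t')`_k) ->
    (forall p, chi a bc p (wd t') = chi a bc p (wd s')) ->
    (forall y, (y < n)%N -> (y < N)%N -> (wd s')`_y = (wd t')`_y) -> ~ (wd s')`_x < (wd t')`_x.
  move=> ss' st' E' IH' lt; have [j aj wj] := chi_count (wd_bound _) (wd_bound _) E' i.
  have [ji|ij|ji] := ltngtP j i.
  - have := ss' _ _ ji aj; rewrite -wj IH' ?ltxx //; apply: leq_trans ji _; exact: xN.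
  - by have := st' _ _ ij (esym aj); rewrite wj /= => h; have := lt_trans h lt; rewrite ltxx.
  - by move: lt; rewrite -[x]/(nat_of_ord i) -wj ji ltxx.
have IHs y : (y < n)%N -> (y < N)%N -> (wd s)`_y = (wd t)`_y by move=> yn; apply: IH.
case: (ltrgtP (wd s)`_x (wd t)`_x) => // lt; exfalso.
- by apply: (half s t) lt => // p; rewrite E.
- by apply: (half t s) lt => // y yn yN; rewrite IHs.
Qed.

Lemma comp_eigen (A : 'End(U)) c (la : wtT n -> C) (f : wtT n -> U) :
  (forall t, f t \in Ew U (wd t)) -> (forall t, A (f t) = la t *: f t) ->
  A (\sum_t f t) = c *: \sum_t f t -> forall t, f t != 0 -> la t = c.
Proof.
move=> fE Af AS t ft.
have S0 : \sum_t (la t - c) *: f t = 0.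
  transitivity (A (\sum_t f t) - c *: \sum_t f t); last by rewrite AS subrr.
  by rewrite linear_sum scaler_sumr -sumrB; apply: eq_bigr => t' _ /=; rewrite Af scalerBl.
have /eqP := @Ew_indep _ _ U predT (fun t => (la t - c) *: f t) (fun t _ => rpredZ _ (fE t)) S0 t isT.
by rewrite scaler_eq0 (negPf ft) orbF subr_eq0 => /eqP.
Qed.

(* Adding the letter m to its block: if the symmetrization dies at this step, then
   s_{i0,m} applied to the previous symmetrization has, at the first position i0 of
   the block, a content exceeding all contents of the block. *)
Lemma eB_nz a w v : size w = n -> mincr a -> bsorted a w -> v \in Ew U w -> v != 0 -> eB a v != 0.
Proof.
move=> sw ainc /bsortedP srt vw v0.
have wb : all (fun e => `|e| <= n%:Z) w.
  have /valid_bound := Ew_valid sw vw v0; apply: sub_all => e; rewrite sw; lia.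
pose B := (\sum_i a i)%N.
have aB i : (a i <= B)%N by rewrite /B (bigD1 i) //= leq_addr.
(* Positions from m on receive distinct values above all others, so [am m] stays increasing and its
   stabilizer only permutes the first m positions inside their blocks. *)
pose am m : mi n := [ffun i : 'I_n => if (i < m)%N then a i else (B + i).+1].
have aminc m : mincr (am m).
  move=> i j ij; rewrite !ffunE; have := ainc _ _ ij; have := aB i; have := aB j.
  by case: (ltnP i m); case: (ltnP j m); lia.
have amE m i k : am m i = am m k -> i = k \/ [/\ (i < m)%N, (k < m)%N & a i = a k].
  rewrite !ffunE; have := aB i; have := aB k.
  by case: ifP => im; case: ifP => km; [right | lia | lia | left; apply: val_inj => /=; lia].
have -> : eB a = eB (am n).
  by congr eB; apply/ffunP=> i; rewrite ffunE ltn_ord.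
suff H m : (m <= n)%N -> eB (am m) v != 0 by apply: H.
elim: m => [|m IH] mn.
  rewrite eB_id // => g ga; suff -> : g = 1%g by rewrite sact1.
  by apply/permP=> i; rewrite perm1; case: (amE _ _ _ (mact_stab i ga)) => // -[].
pose k := Ordinal mn; have {IH} := IH (ltnW mn); set g0 := eB (am m) v => g00.
pose blk j := (j < m)%N && (a j == a k).
pose h : U := g0 + \sum_(j | blk j) s_ j k g0.
have subst g : mact g (am m) = am m -> mact g (am m.+1) = am m.+1.
  move=> ga; apply/ffunP=> i; rewrite ffunE.
  have := mact_stab ((g^-1)%g i) ga; rewrite permKV => /amE[<-//|[im jm aij]].
  by rewrite !ffunE !ltnS !(ltnW im, ltnW jm) aij.
have g0i g : mact g (am m) = am m -> sact U g g0 = g0 by apply: eB_invl.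
have tst (i j : 'I_n) m' : (i < m')%N -> (j < m')%N -> a i = a j -> mact (tperm i j) (am m') = am m'.
  by move=> im jm aij; apply/ffunP=> x; rewrite ffunE tpermV; case: tpermP => [->|->|//]; rewrite !ffunE im jm aij.
have hinv g : mact g (am m.+1) = am m.+1 -> sact U g h = h.
  apply: (@stab_gen _ _ (fun g => sact U g h = h)) => //.
  - by rewrite sact1.
  - by move=> x y hx hy; rewrite sactM hy hx.
  - move=> i j ij /amE[E|[im jm aij]]; first by rewrite E in ij; lia.
    have [jk|jk] := eqVneq j k; last first.
      have jm' : (j < m)%N by move: jk; rewrite -val_eqE /=; lia.
      have im' : (i < m)%N by lia.
      have ik : i != k by rewrite -val_eqE /=; lia.
      rewrite /h linearD linear_sum /= g0i ?tst //; congr (_ + _).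
      rewrite [RHS](reindex_perm (tperm i j)) /=; apply: eq_big => [l|l _].
        by rewrite /blk; case: tpermP => [->|->|//]; rewrite im' jm' aij.
      by rewrite sact_tperm tpermV g0i ?tst // [tperm i j k]tpermD.
    rewrite jk in ij aij *; have im' : (i < m)%N by move: ij => /=; lia.
    rewrite /h linearD linear_sum /= (bigD1 i) /=; last by rewrite /blk im' aij eqxx.
    rewrite [in RHS](bigD1 i) /=; last by rewrite /blk im' aij eqxx.
    rewrite sK addrA [s_ i k g0 + _]addrC -!addrA; congr (_ + (_ + _)).
    apply: eq_bigr => l /andP[/andP[lm /eqP al] li].
    have il : i != l by rewrite eq_sym.
    have kl : k != l by rewrite -val_eqE /=; lia.
    have ki' : k != i by rewrite -val_eqE /=; lia.
    have lk : l != k by rewrite eq_sym.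
    rewrite sact_tperm tpermV tpermR (tpermD il kl) sact_tperm tpermV tpermR.
    rewrite (tpermD lk (_ : i != k)) ?[i == k]eq_sym //.
    by rewrite g0i //; apply: tst; rewrite // al aij.
apply/eqP => ev0.
have h0 : h = 0.
  rewrite -(eB_id hinv) /h linearD linear_sum /=.
  have eg0 : eB (am m.+1) g0 = 0.
    rewrite /g0 [eB (am m) v]eBE linearZ linear_sum /= big1 ?scaler0 // => g /eqP ga.
    by rewrite eB_invr ?ev0 //; apply: subst.
  rewrite eg0 big1 ?addr0 // => j /andP[jm /eqP aj]; rewrite eB_invr //.
  by apply: tst; rewrite //= ltnS ltnW.
have [i0 bi0|nb] := pickP blk; last first.
  by move: h0; rewrite /h big_pred0 // addr0 => /eqP; rewrite (negPf g00).
case: (arg_minnP (fun i : 'I_n => i : nat) bi0) => {bi0} i0 /andP[i0m /eqP ai0] min0.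
have Jg : JM U k g0 = (w`_k)%:~R *: g0.
  have comm g : mact g (am m) = am m -> forall x, sact U g (JM U k x) = JM U k (sact U g x).
    apply: (@stab_gen _ _ (fun g => forall x, sact U g (JM U k x) = JM U k (sact U g x))) => //.
    - by move=> x; rewrite !sact1.
    - by move=> x y hx hy z; rewrite !sactM hy hx.
    - move=> i j ij /amE[E|[im jm _]] x; first by rewrite E in ij; lia.
      by rewrite s_JMout //= ?im ?jm // -val_eqE /=; lia.
  by rewrite /g0 -(eB_comm _ comm) (Ew_JM _ vw) linearZ.
pose y := s_ i0 k g0.
have y0 : y != 0 by apply: contra_neq g00 => E; rewrite -[g0](sK i0 k) -/y E linear0.
have Jy : JM U i0 y = (w`_k + 1)%:~R *: y.
  rewrite /y -linearZ /= intrD scalerDl scale1r -Jg -[X in _ + X]opprK.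
  have -> : - g0 = \sum_(j | blk j) s_ j k g0 by apply/eqP; rewrite eq_sym -subr_eq0 opprK addrC -/h h0.
  have -> : JM U k g0 - \sum_(j | blk j) s_ j k g0 = \sum_(j : 'I_n | (j < k)%N && ~~ blk j) s_ j k g0.
    rewrite JME (bigID blk) addrAC -[RHS]add0r; congr (_ + _).
      apply/eqP; rewrite subr_eq0; apply/eqP; apply: eq_big => [j|j _]; last by rewrite tpermC.
      by rewrite /blk /=; case: ltnP.
    by apply: eq_bigr => j _; rewrite tpermC.
  rewrite JME linear_sum /=; apply: eq_big => [j|j ji].
    rewrite /blk; case: ltnP => /= jm.
      have jm' : (j < m)%N by apply: leq_trans jm (ltnW i0m).
      rewrite jm' /=; apply/esym; apply: contraTN jm => aj.
      by rewrite -leqNgt; apply: min0; rewrite /blk jm' aj.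
    case: ltnP => //= jm'; apply/esym/negbTE; rewrite negbK eqn_leq -{2}ai0 ainc ?andbT //; last exact: ltnW.
    exact: ainc.
  rewrite [in RHS]sact_tperm tpermV tpermR (tpermC i0 j) tpermD //; apply/eqP=> /(congr1 (@nat_of_ord n)) /=; lia.
have Dy p : Dop (am m.+1) bc p y = chi (am m.+1) bc p w *: y.
  have t1 : mact (tperm i0 k) (am m.+1) = am m.+1 by apply: tst; rewrite //= ltnS ltnW.
  rewrite -g_Dop // -linearZ /=; congr (sact _ _ _).
  rewrite /g0 -eB_comm ?(Dop_eigen _ _ _ vw) ?linearZ // => g ga x.
  by apply: g_Dop => //; apply: subst.
have /memv_sumP[u uE yE] : y \in (\sum_(t : wtT n) Ew U (wd t))%VS by rewrite Ew_sum memvf.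
case/eqP: y0; rewrite yE big1 // => t _; apply/eqP/negPn/negP => ut0.
have uE' t' : u t' \in Ew U (wd t') by apply: uE.
have A1 : (wd t)`_i0 = w`_k + 1.
  apply/eqP; rewrite -(eqr_int C); apply/eqP.
  apply: (@comp_eigen (JM U i0) _ (fun t => ((wd t)`_i0)%:~R) u) ut0 => //; last by rewrite -yE Jy.
  by move=> t'; rewrite (Ew_JM _ (uE' t')).
have A2 p : chi (am m.+1) bc p (wd t) = chi (am m.+1) bc p w.
  apply: (@comp_eigen (Dop (am m.+1) bc p) _ (fun t => chi (am m.+1) bc p (wd t)) u) ut0 => //; last by rewrite -yE Dy.
  by move=> t'; rewrite (Dop_eigen _ _ _ (uE' t')).
have [j aj wj] := @chi_count _ w (wd t) wb (wd_bound t) (fun p => esym (A2 p)) i0.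
rewrite A1 in wj; have [E|[jm _ aj']] := amE _ _ _ aj.
  have := srt i0 k i0m ai0; rewrite -E wj; lia.
have [jk|jk] := eqVneq j k; first by rewrite jk in wj; lia.
by have := srt j k _; rewrite wj aj' ai0; move: jk; rewrite -val_eqE /=; lia.
Qed.

End BlockInvariants.

(** * Straightening of weight vectors under block symmetrization *)

Section Straightening.
Variables (C : numClosedFieldType) (n : nat) (U : srep C n).
Implicit Types (v : U) (g h : 'S_n) (i j k l : 'I_n) (a : mi n) (p q : {poly C}) (w u : seq int) (x y : int).
Local Notation s_ i j := (sact U (tperm i j)).

Lemma nth_intr w (l : nat) : (map (fun z : int => z%:~R : C) w)`_l = (w`_l)%:~R.
Proof.
have [lw|lw] := ltnP l (size w); first by rewrite (nth_map 0).
by rewrite !nth_default ?size_map.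
Qed.

Lemma Ew_map w v : size w = n -> v \in Ew U w ->
  forall l, (l < size (map (fun z : int => z%:~R : C) w))%N -> JM U l v = (map (fun z : int => z%:~R : C) w)`_l *: v.
Proof. by move=> sw vw l _; rewrite nth_intr (Ew_JM _ vw). Qed.

Lemma Ew_swap w x y u i k v : i = size w :> nat -> k = i.+1 :> nat -> size (w ++ [:: x, y & u]) = n -> x != y ->
  v \in Ew U (w ++ [:: x, y & u]) -> s_ i k v + ((x - y)%:~R)^-1 *: v \in Ew U (w ++ [:: y, x & u]).
Proof.
move=> iw ki sw xy vw; apply/EwP => l; have := Ew_map sw vw; rewrite map_cat /= => Jv.
have sz : (size (map (fun z : int => z%:~R : C) w ++ [:: x%:~R, y%:~R & map (fun z : int => z%:~R : C) u]) <= n)%N.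
  by rewrite -sw size_cat /= !size_map size_cat.
have xyC : x%:~R != y%:~R :> C by rewrite eqr_int.
have := @Adj_swap _ _ U _ _ _ _ sz v Jv l xyC.
have -> : Ordinal (posi_lt sz) = i by apply: val_inj; rewrite /= size_map.
have -> : Ordinal (posk_lt sz) = k by apply: val_inj; rewrite /= size_map ki iw.
rewrite intrB => -> //; last first.
  by rewrite size_cat /= !size_map; have := ltn_ord l; rewrite -[X in (_ < X)%N]sw size_cat.
by congr (_ *: _); rewrite -nth_intr map_cat.
Qed.

Lemma Ew_neq w x u v : size (w ++ [:: x, x & u]) = n -> v \in Ew U (w ++ [:: x, x & u]) -> v = 0.
Proof.
move=> sw vw; have := Ew_map sw vw; rewrite map_cat /= => Jv.
apply: (@Adj_eq _ _ U _ _ _ _ _ v Jv erefl).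
by rewrite -sw size_cat /= !size_map size_cat.
Qed.

Lemma valid_noswap w x u : valid (w ++ [:: x + 1, x & u]) -> valid (w ++ [:: x, x + 1 & u]) -> False.
Proof.
have E y z : w ++ [:: y, z & u] = rcons (rcons w y) z ++ u by rewrite !cat_rcons.
rewrite !E => /valid_catl + /valid_catl; rewrite !valid_rcons => /andP[/andP[_ /andP[a1 a2]] /andP[a3 a4]].
move=> /andP[/andP[_ /andP[b1 b2]] /andP[b3 b4]].
move: a1 a2 a3 a4 b1 b2 b3 b4; rewrite !cnt_rcons !addrK; lia.
Qed.

(** For the difference 1 the intertwiner is s + 1. It would lead to the word with x and x + 1
    exchanged, which is not valid together with the given one, so it vanishes on [v]. *)
Lemma Ew_adj w x u i k v : i = size w :> nat -> k = i.+1 :> nat -> size (w ++ [:: x + 1, x & u]) = n ->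
  v \in Ew U (w ++ [:: x + 1, x & u]) -> s_ i k v = - v.
Proof.
move=> iw ki sw vw; have [->|v0] := eqVneq v 0; first by rewrite linear0 oppr0.
have xx : x + 1 != x by lia.
have := Ew_swap iw ki sw xx vw; rewrite addrAC subrr add0r invr1 scale1r => vw'.
apply/eqP; rewrite -addr_eq0; apply/negPn/negP => nz.
apply: (@valid_noswap w x u); first exact: Ew_valid vw v0.
by apply: Ew_valid vw' nz; rewrite -sw !size_cat.
Qed.

Lemma Ew_far_le w x y u : far x y -> size (w ++ [:: x, y & u]) = n ->
  (\dim (Ew U (w ++ [:: x, y & u])) <= \dim (Ew U (w ++ [:: y, x & u])))%N.
Proof.
move=> fxy sw; have xy : x != y by move: fxy; rewrite /far; lia.
have kn : ((size w).+1 < n)%N by rewrite -sw size_cat /=; lia.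
pose i := Ordinal (ltnW kn); pose k := Ordinal kn; pose c : C := ((x - y)%:~R)^-1.
pose phi : 'End(U) := (s_ i k + c *: \1)%VF.
have phiE v : phi v = s_ i k v + c *: v by rewrite /phi add_lfunE scale_lfunE id_lfunE.
rewrite -(@limg_dim_eq _ _ _ phi).
  apply: dimvS; apply/subvP=> _ /memv_imgP[v vw ->]; rewrite phiE; exact: Ew_swap.
apply/eqP; rewrite -subv0; apply/subvP=> v; rewrite memv_cap memv_ker phiE memv0 => /andP[_ /eqP E].
apply/negPn/negP => v0; have sv : s_ i k v = - c *: v by apply/eqP; rewrite scaleNr -addr_eq0 E.
have := sK i k v; rewrite sv linearZ /= sv scalerA mulrNN -[RHS]scale1r => /eqP.
rewrite -subr_eq0 -scalerBl scaler_eq0 (negPf v0) orbF subr_eq0 -invfM -intrM => /eqP c1.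
have : ((x - y) * (x - y))%:~R = 1%:~R :> C by rewrite -[LHS]invrK c1 invr1.
by move=> /eqP; rewrite eqr_int; move: fxy; rewrite /far; nia.
Qed.

Lemma Ew_dim_eq w u : size w = n -> valid w -> valid u -> cnt w =1 cnt u -> \dim (Ew U w) = \dim (Ew U u).
Proof.
move=> sw vw vu E.
apply: (@valid_connected (fun z => size z = n -> \dim (Ew U w) = \dim (Ew U z)) w u) => //.
  move=> z x y t fxy IH sz.
  have sz' : size (z ++ [:: x, y & t]) = n by rewrite -sz !size_cat.
  rewrite (IH sz'); apply/eqP; rewrite eqn_leq !Ew_far_le //; by rewrite farC.
have P : perm_eq w u by apply/allP=> z _; apply/eqP; exact: E.
by rewrite -(perm_size P).
Qed.

Lemma bsorted_adj a w : mincr a -> (forall i k, k = i.+1 :> nat -> a i = a k -> w`_i < w`_k) -> bsorted a w.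
Proof.
move=> ainc adj; apply/bsortedP => i k.
have [d] := ubnP (k - i)%N; elim: d k => // d IH k kd ik aik.
have [E|ne] := eqVneq (k : nat) i.+1; first exact: adj.
have k'n : (k.-1 < n)%N by have := ltn_ord k; lia.
pose k' := Ordinal k'n; have kk' : k = k'.+1 :> nat by rewrite /=; lia.
have aik' : a i = a k'.
  have := ainc i k'; have := ainc k' k; rewrite -aik /=; lia.
by apply: lt_trans (IH k' _ _ _) (adj _ _ kk' _) => //=; rewrite -?aik ?aik'; lia.
Qed.

(** Each swap of an out-of-order pair in a block raises the weighted sum of i w_i, which is bounded
    on valid words. An equal pair carries no vectors; a pair y + 1, y makes s act by -1, so the
    symmetrization vanishes; for a far pair x > y the intertwiner changes the symmetrization only by
    the factor 1 + 1/(x - y), which is positive. *)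
Lemma eB_straight a w v : mincr a -> size w = n -> v \in Ew U w ->
  eB U a v \in (\sum_(t : wtT n | bsorted a (wd t)) (eB U a @: Ew U (wd t)))%VS.
Proof.
move=> ainc; pose f w : int := \sum_(i : 'I_n) i%:Z * w`_i.
have fb z : size z = n -> valid z -> f z <= (n * (n * n))%N%:Z.
  move=> sz /valid_bound/allP zb; rewrite /f.
  apply: le_trans (ler_sum _ (_ : forall i : 'I_n, _ -> i%:Z * z`_i <= (n * n)%N%:Z)) _.
    move=> i _; have := zb (z`_i); rewrite mem_nth ?sz // => /(_ isT); have := ltn_ord i; nia.
  by rewrite sumr_const card_ord -mulr_natl natz -PoszM lexx.
have [N] := ubnP (absz ((n * (n * n))%N%:Z - f w)); elim: N w v => // N IH w v wN sw vw.
have [->|v0] := eqVneq v 0; first by rewrite linear0 mem0v.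
have vdw := Ew_valid sw vw v0.
have [bs|nbs] := boolP (bsorted a w).
  have [t tw] := wd_onto vdw sw.
  have bt : bsorted a (wd t) by rewrite tw.
  by apply: (subvP (sumv_sup t bt (subvv _))); rewrite memv_img ?tw.
have [i [k [ki aik wik]]] : exists i k, [/\ k = i.+1 :> nat, a i = a k & w`_k <= w`_i].
  apply: contrapT => nE; case/negP: nbs; apply: bsorted_adj => // i k ki aik.
  by rewrite ltNge; apply/negP => ?; apply: nE; exists i, k.
have kn : ((i : nat).+1 < n)%N by have := ltn_ord k; lia.
have stab : mact (tperm i k) a = a.
  by apply/ffunP=> l; rewrite ffunE tpermV; case: tpermP => [->|->|].
pose w0 := take i w; pose u := drop i.+2 w.
have sw0 : i = size w0 :> nat by rewrite size_takel // sw ltnW.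
have Ew0 : w = w0 ++ [:: w`_i, w`_k & u].
  by rewrite /w0 /u -{1}(cat_take_drop i w) (drop_nth 0) ?sw // (drop_nth 0) ?sw // ki.
move: wik Ew0; set x := w`_i; set y := w`_k => wik Ew0.
rewrite Ew0 in vw vdw sw.
have [E|ne] := eqVneq x y; first by rewrite E in vw sw; rewrite (Ew_neq sw vw) linear0 mem0v.
have [E|ne1] := eqVneq x (y + 1).
  rewrite E in vw sw; have sv := Ew_adj sw0 ki sw vw.
  have := eB_invr v stab; rewrite sv linearN /= => /eqP; rewrite eq_sym -addr_eq0 -mulr2n -scaler_nat scaler_eq0 pnatr_eq0 /=.
  by move=> /eqP->; rewrite mem0v.
have fxy : far x y by rewrite /far; lia.
have vw' := Ew_swap sw0 ki sw ne vw.
set c := (_)^-1 in vw'.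
have c1 : 1 + c != 0.
  by rewrite gt_eqF // ltr_wpDr ?ltr01 // invr_ge0 ler0z; lia.
have -> : eB U a v = (1 + c)^-1 *: eB U a (s_ i k v + c *: v).
  by rewrite linearD linearZ /= eB_invr // -[X in _ *: (X + _)]scale1r -scalerDl scalerA mulVf ?scale1r.
apply: rpredZ; have sw' : size (w0 ++ [:: y, x & u]) = n by rewrite -sw !size_cat.
have vdw' := valid_swap fxy vdw.
apply: (IH (w0 ++ [:: y, x & u])) => //.
have nth' l : (w0 ++ [:: y, x & u])`_l = w`_(tperm i k l).
  rewrite Ew0; case: tpermP => [->|->|/eqP li /eqP lk].
  - by rewrite !nth_cat ki -sw0 ltnn ltnNge leqnSn /= subnn subSnn.
  - by rewrite !nth_cat ki -sw0 ltnn ltnNge leqnSn /= subnn subSnn.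
  - rewrite !nth_cat -sw0; case: ltnP => // il.
    have : (i.+2 <= l)%N by move: li lk; rewrite -!val_eqE /= ki; lia.
    by move=> il2; have -> : (l - i = (l - i.+2).+2)%N by lia.
have fE : f (w0 ++ [:: y, x & u]) = f w + (x - y).
  rewrite /f (bigD1 i) //= (bigD1 k) /=; last by rewrite -val_eqE /=; lia.
  rewrite [in RHS](bigD1 i) //= [in RHS](bigD1 k) /=; last by rewrite -val_eqE /=; lia.
  rewrite !nth' tpermL tpermR -/x -/y.
  have -> : \sum_(l < n | (l != i) && (l != k)) l%:Z * (w0 ++ [:: y, x & u])`_l
          = \sum_(l < n | (l != i) && (l != k)) l%:Z * w`_l.
    by apply: eq_bigr => l /andP[li lk]; rewrite nth' tpermD // eq_sym.
  by rewrite ki; set S := \sum_(_ | _) _; rewrite -addn1 PoszD; ring.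
have := fb _ sw' vdw'; rewrite fE; move: wN; lia.
Qed.

Definition wdim w := \dim (Ew U w).

(** By straightening, symmetrized weight spaces of block-sorted words span the block invariants, and
    by [eB_nz] symmetrization is injective on each of them; [q] keeps those with eigenvalue [om]. *)
Lemma dimVS a c p q (om : C) : mincr a ->
  (forall t : wtT n, valid (wd t) -> bsorted a (wd t) -> q.[chi a c p (wd t)] = (chi a c p (wd t) == om)%:R) ->
  \dim (lpoly (Dop U a c p) q @: VS U a) = \sum_(t : wtT n | bsorted a (wd t) && (chi a c p (wd t) == om)) wdim (wd t).
Proof.
move=> ainc qE.
have qD (t : wtT n) v : v \in Ew U (wd t) -> bsorted a (wd t) ->
    lpoly (Dop U a c p) q (eB U a v) = (chi a c p (wd t) == om)%:R *: eB U a v.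
  move=> vt bt; have [->|v0] := eqVneq v 0; first by rewrite (linear0 (eB U a)) (linear0 (lpoly _ _)) scaler0.
  rewrite (@lpoly_eigen _ _ _ _ _ (chi a c p (wd t))); last by rewrite -eB_Dop // (Dop_eigen _ _ _ vt) linearZ.
  by rewrite qE // (Ew_valid (size_wd t) vt v0).
have imE : (lpoly (Dop U a c p) q @: VS U a)%VS =
    (\sum_(t : wtT n | bsorted a (wd t) && (chi a c p (wd t) == om)) (eB U a @: Ew U (wd t)))%VS.
  apply/eqP; rewrite eqEsubv; apply/andP; split; last first.
    apply/subv_sumP => t /andP[bt ct]; apply/subvP=> _ /memv_imgP[v vt ->].
    have -> : eB U a v = lpoly (Dop U a c p) q (eB U a v) by rewrite (qD t) // ct scale1r.
    by apply/memv_img/memv_img/memvf.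
  apply/subvP=> _ /memv_imgP[_ /memv_imgP[v _ ->] ->].
  have /memv_sumP[u uE ->] : v \in (\sum_(t : wtT n) Ew U (wd t))%VS by rewrite Ew_sum memvf.
  rewrite !linear_sum; apply: memv_suml => t _ /=.
  have /memv_sumP[u' uE' ->] := eB_straight ainc (size_wd t) (uE t isT).
  rewrite linear_sum; apply: memv_suml => s bs /=.
  have /memv_imgP[v' vs ->] := uE' s bs; rewrite (qD s) //.
  have [cs|_] := eqVneq; last by rewrite scale0r mem0v.
  rewrite scale1r; apply: (subvP (@sumv_sup _ _ _ s (fun t => bsorted a (wd t) && (chi a c p (wd t) == om)) _ _ _ (subvv _))).
    by rewrite bs cs eqxx.
  exact: memv_img.
have nz (t : wtT n) v : bsorted a (wd t) -> v \in Ew U (wd t) -> eB U a v = 0 -> v = 0.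
  move=> bt vt E; apply/eqP/negPn/negP => v0.
  by have := eB_nz (size_wd t) ainc bt vt v0; rewrite E eqxx.
rewrite imE dim_sum_indep => [|u uE S0].
  apply: eq_bigr => t /andP[bt _]; apply: limg_dim_eq; apply/eqP; rewrite -subv0; apply/subvP=> v.
  by rewrite memv_cap memv_ker memv0 => /andP[vt /eqP/(nz t v bt vt)->].
(* Independence is tested with the coefficient [bc], which separates block-sorted words even where
   the eigenvalues for [c] coincide. *)
pose P (t : wtT n) := bsorted a (wd t) && (chi a c p (wd t) == om).
have H1 (s s' : wtT n) : P s -> P s' -> (fun p => chi a (bc C n) p (wd s)) =1 (fun p => chi a (bc C n) p (wd s')) -> s = s'.
  by move=> /andP[bs _] /andP[bs' _] E; apply: bsorted_inj bs bs' E.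
have H2 (s : wtT n) p' : P s -> Dop U a (bc C n) p' (u s) = chi a (bc C n) p' (wd s) *: u s.
  move=> Ps; have /memv_imgP[v vs ->] := uE s Ps.
  by rewrite -eB_Dop // (Dop_eigen _ _ _ vs) linearZ.
exact: (joint_indep H1 H2 S0).
Qed.

End Straightening.

(** * Schur, Maschke and central characters *)

Section Irreducibles.
Variables (C : numClosedFieldType) (n : nat) (U : srep C n).
Implicit Types (v : U) (g h : 'S_n) (S T : {vspace U}) (w : seq int).

Definition stable S := forall g v, v \in S -> sact U g v \in S.
Definition irr := (fullv : {vspace U}) != 0%VS /\ forall S, stable S -> S = 0%VS \/ S = fullv.

Lemma schur (A : 'End(U)) : irr -> (forall g v, sact U g (A v) = A (sact U g v)) ->
  exists c, forall v, A v = c *: v.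
Proof.
move=> [U0 ir] gA; have [v _ [v0 [c vc]]] := eigen_in U0 (subvf (A @: fullv)%VS).
exists c; have [|E|E u] := ir (lker (A - c *: \1%VF)).
- by move=> g u; rewrite !mem_eig => /eqP E; rewrite -gA E linearZ.
- by case/eqP: v0; apply/eqP; rewrite -memv0 -E mem_eig vc.
- by apply/eqP; rewrite -mem_eig E memvf.
Qed.

Lemma maschke S : stable S -> exists P : 'End(U),
  [/\ forall g v, sact U g (P v) = P (sact U g v), forall v, P v \in S & forall v, v \in S -> P v = v].
Proof.
move=> st; pose P : 'End(U) := (#|'S_n|%:R)^-1 *: \sum_(g : 'S_n) (sact U g \o projv S \o sact U (g^-1)%g)%VF.
have PE v : P v = (#|'S_n|%:R)^-1 *: \sum_(g : 'S_n) sact U g (projv S (sact U (g^-1)%g v)).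
  by rewrite scale_lfunE sum_lfunE; congr (_ *: _); apply: eq_bigr => g _; rewrite !comp_lfunE.
exists P; split=> [g v|v|v vS].
- rewrite !PE linearZ linear_sum /=; congr (_ *: _); rewrite [RHS](reindex_inj (mulgI g)).
  by apply: eq_bigr => h _ /=; rewrite sactM invMg sactM sactK.
- rewrite PE rpredZ // rpred_sum // => g _; apply: st; exact: memv_proj.
- rewrite PE (eq_bigr (fun=> v)) => [|g _]; last by rewrite projv_id ?sactKV //; apply: st.
  rewrite sumr_const -scaler_nat scalerA mulVf ?scale1r // pnatr_eq0 -lt0n.
  by apply/card_gt0P; exists 1%g.
Qed.

Lemma g_Dop0 p g v : sact U g (Dop U (mzero n) 1 p v) = Dop U (mzero n) 1 p (sact U g v).
Proof. by apply: g_Dop; [move=> i j _; rewrite !ffunE | rewrite mact0]. Qed.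

(** Symmetric polynomials in the Jucys-Murphy elements commute with the group and are scalars by
    Schur; their values determine the multiset of contents. *)
Lemma irr_cnt w w' v v' : irr -> size w = n -> size w' = n -> v \in Ew U w -> v != 0 ->
  v' \in Ew U w' -> v' != 0 -> cnt w =1 cnt w'.
Proof.
move=> ir sw sw' vw v0 vw' v0' x.
have chiE (p : {poly C}) : chi (mzero n) 1 p w = chi (mzero n) 1 p w'.
  have [c cE] := schur ir (g_Dop0 p).
  have eqc z u : u \in Ew U z -> u != 0 -> chi (mzero n) 1 p z = c.
    move=> uz u0; have := cE u; rewrite (Dop_eigen _ _ _ uz) => /eqP.
    by rewrite -subr_eq0 -scalerBl scaler_eq0 (negPf u0) orbF subr_eq0 => /eqP.
  by rewrite (eqc _ _ vw v0) (eqc _ _ vw' v0').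
have := polysum_count chiE (x%:~R).
have cE z : size z = n -> #|[set i : 'I_n | ((mzero n i)%:R + 1 * (z`_i)%:~R == x%:~R :> C)%R]| = cnt z x.
  move=> sz; rewrite /cnt -sum1_count -sum1_card (big_nth 0) sz big_mkord.
  by apply: eq_bigl => i; rewrite inE ffunE add0r mul1r eqr_int.
by rewrite !cE.
Qed.

Definition csum : 'End(U) := \sum_(i : 'I_n) JM U i.
Lemma csumE v : csum v = \sum_(i : 'I_n) \sum_(j : 'I_n | (j < i)%N) sact U (tperm i j) v.
Proof. by rewrite /csum sum_lfunE; apply: eq_bigr => i _; rewrite JME. Qed.
Lemma csum_Ew w v : size w = n -> v \in Ew U w -> csum v = (\sum_(x <- w) x)%:~R *: v.
Proof.
move=> sw vw; rewrite /csum sum_lfunE (big_nth 0) sw big_mkord rmorph_sum scaler_suml /=.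
by apply: eq_bigr => i _; rewrite (Ew_JM _ vw).
Qed.

Lemma g_csum g v : sact U g (csum v) = csum (sact U g v).
Proof.
have E y : csum y = Dop U (mzero n) 1 'X y.
  rewrite DopE /csum sum_lfunE; apply: eq_bigr => i _.
  by rewrite -[X in opoly _ X]expr1 opolyXn /= ZcE ffunE scale0r add0r scale1r.
by rewrite !E g_Dop0.
Qed.

Lemma irr_csum w u v : irr -> size w = n -> u \in Ew U w -> u != 0 -> csum v = (\sum_(x <- w) x)%:~R *: v.
Proof.
move=> ir sw uw u0.
have [c cE] := schur ir g_csum.
have := cE u; rewrite (csum_Ew sw uw) => /eqP.
by rewrite -subr_eq0 -scalerBl scaler_eq0 (negPf u0) orbF subr_eq0 cE => /eqP->.
Qed.

Lemma irr_weight : irr -> exists2 t : wtT n, valid (wd t) & exists2 v, v \in Ew U (wd t) & v != 0.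
Proof.
move=> [U0 _]; have := vpick0 (fullv : {vspace U}); rewrite (negPf U0) => v0.
have /memv_sumP[u uE vE] : vpick (fullv : {vspace U}) \in (\sum_(t : wtT n) Ew U (wd t))%VS by rewrite Ew_sum memvf.
have [t ut0|z] := pickP (fun t => u t != 0).
  by exists t; [apply: Ew_valid (size_wd t) (uE t isT) ut0 | exists (u t); rewrite ?uE].
by move: v0; rewrite vE big1 ?eqxx // => t _; apply/eqP/negbFE/z.
Qed.

Lemma minimal_stable S : stable S -> S != 0%VS -> exists T, [/\ stable T, T != 0%VS, (T <= S)%VS &
  forall T', stable T' -> (T' <= T)%VS -> T' = 0%VS \/ T' = T].
Proof.
have [N] := ubnP (\dim S); elim: N S => // N IH S SN st S0.
have [[T [stT T0 TS nT]]|nE] := pselect (exists T, [/\ stable T, T != 0%VS, (T <= S)%VS & T <> S]).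
  have [|T' [stT' T'0 T'T min]] := IH T _ stT T0.
    apply: leq_trans (_ : \dim T < \dim S)%N _; last by rewrite -ltnS.
    rewrite ltn_neqAle dimvS // andbT; apply/negP => /eqP E; apply: nT.
    by apply/eqP; rewrite eqEdim TS E leqnn.
  by exists T'; split=> //; apply: subv_trans TS.
exists S; split=> // T' stT' T'S; have [->|T'0] := eqVneq T' 0%VS; first by left.
by right; apply: contrapT => ne; apply: nE; exists T'.
Qed.

Fact subrep_act1 S (v : subvs_of S) : linfun (vsproj S \o sact U 1%g \o vsval) v = v.
Proof. by rewrite lfunE /= sact1 vsvalK. Qed.
Fact subrep_actM S (st : stable S) g h (v : subvs_of S) : linfun (vsproj S \o sact U (g * h)%g \o vsval) v =
  linfun (vsproj S \o sact U g \o vsval) (linfun (vsproj S \o sact U h \o vsval) v).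
Proof. by rewrite !lfunE /= vsprojK ?st ?subvsP // sactM. Qed.
Definition subrep S (st : stable S) : srep C n :=
  @SRep C n (subvs_of S) (fun g => linfun (vsproj S \o sact U g \o vsval)) (@subrep_act1 S) (subrep_actM st).
Lemma subrepE S (st : stable S) g (v : subrep st) : vsval (sact (subrep st) g v) = sact U g (vsval v).
Proof. by rewrite /= lfunE /= vsprojK // st ?subvsP. Qed.
End Irreducibles.

Lemma subrep_irr (C : numClosedFieldType) (n : nat) (U : srep C n) (T : {vspace U}) (st : stable T) :
  T != 0%VS -> (forall T', stable T' -> (T' <= T)%VS -> T' = 0%VS \/ T' = T) -> irr (subrep st).
Proof.
move=> T0 min; split.
  by rewrite -dimv_eq0 dimvf (_ : dim _ = \dim T) // dimv_eq0.
move=> S stS; pose f : 'Hom(subvs_of T, U) := linfun vsval.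
have fE v : f v = vsval v by rewrite lfunE.
have [||E|E] := min (f @: (S : {vspace subvs_of T}))%VS.
- move=> g _ /memv_imgP[v vS ->]; rewrite fE -(subrepE (st := st)) -fE; apply: memv_img; exact: stS.
- by apply/subvP=> _ /memv_imgP[v vS ->]; rewrite fE subvsP.
- left; apply/eqP; rewrite -subv0; apply/subvP=> v vS; rewrite memv0.
  have : f v \in (f @: (S : {vspace subvs_of T}))%VS by apply: memv_img.
  by rewrite E memv0 fE => /eqP v0; apply/eqP/val_inj; rewrite /= v0.
- right; apply/eqP; rewrite eqEsubv subvf; apply/subvP=> v _.
  have : f v \in (f @: (S : {vspace subvs_of T}))%VS by rewrite E fE subvsP.
  by move=> /memv_imgP[u uS]; rewrite !fE => /val_inj->.
Qed.

(** * Specht modules *)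

Lemma pairsum_sym (V : nmodType) (n : nat) (f : 'I_n -> 'I_n -> V) : (forall i j, f i j = f j i) ->
  \sum_i \sum_(j | j != i) f i j = (\sum_(i : 'I_n) \sum_(j : 'I_n | (j < i)%N) f i j) *+ 2.
Proof.
move=> fs; under eq_bigr => i _ do rewrite (bigID (fun j : 'I_n => (j < i)%N)) /=.
rewrite big_split mulr2n /=; congr (_ + _).
  by apply: eq_bigr => i _; apply: eq_bigl => j; rewrite -val_eqE /=; case: ltngtP.
rewrite (exchange_big_dep predT) //=; apply: eq_bigr => i _.
apply: eq_big => [j|j _]; last exact: fs.
by rewrite -val_eqE /=; case: (ltngtP i j).
Qed.

Lemma exch4 (V : nmodType) (n : nat) (P Q : {set 'S_n}) (f : 'S_n -> 'S_n -> 'I_n -> 'I_n -> V) :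
  \sum_(p in P) \sum_(q in Q) \sum_i \sum_(j | j != i) f p q i j
  = \sum_i \sum_(j | j != i) \sum_(p in P) \sum_(q in Q) f p q i j.
Proof.
under eq_bigr => p _ do rewrite exchange_big.
rewrite exchange_big; apply: eq_bigr => i _ /=.
by under eq_bigr => p _ do rewrite exchange_big; rewrite exchange_big.
Qed.

Lemma subrep_sum (C : numClosedFieldType) (n : nat) (U : srep C n) (S : {vspace U}) (st : stable S)
  (I : Type) (r : seq I) (P : pred I) (f : I -> subrep st) :
  vsval (\sum_(i <- r | P i) f i) = \sum_(i <- r | P i) vsval (f i).
Proof. exact: (big_morph (fun v : subrep st => vsval v)). Qed.

Lemma subrep_csum (C : numClosedFieldType) (n : nat) (U : srep C n) (S : {vspace U}) (st : stable S) (v : subrep st) :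
  vsval (csum (subrep st) v) = csum U (vsval v).
Proof.
rewrite [in LHS]csumE [in RHS]csumE subrep_sum; apply: eq_bigr => i _.
rewrite subrep_sum; apply: eq_bigr => j _; exact: subrepE.
Qed.

Section Tableau.
Variables (n : nat) (lam : seq nat).
Hypothesis lamP : is_partition n lam.
Local Notation ri := (reshape_index lam).
Local Notation ro := (reshape_offset lam).
Implicit Types (i j k l : 'I_n).

Lemma part_sum : sumn lam = n. Proof. by have /and3P[_ _ /eqP] := lamP. Qed.
Lemma part_geq r r' : (r <= r')%N -> (nth 0 lam r' <= nth 0 lam r)%N.
Proof.
move=> rr'; have [lt|ge] := ltnP r' (size lam); last by rewrite nth_default.
have /and3P[srt _ _] := lamP.
have tr : transitive geq by move=> x y z /= h1 h2; apply: leq_trans h2 h1.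
have rf : reflexive geq by move=> x; apply: leqnn.
exact: (sorted_leq_nth tr rf 0 srt r r' (leq_ltn_trans rr' lt) lt rr').
Qed.
Lemma ro_lt k : (ro k < nth 0 lam (ri k))%N.
Proof. by apply: reshape_offsetP; rewrite part_sum. Qed.
Lemma rk_sum k : k = (sumn (take (ri k) lam) + ro k)%N :> nat.
Proof. by rewrite -[LHS](reshape_indexK lam). Qed.
Lemma sumn_take_leq r r' : (r <= r')%N -> (sumn (take r lam) <= sumn (take r' lam))%N.
Proof.
by move=> rr'; rewrite -(subnKC rr') takeD sumn_cat leq_addr.
Qed.
Lemma sumn_takeS r : (sumn (take r.+1 lam) = sumn (take r lam) + nth 0 lam r)%N.
Proof.
have [lt|ge] := ltnP r (size lam); last by rewrite nth_default // !take_oversize ?addn0 // ltnW.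
by rewrite (take_nth 0) // -cats1 sumn_cat /= addn0.
Qed.

Lemma ri_mono k l : (k <= l)%N -> (ri k <= ri l)%N.
Proof.
move=> kl; rewrite leqNgt; apply/negP => lt.
have := sumn_take_leq lt; rewrite sumn_takeS; have := ro_lt l; have := rk_sum k; have := rk_sum l.
by move: kl; lia.
Qed.

Lemma box_inj k l : ri k = ri l -> ro k = ro l -> k = l.
Proof. by move=> e1 e2; apply: val_inj; rewrite /= (rk_sum k) (rk_sum l) e1 e2. Qed.

Lemma box_ex r c : (c < nth 0 lam r)%N -> exists k, ri k = r /\ ro k = c.
Proof.
move=> cr; have kn := flatten_indexP cr; rewrite part_sum in kn.
by exists (Ordinal kn); rewrite /= flatten_indexKl ?flatten_indexKr.
Qed.

Lemma row_before k : #|[set l : 'I_n | (l < k)%N && (ri l == ri k)]| = ro k.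
Proof.
have ex (c : 'I_(ro k)) : exists l, ri l = ri k /\ ro l = c.
  by apply: box_ex; apply: ltn_trans (ltn_ord c) (ro_lt k).
pose f c := sval (cid (ex c)).
have fP c : ri (f c) = ri k /\ ro (f c) = c by rewrite /f; case: cid.
have finj : injective f by move=> c c' /(congr1 (fun l : 'I_n => ro l)); rewrite !(proj2 (fP _)) => /val_inj.
rewrite -[RHS]card_ord -(card_imset _ finj); apply: eq_card => l; rewrite inE.
apply/andP/imsetP => [[lk /eqP rl]|[c _ ->]].
  have ok : (ro l < ro k)%N by have E1 := rk_sum l; have E2 := rk_sum k; rewrite rl in E1; lia.
  by exists (Ordinal ok) => //; apply: box_inj; rewrite (proj1 (fP _), proj2 (fP _)).
have [e1 e2] := fP c; rewrite e1 eqxx; split=> //.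
by have E1 := rk_sum (f c); have E2 := rk_sum k; rewrite e1 e2 in E1; have := ltn_ord c; lia.
Qed.

Lemma col_before k : #|[set l : 'I_n | (l < k)%N && (ro l == ro k)]| = ri k.
Proof.
have ex (c : 'I_(ri k)) : exists l, ri l = c /\ ro l = ro k.
  by apply: box_ex; apply: leq_trans (ro_lt k) (part_geq _); apply: ltnW.
pose f c := sval (cid (ex c)).
have fP c : ri (f c) = c /\ ro (f c) = ro k by rewrite /f; case: cid.
have finj : injective f by move=> c c' /(congr1 (fun l : 'I_n => ri l)); rewrite !(proj1 (fP _)) => /val_inj.
rewrite -[RHS]card_ord -(card_imset _ finj); apply: eq_card => l; rewrite inE.
apply/andP/imsetP => [[lk /eqP rl]|[c _ ->]].
  have ok : (ri l < ri k)%N.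
    rewrite ltn_neqAle ri_mono 1?ltnW // andbT; apply/eqP => E.
    by move: lk; rewrite (box_inj E rl) ltnn.
  by exists (Ordinal ok) => //; apply: box_inj; rewrite (proj1 (fP _), proj2 (fP _)).
have [e1 e2] := fP c; rewrite e2 eqxx; split=> //.
by rewrite ltnNge; apply/negP => /ri_mono; rewrite e1 leqNgt ltn_ord.
Qed.

Definition cword : seq int := mkseq (fun k : nat => (ro k)%:Z - (ri k)%:Z) n.
Lemma size_cword : size cword = n. Proof. exact: size_mkseq. Qed.
Lemma nth_cword k : cword`_k = (ro k)%:Z - (ri k)%:Z.
Proof. by rewrite nth_mkseq. Qed.
Definition rowmi : mi n := [ffun k : 'I_n => ri k].
Lemma rowmi_incr : mincr rowmi. Proof. by move=> k l kl; rewrite !ffunE ri_mono. Qed.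

(* A letter -x can only follow a letter 1 - x, which lies in an earlier row. *)
Lemma row_reading (w : seq int) : size w = n -> valid w -> bsorted rowmi w ->
  \sum_(x <- w) x = \sum_(x <- cword) x -> w = cword.
Proof.
move=> sw vw /bsortedP bs sumE.
have ge_row k : - (ri k)%:Z <= w`_k.
  have [N] := ubnP (ri k); elim: N k => // N IH k kN.
  have [|neg] := lerP 0 w`_k; first by lia.
  have kw : (k < size w)%N by rewrite sw.
  have : addable (take k w) (w`_k) by have := allP vw k; rewrite mem_iota sw add0n /= ltn_ord; apply.
  rewrite /addable neg => /andP[/eqP c1 _].
  have : w`_k + 1 \in take k w by rewrite -has_pred1 has_count -/(cnt _ _) c1 [(_ + _)%R]addrC.
  move=> /(nthP 0)[x]; rewrite size_takel ?(ltnW kw) // => xk; rewrite nth_take // => wx.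
  have xn : (x < n)%N by apply: ltn_trans xk _.
  have lt : (ri (Ordinal xn) < ri k)%N.
    rewrite ltn_neqAle (@ri_mono (Ordinal xn) k) ?andbT; last exact: ltnW.
    apply/eqP => E; have h : rowmi (Ordinal xn) = rowmi k by rewrite !ffunE.
    have lt : w`_x < w`_k := bs (Ordinal xn) k xk h.
    by move: lt; rewrite wx gtrDl.
  have h : - (ri (Ordinal xn))%:Z <= w`_x := IH (Ordinal xn) (leq_trans lt kN).
  apply: le_trans (_ : - (ri (Ordinal xn))%:Z - 1 <= _); first by move: lt => /=; lia.
  by rewrite lerBlDr -wx.
have ge k : cword`_k <= w`_k.
  rewrite nth_cword; have [N] := ubnP (ro k); elim: N k => // N IH k kN.
  case: (posnP (ro k)) => [->|rpos]; first by have := ge_row k; lia.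
  have [l [l1 l2]] := @box_ex (ri k) (ro k).-1 (leq_ltn_trans (leq_pred _) (ro_lt k)).
  have lk : (l < k)%N by have E1 := rk_sum l; have E2 := rk_sum k; rewrite l1 l2 in E1; lia.
  have h1 : (ro l)%:Z - (ri l)%:Z <= w`_l by apply: IH; rewrite l2; move: kN rpos; lia.
  have h2 : w`_l < w`_k by apply: bs lk _; rewrite !ffunE l1.
  apply: le_trans (_ : (ro l)%:Z - (ri l)%:Z + 1 <= _); first by rewrite l1 l2; lia.
  by rewrite lezD1 (le_lt_trans h1 h2).
apply: (@eq_from_nth _ 0) => [|x]; first by rewrite size_cword.
rewrite sw => xn; move: sumE; rewrite [LHS](big_nth 0) [RHS](big_nth 0) size_cword sw !big_mkord => /eqP.
rewrite -subr_eq0 -sumrB psumr_eq0 => [|k _]; last by rewrite subr_ge0 ge.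
by move=> /allP/(_ (Ordinal xn) (mem_index_enum _)); rewrite subr_eq0 => /eqP.
Qed.

End Tableau.

Section SpechtWeight.
Variables (C : numClosedFieldType) (n : nat) (lam : seq nat).
Hypothesis lamP : is_partition n lam.
Local Notation ri := (reshape_index lam).
Local Notation ro := (reshape_offset lam).
Local Notation R := (row_stab n lam).
Local Notation Co := (col_stab n lam).
Local Notation ga := {ffun 'S_n -> C^o}.
Implicit Types (i j k l : 'I_n) (g p q s u : 'S_n).

Fact reg_act1 (f : ga) : linfun (@ltrans C n 1%g) f = f.
Proof. by rewrite lfunE /= ltrans1. Qed.
Fact reg_actM g h (f : ga) : linfun (@ltrans C n (g * h)%g) f = linfun (@ltrans C n g) (linfun (@ltrans C n h) f).
Proof. by rewrite !lfunE /= ltransM. Qed.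
Definition reg : srep C n := @SRep C n ga (fun g => linfun (@ltrans C n g)) reg_act1 reg_actM.
Lemma regE g (f : reg) : sact reg g f = ltrans g f. Proof. by rewrite /= lfunE. Qed.

Definition tri s : ga := [ffun u => \sum_(p in R) \sum_(q in Co) (-1) ^+ q * (u == (p * s * q)%g)%:R].
Local Notation ys := (young_symmetrizer C n lam).

Lemma tri1 : tri 1%g = ys.
Proof. by apply/ffunP=> u; rewrite !ffunE; apply: eq_bigr => p _; apply: eq_bigr => q _; rewrite mulg1. Qed.

Lemma row_stabP p : reflect (forall k, ri (p k) = ri k) (p \in R).
Proof. by rewrite inE; apply: (iffP forallP) => h k; apply/eqP. Qed.
Lemma col_stabP p : reflect (forall k, ro (p k) = ro k) (p \in Co).
Proof. by rewrite inE; apply: (iffP forallP) => h k; apply/eqP. Qed.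
Lemma rowM p q : p \in R -> ((q * p)%g \in R) = (q \in R).
Proof. by move=> /row_stabP pR; apply/row_stabP/row_stabP => h k; have := h k; rewrite permM pR. Qed.
Lemma colM p q : p \in Co -> ((p * q)%g \in Co) = (q \in Co).
Proof.
move=> /col_stabP pC; apply/col_stabP/col_stabP => h k; last by rewrite permM h pC.
by rewrite -{1}[k](permKV p) -permM h -[in RHS](permKV p k) pC.
Qed.
Lemma row_tperm i j : ri i = ri j -> tperm i j \in R.
Proof. by move=> E; apply/row_stabP=> k; case: tpermP => [->|->|]. Qed.
Lemma col_tperm i j : ro i = ro j -> tperm i j \in Co.
Proof. by move=> E; apply/col_stabP=> k; case: tpermP => [->|->|]. Qed.

Lemma tri_row r s : r \in R -> tri (r * s)%g = tri s.
Proof.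
move=> rR; apply/ffunP=> u; rewrite !ffunE [RHS](reindex_inj (mulIg r)).
apply: eq_big => [p|p _]; first by rewrite rowM.
by apply: eq_bigr => q _; rewrite !mulgA.
Qed.
Lemma tri_col c s : c \in Co -> tri (s * c)%g = (-1) ^+ c *: tri s.
Proof.
move=> cC; apply/ffunP=> u; rewrite !ffunE scaler_sumr; apply: eq_bigr => p _.
rewrite scaler_sumr [RHS](reindex_inj (mulgI c)); apply: eq_big => [q|q _]; first by rewrite colM.
by rewrite /GRing.scale /= odd_permM signr_addb -!mulrA signrMK !mulgA.
Qed.

(** A row transposition is absorbed on the left, a column transposition on the right with a sign.
    Otherwise let i be in the upper row and take the box z in the row of i and the column of j: from
    (i j)(j z) = (i z)(i j) the value equals its own negative. *)
Lemma tri_tperm i j : i != j -> tri (tperm i j) = ((ri i == ri j)%:R - (ro i == ro j)%:R) *: ys.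
Proof.
move=> ij; have [rij|rij] := eqVneq (ri i) (ri j).
  have -> : (ro i == ro j) = false.
    by apply/negbTE; apply: contra_neq ij; apply: box_inj.
  by rewrite subr0 scale1r -tri1 -[tperm i j]mulg1 tri_row ?row_tperm.
have [cij|cij] := eqVneq (ro i) (ro j).
  by rewrite sub0r -tri1 -[tperm i j]mul1g tri_col ?col_tperm // odd_tperm ij expr1.
rewrite subrr scale0r.
wlog lt : i j ij rij cij / (ri i < ri j)%N => [hw|].
  case: (ltngtP (ri i) (ri j)) rij => // lt _; first by apply: hw; rewrite // ltn_eqF.
  by rewrite tpermC; apply: (hw j i) => //; [rewrite eq_sym | rewrite ltn_eqF | rewrite eq_sym].
have [z [z1 z2]] := box_ex lamP (leq_trans (ro_lt lamP j) (part_geq lamP (ltnW lt))).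
have zi : i != z by apply: contra_neq cij => ->.
have zj : j != z by apply: contra_neq rij => ->.
have E : (tperm i j * tperm j z = tperm i z * tperm i j)%g.
  have := tpermJ i z (tperm i j); rewrite tpermL tpermD // 1?eq_sym // conjgE tpermV => <-.
  by rewrite !mulgA tperm2 mul1g.
have := tri_col (tperm i j) (col_tperm (esym z2)); rewrite E tri_row ?row_tperm // odd_tperm zj expr1 scaleN1r.
by move=> /eqP; rewrite -addr_eq0 -mulr2n -scaler_nat scaler_eq0 pnatr_eq0 /= => /eqP.
Qed.

Definition ctsum : int := \sum_(x <- cword n lam) x.

(** The class sum of transpositions is central, so it may be inserted between the row and the column
    factor, where [tri_tperm] evaluates each term. The earlier boxes in the row of a box, minus
    those in its column, number its content. *)
Lemma csum_ys : csum reg ys = ctsum%:~R *: ys.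
Proof.
have two0 : (2%:R : C) != 0 by rewrite pnatr_eq0.
have E : \sum_i \sum_(j | j != i) sact reg (tperm i j) ys = \sum_i \sum_(j | j != i) tri (tperm i j).
  apply/ffunP=> u; rewrite !sum_ffunE.
  transitivity (\sum_(p in R) \sum_(q in Co) \sum_i \sum_(j | j != i) (-1) ^+ q * ((tperm i j)^-1 * u == p * q)%g%:R : C).
    rewrite exch4; apply: eq_bigr => i _; rewrite sum_ffunE; apply: eq_bigr => j _.
    by rewrite regE !ffunE.
  transitivity (\sum_(p in R) \sum_(q in Co) \sum_i \sum_(j | j != i) (-1) ^+ q * (u == p * (tperm i j) * q)%g%:R : C).
    apply: eq_bigr => p _; apply: eq_bigr => q _.
    rewrite [RHS](reindex_perm p) /=; apply: eq_bigr => i _.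
    rewrite [RHS](reindex_perm p) /=; apply: eq_big => [j|j _]; first by rewrite (inj_eq perm_inj).
    congr (_ * _%:R); rewrite tpermV -tpermJ conjgE mulKVg.
    by rewrite -(inj_eq (mulgI (tperm i j))) !mulgA tperm2 mul1g.
  rewrite exch4; apply: eq_bigr => i _; rewrite sum_ffunE; apply: eq_bigr => j _.
  by rewrite ffunE.
have sym1 i j : sact reg (tperm i j) ys = sact reg (tperm j i) ys by rewrite tpermC.
apply: (scalerI two0); rewrite !scaler_nat csumE -(pairsum_sym sym1) E.
rewrite pairsum_sym => [|i j]; last by rewrite tpermC.
congr (_ *+ 2); rewrite /ctsum (big_nth 0) size_cword big_mkord rmorph_sum scaler_suml /=.
apply: eq_bigr => i _; rewrite nth_cword //.
rewrite (eq_bigr (fun j => ((ri i == ri j)%:R - (ro i == ro j)%:R) *: ys)) => [|j ji]; last first.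
  by rewrite tri_tperm // -val_eqE /=; lia.
rewrite -scaler_suml sumrB intrB; congr ((_ - _) *: _).
- rewrite -pmulrn -(row_before lamP i) -sum1_card natr_sum big_mkcond [RHS]big_mkcond; apply: eq_bigr => j _.
  by rewrite inE eq_sym; case: ltnP; case: eqP.
- rewrite -pmulrn -(col_before lamP i) -sum1_card natr_sum big_mkcond [RHS]big_mkcond; apply: eq_bigr => j _.
  by rewrite inE eq_sym; case: ltnP; case: eqP.
Qed.

Lemma specht_neq0 : specht C n lam != 0%VS.
Proof.
apply/eqP => E; have : ys \in specht C n lam.
  by apply: memv_span; apply/imageP; exists 1%g => //; rewrite ltrans1.
rewrite E memv0 => /eqP/ffunP/(_ 1%g); rewrite !ffunE => /eqP.
have one_R : 1%g \in R by apply/row_stabP=> k; rewrite perm1.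
have one_C : 1%g \in Co by apply/col_stabP=> k; rewrite perm1.
rewrite (bigD1 1%g) //= (bigD1 1%g) //= odd_perm1 mulg1 eqxx mulr1 expr0.
have triv p q : p \in R -> q \in Co -> 1%g = (p * q)%g -> q = 1%g.
  move=> /row_stabP pR /col_stabP qC E1; apply/permP=> k; rewrite perm1.
  suff rq : ri (q k) = ri k by have B := box_inj rq (qC k).
  have qp x : q (p x) = x by rewrite -permM -E1 perm1.
  have pq x : p (q x) = x by apply: (@perm_inj _ q); rewrite qp.
  by rewrite -[in RHS](pq k) pR.
rewrite [X in 1 + X + _]big1 => [|q /andP[qC q1]]; last first.
  by case: eqP => [E1|]; rewrite ?mulr0 //; case/eqP: q1; apply: triv E1.
rewrite addr0 big1 ?addr0 ?oner_eq0 // => p /andP[pR p1]; apply: big1 => q qC.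
case: eqP => [E1|]; rewrite ?mulr0 //; case/eqP: p1.
by have q1 := triv _ _ pR qC E1; rewrite E1 q1 mulg1.
Qed.

Lemma stable_specht : @stable C n reg (specht C n lam).
Proof. by move=> g v; rewrite regE; apply: ltrans_specht. Qed.

Lemma ys_row p : p \in R -> ltrans p ys = ys.
Proof.
move=> pR; apply/ffunP=> u; rewrite !ffunE [LHS](reindex_inj (mulgI (p^-1)%g)).
have pV : (p^-1)%g \in R by apply/row_stabP=> k; rewrite -[in RHS](permKV p k) (row_stabP _ pR).
apply: eq_big => [q|q _] /=; last by apply: eq_bigr => c _; rewrite -mulgA (inj_eq (mulgI _)).
apply/row_stabP/row_stabP => h k; first by have := h (p k); rewrite permM permK (row_stabP _ pR).
by rewrite permM h (row_stabP _ pV).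
Qed.

Lemma csum_specht (f : reg) : (f : ga) \in specht C n lam -> csum reg f = ctsum%:~R *: f.
Proof.
move=> fS; suff /subvP/(_ f fS) : ((specht C n lam : {vspace reg}) <= lker (csum reg - ctsum%:~R *: \1%VF))%VS.
  by rewrite mem_eig => /eqP.
apply/span_subvP=> _ /imageP[w _ ->]; rewrite mem_eig; apply/eqP.
by rewrite -[ltrans w _]regE -g_csum csum_ys linearZ.
Qed.

(** An equivariant projection onto [T] does not kill the Young symmetrizer, which generates the
    Specht space. The image is invariant under the row stabilizer, so by straightening [T] has a
    weight that increases along rows; its content sum is that of [lam], and [row_reading] identifies
    it. *)
Lemma specht_weight (T : {vspace reg}) (st : @stable C n reg T) : T != 0%VS ->
  ((T : {vspace ga}) <= specht C n lam)%VS -> exists2 v : subrep st, v \in Ew (subrep st) (cword n lam) & v != 0.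
Proof.
move=> T0 TS; have [P [Pg PT PId]] := maschke st.
pose x : subrep st := vsproj T (P ys).
have xE : vsval x = P ys by rewrite vsprojK.
have x0 : x != 0.
  apply: contra_neq T0 => x0; apply/eqP; rewrite -subv0; apply/subvP=> f fT; rewrite memv0 -(PId f fT).
  have Pys : P ys = 0 by rewrite -xE x0.
  have fS := subvP TS _ fT; rewrite -memv_ker; move: f fS {fT}; apply/subvP.
  apply/span_subvP=> _ /imageP[w _ ->].
  by rewrite memv_ker -[ltrans w _]regE -Pg Pys linear0.
have xV : x \in VS (subrep st) (rowmi n lam).
  apply/VSP => g ga; apply: val_inj; rewrite [LHS]subrepE xE Pg regE ys_row //.
  by apply/row_stabP=> k; have := mact_stab k ga; rewrite !ffunE.
have E : eB (subrep st) (rowmi n lam) x = x by apply: eB_id; apply/VSP.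
have /memv_sumP[f fE xf] : x \in (\sum_(t : wtT n) Ew (subrep st) (wd t))%VS by rewrite Ew_sum memvf.
have [t bt [v vt v0]] : exists2 t : wtT n, bsorted (rowmi n lam) (wd t) & exists2 v, v \in Ew (subrep st) (wd t) & v != 0.
  apply: contrapT => no; case/eqP: x0; rewrite -E xf linear_sum big1 // => t _ /=.
  have /memv_sumP[h hE ->] := eB_straight (rowmi_incr lamP) (size_wd t) (fE t isT).
  rewrite big1 // => s bs; have /memv_imgP[v vs ->] := hE s bs.
  have [->|v0] := eqVneq v 0; first by rewrite linear0.
  by case: no; exists s => //; exists v.
have vd := Ew_valid (size_wd t) vt v0.
suff <- : wd t = cword n lam by exists v.
apply: row_reading => //; first exact: size_wd.
have : csum (subrep st) v = ctsum%:~R *: v.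
  apply: val_inj; rewrite /= -csum_specht; last by apply: (subvP TS); apply: subvsP.
  refine (@subrep_csum C n reg T st v).
rewrite (csum_Ew (size_wd t) vt) => /eqP.
by rewrite -subr_eq0 -scalerBl scaler_eq0 (negPf v0) orbF subr_eq0 eqr_int => /eqP.
Qed.

End SpechtWeight.

(** * The determinantal shift relation *)

Section Evolution.
Variables (R : comNzRingType) (tau : nat -> nat -> R).

(** Entries of a product of c transfer matrices: the weight of the paths from [j] to [p] that at
    each time c' either stay or go from p' to p' + 1 with weight [tau c' p']. *)
Fixpoint Mev (c p j : nat) : R := match c with
  | 0 => (p == j)%:R
  | c.+1 => Mev c p j + (if p is p'.+1 then tau c p' * Mev c p' j else 0)
  end.

Lemma Mev_supp c p j : (j + c < p)%N -> Mev c p j = 0.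
Proof.
elim: c p => [|c IH] p /=; first by rewrite addn0 => jp; rewrite gtn_eqF.
case: p => [|p] jp //; rewrite !IH ?mulr0 ?addr0 //; lia.
Qed.

Variables (m r : nat).
Hypothesis rm : (r < m)%N.
Hypothesis tau_shift : forall c p, tau (c + r) (p + m) = tau c p.
Hypothesis tau_wall : forall c, tau (c + r) m.-1 = 0.

(** The wall forbids the step from m - 1 to m from time r on, so a path ending at p + m at time c +
    r is already at some k + m at time r, and [tau_shift] translates the rest of it. Since r < m,
    only k < j, hence k < N, contributes. *)
Lemma Mev_shift c p j N : (j < N)%N ->
  Mev (c + r) (p + m) j = \sum_(k < N) Mev c p k * Mev r (k + m) j.
Proof.
move=> jN; elim: c p => [|c IH] p /=.
  have [pN|Np] := ltnP p N.
    rewrite add0n (bigD1 (Ordinal pN)) //= eqxx mul1r big1 ?addr0 // => k.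
    by rewrite -val_eqE /= eq_sym => /negPf->; rewrite mul0r.
  rewrite add0n Mev_supp; last by lia.
  by rewrite big1 // => k _; rewrite gtn_eqF ?mul0r //; have := ltn_ord k; lia.
case: p => [|p].
  rewrite add0n -[m]prednK; last by lia.
  rewrite tau_wall mul0r addr0 prednK; last by lia.
  have := IH 0%N; rewrite add0n => ->; apply: eq_bigr => k _; by rewrite addr0.
have := IH p.+1; rewrite addSn => E.
rewrite tau_shift E IH mulr_sumr -big_split; apply: eq_bigr => k _ /=.
by rewrite mulrDl mulrA.
Qed.

Lemma det_rows_add (A : comNzRingType) N (X Y : 'M[A]_N) :
  \det (X + Y) = \sum_(S : {set 'I_N}) \det (\matrix_(i, j) if i \in S then X i j else Y i j).
Proof.
rewrite /determinant exchange_big; apply: eq_bigr => s _ /=.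
rewrite -mulr_sumr; congr (_ * _).
under eq_bigr do rewrite mxE.
rewrite bigA_distr; apply: eq_bigr => S _; apply: eq_bigr => i _; by rewrite mxE.
Qed.

(* The coefficient of x^k in det (A + x A D) = det A * det (1 + x D) = det A. *)
Lemma det_nilp_rows N (A D : 'M[R]_N) k : (0 < k)%N -> (forall i j : 'I_N, (j <= i)%N -> D i j = 0) ->
  \sum_(S : {set 'I_N} | #|S| == k) \det (\matrix_(i, j) if i \in S then (A *m D) i j else A i j) = 0.
Proof.
move=> k0 D0; pose pc := map_mx (@polyC R).
have E : \det ('X *: pc N N (A *m D) + pc N N A) = \det (pc N N A).
  have -> : 'X *: pc N N (A *m D) + pc N N A = pc N N A *m (1%:M + 'X *: pc N N D).
    by rewrite mulmxDr mulmx1 -scalemxAr /pc map_mxM addrC.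
  rewrite det_mulmx (_ : \det (1%:M + 'X *: pc N N D) = 1) ?mulr1 // -det_tr det_trig.
    by rewrite big1 // => i _; rewrite !mxE eqxx D0 // mulr0 addr0.
  apply/is_trig_mxP => i j ij; rewrite !mxE D0 ?mulr0 ?addr0 1?ltnW //.
  by rewrite gt_eqF.
have := congr1 (fun q : {poly R} => q`_k) E; rewrite /= det_map_mx coefC gtn_eqF // det_rows_add coef_sum.
move=> E2; rewrite -[RHS]E2 big_mkcond; apply: eq_bigr => S _ /=.
have -> : \det (\matrix_(i, j) (if i \in S then ('X *: pc N N (A *m D)) i j else pc N N A i j))
  = 'X^#|S| * (\det (\matrix_(i, j) if i \in S then (A *m D) i j else A i j))%:P.
  rewrite -det_map_mx /determinant mulr_sumr; apply: eq_bigr => s _.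
  rewrite mulrCA; congr (_ * _).
  rewrite -prodr_const [in RHS]big_mkcond -big_split; apply: eq_bigr => i _ /=.
  by rewrite !mxE; case: ifP => _; rewrite ?mul1r.
rewrite mulrC coefMXn coefC; case: (ltngtP #|S| k) => [lt|//|->]; last by rewrite subnn.
by rewrite subn_eq0 leqNgt lt.
Qed.

(** Once the weights vanish, r more times change nothing, so by [Mev_shift] raising a row index by m
    multiplies the row by [D]. This matrix is strictly upper triangular because r steps cannot lift
    a position by m. *)
Lemma det_shift_rel N P C0 C (ga : 'I_N -> nat) k : (0 < k)%N ->
  (forall c p, (C0 <= c)%N -> (p < P)%N -> tau c p = 0) -> (C0 <= C)%N -> (forall i, ga i + m <= P)%N ->
  \sum_(S : {set 'I_N} | #|S| == k) \det (\matrix_(i, j < N) Mev C (ga i + (if i \in S then m else 0)) j) = 0.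
Proof.
move=> k0 froz C0C gaP.
have fr p c (j : nat) : (p <= P)%N -> Mev (C + c) p j = Mev C p j.
  elim: c p => [|c IH] p pP; first by rewrite addn0.
  by rewrite addnS /= IH //; case: p pP => [|p] pP; rewrite ?addr0 // froz ?mul0r ?addr0 //; lia.
pose A := \matrix_(i, j < N) Mev C (ga i) j.
pose D := \matrix_(i, j < N) Mev r (i + m) j.
rewrite -[RHS](@det_nilp_rows N A D k k0) => [|i j ji]; last first.
  by rewrite mxE Mev_supp //; lia.
apply: eq_bigr => S _; congr (\det _); apply/matrixP=> i j; rewrite !mxE.
case: ifP => _; last by rewrite addn0.
rewrite -(@fr _ r) // (@Mev_shift _ _ _ N) //.
by apply: eq_bigr => l _; rewrite !mxE.
Qed.

End Evolution.

(** * Determinants for words whose letters occupy slots *)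

Section SlotDeterminant.
Variables (R : comNzRingType) (N : nat) (tw : nat * int -> R).
Implicit Types (x : nat * int) (L s : seq (nat * int)) (kap : int -> nat) (ga : 'I_N -> nat).

(* The slots are listed from the last one to the first one. *)
Fixpoint subsr L : seq (seq (nat * int)) :=
  if L is x :: L' then subsr L' ++ [seq rcons s x | s <- subsr L'] else [:: [::]].

Definition goodw kap s := valid (map snd s) && `[< cnt (map snd s) =1 kap >].
Definition Gen L kap : R := \sum_(s <- subsr L | goodw kap s) \prod_(x <- s) tw x.

Lemma Gen_cons x L kap : Gen (x :: L) kap = Gen L kap +
  tw x * \sum_(s <- subsr L | goodw kap (rcons s x)) \prod_(y <- s) tw y.
Proof.
rewrite /Gen /= big_cat big_map; congr (_ + _); rewrite mulr_sumr; apply: eq_bigr => s _.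
by rewrite -cats1 big_cat big_seq1 mulrC.
Qed.

Definition pospart (a : int) : nat := if (0 < a)%R then absz a else 0%N.
Lemma pospartP a : (0 < a)%R /\ (pospart a)%:Z = a \/ (a <= 0)%R /\ pospart a = 0%N.
Proof. by rewrite /pospart; case: ltrP => a0; [left | right]; split=> //; lia. Qed.

Definition gcount ga (y : int) := #|[set i | y <= (ga i)%:Z]|.
(** Length of diagonal a of the shape whose column lengths have the beta-numbers [ga]: among the
    entries that are at least N - a, those also present for the empty shape are subtracted. *)
Definition gcnt ga (a : int) : nat := (gcount ga (N%:Z - a) - pospart a)%N.
Definition sdecr ga := forall i j : 'I_N, (i < j)%N -> (ga j < ga i)%N.

(** The one-particle version of [Gen]: a box of content a moves one beta-number from N - a - 1 to N
    - a, and the empty shape has the beta-numbers N - 1 - j. *)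
Fixpoint Msl L (p : nat) (j : 'I_N) : R :=
  if L is x :: L' then Msl L' p j + (if p%:Z == N%:Z - x.2 then tw x * Msl L' p.-1 j else 0)
  else (p == N - 1 - j)%N%:R.

Lemma sdecr_ge ga (i : 'I_N) : sdecr ga -> (N - 1 - i <= ga i)%N.
Proof.
move=> sd; have [d] := ubnP (N - 1 - i)%N; elim: d i => // d IH i id.
have [lt|] := ltnP i.+1 N; last by have := ltn_ord i; lia.
have := IH (Ordinal lt); have := sd i (Ordinal lt) (leqnn _); rewrite /=; lia.
Qed.

Lemma gcount_ge ga a : sdecr ga -> (a <= N%:Z)%R -> (pospart a <= gcount ga (N%:Z - a))%N.
Proof.
move=> sd aN; have aN' : (pospart a <= N)%N by have := pospartP a; lia.
have winj : injective (widen_ord aN') by move=> i j /(congr1 val) /= E; apply: val_inj.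
rewrite /gcount -[X in (X <= _)%N]card_ord -(card_imset _ winj).
apply/subset_leq_card/subsetP => _ /imsetP[i _ ->]; rewrite inE.
by have := sdecr_ge (widen_ord aN' i) sd; have := ltn_ord i; have := pospartP a; rewrite /=; lia.
Qed.

Lemma gcount_step ga y : gcount ga y = (gcount ga (y + 1) + #|[set i | (ga i)%:Z == y]|)%N.
Proof.
rewrite /gcount -(cardsID [set i | y + 1 <= (ga i)%:Z] [set i | y <= (ga i)%:Z]).
by congr (_ + _)%N; apply: eq_card => i; rewrite !inE; lia.
Qed.

Lemma sdecr_inj ga : sdecr ga -> injective ga.
Proof. by move=> sd i j E; apply: val_inj; case: (ltngtP i j) => // /sd; rewrite E ltnn. Qed.

Lemma gcount1 ga y i : sdecr ga -> (ga i)%:Z = y -> #|[set j | (ga j)%:Z == y]| = 1%N.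
Proof.
move=> sd gy; apply/eqP/cards1P; exists i; apply/setP=> j; rewrite !inE -gy.
apply/eqP/eqP => [[]|->//]; exact: sdecr_inj.
Qed.
Lemma gcount0 ga y : (forall i, (ga i)%:Z != y) -> #|[set j | (ga j)%:Z == y]| = 0%N.
Proof. by move=> h; apply: eq_card0 => j; rewrite inE (negPf (h j)). Qed.

Lemma goodw_rcons ga s x : sdecr ga -> (x.2 < N%:Z)%R ->
  goodw (gcnt ga) (rcons s x) ->
  exists2 i, (ga i)%:Z = N%:Z - x.2 & forall j, (ga j)%:Z != N%:Z - x.2 - 1.
Proof.
case: x => c a /= sd aN; rewrite /goodw map_rcons valid_rcons => /andP[/andP[_ ad] /asboolP E].
set w := map snd s in ad E.
have c0 := E a; have c1 := E (a + 1); have c2 := E (a - 1).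
rewrite !cnt_rcons eqxx /gcnt in c0 c1 c2.
rewrite (_ : (a == a + 1) = false) in c1; last by lia.
rewrite (_ : (a == a - 1) = false) in c2; last by lia.
have g0 := gcount_ge sd (ltW aN); have g1 : (pospart (a + 1) <= gcount ga (N%:Z - (a + 1)))%N.
  by apply: gcount_ge => //; lia.
have g2 : (pospart (a - 1) <= gcount ga (N%:Z - (a - 1)))%N by apply: gcount_ge => //; lia.
have s1 := gcount_step ga (N%:Z - (a + 1)); have s2 := gcount_step ga (N%:Z - a).
rewrite (_ : N%:Z - (a + 1) + 1 = N%:Z - a) in s1; last by lia.
rewrite (_ : N%:Z - a + 1 = N%:Z - (a - 1)) in s2; last by lia.
move: ad; rewrite /addable /= => /andP[/eqP ad1 /eqP ad2].
have [i /eqP gi|no] := pickP (fun i => (ga i)%:Z == N%:Z - a); last first.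
  rewrite (gcount0 (fun i => negbT (no i))) in s2; exfalso.
  by have := pospartP a; have := pospartP (a - 1); lia.
exists i => // j; apply/eqP => gj.
have gj' : (ga j)%:Z = N%:Z - (a + 1) by lia.
rewrite (gcount1 sd gj') in s1; exfalso.
by have := pospartP a; have := pospartP (a + 1); lia.
Qed.

Lemma goodw_move ga s x i : sdecr ga -> (x.2 < N%:Z)%R ->
  (ga i)%:Z = N%:Z - x.2 -> (forall j, (ga j)%:Z != N%:Z - x.2 - 1) ->
  goodw (gcnt ga) (rcons s x) = goodw (gcnt (fun j => if j == i then (ga i).-1 else ga j)) s.
Proof.
case: x => c a /= sd aN gi nj; set ga' := fun j => _.
have sd' : sdecr ga'.
  move=> k l kl; have := sd _ _ kl; rewrite /ga'; case: eqP => [->|_]; case: eqP => [->|_] //; try lia.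
  by have := nj k; have := nj l; lia.
have ga'E y : (gcount ga y = gcount ga' y + (y == (N%:Z - a)%R))%N.
  rewrite /gcount; have [->|yn] := eqVneq.
    rewrite [LHS](cardsD1 i) inE gi lexx addnC; congr (_ + _)%N; apply: eq_card => j.
    by rewrite !inE /ga'; case: eqP => [->|_] //=; have := nj i; lia.
  rewrite addn0; apply: eq_card => j; rewrite !inE /ga'; case: eqP => [->|_] //; lia.
have cE e : gcnt ga e = (gcnt ga' e + (a == e))%N.
  rewrite /gcnt ga'E (_ : (N%:Z - e == N%:Z - a) = (a == e)); last by lia.
  have [eN|eN] := leP e N%:Z; first by have := gcount_ge sd' eN; lia.
  have -> : (a == e) = false by lia.
  by rewrite !addn0.
rewrite /goodw map_rcons valid_rcons -andbA; congr (_ && _).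
have -> : `[< cnt (rcons (map snd s) a) =1 gcnt ga >] = `[< cnt (map snd s) =1 gcnt ga' >].
  by apply/asboolP/asboolP => E e; have := E e; rewrite cnt_rcons cE; lia.
case: asboolP => [E|_]; rewrite ?andbF ?andbT //.
rewrite /addable /= !E /gcnt.
have aN1 : (a <= N%:Z) by exact: ltW.
have g0 := gcount_ge sd' aN1; have g1 : (pospart (a + 1) <= gcount ga' (N%:Z - (a + 1)))%N.
  by apply: gcount_ge => //; lia.
have g2 : (pospart (a - 1) <= gcount ga' (N%:Z - (a - 1)))%N by apply: gcount_ge => //; lia.
have s1 := gcount_step ga' (N%:Z - (a + 1)); have s2 := gcount_step ga' (N%:Z - a).
rewrite (_ : N%:Z - (a + 1) + 1 = N%:Z - a) in s1; last by lia.
rewrite (_ : N%:Z - a + 1 = N%:Z - (a - 1)) in s2; last by lia.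
have gi' : (ga' i)%:Z = N%:Z - (a + 1) by rewrite /ga' eqxx; lia.
rewrite (gcount1 sd' gi') in s1; rewrite gcount0 in s2; last first.
  move=> j; rewrite /ga'; case: (eqVneq j i) => [_|ji]; first by lia.
  by apply: contra_neq ji => E2; apply: (sdecr_inj sd); lia.
by have := pospartP a; have := pospartP (a + 1); have := pospartP (a - 1); lia.
Qed.

(** Induction over the slots takes the place of a path-crossing involution. The last slot affects
    only the row with [ga i] equal to N - x.2, and the determinant is linear in it. If the position
    just below is occupied, the new matrix has two equal rows, which matches the absence of good
    words ending in that slot. *)
Lemma Gen_det L ga : sdecr ga -> all (fun x => x.2 < N%:Z) L ->
  Gen L (gcnt ga) = \det (\matrix_(i, j < N) Msl L (ga i) j).
Proof.
elim: L ga => [|x L IH] ga sd /=.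
  move=> _; rewrite /Gen /= big_mkcond big_seq1 big_nil /goodw /=.
  case: asboolP => [E|nE].
    have gaE i : ga i = (N - 1 - i)%N.
      have := E 0; rewrite /gcnt subn0 subr0 /gcount => /esym/eqP; rewrite cards_eq0 => /eqP/setP S0.
      apply/eqP; rewrite eqn_leq sdecr_ge // andbT.
      have [d] := ubnP i; elim: d i => // d IHd i id.
      case: (posnP i) => [i0|ipos]; first by have := S0 i; rewrite !inE; lia.
      have i'n : (i.-1 < N)%N by have := ltn_ord i; lia.
      have := IHd (Ordinal i'n); have := sd (Ordinal i'n) i; rewrite /=; lia.
    rewrite -[LHS](@det1 R N); congr (\det _); apply/matrixP=> i j; rewrite !mxE gaE.
    by congr (_%:R); have := ltn_ord i; have := ltn_ord j; rewrite -val_eqE /=; lia.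
  (* If the shape is not empty, some beta-number is at least N; without slots the corresponding row
     is zero. *)
  have [i gi] : exists i, (N <= ga i)%N.
    apply: contrapT => nE2; apply: nE => a; rewrite /cnt /gcnt /=.
    have gaE i : ga i = (N - 1 - i)%N.
      apply/eqP; rewrite eqn_leq sdecr_ge // andbT.
      have [d] := ubnP i; elim: d i => // d IHd i id.
      case: (posnP i) => [i0|ipos].
        by have : ~ (N <= ga i)%N by [move=> ?; apply: nE2; exists i]; lia.
      have i'n : (i.-1 < N)%N by have := ltn_ord i; lia.
      have := IHd (Ordinal i'n); have := sd (Ordinal i'n) i; rewrite /=; lia.
    apply/esym/eqP; rewrite subn_eq0 /gcount; have pa := pospartP a.
    have [aN|aN] := leqP (pospart a) N; last by apply: leq_trans (max_card _) _; rewrite card_ord ltnW.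
    have winj : injective (widen_ord aN) by move=> i j /(congr1 val) /= E; apply: val_inj.
    rewrite -[X in (_ <= X)%N]card_ord -(card_imset _ winj).
    apply/subset_leq_card/subsetP => i; rewrite inE gaE => h.
    have ia : (i < pospart a)%N by have := ltn_ord i; lia.
    by apply/imsetP; exists (Ordinal ia) => //; apply: val_inj.
  rewrite (expand_det_row _ i) big1 // => j _; rewrite !mxE.
  by rewrite (_ : (ga i == _) = false) ?mul0r //; have := ltn_ord j; lia.
move=> /andP[xN LN]; rewrite Gen_cons IH //.
have [i /eqP gi|no] := pickP (fun i => (ga i)%:Z == N%:Z - x.2); last first.
  rewrite big1_seq ?mulr0 ?addr0 => [|s /andP[gs _]]; last first.
    by have [i gi _] := goodw_rcons sd xN gs; have := no i; rewrite gi eqxx.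
  by congr (\det _); apply/matrixP=> i j; rewrite !mxE no addr0.
pose ga' j := if j == i then (ga i).-1 else ga j.
have -> : \det (\matrix_(k, j < N) (Msl L (ga k) j + (if (ga k)%:Z == N%:Z - x.2 then tw x * Msl L (ga k).-1 j else 0)))
  = \det (\matrix_(k, j < N) Msl L (ga k) j) + tw x * \det (\matrix_(k, j < N) Msl L (ga' k) j).
  have other k : k != i -> (ga k)%:Z == N%:Z - x.2 = false.
    by move=> ki; apply/negbTE; apply: contra_neq ki => E; apply: (sdecr_inj sd); lia.
  rewrite -[X in _ = X + _]mul1r; apply: (determinant_multilinear (i0 := i)).
  - by apply/rowP=> j; rewrite !mxE /ga' eqxx gi eqxx mul1r.
  - by apply/matrixP=> k j; rewrite !mxE other ?addr0 // eq_sym neq_lift.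
  - by apply/matrixP=> k j; rewrite !mxE /ga' other ?addr0 // eq_sym ?(negPf (neq_lift _ _)) // neq_lift.
congr (_ + _ * _).
have [j gj|nj] := pickP (fun j => (ga j)%:Z == N%:Z - x.2 - 1).
  rewrite big1_seq => [|s /andP[gs _]]; last first.
    by have [_ _ /(_ j)] := goodw_rcons sd xN gs; rewrite gj.
  have ji : j != i by apply/eqP => E; move: gj; rewrite E gi; lia.
  apply/esym/(determinant_alternate ji) => k; rewrite !mxE /ga' eqxx (negPf ji).
  by congr (Msl L _ k); lia.
have nj' j : (ga j)%:Z != N%:Z - x.2 - 1 by rewrite nj.
under eq_bigl => s do rewrite (goodw_move s sd xN gi nj').
apply: IH => //; move=> k l kl; have := sd _ _ kl; rewrite /ga'; case: eqP => [->|_]; case: eqP => [->|_] //; try lia.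
by have := nj' k; have := nj' l; lia.
Qed.

End SlotDeterminant.

(** * Graded submodules *)

Section Comprehension.
Variables (K : fieldType) (V : vectType K).
Implicit Types (P : V -> Prop).

Definition linpred P := P 0 /\ forall a u v, P u -> P v -> P (a *: u + v).

(** A subspace of maximal dimension inside [P] contains all of [P], since adding the line of a
    further vector would stay inside [P] and be larger. *)
Lemma pspace_ex P : linpred P -> exists S : {vspace V}, forall v, v \in S <-> P v.
Proof.
move=> [P0 PL]; pose good k := `[< exists S : {vspace V}, (forall v, v \in S -> P v) /\ \dim S = k >].
have g0 : good 0%N by apply/asboolP; exists 0%VS; rewrite dimv0; split=> // v; rewrite memv0 => /eqP->.
have ub k : good k -> (k <= \dim {:V})%N by move=> /asboolP[S [_ <-]]; apply: dimvS; apply: subvf.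
have [k /asboolP[S [SP Sk]] kmax] := ex_maxnP (ex_intro good _ g0) ub.
exists S => v; split=> [/SP//|Pv]; apply/negPn/negP => vS.
have : (\dim (S + <[v]>) <= k)%N.
  apply: kmax; apply/asboolP; exists (S + <[v]>)%VS; split=> // _ /memv_addP[s sS [_ /vlineP[c ->] ->]].
  by rewrite addrC; apply: PL => //; apply: SP.
rewrite -Sk => le; have := dimv_leqif_sup (addvSl S <[v]>); rewrite /leqif => -[le2 eq2].
have : (S + <[v]> <= S)%VS by rewrite -eq2 eqn_leq le2.
by move=> /subvP/(_ v); rewrite (negPf vS) => /(_ (subvP (addvSr _ _) _ (memv_line v))).
Qed.

Definition pspace P : {vspace V} :=
  if pselect (linpred P) is left h then sval (cid (pspace_ex h)) else 0%VS.

Lemma pspaceP P v : linpred P -> v \in pspace P <-> P v.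
Proof. by rewrite /pspace; case: pselect => // h _; case: cid => S /= ->. Qed.
End Comprehension.

Section GradedPieces.
Variables (C : fieldType) (n : nat).

Definition midx d := {x : {ffun 'I_n -> 'I_d.+1} | \sum_i (x i : nat) == d}%N.
HB.instance Definition _ d := Finite.on (midx d).
Definition tomi d (x : midx d) : mi n := [ffun i => (sval x i : nat)].

Lemma tomi_inj d : injective (@tomi d).
Proof.
move=> x y /ffunP E; apply: val_inj; apply/ffunP=> i; apply: val_inj.
by have := E i; rewrite !ffunE.
Qed.
Lemma mdg_tomi d (x : midx d) : mdg (tomi x) = d.
Proof.
by apply: etrans (_ : _ = \sum_i (sval x i : nat))%N (eqP (valP x)); apply: eq_bigr => i _; rewrite ffunE.
Qed.
Lemma tomi_onto d (a : mi n) : mdg a = d -> exists x : midx d, tomi x = a.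
Proof.
move=> ad; have le i : (a i < d.+1)%N by rewrite ltnS -ad /mdg (bigD1 i) //= leq_addr.
pose y : {ffun 'I_n -> 'I_d.+1} := [ffun i => Ordinal (le i)].
have P : (\sum_i (y i : nat) == d)%N.
  by rewrite -[X in _ == X]ad; apply/eqP/eq_bigr => i _; rewrite ffunE.
by exists (exist _ y P); apply/ffunP=> i; rewrite !ffunE.
Qed.

Variable U : srep C n.
Local Notation F := (F U).
Implicit Types (f h : F) (d : nat).

Definition G d : vectType C := {ffun midx d -> U}.
Definition emb d (phi : G d) : F := fun a => \sum_(x | tomi x == a) phi x.
Definition res d f : G d := [ffun x => f (tomi x)].
Definition hom d f := forall a, mdg a != d -> f a = 0.

Lemma embE d (phi : G d) x : emb phi (tomi x) = phi x.
Proof. by rewrite /emb (big_pred1 x) // => y; rewrite (inj_eq (@tomi_inj d)). Qed.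
Lemma emb_hom d (phi : G d) : hom d (emb phi).
Proof. by move=> a ad; rewrite /emb big_pred0 // => x; apply: contraNF ad => /eqP<-; rewrite mdg_tomi. Qed.
Lemma res_emb d : cancel (@emb d) (@res d).
Proof. by move=> phi; apply/ffunP=> x; rewrite ffunE embE. Qed.
Lemma emb_res d f : hom d f -> emb (res d f) = f.
Proof.
move=> hf; apply/funext=> a; have [ad|ad] := eqVneq (mdg a) d; last by rewrite hf // emb_hom.
by have [x <-] := tomi_onto ad; rewrite embE ffunE.
Qed.

Fact emb_is_linear d : linear (@emb d).
Proof.
move=> c phi psi; apply/funext=> a; rewrite FD FZ /emb scaler_sumr -big_split.
by apply: eq_bigr => x _; rewrite !ffunE.
Qed.
HB.instance Definition _ d := GRing.isLinear.Build C (G d) F *:%R (@emb d) (@emb_is_linear d).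
Fact res_is_linear d : linear (@res d).
Proof. by move=> c f h; apply/ffunP=> x; rewrite !ffunE. Qed.
HB.instance Definition _ d := GRing.isLinear.Build C F (G d) *:%R (@res d) (@res_is_linear d).

Lemma hom0 d : hom d 0. Proof. by []. Qed.
Lemma homP d c f h : hom d f -> hom d h -> hom d (c *: f + h).
Proof. by move=> hf hh a ad; rewrite FD FZ hf // hh // scaler0 addr0. Qed.
Lemma homZ d c f : hom d f -> hom d (c *: f).
Proof. by move=> hf; rewrite -[c *: f]addr0; apply: homP. Qed.
Lemma homD d f h : hom d f -> hom d h -> hom d (f + h).
Proof. by move=> hf hh; rewrite -[f]scale1r; apply: homP. Qed.
Lemma hom_sum d (I : Type) (r : seq I) (P : pred I) (f : I -> F) :
  (forall i, P i -> hom d (f i)) -> hom d (\sum_(i <- r | P i) f i).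
Proof. by move=> hf; apply: big_ind => //; apply: homD. Qed.
Lemma hom_g d g f : hom d f -> hom d (gop g f).
Proof. by move=> hf a ad; rewrite gopE hf ?linear0 // mdg_mact. Qed.
Lemma hom_Y d k f : hom d.+1 f -> hom d (Yop k f).
Proof. by move=> hf a ad; rewrite YopE hf // mdg_minc. Qed.
Lemma hom_Y0 k f : hom 0 f -> Yop k f = 0.
Proof. by move=> hf; apply/funext=> a; rewrite YopE hf // mdg_minc. Qed.
Lemma hom_C d b k j f : hom d f -> hom d (Cop b k j f).
Proof.
move=> hf; rewrite CopE; case: ifP => _.
  by apply: homD => //; apply: homZ; apply: hom_sum => l _; apply: hom_g.
by rewrite -scaleNr; apply: homZ; apply: hom_g.
Qed.

Lemma hom_X d b j f : hom d f -> hom d.+1 (Xop b j f).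
Proof.
move=> hf a; move: d f hf; elim/mi_ind: a => [|a k IH] d f hf; first by rewrite Xop0.
rewrite mdg_minc eqSS -YopE YX FD => ad.
rewrite (hom_C _ _ _ hf) // addr0; case: d hf ad => [|d] hf ad; first by rewrite hom_Y0 // X0.
by apply: (IH d); [apply: hom_Y | ].
Qed.

(* Taylor coefficients: an operator recovered from its iterated derivatives at 0. *)
Lemma Y_detect d f : hom d.+1 f -> (forall k, Yop k f = 0) -> f = 0.
Proof.
move=> hf Y0f; apply: Yop_ext => [|k]; last by rewrite Y0f Y0.
by rewrite hf // mdg0.
Qed.
End GradedPieces.

Section NaturalMaps.
Variables (C : fieldType) (n : nat) (b : C) (U W : srep C n).

(** Induction through [YX], as for [XopC]: compatibility with X follows from that with Y and the
    group once constant terms agree. *)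
Lemma Xnat (N : F U -> Prop) (th : F U -> F W) : linear th ->
  (forall k f, th (Yop k f) = Yop k (th f)) -> (forall g f, th (gop g f) = gop g (th f)) ->
  (forall k f, N f -> N (Yop k f)) ->
  (forall j f, N f -> th (Xop b j f) (mzero n) = 0) ->
  forall j f, N f -> th (Xop b j f) = Xop b j (th f).
Proof.
move=> tl tY tg NY t0; have th0 : th 0 = 0 by have := tl (-1) 0 0; rewrite scaler0 add0r scaleN1r addNr.
have thD : {morph th : f h / f + h} by move=> f h; have := tl 1 f h; rewrite !scale1r.
have thZ c f : th (c *: f) = c *: th f by have := tl c f 0; rewrite th0 !addr0.
have tC k j f : th (Cop b k j f) = Cop b k j (th f).
  rewrite !CopE; case: ifP => _; last by rewrite -scaleNr thZ tg scaleNr.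
  rewrite thD thZ (big_morph th thD th0); congr (_ + _ *: _); apply: eq_bigr => l _; exact: tg.
move=> j f Nf; apply/funext=> a; move: f Nf; elim/mi_ind: a => [|a k IH] f Nf.
  by rewrite t0 // Xop0.
by rewrite -!YopE -tY !YX thD !FD tC IH ?tY //; apply: NY.
Qed.
End NaturalMaps.

Section Euler.
Variables (C : numClosedFieldType) (n : nat) (b : C) (U : srep C n).
Implicit Types (f : F U).

(** The sum of the z_i is the Euler element: moving Y_k past it costs one Y_k, so its value at [a]
    is found from the one at [mzero], where only the class sum of transpositions survives. *)
Lemma Euler f a : Psym b 'X f a = (mdg a)%:R *: f a + b *: csum U (f a).
Proof.
have two0 : (2%:R : C) != 0 by rewrite pnatr_eq0.
pose T (h : F U) : F U := \sum_(i : 'I_n) \sum_(j : 'I_n | (j < i)%N) gop (tperm i j) h.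
have TE h x : T h x = \sum_(i : 'I_n) \sum_(j : 'I_n | (j < i)%N) gop (tperm i j) h x.
  by rewrite /T fsumE; apply: eq_bigr => i _; rewrite fsumE.
have PE (h : F U) : Psym b 'X h = \sum_i pop b i h + b *: T h.
  rewrite /Psym.
  rewrite (eq_bigr (fun i => pop b i h + b *: \sum_(j : 'I_n | (i < j)%N) gop (tperm i j) h)) => [|i _].
    rewrite big_split -scaler_sumr; congr (_ + _ *: _).
    rewrite (exchange_big_dep predT) //=; apply: eq_bigr => i _; apply: eq_bigr => j _.
    by rewrite tpermC.
  by rewrite -[X in opoly _ X]expr1 opolyXn.
have YT (k : 'I_n) (h : F U) : Yop k (T h) = T (Yop k h) + \sum_(l | l != k) (gop (tperm k l) (Yop l h) - gop (tperm k l) (Yop k h)).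
  have sym1 (x : F U) i j : gop (tperm i j) x = gop (tperm j i) x by rewrite tpermC.
  have YTE : Yop k (T h) = \sum_(i : 'I_n) \sum_(j : 'I_n | (j < i)%N) gop (tperm i j) (Yop (tperm i j k) h).
    rewrite /T Ysum; apply: eq_bigr => i _; rewrite Ysum; apply: eq_bigr => j _.
    by rewrite gYop tpermV tpermK.
  apply: (scalerI two0); rewrite scalerDr !scaler_nat YTE.
  rewrite -[LHS]pairsum_sym => [|i j]; last by rewrite tpermC.
  rewrite -[T _ *+ 2]pairsum_sym //; apply/eqP; rewrite addrC -subr_eq; apply/eqP.
  rewrite -sumrB (eq_bigr (fun i => \sum_(j | j != i) (gop (tperm i j) (Yop (tperm i j k) h) - gop (tperm i j) (Yop k h)))).
    rewrite (bigD1 k) //= mulr2n; congr (_ + _).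
      by apply: eq_bigr => l lk; rewrite tpermL.
    rewrite [RHS](eq_bigl (fun i => true && (i != k))) //; apply: eq_bigr => i ik.
    rewrite (bigD1 k) 1?eq_sym //= big1 ?addr0 => [|j /andP[ji jk]]; first by rewrite tpermR tpermC.
    by rewrite tpermD ?subrr // eq_sym.
  by move=> i _; rewrite sumrB.
have YE (k : 'I_n) (h : F U) : Yop k (Psym b 'X h) = Psym b 'X (Yop k h) + Yop k h.
  rewrite !PE YD YZ YT Ysum.
  under eq_bigr => i _ do rewrite /pop YX YopC.
  rewrite big_split /= -!addrA; congr (_ + _); rewrite scalerDr addrCA; congr (_ + _).
  rewrite (bigD1 k) //= CopE eqxx.
  have -> : \sum_(i | i != k) Cop b k i (Yop i h) = - (b *: \sum_(l | l != k) gop (tperm k l) (Yop l h)).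
    by rewrite scaler_sumr -sumrN; apply: eq_bigr => l lk; rewrite CopE eq_sym (negPf lk).
  by rewrite sumrB scalerBr addrA subrK addrK.
elim/mi_ind: a f => [|a k IH] f.
  rewrite mdg0 scale0r add0r PE FD FZ fsumE big1 => [|i _]; last by rewrite /pop Xop0.
  rewrite add0r TE csumE; congr (_ *: _); apply: eq_bigr => i _; apply: eq_bigr => j _.
  by rewrite gopE mact0.
by rewrite -YopE YE FD IH YopE mdg_minc -addn1 natrD scalerDl scale1r addrAC.
Qed.
End Euler.

(** * Spherical multiplicities of graded submodules *)

Section GradedSubmodules.
Variables (C : numClosedFieldType) (n : nat) (b : C).
Implicit Types (U W : srep C n) (d : nat) (g : 'S_n).

Definition gsub U (N : nat -> F U -> Prop) :=
  [/\ forall d f, N d f -> hom d f, forall d, N d 0 /\ (forall c f h, N d f -> N d h -> N d (c *: f + h)),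
      forall d g f, N d f -> N d (gop g f), forall d k f, N d.+1 f -> N d (Yop k f)
    & forall d j f, N d f -> N d.+1 (Xop b j f)].

Definition eop U (f : F U) : F U := (n`!%:R)^-1 *: \sum_(g : 'S_n) gop g f.

Lemma eop_linear U : linear (@eop U).
Proof.
move=> c f h; rewrite /eop; under eq_bigr do rewrite gD gZ.
by rewrite big_split /= -scaler_sumr scalerDr !scalerA mulrC.
Qed.
Lemma eop0 U : eop (0 : F U) = 0.
Proof. by have := @eop_linear U (-1) 0 0; rewrite scaler0 add0r scaleN1r addNr. Qed.
Lemma eopD U (f h : F U) : eop (f + h) = eop f + eop h.
Proof. by have := @eop_linear U 1 f h; rewrite !scale1r. Qed.
Lemma g_eop U g (f : F U) : gop g (eop f) = eop f.
Proof.
rewrite /eop gZ gsum; congr (_ *: _); rewrite [RHS](reindex_inj (mulgI g)).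
by apply: eq_bigr => h _; rewrite gopM.
Qed.
Lemma eop_g U g (f : F U) : eop (gop g f) = eop f.
Proof.
rewrite /eop; congr (_ *: _); rewrite [RHS](reindex_inj (mulIg g)).
by apply: eq_bigr => h _; rewrite gopM.
Qed.
Lemma eop_id U (f : F U) : (forall g, gop g f = f) -> eop f = f.
Proof.
move=> fi; rewrite /eop (eq_bigr (fun=> f)) // sumr_const -scaler_nat scalerA -(card_Sn n) .
rewrite (_ : #|_| = #|'S_n|) // mulVf ?scale1r // card_Sn pnatr_eq0 -lt0n fact_gt0 //.
Qed.
Section Closure.
Variables (U : srep C n) (N : nat -> F U -> Prop).
Hypothesis sN : gsub N.
Lemma gsub_hom d f : N d f -> hom d f. Proof. by case: sN => h _ _ _ _; apply: h. Qed.
Lemma gsub0 d : N d 0. Proof. by case: sN => _ h _ _ _; case: (h d). Qed.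
Lemma gsubP d c f h : N d f -> N d h -> N d (c *: f + h). Proof. by case: sN => _ H _ _ _; case: (H d) => _; apply. Qed.
Lemma gsubD d f h : N d f -> N d h -> N d (f + h).
Proof. by move=> Nf Nh; rewrite -[f]scale1r; apply: gsubP. Qed.
Lemma gsubZ d c f : N d f -> N d (c *: f).
Proof. by move=> Nf; rewrite -[c *: f]addr0; apply: gsubP => //; apply: gsub0. Qed.
Lemma gsub_g d g f : N d f -> N d (gop g f). Proof. by case: sN => _ _ h _ _; apply: h. Qed.
Lemma gsub_Y d k f : N d.+1 f -> N d (Yop k f). Proof. by case: sN => _ _ _ h _; apply: h. Qed.
Lemma gsub_X d j f : N d f -> N d.+1 (Xop b j f). Proof. by case: sN => _ _ _ _ h; apply: h. Qed.
Lemma gsub_sum d (I : Type) (r : seq I) (P : pred I) (f : I -> F U) :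
  (forall i, P i -> N d (f i)) -> N d (\sum_(i <- r | P i) f i).
Proof. by move=> Nf; apply: big_ind => //; [apply: gsub0 | apply: gsubD]. Qed.
Lemma gsub_pop d i f : N d f -> N d (pop b i f).
Proof.
case: d => [|d] Nf; last by apply/gsub_X/gsub_Y.
by rewrite /pop hom_Y0 ?X0; [apply: gsub0 | apply: gsub_hom].
Qed.
Lemma gsub_zop d i f : N d f -> N d (zop b i f).
Proof. by move=> Nf; apply: gsubD; [apply: gsub_pop | apply/gsubZ/gsub_sum => j _; apply: gsub_g]. Qed.
Lemma gsub_opoly d A p f : (forall f, N d f -> N d (A f)) -> N d f -> N d (opoly A p f).
Proof.
move=> NA Nf; apply: gsub_sum => k _; apply: gsubZ; elim: (k : nat) => //= l; exact: NA.
Qed.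
Lemma gsub_Psym d p f : N d f -> N d (Psym b p f).
Proof. by move=> Nf; apply: gsub_sum => i _; apply: gsub_opoly => // h; apply: gsub_zop. Qed.
Lemma gsub_eop d f : N d f -> N d (eop f).
Proof. by move=> Nf; apply/gsubZ/gsub_sum => g _; apply: gsub_g. Qed.
End Closure.

Lemma gsub_full U : gsub (@hom C n U).
Proof.
split=> // [d|d g f|d k f|d j f]; first by split=> // c f h; apply: homP.
- exact: hom_g.
- exact: hom_Y.
- exact: hom_X.
Qed.
Lemma gsub_zero U : gsub (fun d (f : F U) => f = 0).
Proof.
split=> [d f -> //|d|d g f ->|d k f ->|d j f ->]; rewrite ?g0 ?Y0 ?X0 //.
by split=> // c f h -> ->; rewrite scaler0 addr0.
Qed.

Variable p : {poly C}.
(** With [q] chosen as in [qsel], this is the projector onto the invariants in one generalized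
    eigenspace of [Psym b p], in all degrees up to D and for all [U] at once. *)
Definition Qop (q : {poly C}) U (f : F U) : F U := opoly (Psym b p) q (eop f).

Lemma Qop_linear q U : linear (@Qop q U).
Proof.
move=> c f h; rewrite /Qop eop_linear.
exact: (opoly_is_linear q (@Psym_linear _ _ b U p)).
Qed.
Lemma Qop0 q U : Qop q (0 : F U) = 0.
Proof. by have := @Qop_linear q U (-1) 0 0; rewrite scaler0 add0r scaleN1r addNr. Qed.
Lemma gsub_Qop q U (N : nat -> F U -> Prop) d f : gsub N -> N d f -> N d (Qop q f).
Proof. by move=> sN Nf; apply: gsub_opoly => // [h|]; [apply: gsub_Psym | apply: gsub_eop]. Qed.
Lemma g_Qop q U g (f : F U) : gop g (Qop q f) = Qop q f.
Proof.
rewrite /Qop (opoly_comm (B := gop g)) ?g_eop //; first exact: gop_is_linear.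
by move=> u; apply: gPsym.
Qed.

Definition dQ q U (N : nat -> F U -> Prop) d :=
  \dim (pspace (fun phi : G U d => exists2 f, N d f & emb phi = Qop q f)).

Lemma dQ_pred q U (N : nat -> F U -> Prop) d : gsub N ->
  linpred (fun phi : G U d => exists2 f, N d f & emb phi = Qop q f).
Proof.
move=> sN; split; first by exists 0; [apply: gsub0 | rewrite Qop0 linear0].
move=> a u v [f Nf Ef] [h Nh Eh]; exists (a *: f + h); first exact: gsubP.
by rewrite linearP /= Ef Eh Qop_linear.
Qed.

Definition Qidem q D := forall U d (f : F U), (d <= D)%N -> hom d f -> Qop q (Qop q f) = Qop q f.

(** An idempotent that commutes with morphisms is exact, so its rank is additive. The map [th] need
    not preserve degrees: it compares degree [d] with degree [d'], as a composition factor starts in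
    a higher degree. *)
Lemma dQ_exact q D U W (N N' : nat -> F U -> Prop) (M : nat -> F W -> Prop) (th : F U -> F W) d d' :
  Qidem q D -> (d <= D)%N -> gsub N -> gsub N' -> gsub M -> linear th ->
  (forall g f, th (gop g f) = gop g (th f)) ->
  (forall e f, N e f -> forall k, th (Yop k f) = Yop k (th f)) ->
  (forall e f, N e f -> forall j, th (Xop b j f) = Xop b j (th f)) ->
  (forall f, N' d f <-> N d f /\ th f = 0) -> (forall f, N d f -> M d' (th f)) ->
  (forall h, M d' h -> exists2 f, N d f & th f = h) ->
  dQ q N d = (dQ q N' d + dQ q M d')%N.
Proof.
move=> Qi dD sN sN' sM tl tg tY tX ker im surj.
have th0 : th 0 = 0 by have := tl (-1) 0 0; rewrite scaler0 add0r scaleN1r addNr.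
have thD : {morph th : f h / f + h} by move=> f h; have := tl 1 f h; rewrite !scale1r.
have thZ c f : th (c *: f) = c *: th f by have := tl c f 0; rewrite th0 !addr0.
have tsum (I : Type) (r : seq I) (P : pred I) (f : I -> F U) : th (\sum_(i <- r | P i) f i) = \sum_(i <- r | P i) th (f i).
  exact: (big_morph th thD th0).
have tpop e i f : N e f -> th (pop b i f) = pop b i (th f).
  case: e => [|e] Nf; last by rewrite /pop (tX e) ?(tY _ _ Nf) //; apply: gsub_Y.
  by rewrite /pop (tX 0%N) ?(tY _ _ Nf) // hom_Y0; [apply: gsub0 | apply: gsub_hom Nf].
have tz e i f : N e f -> th (zop b i f) = zop b i (th f).
  move=> Nf; rewrite /zop thD thZ (tpop e) // tsum; congr (_ + _ *: _).
  by apply: eq_bigr => j _; apply: tg.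
have topoly e A B r f : (forall h, N e h -> N e (A h)) -> (forall h, N e h -> th (A h) = B (th h)) ->
    N e f -> th (opoly A r f) = opoly B r (th f).
  move=> NA tA Nf; rewrite /opoly tsum; apply: eq_bigr => k _; rewrite thZ; congr (_ *: _).
  have : N e (iter k A f) /\ th (iter k A f) = iter k B (th f); last by case.
  by elim: (k : nat) => //= l [Nl El]; split; [apply: NA | rewrite tA // El].
have tQ e f : N e f -> th (Qop q f) = Qop q (th f).
  move=> Nf; have te : th (eop f) = eop (th f).
    by rewrite /eop thZ tsum; congr (_ *: _); apply: eq_bigr => g _; apply: tg.
  rewrite /Qop (topoly e _ (Psym b p)) ?te //; last exact: gsub_eop.
    by move=> h; apply: gsub_Psym.
  move=> h Nh; rewrite /Psym tsum; apply: eq_bigr => i _; apply: (topoly e) => // h'.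
    exact: gsub_zop.
  exact: tz.
pose T : G U d -> G W d' := res d' \o th \o @emb _ _ U d.
have Tl : linear T by move=> c u v; rewrite /T /= linearP tl linearP.
pose TL : {linear G U d -> G W d'} := HB.pack T (GRing.isLinear.Build C (G U d) (G W d') *:%R T Tl).
have TE u : linfun TL u = res d' (th (emb u)) by rewrite lfunE.
pose S := pspace (fun phi : G U d => exists2 f, N d f & emb phi = Qop q f).
have SP u := pspaceP u (dQ_pred q d sN).
have S'P u := pspaceP u (dQ_pred q d sN').
have MP u := pspaceP u (dQ_pred q d' sM).
rewrite {1}/dQ -/S -(limg_ker_dim (linfun TL) S); congr (_ + _)%N; congr (\dim _).
  apply/vspaceP=> u; rewrite memv_cap memv_ker TE.
  apply/andP/idP => [[/SP[f Nf Ef] /eqP r0]|/S'P[f N'f Ef]].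
    apply/S'P; exists (emb u); last by rewrite Ef (Qi _ d) //; apply: gsub_hom Nf.
    have Nu : N d (emb u) by rewrite Ef; apply: gsub_Qop.
    apply/ker; split=> //; rewrite -(emb_res (gsub_hom sM (im _ Nu))) r0; exact: linear0.
  have Nf := proj1 (proj1 (ker f) N'f); have tf := proj2 (proj1 (ker f) N'f).
  split; first by apply/SP; exists f.
  by rewrite Ef (tQ d) // tf Qop0 linear0.
apply/vspaceP=> v; apply/memv_imgP/idP => [[u /SP[f Nf Ef] ->]|/MP[h Mh Eh]].
  rewrite TE Ef (tQ d) //; apply/MP; exists (th f); first exact: im.
  by rewrite emb_res //; apply: (gsub_hom (N := M)) => //; apply: gsub_Qop => //; apply: im.
have [f Nf tf] := surj h Mh; exists (res d (Qop q f)).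
  by apply/SP; exists f; rewrite // emb_res //; apply: (gsub_hom (N := N)) => //; apply: gsub_Qop.
rewrite TE emb_res; last by apply: (gsub_hom (N := N)) => //; apply: gsub_Qop.
by rewrite (tQ d) // tf -Eh res_emb.
Qed.

Inductive Lg U : nat -> F U -> Prop :=
| Lg_const f : hom 0 f -> Lg 0 f
| Lg_0 d : Lg d 0
| Lg_lin d c f h : Lg d f -> Lg d h -> Lg d (c *: f + h)
| Lg_X d j f : Lg d f -> Lg d.+1 (Xop b j f).

End GradedSubmodules.

(** * Symmetrized monomials applied to a lowest invariant *)

Section NormalOrdering.
Variables (K : numClosedFieldType) (n : nat) (b : K) (U : srep K n) (v : F U).
Hypothesis v_inv : forall g, gop g v = v.
Local Notation X := (@Xop K n b U).
Local Notation Y := (@Yop K n U).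
Implicit Types (p q a : mi n) (f h : F U) (g : 'S_n) (i j : 'I_n).

Section Monomials.
Variables (A : 'I_n -> F U -> F U).
Hypothesis AC : forall i j f, A i (A j f) = A j (A i f).
Definition Am p f : F U := foldr (fun i f => iter (p i) (A i) f) f (enum 'I_n).

Lemma iterC i j x f : A i (iter x (A j) f) = iter x (A j) (A i f).
Proof. by elim: x => //= x <-; rewrite AC. Qed.
Lemma Am_seq (s : seq 'I_n) p i f : foldr (fun i f => iter (p i) (A i) f) (A i f) s
  = A i (foldr (fun i f => iter (p i) (A i) f) f s).
Proof. by elim: s => //= j s ->; rewrite iterC. Qed.
Lemma AmA p i f : Am p (A i f) = A i (Am p f). Proof. exact: Am_seq. Qed.
Lemma Am0 f : Am (mzero n) f = f.
Proof. by rewrite /Am; elim: (enum _) => //= i s ->; rewrite ffunE. Qed.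
Lemma Am_minc p i f : Am (minc p i) f = A i (Am p f).
Proof.
have : i \in enum 'I_n by rewrite mem_enum.
have : uniq (enum 'I_n) by rewrite enum_uniq.
rewrite /Am; elim: (enum 'I_n) => //= j s IH /andP[js us]; rewrite inE [X in iter X _ _]ffunE.
have [-> _|ij /= is_] := eqVneq i j.
  rewrite addn1 /=; congr (A j (iter _ _ _)).
  elim: s js {IH us} => //= k s IHs; rewrite inE negb_or => /andP[jk js]; rewrite IHs // ffunE.
  by rewrite eq_sym (negPf jk) addn0.
by rewrite addn0 IH // iterC.
Qed.
Lemma Am_madd p p' f : Am (madd p p') f = Am p (Am p' f).
Proof.
elim/mi_ind: p => [|p i IH]; first by rewrite Am0; congr Am; apply/ffunP=> i; rewrite !ffunE.
have -> : madd (minc p i) p' = minc (madd p p') i by apply/ffunP=> k; rewrite !ffunE addnAC.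
by rewrite !Am_minc IH.
Qed.
End Monomials.

Definition Xm := Am X.
Definition Ym := Am Y.
Lemma Xm0 f : Xm (mzero n) f = f. Proof. exact: Am0. Qed.
Lemma Ym0 f : Ym (mzero n) f = f. Proof. exact: Am0. Qed.
Lemma XmS p i f : Xm (minc p i) f = X i (Xm p f). Proof. by apply: Am_minc => *; apply: XopC. Qed.
Lemma YmS p i f : Ym (minc p i) f = Y i (Ym p f). Proof. by apply: Am_minc => *; apply: YopC. Qed.
Lemma Xm_lin p : linear (Xm p).
Proof. by elim/mi_ind: p => [|p i IH] c f h; rewrite ?Xm0 // !XmS IH linearP. Qed.
Lemma Ym_lin p : linear (Ym p).
Proof. by elim/mi_ind: p => [|p i IH] c f h; rewrite ?Ym0 // !YmS IH linearP. Qed.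
Lemma gXm g p f : gop g (Xm p f) = Xm (mact (g^-1)%g p) (gop g f).
Proof.
elim/mi_ind: p => [|p i IH]; first by rewrite mact0 !Xm0.
by rewrite mact_minc !XmS gopX IH.
Qed.
Lemma gYm g p f : gop g (Ym p f) = Ym (mact (g^-1)%g p) (gop g f).
Proof.
elim/mi_ind: p => [|p i IH]; first by rewrite mact0 !Ym0.
by rewrite mact_minc !YmS gYop IH.
Qed.

Lemma Xm_madd p p' f : Xm (madd p p') f = Xm p (Xm p' f).
Proof. by apply: Am_madd => *; apply: XopC. Qed.

(* Low k l: combinations of the X^p Y^q v of bidegree (k - t, l - t) with t > 0. *)
Inductive Low : nat -> nat -> F U -> Prop :=
| Low_mon p q k l : (mdg p < k)%N -> (mdg p + l = mdg q + k)%N -> Low k l (Xm p (Ym q v))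
| Low_0 k l : Low k l 0
| Low_lin k l c f h : Low k l f -> Low k l h -> Low k l (c *: f + h).

Lemma Low_Z k l c f : Low k l f -> Low k l (c *: f).
Proof. by move=> Lf; rewrite -[c *: f]addr0; apply: Low_lin => //; apply: Low_0. Qed.
Lemma Low_D k l f h : Low k l f -> Low k l h -> Low k l (f + h).
Proof. by move=> Lf Lh; rewrite -[f]scale1r; apply: Low_lin. Qed.
Lemma Low_N k l f : Low k l f -> Low k l (- f).
Proof. by move=> Lf; rewrite -scaleN1r; apply: Low_Z. Qed.
Lemma Low_sum k l (I : Type) (r : seq I) (P : pred I) (f : I -> F U) :
  (forall x, P x -> Low k l (f x)) -> Low k l (\sum_(x <- r | P x) f x).
Proof. by move=> Lf; apply: big_ind => //; [apply: Low_0 | apply: Low_D]. Qed.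

Lemma Low_X k l j f : Low k l f -> Low k.+1 l (X j f).
Proof.
elim=> {k l f} [p q k l pk E|k l|k l c f h _ IHf _ IHh].
- by rewrite -XmS; apply: Low_mon; rewrite mdg_minc; lia.
- by rewrite X0; apply: Low_0.
- by rewrite linearP; apply: Low_lin.
Qed.
Lemma Low_g k l g f : Low k l f -> Low k l (gop g f).
Proof.
elim=> {k l f} [p q k l pk E|k l|k l c f h _ IHf _ IHh].
- by rewrite gXm gYm v_inv; apply: Low_mon; rewrite !mdg_mact.
- by rewrite g0; apply: Low_0.
- by rewrite linearP; apply: Low_lin.
Qed.
Lemma Low_C k l i j f : Low k l f -> Low k l (Cop b i j f).
Proof.
move=> Lf; rewrite CopE; case: ifP => _.
  by apply: Low_D => //; apply: Low_Z; apply: Low_sum => l' _; apply: Low_g.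
by apply/Low_N/Low_Z/Low_g.
Qed.

Lemma Y_mon i p q : Low (mdg p) (mdg q).+1 (Y i (Xm p (Ym q v)) - Xm p (Ym (minc q i) v)).
Proof.
elim/mi_ind: p => [|p j IH].
  by rewrite !Xm0 YmS subrr; apply: Low_0.
rewrite !XmS YX addrAC -XN -XD; apply: Low_D.
  by rewrite mdg_minc; apply: Low_X.
by apply: Low_C; apply: Low_mon; rewrite mdg_minc; lia.
Qed.

Lemma Low_Y k l i f : Low k l f -> Low k l.+1 (Y i f).
Proof.
elim=> {k l f} [p q k l pk E|k l|k l c f h _ IHf _ IHh].
- rewrite -[Y i _](subrK (Xm p (Ym (minc q i) v))); apply: Low_D.
    have := Y_mon i p q.
    have shift k1 l1 k2 l2 f : Low k1 l1 f -> (k1 <= k2)%N -> (k1 + l2 = l1 + k2)%N -> Low k2 l2 f.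
      move=> L; elim: L k2 l2 => {k1 l1 f} [p1 q1 k1 l1 h1 h2|k1 l1|k1 l1 c f h _ IHf _ IHh] k2 l2 le E2.
      - by apply: Low_mon; lia.
      - exact: Low_0.
      - by apply: Low_lin; [apply: IHf | apply: IHh].
    by move=> /shift; apply; lia.
  by apply: Low_mon; rewrite ?mdg_minc; lia.
- by rewrite Y0; apply: Low_0.
- by rewrite linearP; apply: Low_lin.
Qed.

Lemma Low_weak k1 l1 k2 l2 f : Low k1 l1 f -> (k1 <= k2)%N -> (k1 + l2 = l1 + k2)%N -> Low k2 l2 f.
Proof.
move=> L; elim: L k2 l2 => {k1 l1 f} [p1 q1 k1 l1 h1 h2|k1 l1|k1 l1 c f h _ IHf _ IHh] k2 l2 le E2.
- by apply: Low_mon; lia.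
- exact: Low_0.
- by apply: Low_lin; [apply: IHf | apply: IHh].
Qed.

Lemma Low_Xm k l p f : Low k l f -> Low (mdg p + k) l (Xm p f).
Proof.
move=> Lf; elim/mi_ind: p => [|p i IH]; first by rewrite mdg0 Xm0.
by rewrite mdg_minc XmS; apply: Low_X.
Qed.
Lemma Low_Ym k l q f : Low k l f -> Low k (mdg q + l) (Ym q f).
Proof.
move=> Lf; elim/mi_ind: q => [|q i IH]; first by rewrite mdg0 Ym0.
by rewrite mdg_minc YmS; apply: Low_Y.
Qed.

Lemma Ym_mon q' p q : Low (mdg p) (mdg q' + mdg q) (Ym q' (Xm p (Ym q v)) - Xm p (Ym (madd q' q) v)).
Proof.
elim/mi_ind: q' => [|q' i IH].
  rewrite Ym0 (_ : madd _ q = q) ?subrr; last by apply/ffunP=> k; rewrite !ffunE.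
  exact: Low_0.
have -> : madd (minc q' i) q = minc (madd q' q) i by apply/ffunP=> k; rewrite !ffunE addnAC.
rewrite YmS -[Ym q' _](subrK (Xm p (Ym (madd q' q) v))) YD -addrA.
apply: Low_D; first by rewrite mdg_minc addSn; apply: Low_Y.
by have := Y_mon i p (madd q' q); rewrite mdg_madd mdg_minc addSn.
Qed.

Definition msing i x : mi n := [ffun j => if j == i then x else 0%N].
Lemma mdg_msing i x : mdg (msing i x) = x.
Proof.
by rewrite /mdg (bigD1 i) //= ffunE eqxx big1 ?addn0 // => j /negPf ji; rewrite ffunE ji.
Qed.
Lemma msingS i x : msing i x.+1 = minc (msing i x) i.
Proof. by apply/ffunP=> j; rewrite !ffunE; case: eqP; rewrite ?addn1 ?addn0. Qed.

Definition pab x y : F U := \sum_i Xm (msing i x) (Ym (msing i y) v).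

Hypothesis v_low : forall x y, (x < y)%N -> pab x y = 0.
Hypothesis v_eig : forall k, exists c, Psym b 'X^k v = c *: v.

(** Modulo [Low], X_i^x Y_i^x v agrees with z_i^x v, and the sum of the latter over i is a multiple
    of [v]. *)
Lemma paa_eig x : exists c, Low x x (pab x x - c *: v).
Proof.
have [c Pv] := v_eig x; exists c; rewrite -Pv /Psym /pab -sumrB; apply: Low_sum => i _.
rewrite opolyXn -opprB; apply: Low_N.
elim: x {c Pv} => [|x IH] /=.
  have m0 : msing i 0 = mzero n by apply/ffunP=> j; rewrite !ffunE; case: ifP.
  by rewrite m0 Xm0 Ym0 subrr; apply: Low_0.
set u := iter x _ v in IH *; set w := Xm (msing i x) (Ym (msing i x) v) in IH.
have wl : Low x.+1 x.+1 w by apply: Low_mon; rewrite mdg_msing //; lia.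
have -> : zop b i u - Xm (msing i x.+1) (Ym (msing i x.+1) v)
  = zop b i (u - w) + (X i (Y i w - Xm (msing i x) (Ym (msing i x.+1) v))
    + b *: \sum_(j : 'I_n | (i < j)%N) gop (tperm i j) w).
  have zB : zop b i (u - w) = zop b i u - zop b i w by rewrite zopD -[- w]scaleN1r zopZ scaleN1r.
  rewrite (msingS i x) XmS -msingS XD XN zB.
  have zg (V : zmodType) (A0 A B S : V) : A0 - B = A0 - (A + S) + (A - B + S) by rewrite (addrAC A) addrA subrK.
  rewrite [zop b i w]/zop [pop b i w]/pop; exact: zg.
have zl f : Low x x f -> Low x.+1 x.+1 (zop b i f).
  move=> Lf; rewrite /zop; apply: Low_D; first by apply/Low_X/Low_Y.
  by apply: Low_Z; apply: Low_sum => j _; apply: Low_g; apply: Low_weak Lf _ _; lia.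
apply: Low_D; first exact: zl.
apply: Low_D; last by apply: Low_Z; apply: Low_sum => j _; apply: Low_g.
apply: Low_X; rewrite msingS; have := Y_mon i (msing i x) (msing i x); by rewrite mdg_msing.
Qed.

Definition msupp p q := #|[set i | (p i + q i != 0)%N]|.

Definition Kv f := exists c, f = c *: v.
Lemma KvD f h : Kv f -> Kv h -> Kv (f + h).
Proof. by move=> [c ->] [d ->]; exists (c + d); rewrite scalerDl. Qed.
Lemma KvZ (c : K) f : Kv f -> Kv (c *: f).
Proof. by move=> [d ->]; exists (c * d); rewrite scalerA. Qed.
Lemma KvN f : Kv f -> Kv (- f).
Proof. by move=> Kf; rewrite -scaleN1r; apply: KvZ. Qed.
Lemma Kv0 : Kv 0. Proof. by exists 0; rewrite scale0r. Qed.

Lemma eLow t f : (forall p q, (mdg p < t)%N -> mdg p = mdg q -> Kv (eop (Xm p (Ym q v)))) ->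
  Low t t f -> Kv (eop f).
Proof.
move=> IH; suff gen k l f' : Low k l f' -> k = t -> l = t -> Kv (eop f') by move=> Lf; apply: gen Lf _ _.
elim=> {k l f'} [p q k l pk E|k l|k l c f1 h _ IHf _ IHh] kt lt.
- by apply: IH; move: pk E; rewrite kt lt; lia.
- by rewrite eop0; apply: Kv0.
- by rewrite eop_linear; apply: KvD; [apply: KvZ; apply: IHf | apply: IHh].
Qed.

(* The product of the polarized power sums p_{p_i,q_i}, the factor of a pair with
   p_i < q_i acting first and killing v, is a multiple of e X^p Y^q v modulo
   lower total degree and modulo pairs (p, q) of smaller support. *)
Lemma eop_mon_scalar p q : mdg p = mdg q -> Kv (eop (Xm p (Ym q v))).
Proof.
have [t] := ubnP (mdg p); elim: t p q => // t IHt p q; rewrite ltnS leq_eqVlt => /orP[/eqP pt|]; last exact: IHt.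
have {}IHt p' q' : (mdg p' < t)%N -> mdg p' = mdg q' -> Kv (eop (Xm p' (Ym q' v))) by apply: IHt.
have eL f := @eLow t f IHt.
have [s] := ubnP (msupp p q); elim: s p q pt => // s IHs p q pt psu pq.
have [t0|tpos] := posnP t.
  have z a : mdg a = 0%N -> a = mzero n.
    move=> /eqP; rewrite /mdg sum_nat_eq0 => /forallP z; apply/ffunP=> i; rewrite ffunE.
    by apply/eqP; have := z i.
  have p0 : p = mzero n by apply: z; rewrite pt.
  have q0 : q = mzero n by apply: z; rewrite -pq pt.
  by rewrite p0 q0 Xm0 Ym0; exists 1; rewrite eop_id // scale1r.
(* If no pair has p_i < q_i, equality of the total degrees forces p = q, and some common entry is
   positive. *)
have [i0 pi0] : exists i0, (p i0 < q i0)%N \/ (0 < p i0)%N /\ p i0 = q i0.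
  have [i lt|ge] := pickP (fun i => (p i < q i)%N); first by exists i; left.
  have eq_pq i : p i = q i.
    have le j : (q j <= p j)%N by rewrite leqNgt ge.
    apply/eqP; rewrite eqn_leq le andbT; have := pq.
    rewrite /mdg (bigD1 i) //= [in RHS](bigD1 i) //=.
    have : (\sum_(j | j != i) q j <= \sum_(j | j != i) p j)%N by apply: leq_sum.
    by move: (\sum_(j | _) q j)%N (\sum_(j | _) p j)%N => A B; lia.
  have [i ipos|z] := pickP (fun i => (0 < p i)%N).
    by exists i; right.
  move: tpos; rewrite -pt /mdg big1 // => i _; by apply/eqP; rewrite -leqn0 leqNgt z.
pose z0 (x : mi n) : mi n := [ffun j => if j == i0 then 0%N else x j].
have z0D (x : mi n) : madd (z0 x) (msing i0 (x i0)) = x.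
  by apply/ffunP=> j; rewrite !ffunE; case: eqP => [->|_]; rewrite ?add0n ?addn0.
have mz (x : mi n) : (mdg (z0 x) + x i0)%N = mdg x by rewrite -{3}(z0D x) mdg_madd mdg_msing.
(* The pair of exponents at i0 is moved to position i; the sum over i is the leading part of the
   product with a polarized power sum. *)
pose T i := Xm (madd (z0 p) (msing i (p i0))) (Ym (madd (z0 q) (msing i (q i0))) v).
pose Z := Xm (z0 p) (Ym (z0 q) (pab (p i0) (q i0))).
have Xsum (I : Type) (r : seq I) x (h : I -> F U) : Xm x (\sum_(l <- r) h l) = \sum_(l <- r) Xm x (h l).
  by apply: (big_morph (Xm x)) => [f1 f2|]; [have := Xm_lin x 1 f1 f2; rewrite !scale1r | have := Xm_lin x (-1) 0 0; rewrite scaler0 addr0 scaleN1r addNr].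
have Ysum (I : Type) (r : seq I) x (h : I -> F U) : Ym x (\sum_(l <- r) h l) = \sum_(l <- r) Ym x (h l).
  by apply: (big_morph (Ym x)) => [f1 f2|]; [have := Ym_lin x 1 f1 f2; rewrite !scale1r | have := Ym_lin x (-1) 0 0; rewrite scaler0 addr0 scaleN1r addNr].
have ZT : Low t t (Z - \sum_i T i).
  rewrite /Z /pab Ysum Xsum -sumrB; apply: Low_sum => i _.
  rewrite /T Xm_madd.
  have XB x f h : Xm x (f - h) = Xm x f - Xm x h.
    by have := Xm_lin x (-1) h f; rewrite !scaleN1r ![- _ + _]addrC.
  rewrite -XB.
  have := Low_Xm (z0 p) (Ym_mon (z0 q) (msing i (p i0)) (msing i (q i0))).
  by rewrite !mdg_msing !mz -pq pt.
have KZ : Kv (eop Z).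
  case: pi0 => [lt|[ppos pe]].
    rewrite /Z v_low //; have := Ysum _ [::] (z0 q) (fun _ : nat => 0); rewrite !big_nil => ->.
    by have := Xsum _ [::] (z0 p) (fun _ : nat => 0); rewrite !big_nil => ->; rewrite eop0; apply: Kv0.
  have [c Lc] := paa_eig (p i0).
  rewrite /Z -pe -[pab _ _](subrK (c *: v)) addrC Ym_lin Xm_lin eop_linear; apply: KvD.
    by apply/KvZ/IHt; [have := mz p; lia | have := mz p; have := mz q; lia].
  by apply: eL; have := Low_Xm (z0 p) (Low_Ym (z0 q) Lc); rewrite mz pe mz -pq pt.
have KT : Kv (\sum_i eop (T i)).
  have -> : \sum_i eop (T i) = eop Z - eop (Z - \sum_i T i).
    rewrite -scaleN1r addrC -eop_linear scaleN1r opprB addrNK.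
    by rewrite (big_morph _ (@eopD _ _ U) (@eop0 _ _ U)).
  by apply: KvD => //; apply/KvN/eL.
have KvS (P : pred 'I_n) (h : 'I_n -> F U) : (forall i, P i -> Kv (h i)) -> Kv (\sum_(i | P i) h i).
  by move=> Kh; apply: big_ind => //; [apply: Kv0 | apply: KvD].
(* At an unoccupied position, moving the pair only conjugates the original monomial; at an occupied
   one the support shrinks. Position i0 itself is free, so the multiplicity of the original term is
   nonzero. *)
pose free i := (z0 p i + z0 q i == 0)%N.
have nonfree i : ~~ free i -> Kv (eop (T i)).
  rewrite /free => nf; apply: IHs; rewrite ?mdg_madd ?mdg_msing ?mz //.
  rewrite ltnS in psu; apply: leq_trans psu; apply: proper_card; apply/properP; split.
    apply/subsetP=> j; rewrite !inE !ffunE; case: (j =P i0) => [->|_]; last first.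
      by case: (j =P i) => [->|_]; rewrite ?addn0 // => _; move: nf; rewrite !ffunE; case: ifP.
    by rewrite !add0n; case: ifP => // _; rewrite !addn0.
  exists i0; first by rewrite inE; case: pi0; lia.
  have ni : (i0 == i) = false by apply/eqP => E; move: nf; rewrite -E !ffunE eqxx.
  by rewrite inE !ffunE eqxx !add0n ni.
have isfree i : free i -> eop (T i) = eop (Xm p (Ym q v)).
  rewrite /free addn_eq0 => /andP[/eqP fp /eqP fq].
  rewrite -[RHS](eop_g (tperm i i0)) gXm gYm v_inv /T tpermV.
  have sw (x : mi n) : z0 x i = 0%N -> mact (tperm i i0) x = madd (z0 x) (msing i (x i0)).
    rewrite ffunE => E; apply/ffunP=> j; rewrite !ffunE tpermV; case: tpermP => [->|->|/eqP ji /eqP ji0].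
    - by rewrite E eqxx add0n.
    - by rewrite eqxx add0n [i0 == i]eq_sym; move: E; case: eqP => [->|_ ->].
    - by rewrite (negPf ji0) (negPf ji) addn0.
  by rewrite !sw.
have [c E] : Kv (eop (Xm p (Ym q v)) *+ #|free|).
  have -> : eop (Xm p (Ym q v)) *+ #|free| = \sum_i eop (T i) - \sum_(i | ~~ free i) eop (T i).
    by rewrite (bigID free) /= addrK -sumr_const; apply: eq_bigr => i /isfree.
  by apply: KvD => //; apply/KvN/KvS.
have f0 : (#|free|%:R : K) != 0.
  rewrite pnatr_eq0 -lt0n; apply/card_gt0P; exists i0; by rewrite unfold_in /free !ffunE eqxx.
exists (#|free|%:R^-1 * c); by rewrite -scalerA -E -scaler_nat scalerA mulVf // scale1r.
Qed.
End NormalOrdering.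

(** * Composition factors in bounded degree *)

Section JordanHolder.
Variables (C : numClosedFieldType) (n : nat) (b : C).
Implicit Types (U W : srep C n) (d : nat) (g : 'S_n) (k j : 'I_n).
Local Notation Lg := (@Lg C n b).

Lemma Lg_hom U d (f : F U) : Lg d f -> hom d f.
Proof.
elim=> {d f} [f //|d|d c f h _ hf _ hh|d j f _ hf]; first exact: hom0.
  exact: homP.
exact: hom_X.
Qed.
Lemma Lg_Z U d c (f : F U) : Lg d f -> Lg d (c *: f).
Proof. by move=> Lf; rewrite -[c *: f]addr0; apply: Lg_lin => //; apply: Lg_0. Qed.
Lemma Lg_D U d (f h : F U) : Lg d f -> Lg d h -> Lg d (f + h).
Proof. by move=> Lf Lh; rewrite -[f]scale1r; apply: Lg_lin. Qed.
Lemma Lg_sum U d (I : Type) (r : seq I) (P : pred I) (f : I -> F U) :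
  (forall i, P i -> Lg d (f i)) -> Lg d (\sum_(i <- r | P i) f i).
Proof. by move=> Lf; apply: big_ind => //; [apply: Lg_0 | apply: Lg_D]. Qed.
Lemma Lg_g U d g (f : F U) : Lg d f -> Lg d (gop g f).
Proof.
elim=> {d f} [f hf|d|d c f h _ hf _ hh|d j f _ hf].
- by apply: Lg_const; apply: hom_g.
- by rewrite g0; apply: Lg_0.
- by rewrite linearP; apply: Lg_lin.
- by rewrite gopX; apply: Lg_X.
Qed.
Lemma Lg_C U d i j (f : F U) : Lg d f -> Lg d (Cop b i j f).
Proof.
move=> Lf; rewrite CopE; case: ifP => _.
  by apply: Lg_D => //; apply: Lg_Z; apply: Lg_sum => l' _; apply: Lg_g.
by rewrite -scaleNr; apply/Lg_Z/Lg_g.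
Qed.
Lemma Lg_Y U d k (f : F U) : Lg d.+1 f -> Lg d (Yop k f).
Proof.
suff gen e (h : F U) : Lg e h -> (e = 0%N -> Yop k h = 0) /\ (forall d', e = d'.+1 -> Lg d' (Yop k h)).
  by move=> /gen[_]; apply.
elim=> {e h} [h hh|e|e c h1 h2 _ [A1 B1] _ [A2 B2]|e j h Lh [A B]].
- by split=> // _; apply: hom_Y0.
- by split=> [_|d' _]; rewrite Y0 //; apply: Lg_0.
- split=> [e0|d' ed]; first by rewrite linearP /= A1 // A2 // scaler0 addr0.
  by rewrite linearP; apply: Lg_lin; [apply: B1 | apply: B2].
- split=> // d' [<-]; rewrite YX; apply: Lg_D; last exact: Lg_C.
  by case: e A B {Lh} => [|e] A B; [rewrite A // X0; apply: Lg_0 | apply: Lg_X; apply: B].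
Qed.

Lemma gsub_Lg U : gsub b (@Lg U).
Proof.
split=> [d f|d|d g f|d k f|d j f]; [exact: Lg_hom | | exact: Lg_g | exact: Lg_Y | exact: Lg_X].
by split; [apply: Lg_0 | move=> c f h; apply: Lg_lin].
Qed.

Definition cst U (v : U) : F U := fun a => if a == mzero n then v else 0.
Lemma cst_hom U (v : U) : hom 0 (cst v).
Proof. by move=> a ad; rewrite /cst; case: eqP => // E; rewrite E mdg0 eqxx in ad. Qed.
Lemma cst_lin U c (u v : U) : cst (c *: u + v) = c *: cst u + cst v.
Proof. by apply/funext=> a; rewrite FD FZ /cst; case: ifP => _ //; rewrite scaler0 addr0. Qed.
Lemma cst_g U g (v : U) : gop g (cst v) = cst (sact U g v).
Proof.
apply/funext=> a; rewrite gopE /cst; have -> : (mact g a == mzero n) = (a == mzero n).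
  apply/eqP/eqP => [E|->]; last exact: mact0.
  by rewrite -[a]mact1 -(mulgV g) mactM E mact0.
by case: ifP => // _; rewrite linear0.
Qed.
Lemma hom0_cst U (f : F U) : hom 0 f -> f = cst (f (mzero n)).
Proof.
move=> hf; apply/funext=> a; rewrite /cst; case: eqP => [->//|/eqP a0]; apply: hf.
apply: contra_neq a0 => ad; apply/ffunP=> i; rewrite ffunE; move/eqP: ad; rewrite /mdg sum_nat_eq0.
by move=> /forallP/(_ i)/eqP.
Qed.

Lemma gsub_simple W (N : nat -> F W -> Prop) d f : irr W -> gsub b N -> N d f -> f != 0 ->
  forall e h, Lg e h -> N e h.
Proof.
move=> [W0 ir] sN Nf f0.
have [v v0 Nv] : exists2 v : W, v != 0 & N 0%N (cst v).
  elim: d f Nf f0 => [|d IH] f Nf f0.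
    have E := hom0_cst (gsub_hom sN Nf); exists (f (mzero n)); last by rewrite -E.
    by apply: contra_neq f0 => z; rewrite E z; apply/funext=> a; rewrite /cst; case: ifP.
  have [k Yk] : exists k, Yop k f != 0.
    apply: contrapT => no; case/eqP: f0; apply: (Y_detect (gsub_hom sN Nf)) => k.
    by apply/eqP/negPn/negP => Yk; apply: no; exists k.
  by apply: (IH (Yop k f)) => //; apply: (gsub_Y sN).
have lP : linpred (fun u : W => N 0%N (cst u)).
  split; last by move=> a u w Nu Nw; rewrite cst_lin; apply: (gsubP sN).
  rewrite (_ : cst 0 = 0); [exact: (gsub0 sN) | by apply/funext=> a; rewrite /cst; case: ifP].
have SP u := pspaceP u lP; have [|S0|SF] := ir (pspace (fun u : W => N 0%N (cst u))).
- by move=> g u /SP Nu; apply/SP; rewrite -cst_g; apply: (gsub_g sN).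
- by case/eqP: v0; apply/eqP; rewrite -memv0 -S0; apply/SP.
move=> e h; elim=> {e h} [h hh|e|e c h1 h2 _ N1 _ N2|e j h _ Nh].
- by rewrite (hom0_cst hh); apply/SP; rewrite SF memvf.
- exact: (gsub0 sN).
- exact: (gsubP sN).
- exact: (gsub_X sN).
Qed.

Lemma grep_act1 U d (v : G U d) : linfun (@res _ _ U d \o gop 1%g \o @emb _ _ U d) v = v.
Proof. by rewrite lfunE /= gop1 res_emb. Qed.
Lemma grep_actM U d g h (v : G U d) : linfun (@res _ _ U d \o gop (g * h)%g \o @emb _ _ U d) v =
  linfun (@res _ _ U d \o gop g \o @emb _ _ U d) (linfun (@res _ _ U d \o gop h \o @emb _ _ U d) v).
Proof. by rewrite !lfunE /= gopM emb_res //; apply/hom_g/emb_hom. Qed.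
Definition grep U d : srep C n := @SRep C n (G U d) _ (@grep_act1 U d) (@grep_actM U d).
Lemma grepE U d g (v : grep U d) : sact (grep U d) g v = res d (gop g (emb v)).
Proof. by rewrite /= lfunE. Qed.

(** In the lowest degree where N and N' differ, Maschke gives an irreducible [W] in a complement of
    N'. The projection to [W] extends to a map into the costandard module of [W]. It commutes with X
    on N because X sends the degree before d0, where N and N' agree, into N'. *)
Lemma factor U (N N' : nat -> F U -> Prop) d0 : gsub b N -> gsub b N' ->
  (forall d f, N' d f -> N d f) -> (exists2 f, N d0 f & ~ N' d0 f) ->
  (forall d f, (d < d0)%N -> N d f -> N' d f) ->
  exists W : srep C n, irr W /\ exists th : F U -> F W,
   [/\ linear th, forall g f, th (gop g f) = gop g (th f), forall k f, th (Yop k f) = Yop k (th f),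
       forall d f, N d f -> forall j, th (Xop b j f) = Xop b j (th f) &
       [/\ forall d f, N' d f -> th f = 0, forall d f, hom d f -> (d0 <= d)%N -> hom (d - d0) (th f),
           forall d f, hom d f -> (d < d0)%N -> th f = 0 & forall h, hom 0 h -> exists2 f, N d0 f & th f = h]].
Proof.
move=> sN sN' NN [f0 Nf0 nf0] low.
pose GR := grep U d0.
have lin_of (M : nat -> F U -> Prop) : gsub b M -> linpred (fun phi : G U d0 => M d0 (emb phi)).
  by move=> sM; split; [rewrite linear0; apply: (gsub0 sM) | move=> a u v Mu Mv; rewrite linearP; apply: (gsubP sM)].
pose S : {vspace GR} := pspace (fun phi : G U d0 => N d0 (emb phi)).
pose S' : {vspace GR} := pspace (fun phi : G U d0 => N' d0 (emb phi)).
have SP u : u \in S <-> N d0 (emb u) := pspaceP u (lin_of _ sN).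
have S'P u : u \in S' <-> N' d0 (emb u) := pspaceP u (lin_of _ sN').
have stab M (sM : gsub b M) (T : {vspace GR}) : (forall u, u \in T <-> M d0 (emb u)) -> stable T.
  move=> TP g u /TP Mu; apply/TP; rewrite grepE emb_res; first exact: (gsub_g sM).
  by apply/hom_g/emb_hom.
have stS := stab _ sN S SP; have stS' := stab _ sN' S' S'P.
have [P [Pg PS' PId]] := maschke stS'.
pose Cm := (S :&: lker P)%VS.
have stC : stable Cm.
  move=> g u; rewrite !memv_cap !memv_ker => /andP[uS /eqP uP].
  by rewrite stS //= -Pg uP linear0.
have C0 : Cm != 0%VS.
  pose u : GR := res d0 f0; have Eu : emb u = f0 by apply: emb_res; apply: (gsub_hom sN).
  have uS : u \in S by apply/SP; rewrite Eu.
  have nuS' : u \notin S' by apply/negP => /S'P; rewrite Eu.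
  have uPC : u - P u \in Cm.
    rewrite memv_cap memv_ker rpredB //=; last by apply/SP/NN/S'P.
    by rewrite linearB /= [P (P u)]PId ?subrr.
  apply: contraNneq nuS' => E; move: uPC; rewrite E memv0 subr_eq0 => /eqP->; exact: PS'.
have [T [stT T0 TC Tmin]] := minimal_stable stC C0.
pose W := subrep stT; have irW : irr W := subrep_irr stT T0 Tmin.
have [PT [PTg PTT PTId]] := maschke stT.
pose q (u : GR) : W := vsproj T (PT (u - P u)).
have qE u : vsval (q u) = PT (u - P u) by rewrite vsprojK.
have ql : linear q.
  move=> c u v; rewrite /q -linearP; congr (vsproj _ _); rewrite -linearP; congr (PT _).
  by rewrite linearP /= scalerBr opprD addrACA.
have qg g u : q (sact GR g u) = sact W g (q u).
  by apply: val_inj; rewrite [RHS]subrepE [LHS]qE qE -Pg -linearB PTg.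
have q0 : q 0 = 0 by have := ql (-1) 0 0; rewrite scaler0 add0r scaleN1r addNr.
have qS' u : u \in S' -> q u = 0 by move=> uS; rewrite /q PId // subrr !linear0.
pose sh (ga : mi n) (f : F U) : F U := fun a => f (madd a ga).
have shl ga : linear (sh ga) by move=> c f h; apply/funext=> a; rewrite FD FZ.
have sh_hom ga d f : hom d f -> (mdg ga <= d)%N -> hom (d - mdg ga) (sh ga f).
  move=> hf le a ad; apply: hf; rewrite mdg_madd; apply: contra_neq ad => <-; by rewrite addnK.
have sh_hom' ga d f : hom d f -> (d < mdg ga)%N -> sh ga f = 0.
  by move=> hf lt; apply/funext=> a; apply: hf; rewrite mdg_madd gtn_eqF //; lia.
have madd0 a : madd a (mzero n) = a by apply/ffunP=> i; rewrite !ffunE addn0.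
have madd0l a : madd (mzero n) a = a by apply/ffunP=> i; rewrite !ffunE add0n.
(* Coinduction: the coefficient at [ga] is the projection of the degree-d0 part of Y^ga f, and [sh]
   is that iterated shift. *)
pose th (f : F U) : F W := fun ga => q (res d0 (sh ga f)).
have thl : linear th.
  by move=> c f h; apply/funext=> ga; rewrite FD FZ /th shl linearP ql.
have th_deg d f ga : hom d f -> (mdg ga + d0)%N != d -> th f ga = 0.
  move=> hf ne; rewrite /th; have [lt|le] := ltnP d (mdg ga).
    by rewrite (sh_hom' _ _ _ hf lt) linear0 q0.
  suff -> : res d0 (sh ga f) = 0 by rewrite q0.
  apply/ffunP=> x; rewrite !ffunE; apply: (sh_hom _ _ _ hf le); rewrite mdg_tomi.
  by apply: contra_neq ne => ->; rewrite subnKC.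
have thg g f : th (gop g f) = gop g (th f).
  apply/funext=> ga; rewrite gopE /th -qg grepE; congr q.
  apply/ffunP=> x; rewrite !ffunE.
  have E : sact U g (sh (mact g ga) f (mact g (tomi x))) = gop g f (madd (tomi x) ga).
    by rewrite gopE /sh; congr (sact _ _ (f _)); apply/ffunP=> i; rewrite !ffunE.
  rewrite [LHS]/sh /= -E gopE; congr (sact _ _ _).
  have [y yE] : exists y : midx n d0, tomi y = mact g (tomi x) by apply: tomi_onto; rewrite mdg_mact mdg_tomi.
  by rewrite -yE embE ffunE.
have thY k f : th (Yop k f) = Yop k (th f).
  apply/funext=> ga; rewrite YopE /th; congr (q (res _ _)); apply/funext=> a; rewrite /sh YopE; congr f.
  by apply/ffunP=> i; rewrite !ffunE addnA.
have thN' d f : N' d f -> th f = 0.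
  move=> N'f; apply/funext=> ga; have [E|ne] := eqVneq (mdg ga + d0)%N d; last by rewrite (th_deg d) //; apply: (gsub_hom sN').
  rewrite F0 /th; apply: qS'; apply/S'P.
  have shN : forall e (h : F U), N' e h -> e = (mdg ga + d0)%N -> N' d0 (sh ga h).
    elim/mi_ind: ga {E} => [|ga k IH] e h N'h eE.
      move: N'h; rewrite eE mdg0 add0n; suff -> : sh (mzero n) h = h by [].
      by apply/funext=> a; rewrite /sh madd0.
    suff -> : sh (minc ga k) h = sh ga (Yop k h).
      by apply: (IH (mdg ga + d0)%N) => //; apply: (gsub_Y sN'); move: N'h; rewrite eE mdg_minc.
    by apply/funext=> a; rewrite /sh YopE; congr h; apply/ffunP=> i; rewrite !ffunE addnA.
  have Ns := shN d f N'f (esym E); rewrite emb_res //; exact: (gsub_hom sN').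
have thlow d f : hom d f -> (d < d0)%N -> th f = 0.
  by move=> hf lt; apply/funext=> ga; rewrite (th_deg d) //; lia.
exists W; split=> //; exists th; split=> //.
- move=> d f Nf; pose M (h : F U) := exists e, N e h.
  have XM : forall j h, M h -> th (Xop b j h) = Xop b j (th h).
    apply: (Xnat (N := M)) => // [k h [e Ne]|j h [e Ne]].
      case: e Ne => [|e] Ne; last by exists e; apply: (gsub_Y sN).
      by exists 0%N; rewrite hom_Y0; [apply: (gsub0 sN) | apply: (gsub_hom sN)].
    have hX := gsub_hom sN (gsub_X sN j Ne).
    have [E|ne] := eqVneq e.+1 d0; last by rewrite (th_deg e.+1) // mdg0 add0n eq_sym.
    have N'X : N' d0 (Xop b j h) by rewrite -E; apply: (gsub_X sN'); apply: low => //; rewrite -E.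
    by rewrite (thN' d0).
  by move=> j; apply: XM; exists d.
- split=> // [d f hf le ga gd|h hh].
    by rewrite (th_deg d) //; apply: contra_neq gd => <-; rewrite addnK.
  have E := hom0_cst hh; pose u : GR := vsval (h (mzero n) : W).
  have uT : u \in T := subvsP _.
  have uC := subvP TC u uT; move: uC; rewrite memv_cap memv_ker => /andP[/SP uN /eqP Pu].
  exists (emb u) => //; rewrite E; have hom_u := emb_hom u.
  have -> : th (emb u) = cst (th (emb u) (mzero n)).
    apply: hom0_cst => ga gd; rewrite (th_deg d0) //; apply: contra_neq gd; lia.
  congr cst; rewrite /th; have -> : sh (mzero n) (emb u) = emb u by apply/funext=> a; rewrite /sh madd0.
  by rewrite res_emb; apply: val_inj; rewrite [LHS]qE Pu subr0 PTId.
Qed.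

Definition dmN U (N : nat -> F U -> Prop) d := \dim (pspace (fun phi : G U d => N d (emb phi))).

Lemma dmN_pred U (N : nat -> F U -> Prop) d : gsub b N -> linpred (fun phi : G U d => N d (emb phi)).
Proof.
by move=> sM; split; [rewrite linear0; apply: (gsub0 sM) | move=> a u v Mu Mv; rewrite linearP; apply: (gsubP sM)].
Qed.

Lemma dmN_le U (N N' : nat -> F U -> Prop) d : gsub b N -> gsub b N' -> (forall f, N' d f -> N d f) ->
  (dmN N' d <= dmN N d)%N.
Proof.
move=> sN sN' NN; apply: dimvS; apply/subvP=> u /(pspaceP _ (dmN_pred d sN')) N'u.
by apply/(pspaceP _ (dmN_pred d sN)); apply: NN.
Qed.

Lemma dmN_lt U (N N' : nat -> F U -> Prop) d f : gsub b N -> gsub b N' -> (forall f, N' d f -> N d f) ->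
  N d f -> ~ N' d f -> (dmN N' d < dmN N d)%N.
Proof.
move=> sN sN' NN Nf nf; rewrite ltn_neqAle dmN_le // andbT; apply/negP => /eqP E; apply: nf.
have sub : (pspace (fun phi : G U d => N' d (emb phi)) <= pspace (fun phi : G U d => N d (emb phi)))%VS.
  by apply/subvP=> u /(pspaceP _ (dmN_pred d sN')) N'u; apply/(pspaceP _ (dmN_pred d sN)); apply: NN.
have /eqP Es : pspace (fun phi : G U d => N' d (emb phi)) == pspace (fun phi : G U d => N d (emb phi)).
  by rewrite eqEdim sub /=; move: E; rewrite /dmN => ->.
have hf := gsub_hom sN Nf; have : res d f \in pspace (fun phi : G U d => N d (emb phi)).
  by apply/(pspaceP _ (dmN_pred d sN)); rewrite emb_res.
by rewrite -Es => /(pspaceP _ (dmN_pred d sN')); rewrite emb_res.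
Qed.

Definition factor_of U (N N' : nat -> F U -> Prop) D (x : nat * srep C n) :=
  [/\ irr x.2, (x.1 <= D)%N, (exists2 f, N x.1 f & ~ N' x.1 f) &
    forall ka ka', (forall v : U, csum U v = ka *: v) -> (forall v : x.2, csum x.2 v = ka' *: v) ->
    x.1%:R + b * ka = b * ka'].

Variable p : {poly C}.
Local Notation dQ := (dQ b p).


(** The factor found by [factor] sits in the middle: the preimage N1 of [Lg] and the kernel N2 of
    [th] give N, N1, N2, N' in decreasing order with N1/N2 a shifted [Lg]. Both outer steps have a
    smaller total dimension in degrees up to D. The relation in [factor_of] compares the Euler
    element at the lowest vectors. *)
Theorem JH D U (N N' : nat -> F U -> Prop) : gsub b N -> gsub b N' -> (forall d f, N' d f -> N d f) ->
  exists s : seq (nat * srep C n), List.Forall (factor_of N N' D) s /\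
    forall q d, Qidem n b p q D -> (d <= D)%N ->
      dQ q N d = (dQ q N' d + \sum_(x <- s | (x.1 <= d)%N) dQ q (@Lg x.2) (d - x.1))%N.
Proof.
have [m] := ubnP (\sum_(d < D.+1) (dmN N d - dmN N' d))%N; elim: m N N' => // m IH N N' mN sN sN' NN.
have [[d [dD [f Nf nf]]]|same] := pselect (exists d, (d <= D)%N /\ exists2 f, N d f & ~ N' d f); last first.
  exists [::]; split=> // q d _ dD; rewrite big_nil addn0; congr (\dim (pspace _)); apply/funext=> phi.
  apply/propext; split=> -[f Nf E]; exists f => //; last exact: NN.
  by apply: contrapT => nf; apply: same; exists d; split=> //; exists f.
pose bad d := `[< exists2 f, N d f & ~ N' d f >].
have exb : exists d, bad d by exists d; apply/asboolP; exists f.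
have [d0 /asboolP [f0 Nf0 nf0] d0min] := ex_minnP exb.
have d0D : (d0 <= D)%N by apply: leq_trans dD; apply: d0min; apply/asboolP; exists f.
have low e h : (e < d0)%N -> N e h -> N' e h.
  move=> lt Nh; apply: contrapT => nh; have : bad e by apply/asboolP; exists h.
  by move=> /d0min; rewrite leqNgt lt.
have [W [irW [th [tl tg tY tX [tN' thom tlow tsurj]]]]] := factor sN sN' NN (ex_intro2 _ _ f0 Nf0 nf0) low.
have th0 : th 0 = 0 by have := tl (-1) 0 0; rewrite scaler0 add0r scaleN1r addNr.
have thD : {morph th : f h / f + h} by move=> x y; have := tl 1 x y; rewrite !scale1r.
have thZ c x : th (c *: x) = c *: th x by have := tl c x 0; rewrite th0 !addr0.
pose N2 e h := N e h /\ th h = 0.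
pose N1 e h := N e h /\ Lg (e - d0) (th h).
have sN2 : gsub b N2.
  split=> [e h [Nh _]|e|e g h [Nh h0]|e k h [Nh h0]|e j h [Nh h0]].
  - exact: (gsub_hom sN).
  - split; first by split; [apply: (gsub0 sN)|].
    by move=> c x y [Nx x0] [Ny y0]; split; [apply: (gsubP sN) | rewrite tl x0 y0 scaler0 addr0].
  - by split; [apply: (gsub_g sN) | rewrite tg h0 g0].
  - by split; [apply: (gsub_Y sN) | rewrite tY h0 Y0].
  - by split; [apply: (gsub_X sN) | rewrite (tX e) // h0 X0].
have sL := @gsub_Lg W.
have sN1 : gsub b N1.
  split=> [e h [Nh _]|e|e g h [Nh Lh]|e k h [Nh Lh]|e j h [Nh Lh]].
  - exact: (gsub_hom sN).
  - split; first by split; [apply: (gsub0 sN) | rewrite th0; apply: Lg_0].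
    by move=> c x y [Nx x0] [Ny y0]; split; [apply: (gsubP sN) | rewrite tl; apply: Lg_lin].
  - by split; [apply: (gsub_g sN) | rewrite tg; apply: Lg_g].
  - have NY := gsub_Y sN k Nh; split=> //; have [lt|le] := ltnP e d0.
      by rewrite (tlow e) //; [apply: Lg_0 | apply: (gsub_hom sN)].
    by rewrite tY; apply: Lg_Y; rewrite -subSn.
  - have NX := gsub_X sN j Nh; split=> //; have [lt|le] := ltnP e d0.
      have Xh : th (Xop b j h) = 0.
        by rewrite (tX e) // (tlow e) ?X0 //; apply: (gsub_hom sN).
      by rewrite Xh; apply: Lg_0.
    by rewrite (tX e) // subSn //; apply: Lg_X.
have NN2 e h : N' e h -> N2 e h by move=> N'h; split; [apply: NN | apply: (tN' e)].
have N21 e h : N2 e h -> N1 e h by move=> [Nh h0]; split=> //; rewrite h0; apply: Lg_0.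
have N1N e h : N1 e h -> N e h by case.
have W0 : exists2 w : W, w != 0 & True.
  have [WF _] := irW; exists (vpick (fullv : {vspace W})) => //; by rewrite vpick0.
have [w w0 _] := W0.
have [fw Nfw tfw] := tsurj (cst w) (cst_hom w).
have lt12 : (dmN N2 d0 < dmN N1 d0)%N.
  apply: (@dmN_lt _ _ _ _ fw) => //; first exact: N21.
    by split=> //; rewrite tfw subnn; apply/Lg_const/cst_hom.
  move=> [_]; rewrite tfw => /(congr1 (fun u : F W => u (mzero n))); rewrite /cst eqxx => /eqP.
  by rewrite (negPf w0).
have le1 e := @dmN_le _ N N1 e sN sN1 (N1N e).
have le2 e := @dmN_le _ N1 N2 e sN1 sN2 (N21 e).
have le3 e := @dmN_le _ N2 N' e sN2 sN' (NN2 e).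
have sum_lt (x y : nat -> nat) : (forall e, (x e <= y e)%N) -> (x d0 < y d0)%N -> (\sum_(e < D.+1) x e < \sum_(e < D.+1) y e)%N.
  move=> xy lt; have d0D' : (d0 < D.+1)%N by rewrite ltnS.
  rewrite (bigD1 (Ordinal d0D')) //= [in X in (_ < X)%N](bigD1 (Ordinal d0D')) //= -addSn.
  by apply: leq_add => //; apply: leq_sum => e _.
have [|s1 [F1 H1]] := IH N N1 _ sN sN1 N1N.
  apply: leq_trans (_ : \sum_(e < D.+1) (dmN N e - dmN N' e) <= m)%N; last by rewrite -ltnS.
  apply: (sum_lt (fun e => dmN N e - dmN N1 e)%N (fun e => dmN N e - dmN N' e)%N) => [e|]; first by have := le1 e; have := le2 e; have := le3 e; lia.
  by have := le1 d0; have := le2 d0; have := le3 d0; lia.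
have [|s2 [F2 H2]] := IH N2 N' _ sN2 sN' NN2.
  apply: leq_trans (_ : \sum_(e < D.+1) (dmN N e - dmN N' e) <= m)%N; last by rewrite -ltnS.
  apply: (sum_lt (fun e => dmN N2 e - dmN N' e)%N (fun e => dmN N e - dmN N' e)%N) => [e|]; first by have := le1 e; have := le2 e; have := le3 e; lia.
  by have := le1 d0; have := le2 d0; have := le3 d0; lia.
exists (s1 ++ (d0, W) :: s2); split.
  apply/List.Forall_app; split.
    apply: List.Forall_impl F1 => x [x1 x2 [h Nh nh] x4]; split=> //; exists h => // N'h; apply: nh.
    by apply/N21/NN2.
  constructor.
    split=> //=; first by exists f0.
    move=> ka ka' kaU kaW.
    have Lw : th (Psym b 'X fw) = (d0%:R + b * ka) *: cst w.
      rewrite -tfw -thZ; congr th; apply/funext=> a; rewrite Euler FZ kaU scalerA -scalerDl.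
      have [->//|ad] := eqVneq (mdg a) d0; by rewrite (gsub_hom sN Nfw) // !scaler0.
    have Rw : th (Psym b 'X fw) = Psym b 'X (cst w).
      have tsum (I : Type) (r : seq I) (P : pred I) (x : I -> F U) : th (\sum_(i <- r | P i) x i) = \sum_(i <- r | P i) th (x i).
        exact: (big_morph th thD th0).
      have E V (x : F V) i : opoly (zop b i) 'X x = zop b i x by rewrite -[X in opoly _ X]expr1 opolyXn.
      rewrite /Psym tsum; apply: eq_bigr => i _; rewrite !E /zop thD thZ tsum; congr (_ + _ *: _).
        rewrite /pop; case: d0 Nfw {nf0 Nf0 low d0min d0D thom tlow tsurj N1 N2 sN1 sN2 NN2 N21 N1N lt12 le1 le2 le3 sum_lt s1 F1 H1 s2 F2 H2 tN' Lw} => [|e] Nfw.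
          by rewrite -tfw -tY hom_Y0 ?X0 ?th0 ?X0 //; apply: (gsub_hom sN).
        by rewrite (tX e) ?tY ?tfw //; apply: (gsub_Y sN).
      by apply: eq_bigr => j _; rewrite tg tfw.
    have := congr1 (fun u : F W => u (mzero n)) (etrans (esym Lw) Rw).
    rewrite Euler FZ mdg0 scale0r add0r /cst eqxx kaW scalerA => /eqP.
    by rewrite -subr_eq0 -scalerBl scaler_eq0 (negPf w0) orbF subr_eq0 => /eqP.
  apply: List.Forall_impl F2 => x [x1 x2 [h Nh nh] x4]; split=> //; exists h => //.
  by apply/N1N/N21.
move=> q e Qi eD; rewrite (H1 q e Qi eD).
have -> : dQ q N1 e = (dQ q N2 e + (if (d0 <= e)%N then dQ q (@Lg W) (e - d0) else 0))%N.
  have tX' e' h : N1 e' h -> forall j, th (Xop b j h) = Xop b j (th h) by case=> Nh _; apply: (tX e').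
  case: leqP => [le|lt].
    apply: (@dQ_exact _ _ b p q D U W N1 N2 (@Lg W) th) => // [h|h [//]|h Lh].
    - split=> [N2h|[[Nh _] h0]]; last by [].
      by split; [apply: N21 | case: N2h].
    - have : forall l h, Lg l h -> exists2 x, N (l + d0)%N x & th x = h.
        move=> l h'; elim=> {l h'} [h' hh'|l|l c x y _ [x' Nx' <-] _ [y' Ny' <-]|l j x _ [x' Nx' <-]].
        + exact: tsurj.
        + by exists 0; [apply: (gsub0 sN)|].
        + by exists (c *: x' + y'); [apply: (gsubP sN) | rewrite tl].
        + by exists (Xop b j x'); [apply: (gsub_X sN) | rewrite (tX (l + d0)%N)].
      move=> /(_ _ _ Lh)[x Nx Ex]; rewrite subnK // in Nx.
      by exists x => //; split=> //; rewrite Ex.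
  rewrite addn0; congr (\dim (pspace _)); apply/funext=> phi; apply/propext; split=> -[h Nh E]; exists h => //; last exact: N21.
  case: Nh => Nh _; split=> //; apply: (tlow e) => //; exact: (gsub_hom sN).
rewrite (H2 q e Qi eD) big_cat big_cons /=; case: ifP => _; lia.
Qed.

End JordanHolder.

(** * Spherical eigenvalues *)

Section SortedIndices.
Variable n : nat.
Implicit Types (a : mi n) (g : 'S_n) (i j k l : 'I_n).

Definition incrb a := [forall i : 'I_n, forall j : 'I_n, (i <= j)%N ==> (a i <= a j)%N].
Lemma incrP a : reflect (mincr a) (incrb a).
Proof.
apply: (iffP forallP) => [H i j ij|H i]; first by have /forallP/(_ j)/implyP := H i; apply.
by apply/forallP => j; apply/implyP; apply: H.
Qed.

Definition tup a : n.-tuple nat := [tuple a i | i < n].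
Lemma incr_sorted a : mincr a -> sorted leq (tup a).
Proof.
move=> ainc; apply/(sortedP 0%N) => i; rewrite size_tuple => lt.
have lt' : (i < n)%N by apply: ltn_trans lt.
have := ainc (Ordinal lt') (Ordinal lt) (leqnSn i).
by rewrite -(tnth_nth 0%N (tup a) (Ordinal lt')) -(tnth_nth 0%N (tup a) (Ordinal lt)) !tnth_mktuple.
Qed.

Lemma perm_orbit a g : perm_eq (tup (mact g a)) (tup a).
Proof.
apply/tuple_permP; exists (g^-1)%g; congr tval; apply: eq_from_tnth => i.
by rewrite !tnth_mktuple ffunE.
Qed.

Lemma incr_uniq a g : mincr a -> mincr (mact g a) -> mact g a = a.
Proof.
move=> a1 a2; have E := sorted_eq leq_trans anti_leq (incr_sorted a2) (incr_sorted a1) (perm_orbit a g).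
apply/ffunP=> i; have := congr1 (fun t : n.-tuple nat => tnth t i) (val_inj E).
by rewrite !tnth_mktuple.
Qed.

Lemma incr_ex a : exists g, mincr (mact g a).
Proof.
pose s := sort leq (tup a).
have ss : size s == n by rewrite size_sort size_tuple.
have /tuple_permP[h Eh] : perm_eq (Tuple ss) (tup a) by rewrite /= perm_sort.
have srt : sorted leq s := sort_sorted leq_total (tup a).
exists (h^-1)%g => i j ij; rewrite !ffunE invgK.
have E k : a (h k) = nth 0%N s k.
  by have := tnth_nth 0%N (Tuple ss) k; rewrite /= => <-; rewrite (val_inj Eh : Tuple ss = _) !tnth_mktuple.
rewrite !E; apply: (sorted_leq_nth leq_trans leqnn) => //; rewrite inE (eqP ss); exact: ltn_ord.
Qed.

Lemma downset (D : {set 'I_n}) l : (forall i j, (i <= j)%N -> j \in D -> i \in D) -> (l \in D) = (l < #|D|)%N.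
Proof.
move=> dn; have cle (k : nat) : (k <= n)%N -> #|[set i : 'I_n | (i < k)%N]| = k.
  move=> kn; rewrite -sum1dep_card -(big_ord_widen _ (fun=> 1%N)) // sum_nat_const card_ord muln1 //.
apply/idP/idP => [lD|lt].
  rewrite -[X in (X <= _)%N](cle l.+1) //; apply: subset_leq_card; apply/subsetP=> i; rewrite inE ltnS => il.
  exact: dn lD.
apply: contraLR lt => nlD; rewrite -leqNgt -[X in (_ <= X)%N](cle l (ltnW (ltn_ord l))); apply: subset_leq_card.
apply/subsetP=> i iD; rewrite inE ltnNge; apply: contra nlD => li; exact: dn iD.
Qed.

(** The longest element of the Young subgroup: in the block with ends [lo] and [hi] it sends l to lo
    + hi - l - 1. *)
Lemma block_rev a : mincr a -> exists u : 'S_n, mact u a = a /\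
  forall i l, (u l < u i)%N = (a l < a i)%N || (i < l)%N && (a l == a i).
Proof.
move=> ainc; pose lo x := #|[set l : 'I_n | (a l < x)%N]|; pose hi x := #|[set l : 'I_n | (a l <= x)%N]|.
have loP x l : (a l < x)%N = (l < lo x)%N.
  by rewrite /lo -downset ?inE // => i j ij; rewrite !inE; apply: leq_ltn_trans; apply: ainc.
have hiP x l : (a l <= x)%N = (l < hi x)%N.
  by rewrite /hi -downset ?inE // => i j ij; rewrite !inE; apply: leq_trans; apply: ainc.
have in_blk l : (lo (a l) <= l < hi (a l))%N by rewrite leqNgt -loP ltnn -hiP leqnn.
have hin x : (hi x <= n)%N by rewrite /hi -[X in (_ <= X)%N](card_ord n); apply: max_card.
pose v l := (lo (a l) + hi (a l) - l.+1)%N.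
have vlt l : (v l < n)%N by rewrite /v; have := in_blk l; have := hin (a l); lia.
pose f l := Ordinal (vlt l).
have af l : a (f l) = a l.
  have h1 : (a (f l) <= a l)%N by rewrite hiP /= /v; have := in_blk l; lia.
  have h2 : ~~ (a (f l) < a l)%N by rewrite loP /= /v; have := in_blk l; lia.
  by apply/eqP; rewrite eqn_leq h1 leqNgt.
have fK : involutive f by move=> l; apply: val_inj; rewrite /= /v af /= /v; have := in_blk l; lia.
exists (perm (can_inj fK)); split=> [|i l].
  apply/ffunP=> i; rewrite ffunE -{2}[(i)](permKV (perm (can_inj fK))) [in RHS]permE af //.
rewrite !permE /=; have [E|ne] := eqVneq (a l) (a i).
  by rewrite E ltnn /= /v E; have := in_blk l; have := in_blk i; rewrite E; lia.
rewrite andbF orbF; apply/idP/idP => [lt|lt].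
  by rewrite ltn_neqAle ne -af -[a i]af; apply: ainc; apply: ltnW.
by rewrite ltnNge; apply: contraL lt => le; rewrite -leqNgt -af -[a l]af; apply: ainc.
Qed.
End SortedIndices.

(** * Leading coefficients of invariants *)

Section Leading.
Variables (C : numClosedFieldType) (n : nat) (b : C) (U : srep C n).
Implicit Types (v : U) (f : F U) (g : 'S_n) (i j l : 'I_n) (a : mi n) (p q : {poly C}) (d k : nat).

Lemma opoly_intertwine (V V' : lmodType C) (A : V -> V) (B : V' -> V') (T : V -> V') p (v : V) : linear T -> (forall u, T (A u) = B (T u)) ->
  T (opoly A p v) = opoly B p (T v).
Proof.
move=> Tl TA; have T0 : T 0 = 0 by have := Tl (-1) 0 0; rewrite scaler0 add0r scaleN1r addNr.
have TD : {morph T : x y / x + y} by move=> x y; have := Tl 1 x y; rewrite !scale1r.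
have TZ c x : T (c *: x) = c *: T x by have := Tl c x 0; rewrite T0 !addr0.
rewrite /opoly (big_morph T TD T0); apply: eq_bigr => k _; rewrite TZ; congr (_ *: _).
by elim: (k : nat) => //= m IH; rewrite TA IH.
Qed.

(* Reversing each block of equal entries turns Aop into the Jucys-Murphy elements. *)
Lemma Aop_sum a p v : mincr a -> v \in VS U a ->
  \sum_i opoly (fun v => (a i)%:R *: v + b *: Aop a i v) p v = Dop U a b p v.
Proof.
move=> ainc vV; have [u [ua uP]] := block_rev ainc.
have fx : sact U u v = v by move/VSP: vV; apply.
have auv i : a (u i) = a i by apply: mact_stab.
apply: etrans (_ : sact U u (Dop U a b p v) = _); last by rewrite g_Dop // fx.
rewrite DopE linear_sum [RHS](reindex_inj (@perm_inj _ u)) /=; apply: eq_bigr => i _.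
rewrite (@opoly_intertwine _ _ _ (fun v => (a i)%:R *: v + b *: Aop a i v)) ?fx //; first exact: linearP.
move=> x; rewrite ZcE linearD !linearZ /= auv; congr (_ + _ *: _).
rewrite JME linear_sum [LHS](reindex_inj (@perm_inj _ u)) /= /Aop.
rewrite (bigID (fun l => (a l < a i)%N)) /=; congr (_ + _).
  apply: eq_big => [l|l _]; first by rewrite uP; case: ltngtP; rewrite ?andbF.
  by rewrite sact_tperm !permK.
apply: eq_big => [l|l _]; first by rewrite uP; case: ltngtP; rewrite ?andbF ?andbT.
by rewrite sact_tperm !permK.
Qed.

Definition inv (f : F U) := forall g, gop g f = f.

Lemma inv_VS f a : inv f -> f a \in VS U a.
Proof. by move=> fi; apply/VSP => g ga; rewrite -{2}(fi g) gopE ga. Qed.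

Lemma inv_orbit f a g : inv f -> f (mact g a) = 0 -> f a = 0.
Proof. by move=> fi E; rewrite -(fi g) gopE E linear0. Qed.

Lemma inv_Psym p f : inv f -> inv (Psym b p f).
Proof. by move=> fi g; rewrite gPsym fi. Qed.

Lemma opoly_inv p q f : inv f -> inv (opoly (Psym b p) q f).
Proof.
move=> fi g; rewrite (opoly_comm (B := gop g)) ?fi //; first exact: gop_is_linear.
by move=> u; apply: gPsym.
Qed.

Lemma lead_Psym p f a d : mincr a -> mdg a = d -> inv f -> vanish d (msq a) f ->
  Psym b p f a = Dop U a b p (f a).
Proof.
by move=> ainc ad fi van; rewrite (@Psym_leading C n b U d (msq a) p f a van ad) // Aop_sum //; apply: inv_VS.
Qed.

Lemma lead_opoly p q f a d : mincr a -> mdg a = d -> inv f -> vanish d (msq a) f ->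
  opoly (Psym b p) q f a = lpoly (Dop U a b p) q (f a).
Proof.
move=> ainc ad fi van; rewrite lpolyE /opoly fsumE; apply: eq_bigr => k _; rewrite FZ; congr (_ *: _).
have : [/\ inv (iter k (Psym b p) f), vanish d (msq a) (iter k (Psym b p) f) &
  iter k (Psym b p) f a = iter k (Dop U a b p) (f a)]; last by case.
elim: (k : nat) => //= m [I V E]; split; [exact: inv_Psym | exact: Psym_vanish |].
by rewrite (lead_Psym p ainc ad) // E.
Qed.

Lemma vanish_incr d k f : inv f -> (forall x : midx n d, mincr (tomi x) -> (msq (tomi x) < k)%N -> f (tomi x) = 0) ->
  vanish d k f.
Proof.
move=> fi H a ad ak; have [g ga] := incr_ex a; apply: (inv_orbit (g := g)) => //.
have [x xE] : exists x : midx n d, tomi x = mact g a by apply: tomi_onto; rewrite mdg_mact.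
by rewrite -xE; apply: H; rewrite xE ?msq_mact.
Qed.
End Leading.

(** Here [T x] is the space of possible values at [x] once all earlier coordinates vanish; rank and
    nullity of the evaluation at the head of [s] give the induction. *)
Lemma filt_dim (C : fieldType) (I : finType) (V : vectType C) (s : seq I) (T : I -> {vspace V}) (S : {vspace {ffun I -> V}}) :
  (forall s1 x s2, s = s1 ++ x :: s2 ->
    (forall phi, phi \in S -> (forall y, y \in s1 -> phi y = 0) -> phi x \in T x) /\
    (forall t, t \in T x -> exists phi, [/\ phi \in S, forall y, y \in s1 -> phi y = 0 & phi x = t])) ->
  (forall phi, phi \in S -> (forall y, y \in s -> phi y = 0) -> phi = 0) ->
  \dim S = \sum_(x <- s) \dim (T x).
Proof.
elim: s S => [|x s IH] S H1 H2.
  rewrite big_nil; apply/eqP; rewrite dimv_eq0 -subv0; apply/subvP=> phi /H2 -> //; exact: mem0v.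
pose e (phi : {ffun I -> V}) := phi x.
have el : linear e by move=> c u v; rewrite /e !ffunE.
pose E : {linear {ffun I -> V} -> V} := HB.pack e (GRing.isLinear.Build C {ffun I -> V} V *:%R e el).
have EE phi : linfun E phi = phi x by rewrite lfunE.
rewrite big_cons -(limg_ker_dim (linfun E) S) addnC; congr (_ + _)%N.
  congr (\dim _); apply/eqP; rewrite eqEsubv; have [A B] := H1 [::] x s erefl.
  apply/andP; split; apply/subvP=> v; first by move=> /memv_imgP[phi phiS ->]; rewrite EE; apply: A.
  by move=> /B[phi [phiS _ <-]]; rewrite -EE; apply: memv_img.
apply: IH => [s1 y s2 E'|phi]; last first.
  rewrite memv_cap memv_ker EE => /andP[phiS /eqP phix] phis; apply: H2 => // y; rewrite inE => /orP[/eqP->//|]; exact: phis.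
have [A B] := H1 (x :: s1) y s2 (congr1 (cons x) E'); split=> [phi|t /B[phi [phiS phi0 phiy]]].
  rewrite memv_cap memv_ker EE => /andP[phiS /eqP phix] phis; apply: A => // z; rewrite inE => /orP[/eqP->//|]; exact: phis.
exists phi; split=> // [|z zs]; last by apply: phi0; rewrite inE zs orbT.
by rewrite memv_cap memv_ker EE phiS phi0 ?inE eqxx.
Qed.

(** * Spherical multiplicities of the whole costandard module *)

Section Counting.
Variables (C : numClosedFieldType) (n : nat) (b : C) (p : {poly C}).
Implicit Types (U : srep C n) (d D : nat) (om : C) (q : {poly C}).

Definition qsel D om q := [/\ Qidem n b p q D, q.[om] = 1 &
  forall d (x : midx n d) (t : wtT n), (d <= D)%N -> q.[chi (tomi x) b p (wd t)] = (chi (tomi x) b p (wd t) == om)%:R].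

(** Bezout for the power of X - om and that of the other factors. Idempotency holds modulo a power
    of the product, since the operators may have Jordan blocks. *)
Lemma sep_idem (s : seq C) om M : uniq s -> exists q : {poly C}, [/\ q.[om] = 1,
  forall z, z \in s -> q.[z] = (z == om)%:R &
  exists h, q * q - q = h * (\prod_(z <- s) ('X - z%:P)) ^+ M.+1].
Proof.
move=> us; pose A := ('X - om%:P) ^+ M.+1; pose B := (\prod_(z <- s | z != om) ('X - z%:P)) ^+ M.+1.
have cop : coprimep A B.
  apply: coprimep_expl; apply: coprimep_expr; rewrite coprimep_sym; elim/big_ind: _ => [|u v cu cv|z zom]; first exact: coprime1p.
    by rewrite coprimepMl cu.
  by rewrite coprimep_XsubC root_XsubC eq_sym.
have /Bezout_eq1_coprimepP[[u v] /= E] := cop.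
have A0 : A.[om] = 0 by rewrite /A horner_exp !hornerE subrr expr0n.
have E1 : (v * B).[om] = 1.
  by have := congr1 (fun r : {poly C} => r.[om]) E; rewrite hornerD [(u * A).[om]]hornerM A0 mulr0 add0r hornerC.
have EB : v * B * (v * B) - v * B = - (u * v) * (A * B).
  have E3 : v * B - 1 = - (u * A) by rewrite -E; ring.
  by transitivity (v * B * (v * B - 1)); [ring | rewrite E3; ring].
exists (v * B); split.
- exact: E1.
- move=> z zs; have [->|zom] := eqVneq z om; first by rewrite E1.
  rewrite /B hornerM horner_exp (big_rem z) //= zom hornerM !hornerE subrr mul0r expr0n mulr0 //.
- have [ins|nins] := boolP (om \in s).
    exists (- (u * v)); rewrite (bigD1_seq om) //= exprMn -/A -/B.
    exact: EB.
  exists (- (u * v) * A); have -> : \prod_(z <- s) ('X - z%:P) = \prod_(z <- s | z != om) ('X - z%:P).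
    rewrite [RHS]big_mkcond /=; apply: eq_big_seq => z zs; case: eqP => // zo; by rewrite -zo zs in nins.
  by rewrite -/B EB mulrA.
Qed.

Definition spec D : seq C := undup (flatten [seq [seq chi (tomi x) b p (wd t) | x <- enum [set: midx n d], t <- enum [set: wtT n]] | d <- iota 0 D.+1]).

Lemma spec_mem D d (x : midx n d) (t : wtT n) : (d <= D)%N -> chi (tomi x) b p (wd t) \in spec D.
Proof.
move=> dD; rewrite /spec mem_undup; apply/flatten_mapP; exists d; first by rewrite mem_iota.
by apply/allpairsP; exists (x, t); rewrite !mem_enum !inE.
Qed.

(** Each application of the product over the spectrum kills the leading coefficients and raises the
    filtration by one. As [msq] is at most d^2, hence at most D^2 in degree d, the exponent D^2 + 1
    suffices. *)
Lemma spec_kill U D d (f : F U) : (d <= D)%N -> hom d f -> inv f ->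
  opoly (Psym b p) ((\prod_(z <- spec D) ('X - z%:P)) ^+ (D * D).+1) f = 0.
Proof.
move=> dD hf fi; set R := \prod_(z <- _) _.
have Rl q : linear (opoly (Psym b p) q : F U -> F U) by apply: opoly_is_linear; apply: Psym_linear.
have step k (h : F U) : inv h -> vanish d k h -> vanish d k.+1 (opoly (Psym b p) R h).
  move=> hi van; apply: vanish_incr => [|x xinc xk]; first exact: opoly_inv.
  have van' : vanish d (msq (tomi x)) h by move=> a ad ak; apply: van => //; apply: leq_trans ak _.
  rewrite (lead_opoly b _ _ xinc (mdg_tomi x)) //.
  have : h (tomi x) \in (\sum_(t : wtT n) Ew U (wd t))%VS by rewrite Ew_sum memvf.
  move=> /memv_sumP[w wE ->]; rewrite linear_sum big1 // => t _.
  apply: etrans (lpoly_eigen _ (Dop_eigen _ _ _ (wE t isT))) _.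
  by rewrite /R horner_prod (big_rem _ (spec_mem x t dD)) /= !hornerE subrr mul0r scale0r.
have H k : inv (opoly (Psym b p) (R ^+ k) f) /\ vanish d k (opoly (Psym b p) (R ^+ k) f).
  elim: k => [|k [I V]]; first by rewrite expr0 -polyC1 opolyC scale1r; split=> // a _ /ltn0.
  by rewrite exprS opolyM; [split; [apply: opoly_inv | apply: step] | apply: Psym_linear].
apply/funext=> a; have [ad|ad] := eqVneq (mdg a) d.
  have [_ ->] // := H (D * D).+1; rewrite ltnS /msq; apply: leq_trans (_ : mdg a * mdg a <= _)%N; last first.
    by rewrite ad; apply: leq_mul.
  rewrite {1}/mdg big_distrl /=; apply: leq_sum => i _; apply: leq_mul => //.
  by rewrite /mdg (bigD1 i) //= leq_addr.
have hP (h : F U) : hom d h -> hom d (opoly (Psym b p) (R ^+ (D * D).+1) h).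
  move=> hh; apply: (gsub_opoly (N := @hom C n U)) => //; first exact: (gsub_full b U).
  by move=> h'; apply: (gsub_Psym (gsub_full b U)).
by rewrite (hP f hf).
Qed.

Lemma qsel_ex D om : exists q, qsel D om q.
Proof.
have [q [q1 qs [h E]]] := sep_idem om (D * D) (undup_uniq (flatten [seq [seq chi (tomi x) b p (wd t) | x <- enum [set: midx n d], t <- enum [set: wtT n]] | d <- iota 0 D.+1])).
exists q; split=> // [U d f dD hf|d x t dD]; last by apply: qs; apply: spec_mem.
have Pl := @Psym_linear _ _ b U p.
have ei : inv (eop f) by move=> g; apply: g_eop.
have eh : hom d (eop f) by apply: (gsub_eop (gsub_full b U)).
rewrite /Qop (@eop_id _ _ U (opoly _ _ _)); last by apply: opoly_inv.
rewrite -opolyM // -[q * q](subrK q) opolyD E opolyM // (spec_kill dD) //.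
suff -> : opoly (Psym b p) h (0 : F U) = 0 by rewrite add0r.
by have := opoly_is_linear h Pl (-1) 0 0; rewrite scaler0 add0r scaleN1r addNr.
Qed.

(* An invariant eigenvector of lowest msq-support reads off its eigenvalues. *)
Lemma inv_eigen U d (f : F U) : hom d f -> inv f -> f != 0 ->
  exists2 x : midx n d, mincr (tomi x) & [/\ f (tomi x) != 0, f (tomi x) \in VS U (tomi x) &
    forall p', Psym b p' f (tomi x) = Dop U (tomi x) b p' (f (tomi x))].
Proof.
move=> hf fi f0.
have ex : exists k, [exists x : midx n d, incrb (tomi x) && (f (tomi x) != 0) && (msq (tomi x) == k)].
  apply: contrapT => no; case/eqP: f0; apply/funext=> a; have [ad|ad] := eqVneq (mdg a) d; last exact: hf.
  apply: (vanish_incr (d := d) (k := (msq a).+1)) => // x xinc _; apply: contrapT => /eqP fx; apply: no.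
  by exists (msq (tomi x)); apply/existsP; exists x; rewrite fx eqxx !andbT; apply/incrP.
have [k /existsP[x /andP[/andP[/incrP xinc fx] /eqP xk]] kmin] := ex_minnP ex.
exists x => //; split=> // [|p']; first exact: inv_VS.
apply: (lead_Psym b p' xinc (mdg_tomi x)) => //; apply: vanish_incr => // y yinc; rewrite xk => yk.
apply/eqP; apply: contraTT yk => fy; rewrite -leqNgt; apply: kmin; apply/existsP; exists y.
by rewrite fy eqxx !andbT; apply/incrP.
Qed.

Definition wcount U d om : nat := \sum_(x : midx n d | incrb (tomi x))
  \sum_(t : wtT n | bsorted (tomi x) (wd t) && (chi (tomi x) b p (wd t) == om)) wdim U (wd t).

Lemma Qop_inv q U (f : F U) : inv f -> Qop b p q f = opoly (Psym b p) q f.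
Proof. by move=> fi; rewrite /Qop eop_id. Qed.

(** An invariant is determined by its values at increasing indices. Ordered by [msq], their leading
    values under the projector fill the images computed in [dimVS]. *)
Lemma dQ_full D om q U d : qsel D om q -> (d <= D)%N -> dQ b p q (@hom C n U) d = wcount U d om.
Proof.
move=> [Qi _ qE] dD; have sF := gsub_full b U.
pose J := [seq x <- index_enum (midx n d) | incrb (tomi x)].
pose s := sort (fun x y : midx n d => (msq (tomi x) <= msq (tomi y))%N) J.
have tot : total (fun x y : midx n d => (msq (tomi x) <= msq (tomi y))%N) by move=> x y; apply: leq_total.
have trn : transitive (fun x y : midx n d => (msq (tomi x) <= msq (tomi y))%N) by move=> y x z; apply: leq_trans.
have ss : sorted (fun x y : midx n d => (msq (tomi x) <= msq (tomi y))%N) s by apply: sort_sorted.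
have us : uniq s by rewrite sort_uniq filter_uniq // index_enum_uniq.
have ms x : x \in s = incrb (tomi x) by rewrite mem_sort mem_filter mem_index_enum andbT.
have SP u := pspaceP u (dQ_pred p q d sF).
pose T (x : midx n d) := (lpoly (Dop U (tomi x) b p) q @: VS U (tomi x))%VS.
apply: etrans (_ : \sum_(x <- s) \dim (T x) = _)%N; last first.
  rewrite (perm_big _ (permEl (perm_sort _ _))) big_filter /=.
  apply: eq_big => [//|x xinc]; rewrite /T (@dimVS _ _ _ _ _ _ _ om) //; first exact/incrP.
  by move=> t _ _; apply: qE.
apply: filt_dim => [s1 x s2 E|phi /SP[f hf Ef] phi0]; last first.
  apply/ffunP=> x; rewrite ffunE -embE Ef.
  have [g ga] := incr_ex (tomi x); apply: (inv_orbit (g := g)) => [g'|]; first exact: g_Qop.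
  have [y yE] : exists y : midx n d, tomi y = mact g (tomi x) by apply: tomi_onto; rewrite mdg_mact mdg_tomi.
  by rewrite -yE -Ef embE; apply: phi0; rewrite ms yE; apply/incrP.
have xs : x \in s by rewrite E mem_cat inE eqxx orbT.
have xinc : mincr (tomi x) by apply/incrP; rewrite -ms.
have small y : mincr (tomi y) -> (msq (tomi y) < msq (tomi x))%N -> y \in s1.
  move=> yinc lt; have : y \in s by rewrite ms; apply/incrP.
  rewrite E mem_cat inE => /orP[//|/orP[/eqP yx|ys2]]; first by rewrite yx ltnn in lt.
  have := ss; rewrite E => /(subseq_sorted trn (suffix_subseq _ _)) /= /(order_path_min trn)/allP/(_ _ ys2).
  by rewrite leqNgt lt.
have big y : y \in s1 -> (msq (tomi y) <= msq (tomi x))%N.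
  move=> ys1; have := ss; rewrite E sorted_pairwise // pairwise_cat => /andP[/allrelP H _].
  by apply: H => //; rewrite inE eqxx.
have vS f : inv f -> (forall y, y \in s1 -> f (tomi y) = 0) -> vanish d (msq (tomi x)) f.
  by move=> fi f0; apply: vanish_incr => // y yinc lt; apply: f0; apply: small.
split=> [phi /SP[f hf Ef] phi0|t /memv_imgP[v vV ->]].
  have hi : inv (Qop b p q f) by move=> g; apply: g_Qop.
  rewrite -embE Ef -(Qi U d f dD hf) (Qop_inv _ hi) (lead_opoly b p q xinc (mdg_tomi x)) //.
    by apply: memv_img; apply: inv_VS.
  by apply: vS => // y ys1; rewrite -Ef embE; apply: phi0.
(* A delta function at x, symmetrized and divided by the order [N] of the stabilizer, is an
   invariant with leading value [v]. *)
pose f : F U := fun a => if a == tomi x then v else 0.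
have hf : hom d f.
  by move=> a ad; rewrite /f; case: eqP => // E'; rewrite E' mdg_tomi eqxx in ad.
have ef a : eop f a = (n`!%:R)^-1 *: \sum_(g : 'S_n | mact g a == tomi x) sact U g v.
  rewrite /eop FZ fsumE [in RHS]big_mkcond; congr (_ *: _); apply: eq_bigr => g _.
  by rewrite gopE /f; case: ifP => _ //; rewrite linear0.
have ef0 a : (forall g, mact g a != tomi x) -> eop f a = 0.
  by move=> H; rewrite ef big_pred0 ?scaler0 // => g; apply/negbTE.
pose N := #|[pred g : 'S_n | mact g (tomi x) == tomi x]|.
have efx : eop f (tomi x) = (n`!%:R)^-1 *: (N%:R *: v).
  rewrite ef; congr (_ *: _); rewrite scaler_nat -sumr_const; apply: eq_bigr => g /eqP gx; by move/VSP: vV; apply.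
have N0 : (N%:R : C) != 0.
  by rewrite pnatr_eq0 -lt0n; apply/card_gt0P; exists 1%g; rewrite inE mact1.
have nf0 : (n`!%:R : C) != 0 by rewrite pnatr_eq0 -lt0n fact_gt0.
pose h : F U := (N%:R^-1 * n`!%:R) *: eop f.
have hh : hom d h by apply: homZ; apply: (gsub_eop sF).
have hi : inv h by move=> g; rewrite /h gZ g_eop.
have sc : N%:R^-1 * n`!%:R * (n`!%:R^-1 * N%:R) = 1 :> C by rewrite -mulrA (mulrA n`!%:R) mulfV // mul1r mulVf.
have hx : h (tomi x) = v by rewrite /h FZ efx [n`!%:R^-1 *: _]scalerA scalerA sc scale1r.
have hs1 y : y \in s1 -> h (tomi y) = 0.
  move=> ys1; rewrite /h FZ ef0 ?scaler0 // => g; apply/negP => /eqP gE.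
  have yinc : mincr (tomi y) by apply/incrP; rewrite -ms E mem_cat ys1.
  have yx : y = x by apply: (@tomi_inj n d); rewrite -gE incr_uniq // gE.
  by move: us; rewrite E cat_uniq => /and3P[_ /hasPn/(_ x)]; rewrite inE eqxx -yx ys1 => /(_ isT).
have vh : vanish d (msq (tomi x)) h by apply: vS.
exists (res d (Qop b p q h)); split.
- by apply/SP; exists h => //; rewrite emb_res //; apply: (gsub_Qop p q sF).
- move=> y ys1; rewrite ffunE (Qop_inv _ hi).
  have yinc : mincr (tomi y) by apply/incrP; rewrite -ms E mem_cat ys1.
  rewrite (lead_opoly b p q yinc (mdg_tomi y)) // ?hs1 ?linear0 //.
  by move=> a ad ak; apply: vh => //; apply: leq_trans ak (big y ys1).
- by rewrite ffunE (Qop_inv _ hi) (lead_opoly b p q xinc (mdg_tomi x)) // hx.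
Qed.
End Counting.

Section Span.
Variables (K : numClosedFieldType) (n : nat) (b : K) (U : srep K n) (v : F U) (d0 : nat).
Hypothesis v_inv : inv v.
Local Notation Xm := (@Xm K n b U).
Local Notation Ym := (@Ym K n U).
Implicit Types (f h : F U) (d e : nat) (p q : mi n).

(** The graded submodule generated by [v] in degree [d0]; invariance of [v] makes the normally
    ordered monomials suffice. *)
Inductive Sp : nat -> F U -> Prop :=
| Sp_mon p q e : (mdg p + d0 = mdg q + e)%N -> Sp e (Xm p (Ym q v))
| Sp_0 e : Sp e 0
| Sp_lin e c f h : Sp e f -> Sp e h -> Sp e (c *: f + h).

Lemma Sp_D e f h : Sp e f -> Sp e h -> Sp e (f + h).
Proof. by move=> sf sh; rewrite -[f]scale1r; apply: Sp_lin. Qed.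
Lemma Sp_self : Sp d0 v.
Proof. by rewrite -(Ym0 v) -(Xm0 b (Ym _ v)); apply: Sp_mon. Qed.
Lemma Sp_X e j f : Sp e f -> Sp e.+1 (Xop b j f).
Proof.
elim=> {e f} [p q e E|e|e c f h _ IHf _ IHh].
- by rewrite -XmS; apply: Sp_mon; rewrite mdg_minc addSn E addnS.
- by rewrite X0; apply: Sp_0.
- by rewrite linearP; apply: Sp_lin.
Qed.
Lemma Sp_g e g f : Sp e f -> Sp e (gop g f).
Proof.
elim=> {e f} [p q e E|e|e c f h _ IHf _ IHh].
- by rewrite gXm gYm v_inv; apply: Sp_mon; rewrite !mdg_mact.
- by rewrite g0; apply: Sp_0.
- by rewrite linearP; apply: Sp_lin.
Qed.
Lemma Low_Sp k l e f : Low b v k l f -> (k + d0 = l + e)%N -> Sp e f.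
Proof.
move=> L; elim: L e => {k l f} [p q k l pk E|k l|k l c f h _ IHf _ IHh] e El.
- by apply: Sp_mon; lia.
- exact: Sp_0.
- by apply: Sp_lin; [apply: IHf | apply: IHh].
Qed.
Lemma Sp_Y e k f : Sp e.+1 f -> Sp e (Yop k f).
Proof.
move=> sf; suff gen e' h : Sp e' h -> forall e, e' = e.+1 -> Sp e (Yop k h) by apply: gen sf _ _.
elim=> {e f e' h sf} [p q e E|e|e c f h _ IHf _ IHh] e' Ee.
- rewrite -[Yop k _](subrK (Xm p (Ym (minc q k) v))); apply: Sp_D.
    by apply: Low_Sp (Y_mon b v_inv k p q) _; lia.
  by apply: Sp_mon; rewrite mdg_minc; lia.
- by rewrite Y0; apply: Sp_0.
- by rewrite linearP; apply: Sp_lin; [apply: IHf | apply: IHh].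
Qed.

Hypothesis v_low : forall x y : nat, (x < y)%N -> pab b v x y = 0.
Hypothesis v_eig : forall k : nat, exists c, Psym b 'X^k v = c *: v.

Lemma Sp_scalar f : Sp d0 f -> Kv v (eop f).
Proof.
move=> sf; suff gen e h : Sp e h -> e = d0 -> Kv v (eop h) by apply: gen sf _.
elim=> {sf f e h} [p q e E|e|e c f h _ IHf _ IHh] Ee.
- by apply: eop_mon_scalar => //; lia.
- by rewrite eop0; apply: Kv0.
- by rewrite eop_linear; apply: KvD; [apply: KvZ; apply: IHf | apply: IHh].
Qed.
End Span.

Section Ladders.
Variables (K : numClosedFieldType) (n : nat) (b : K) (U : srep K n).
Implicit Types (f h : F U) (d e : nat) (p q : mi n).

Lemma gsub_Xm N d p f : gsub b N -> N d f -> N (mdg p + d)%N (Xm b p f).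
Proof.
move=> sN Nf; elim/mi_ind: p => [|p i IH]; first by rewrite mdg0 Xm0.
by rewrite mdg_minc XmS; apply: (gsub_X sN).
Qed.
Lemma gsub_Ym N d q f : gsub b N -> N (mdg q + d)%N f -> N d (Ym q f).
Proof.
move=> sN; elim/mi_ind: q d => [|q i IH] d; first by rewrite mdg0 Ym0.
by rewrite mdg_minc YmS addSnnS => /IH Nq; apply: (gsub_Y sN).
Qed.
Lemma hom_Ym0 d q f : hom d f -> (d < mdg q)%N -> Ym q f = 0.
Proof.
move=> hf; elim/mi_ind: q => [|q i IH]; first by rewrite mdg0.
rewrite mdg_minc YmS ltnS leq_eqVlt => /orP[/eqP E|/IH->]; last by rewrite Y0.
apply: hom_Y0; apply: (gsub_Ym (gsub_full b U)); by rewrite addn0 -E.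
Qed.
Lemma Ym_detect d f : hom d f -> f != 0 -> exists2 q, mdg q = d & Ym q f != 0.
Proof.
elim: d f => [|d IH] f hf f0; first by exists (mzero n); rewrite ?mdg0 ?Ym0.
have [k Yk] : exists k, Yop k f != 0.
  apply: contrapT => no; case/eqP: f0; apply: (Y_detect hf) => k.
  by apply/eqP/negPn/negP => Yk; apply: no; exists k.
have [q qd Yq] := IH _ (hom_Y k hf) Yk; exists (minc q k); first by rewrite mdg_minc qd.
by rewrite YmS; have <- : Ym q (Yop k f) = Yop k (Ym q f) by apply: AmA => *; apply: YopC.
Qed.

(** In a nonzero subspace of invariants of least dimension stable under all [Psym b p], every
    eigenspace of one of these commuting operators is the whole subspace, so each of them is a
    scalar there. *)
Lemma joint_eig N d f : gsub b N -> N d f -> inv f -> f != 0 ->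
  exists h, [/\ N d h, inv h, h != 0 & forall p : {poly K}, exists c, Psym b p h = c *: h].
Proof.
move=> sN Nf fi f0; have hN x : N d x -> hom d x by apply: (gsub_hom sN).
pose PS (x : G U d) := N d (emb x) /\ inv (emb x).
have PSl : linpred PS.
  split; first by rewrite /PS linear0; split; [apply: (gsub0 sN) | move=> g; apply: g0].
  move=> c x y [Nx ix] [Ny iy]; rewrite /PS linearP; split; first exact: (gsubP sN).
  by move=> g; rewrite gD gZ ix iy.
have SP x := pspaceP x PSl; set S := pspace PS in SP.
pose T (p : {poly K}) (x : G U d) := res d (Psym b p (emb x)).
have Tl (p : {poly K}) : linear (T p).
  by move=> c x y; rewrite /T linearP (Psym_linear b p) linearP.
pose TL (p : {poly K}) : {linear G U d -> G U d} := HB.pack (T p) (GRing.isLinear.Build K (G U d) (G U d) *:%R (T p) (Tl p)).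
have TE (p : {poly K}) x : linfun (TL p) x = T p x by rewrite lfunE.
have embT (p : {poly K}) x : hom d (emb x) -> emb (T p x) = Psym b p (emb x).
  by move=> hx; apply/emb_res/(gsub_Psym (gsub_full b U)).
have stS (p : {poly K}) x : x \in S -> linfun (TL p) x \in S.
  move=> /SP[Nx ix]; apply/SP; rewrite /PS TE embT; last exact: hN.
  by split; [apply: (gsub_Psym sN) | apply: inv_Psym].
have ex : exists k, `[< exists W : {vspace G U d}, [/\ (W <= S)%VS, W != 0%VS, forall (p : {poly K}) x, x \in W -> linfun (TL p) x \in W & \dim W = k] >].
  exists (\dim S); apply/asboolP; exists S; split=> //; apply/eqP => S0.
  have : res d f \in S by apply/SP; rewrite /PS emb_res //; apply: hN.
  rewrite S0 memv0 => /eqP r0; case/eqP: f0; by rewrite -(emb_res (hN _ Nf)) r0 linear0.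
have [k /asboolP[W [WS W0 stW Wk]] kmin] := ex_minnP ex.
pose x := vpick W; have xW : x \in W by apply: memv_pick.
have xS : x \in S by apply: (subvP WS).
have [Nx ix] : PS x by apply/SP.
exists (emb x); split=> //.
  apply: contra_neq W0 => x0; apply/eqP; rewrite -vpick0 -/x; by rewrite -[x]res_emb x0 linear0.
move=> p; have AW : (linfun (TL p) @: W <= W)%VS by apply/subvP=> _ /memv_imgP[y yW ->]; apply: stW.
have [y yW [y0 [c yc]]] := eigen_in W0 AW.
pose V := (W :&: lker (linfun (TL p) - c *: \1%VF))%VS.
have VP z : z \in V -> z \in W /\ linfun (TL p) z = c *: z by rewrite memv_cap mem_eig => /andP[zW /eqP].
have V0 : V != 0%VS.
  apply: contraNneq y0 => V0; have : y \in V by rewrite memv_cap mem_eig yW yc eqxx.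
  by rewrite V0 memv0.
have VW : (V <= W)%VS by apply: capvSl.
have stV (p' : {poly K}) z : z \in V -> linfun (TL p') z \in V.
  move=> /VP[zW zc]; rewrite memv_cap mem_eig stW //=.
  have /SP[Nz _] := subvP WS _ zW; have hz := hN _ Nz.
  rewrite !TE in zc *; rewrite /T embT // PsymC -embT // zc; apply/eqP.
  have E2 : T p' (c *: z) = c *: T p' z by rewrite -!TE linearZ.
  exact: E2.
have /eqP E : V == W.
  rewrite eqEdim VW /= Wk; apply: kmin; apply/asboolP; exists V; split=> //; exact: subv_trans VW WS.
have [_ xc] : x \in W /\ linfun (TL p) x = c *: x by apply: VP; rewrite E.
have E2 : T p x = c *: x by rewrite -TE.
by exists c; rewrite -embT ?E2 ?linearZ //; apply: hN.
Qed.
End Ladders.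

(** * Direct sums of two modules *)

Section ProductRep.
Variables (K : numClosedFieldType) (n : nat) (b : K) (U W : srep K n).
Implicit Types (g : 'S_n).

Let pact g (x : sU U * sU W) : sU U * sU W := (sact U g x.1, sact W g x.2).
Fact pact_linear g : linear (pact g).
Proof. by move=> c x y; rewrite /pact /= !linearP. Qed.
HB.instance Definition _ g := GRing.isLinear.Build K (sU U * sU W)%type (sU U * sU W)%type *:%R (pact g) (pact_linear g).
Fact pact1 x : linfun (pact 1%g) x = x.
Proof. by rewrite lfunE /= /pact !sact1; case: x. Qed.
Fact pactM g h x : linfun (pact (g * h)%g) x = linfun (pact g) (linfun (pact h) x).
Proof. by rewrite !lfunE /= /pact !sactM. Qed.
Definition prs : srep K n := SRep pact1 pactM.
Lemma prsE g (x : prs) : sact prs g x = (sact U g x.1, sact W g x.2).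
Proof. by rewrite /= lfunE. Qed.

Definition pr1 (f : F prs) : F U := fun a => (f a).1.
Definition pr2 (f : F prs) : F W := fun a => (f a).2.
Definition fpair (f : F U) (h : F W) : F prs := fun a => (f a, h a).

Lemma pr1_lin : linear pr1. Proof. by move=> c f h; apply/funext=> a; rewrite FD FZ. Qed.
Lemma pr2_lin : linear pr2. Proof. by move=> c f h; apply/funext=> a; rewrite FD FZ. Qed.
HB.instance Definition _ := GRing.isLinear.Build K (F prs) (F U) *:%R pr1 pr1_lin.
HB.instance Definition _ := GRing.isLinear.Build K (F prs) (F W) *:%R pr2 pr2_lin.
Lemma pr1_g g f : pr1 (gop g f) = gop g (pr1 f).
Proof. by apply/funext=> a; rewrite /pr1 !gopE prsE. Qed.
Lemma pr2_g g f : pr2 (gop g f) = gop g (pr2 f).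
Proof. by apply/funext=> a; rewrite /pr2 !gopE prsE. Qed.
Lemma pr1_Y k f : pr1 (Yop k f) = Yop k (pr1 f).
Proof. by apply/funext=> a; rewrite /pr1 !YopE. Qed.
Lemma pr2_Y k f : pr2 (Yop k f) = Yop k (pr2 f).
Proof. by apply/funext=> a; rewrite /pr2 !YopE. Qed.
Lemma pr1_X j f : pr1 (Xop b j f) = Xop b j (pr1 f).
Proof.
apply: (@Xnat _ _ b prs U (fun=> True) pr1 pr1_lin pr1_Y pr1_g) => // i h _.
by rewrite /pr1 Xop0.
Qed.
Lemma pr2_X j f : pr2 (Xop b j f) = Xop b j (pr2 f).
Proof.
apply: (@Xnat _ _ b prs W (fun=> True) pr2 pr2_lin pr2_Y pr2_g) => // i h _.
by rewrite /pr2 Xop0.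
Qed.
Lemma pr_inj f h : pr1 f = pr1 h -> pr2 f = pr2 h -> f = h.
Proof.
move=> E1 E2; apply/funext=> a; have := congr1 (fun u : F U => u a) E1; have := congr1 (fun u : F W => u a) E2.
by rewrite /pr1 /pr2; case: (f a) (h a) => x y [z t] /= -> ->.
Qed.
Lemma pr1_Xm p f : pr1 (Xm b p f) = Xm b p (pr1 f).
Proof. by elim/mi_ind: p => [|p i IH]; rewrite ?Xm0 // !XmS pr1_X IH. Qed.
Lemma pr2_Xm p f : pr2 (Xm b p f) = Xm b p (pr2 f).
Proof. by elim/mi_ind: p => [|p i IH]; rewrite ?Xm0 // !XmS pr2_X IH. Qed.
Lemma pr1_Ym p f : pr1 (Ym p f) = Ym p (pr1 f).
Proof. by elim/mi_ind: p => [|p i IH]; rewrite ?Ym0 // !YmS pr1_Y IH. Qed.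
Lemma pr2_Ym p f : pr2 (Ym p f) = Ym p (pr2 f).
Proof. by elim/mi_ind: p => [|p i IH]; rewrite ?Ym0 // !YmS pr2_Y IH. Qed.
Lemma pr1_zop i f : pr1 (zop b i f) = zop b i (pr1 f).
Proof. by rewrite /zop /pop linearD linearZ /= pr1_X pr1_Y linear_sum; congr (_ + _ *: _); apply: eq_bigr => j _; apply: pr1_g. Qed.
Lemma pr2_zop i f : pr2 (zop b i f) = zop b i (pr2 f).
Proof. by rewrite /zop /pop linearD linearZ /= pr2_X pr2_Y linear_sum; congr (_ + _ *: _); apply: eq_bigr => j _; apply: pr2_g. Qed.
Lemma pr1_Psym p f : pr1 (Psym b p f) = Psym b p (pr1 f).
Proof. by rewrite /Psym linear_sum; apply: eq_bigr => i _; refine (opoly_intertwine p f pr1_lin (pr1_zop i)). Qed.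
Lemma pr2_Psym p f : pr2 (Psym b p f) = Psym b p (pr2 f).
Proof. by rewrite /Psym linear_sum; apply: eq_bigr => i _; refine (opoly_intertwine p f pr2_lin (pr2_zop i)). Qed.
Lemma pr1_eop f : pr1 (eop f) = eop (pr1 f).
Proof. by rewrite /eop linearZ linear_sum; congr (_ *: _); apply: eq_bigr => g _; apply: pr1_g. Qed.
Lemma pr2_eop f : pr2 (eop f) = eop (pr2 f).
Proof. by rewrite /eop linearZ linear_sum; congr (_ *: _); apply: eq_bigr => g _; apply: pr2_g. Qed.
Lemma pr1_pab f x y : pr1 (pab b f x y) = pab b (pr1 f) x y.
Proof. by rewrite /pab linear_sum; apply: eq_bigr => i _; rewrite /= pr1_Xm pr1_Ym. Qed.
Lemma pr2_pab f x y : pr2 (pab b f x y) = pab b (pr2 f) x y.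
Proof. by rewrite /pab linear_sum; apply: eq_bigr => i _; rewrite /= pr2_Xm pr2_Ym. Qed.
Lemma inv_fpair f h : inv f -> inv h -> inv (fpair f h).
Proof. by move=> fi hi g; apply: pr_inj; rewrite ?pr1_g ?pr2_g; [apply: fi | apply: hi]. Qed.
End ProductRep.

(** * Invariants of lowest degree and their eigenvalues *)

Section LowestInvariants.
Variables (K : numClosedFieldType) (n : nat) (b : K).
Implicit Types (U W : srep K n) (d e : nat).

Definition lowest U d (f : F U) := [/\ Lg b d f, inv f, f != 0,
  forall p, exists c, Psym b p f = c *: f & forall e h, (e < d)%N -> Lg b e h -> inv h -> h = 0 :> F U].

Lemma lowest_ex U e (f : F U) : Lg b e f -> inv f -> f != 0 -> exists d (h : F U), (d <= e)%N /\ lowest d h.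
Proof.
move=> Lf fi f0; pose good d := `[< exists h : F U, [/\ Lg b d h, inv h & h != 0] >].
have ex : exists d, good d by exists e; apply/asboolP; exists f.
have [d /asboolP[h [Lh hi h0]] dmin] := ex_minnP ex.
have [h' [Lh' hi' h0' eig]] := joint_eig (gsub_Lg b U) Lh hi h0.
exists d, h'; split; first by apply: dmin; apply/asboolP; exists f.
split=> // e' x lt Lx xi; apply/eqP/negPn/negP => x0.
have : good e' by apply/asboolP; exists x.
by move=> /dmin; rewrite leqNgt lt.
Qed.

Lemma pab_inv U (f : F U) x y : inv f -> inv (pab b f x y).
Proof.
move=> fi g; rewrite /pab linear_sum [RHS](reindex_perm (g^-1)%g) /=; apply: eq_bigr => i _.
have ms z : mact (g^-1)%g (msing i z) = msing ((g^-1)%g i) z.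
  by apply/ffunP=> j; rewrite !ffunE invgK -(inj_eq (@perm_inj _ (g^-1)%g) (g j)) permK.
by rewrite gXm gYm fi !ms.
Qed.

(** For x < y this is an invariant of smaller degree, so minimality kills it; normal ordering takes
    this as the hypothesis [v_low]. *)
Lemma lowest_pab U d (f : F U) x y : lowest d f -> (x < y)%N -> pab b f x y = 0.
Proof.
move=> [Lf fi f0 eig low] xy; have [yd|dy] := leqP y d; last first.
  rewrite /pab big1 // => i _; rewrite (hom_Ym0 b (Lg_hom Lf)) ?mdg_msing //.
  by have := Xm_lin b (msing i x) (-1) (0 : F U) 0; rewrite scaler0 addr0 scaleN1r addNr.
apply: (low (x + (d - y))%N); [lia | | exact: pab_inv].
apply: Lg_sum => i _; rewrite -{1}(mdg_msing i x); apply: (gsub_Xm _ (gsub_Lg b U)).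
by apply: (gsub_Ym (gsub_Lg b U)); rewrite mdg_msing subnKC.
Qed.

Lemma gsub_Sp U d (f : F U) : inv f -> hom d f -> gsub b (Sp b f d).
Proof.
move=> fi hf; split=> [e h|e|e g h|e k h|e j h].
- elim=> {e h} [p q e E|e|e c x y _ hx _ hy]; [|exact: hom0 | exact: homP].
  have [le|lt] := leqP (mdg q) d.
    have -> : e = (mdg p + (d - mdg q))%N by lia.
    by apply: (gsub_Xm p (gsub_full b U)); apply: (gsub_Ym (gsub_full b U)); rewrite subnKC.
  rewrite (hom_Ym0 b hf lt) (_ : Xm b p 0 = 0) //.
  by have := Xm_lin b p (-1) (0 : F U) 0; rewrite scaler0 addr0 scaleN1r addNr.
- by split; [apply: Sp_0 | move=> c x y; apply: Sp_lin].
- exact: Sp_g.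
- exact: Sp_Y.
- exact: Sp_X.
Qed.

Lemma lowest_Sp U d (f : F U) e h : irr U -> lowest d f -> Lg b e h -> Sp b f d e h.
Proof.
move=> iU [Lf fi f0 eig low]; have hf := Lg_hom Lf.
by apply: (gsub_simple iU (gsub_Sp fi hf) (Sp_self b f d) f0).
Qed.

Lemma lowest_line U d (f h : F U) : irr U -> lowest d f -> Lg b d h -> inv h -> Kv f h.
Proof.
move=> iU lf Lh hi; rewrite -(eop_id hi); have [Lf fi f0 eig low] := lf.
apply: (@Sp_scalar _ _ b _ _ d) => //; first by move=> x y; apply: lowest_pab lf.
by apply: lowest_Sp.
Qed.

Lemma Lg_Sp U d (f : F U) e h : Lg b d f -> Sp b f d e h -> Lg b e h.
Proof.
move=> Lf; elim=> {e h} [p q e E|e|e c x y _ hx _ hy]; [|exact: Lg_0 | exact: Lg_lin].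
have [le|lt] := leqP (mdg q) d.
  have -> : e = (mdg p + (d - mdg q))%N by lia.
  by apply: (gsub_Xm p (gsub_Lg b U)); apply: (gsub_Ym (gsub_Lg b U)); rewrite subnKC.
rewrite (hom_Ym0 b (Lg_hom Lf) lt) (_ : Xm b p 0 = 0); first exact: Lg_0.
by have := Xm_lin b p (-1) (0 : F U) 0; rewrite scaler0 addr0 scaleN1r addNr.
Qed.

Section SameEigenvalues.
Variables (U W : srep K n) (d d' : nat) (f : F U) (h : F W).
Hypothesis (iW : irr W) (lf : lowest d f) (lh : lowest d' h).
Hypothesis same : forall p c, Psym b p f = c *: f -> Psym b p h = c *: h.
Let v := fpair f h.

Lemma v_inv : inv v.
Proof. by apply: inv_fpair; [case: lf | case: lh]. Qed.
Lemma v_low x y : (x < y)%N -> pab b v x y = 0.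
Proof.
move=> xy; apply: pr_inj; rewrite ?pr1_pab ?pr2_pab linear0.
  exact: lowest_pab lf xy.
exact: lowest_pab lh xy.
Qed.
Lemma v_eig p : exists c, Psym b p v = c *: v.
Proof.
have [_ _ _ eig _] := lf; have [c Ec] := eig p; exists c.
apply: pr_inj; first by rewrite pr1_Psym linearZ.
by rewrite pr2_Psym linearZ; apply: same.
Qed.

(* A vector (0, y) in the module generated by (f, h) would generate (0, h). *)
Lemma no_second e y : Sp b v d' e (fpair 0 y) -> hom e y -> y = 0.
Proof.
move=> sy hy; apply/eqP/negPn/negP => y0.
pose N e (y : F W) := hom e y /\ Sp b v d' e (fpair 0 y).
have fp_lin c x z : fpair (0 : F U) (c *: x + z : F W) = c *: fpair 0 x + fpair 0 z.
  by apply: pr_inj; rewrite linearP // /pr1 /=; apply/funext=> a; rewrite FD FZ scaler0 addr0.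
have sN : gsub b N.
  split=> [e' z []//|e'|e' g z [hz sz]|e' k z [hz sz]|e' j z [hz sz]].
  - split; first by split=> //; have -> : fpair (0 : F U) (0 : F W) = 0 by []; apply: Sp_0.
    by move=> c x z [hx sx] [hz sz]; split; [apply: homP | rewrite fp_lin; apply: Sp_lin].
  - split; first exact: hom_g.
    have -> : fpair (0 : F U) (gop g z) = gop g (fpair 0 z) by apply: pr_inj; rewrite ?pr1_g ?pr2_g ?g0 // [RHS]g0.
    by apply: Sp_g => //; apply: v_inv.
  - split; first exact: hom_Y.
    have -> : fpair (0 : F U) (Yop k z) = Yop k (fpair 0 z) by apply: pr_inj; rewrite ?pr1_Y ?pr2_Y // [RHS]Y0.
    by apply: Sp_Y => //; apply: v_inv.
  - split; first exact: hom_X.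
    have -> : fpair (0 : F U) (Xop b j z) = Xop b j (fpair 0 z) by apply: pr_inj; rewrite ?pr1_X ?pr2_X // [RHS]X0.
    exact: Sp_X.
have [Lh hi h0 _ _] := lh.
have [_ sh] := gsub_simple iW sN (conj hy sy) y0 Lh.
have [c Ec] := Sp_scalar v_inv v_low (fun k => v_eig _) sh.
have := congr1 (@pr1 _ _ U W) Ec; rewrite pr1_eop linearZ /= (_ : pr1 (fpair 0 h) = 0 :> F U) // eop0.
rewrite (_ : pr1 v = f) // => /esym/eqP; rewrite scaler_eq0; case: lf => _ _ /negPf-> _ _; rewrite orbF => /eqP c0.
have := congr1 (@pr2 _ _ U W) Ec; rewrite pr2_eop linearZ /= (_ : pr2 (fpair 0 h) = h :> F W) // eop_id // c0 scale0r => E.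
by rewrite E eqxx in h0.
Qed.

(** Were h in a higher degree than f, a Y-monomial of that degree would kill f but not h, and the
    pair would generate a vector excluded by [no_second]. *)
Lemma low_ge : (d' <= d)%N.
Proof.
rewrite leqNgt; apply/negP => lt; have [Lf _ _ _ _] := lf; have [Lh hi h0 _ _] := lh.
have [q qd Yq] := Ym_detect (Lg_hom Lh) h0.
case/eqP: Yq; apply: (@no_second 0).
  have -> : fpair 0 (Ym q h) = Xm b (mzero n) (Ym q v).
    rewrite Xm0; apply: pr_inj; rewrite ?pr1_Ym ?pr2_Ym //.
    by rewrite (_ : pr1 v = f) // (hom_Ym0 b (Lg_hom Lf)) ?qd.
  by apply: Sp_mon; rewrite mdg0 qd addn0.
by apply: (gsub_Ym (gsub_full b W)); rewrite addn0 qd; apply: Lg_hom Lh.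
Qed.
End SameEigenvalues.

Lemma same_sym U W (f : F U) (h : F W) : h != 0 -> (forall p, exists c, Psym b p f = c *: f) ->
  (forall p c, Psym b p f = c *: f -> Psym b p h = c *: h) ->
  forall p c, Psym b p h = c *: h -> Psym b p f = c *: f.
Proof.
move=> h0 eig same p c hc; have [c' Ec'] := eig p; have := same _ _ Ec'; rewrite hc => /eqP.
by rewrite -subr_eq0 -scalerBl scaler_eq0 (negPf h0) orbF subr_eq0 => /eqP->.
Qed.

(** The submodule generated by the pair (f, h) meets each of the two summands trivially by
    [no_second], so it is the graph of an isomorphism: both projections are injective on it and onto
    [Lg]. *)
Lemma same_char U W d d' (f : F U) (h : F W) p q D e : irr U -> irr W -> lowest d f -> lowest d' h ->
  (forall p c, Psym b p f = c *: f -> Psym b p h = c *: h) ->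
  Qidem n b p q D -> (e <= D)%N -> dQ b p q (@Lg K n b U) e = dQ b p q (@Lg K n b W) e.
Proof.
move=> iU iW lf lh same Qi eD.
have [Lf fi f0 eigf _] := lf; have [Lh hi h0 eigh _] := lh.
have same' := same_sym h0 eigf same.
have dd : d = d' by apply/eqP; rewrite eqn_leq (low_ge iU lh lf same') (low_ge iW lf lh same).
subst d'.
pose v := fpair f h; have vi : inv v by apply: inv_fpair.
have hv : hom d v.
  by move=> a ad; apply: (@injective_projections _ _ (v a) 0); rewrite /= ?(Lg_hom Lf) ?(Lg_hom Lh).
have sN := gsub_Sp vi hv.
have Z1 y e' : Sp b v d e' y -> pr1 y = 0 -> y = 0.
  move=> sy y1; have E : y = fpair 0 (pr2 y) by apply: pr_inj.
  have hy := gsub_hom sN sy; rewrite E in sy.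
  have y2 : pr2 y = 0 by apply: (no_second iW lf lh same sy) => a ad; rewrite /pr2 hy.
  by apply: pr_inj; rewrite ?y1 ?y2.
have swap e' y : Sp b v d e' y -> Sp b (fpair h f) d e' (fpair (pr2 y) (pr1 y)).
  elim=> {e' y} [r s e' E|e'|e' c x z _ sx _ sz].
  - have -> : fpair (pr2 (Xm b r (Ym s v))) (pr1 (Xm b r (Ym s v))) = Xm b r (Ym s (fpair h f)); last exact: Sp_mon.
    have E2 : pr2 (Xm b r (Ym s v)) = Xm b r (Ym s h) by rewrite pr2_Xm pr2_Ym.
    have E1 : pr1 (Xm b r (Ym s v)) = Xm b r (Ym s f) by rewrite pr1_Xm pr1_Ym.
    by rewrite E1 E2; apply: pr_inj; rewrite ?pr1_Xm ?pr1_Ym ?pr2_Xm ?pr2_Ym.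
  - exact: Sp_0.
  - exact: (Sp_lin c sx sz).
have Z2 y e' : Sp b v d e' y -> pr2 y = 0 -> y = 0.
  move=> sy y2; have hy := gsub_hom sN sy; have := swap _ _ sy; rewrite y2 => /(no_second iU lh lf same') y1.
  apply: pr_inj => //; rewrite y1 //.
  by move=> a ad; rewrite /pr1 hy.
pose Z0 (_ : nat) (y : F (prs U W)) := y = 0.
have zero : gsub b Z0 := gsub_zero b (prs U W).
have E1 : dQ b p q (Sp b v d) e = (dQ b p q Z0 e + dQ b p q (@Lg K n b U) e)%N.
  apply: (@dQ_exact _ _ b p q D (prs U W) U (Sp b v d) _ (@Lg K n b U) (@pr1 _ _ U W)) => //.
  - exact: gsub_Lg.
  - by move=> g y; apply: pr1_g.
  - by move=> e' y _ k; apply: pr1_Y.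
  - by move=> e' y _ j; apply: pr1_X.
  - by move=> y; split=> [->|[sy /(Z1 _ _ sy)//]]; split; [apply: Sp_0 | apply: linear0].
  - move=> y; elim=> {y} [r s e' E|e'|e' c x z _ sx _ sz].
    + by rewrite pr1_Xm pr1_Ym; apply: (Lg_Sp Lf); apply: Sp_mon.
    + by rewrite linear0; apply: Lg_0.
    + by rewrite linearP; apply: Lg_lin.
  - move=> x /(lowest_Sp iU lf); elim=> {x} [r s e' E|e'|e' c x z _ [x' sx <-] _ [z' sz <-]].
    + by exists (Xm b r (Ym s v)); [apply: Sp_mon | rewrite pr1_Xm pr1_Ym].
    + by exists 0; [apply: Sp_0 | apply: linear0].
    + by exists (c *: x' + z'); [apply: Sp_lin | apply: linearP].
have E2 : dQ b p q (Sp b v d) e = (dQ b p q Z0 e + dQ b p q (@Lg K n b W) e)%N.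
  apply: (@dQ_exact _ _ b p q D (prs U W) W (Sp b v d) _ (@Lg K n b W) (@pr2 _ _ U W)) => //.
  - exact: gsub_Lg.
  - by move=> g y; apply: pr2_g.
  - by move=> e' y _ k; apply: pr2_Y.
  - by move=> e' y _ j; apply: pr2_X.
  - by move=> y; split=> [->|[sy /(Z2 _ _ sy)//]]; split; [apply: Sp_0 | apply: linear0].
  - move=> y; elim=> {y} [r s e' E|e'|e' c x z _ sx _ sz].
    + by rewrite pr2_Xm pr2_Ym; apply: (Lg_Sp Lh); apply: Sp_mon.
    + by rewrite linear0; apply: Lg_0.
    + by rewrite linearP; apply: Lg_lin.
  - move=> x /(lowest_Sp iW lh); elim=> {x} [r s e' E|e'|e' c x z _ [x' sx <-] _ [z' sz <-]].
    + by exists (Xm b r (Ym s v)); [apply: Sp_mon | rewrite pr2_Xm pr2_Ym].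
    + by exists 0; [apply: Sp_0 | apply: linear0].
    + by exists (c *: x' + z'); [apply: Sp_lin | apply: linearP].
by apply/eqP; rewrite -(eqn_add2l (dQ b p q Z0 e)) -E1 -E2.
Qed.
End LowestInvariants.

(** * Independence of spherical characters *)

Section Matching.
Variables (K : numClosedFieldType) (n : nat) (b : K) (p : {poly K}) (D : nat).
Hypothesis b0 : b != 0.
Hypothesis sep : forall d d' (x : midx n d) (x' : midx n d') (t t' : wtT n), (d <= D)%N -> (d' <= D)%N ->
  chi (tomi x) b p (wd t) = chi (tomi x') b p (wd t') ->
  forall p', chi (tomi x) b p' (wd t) = chi (tomi x') b p' (wd t').
Implicit Types (U W : srep K n) (d e : nat) (x y z : nat * srep K n) (s : seq (nat * srep K n)).
Local Notation Lg := (@Lg K n b).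
Local Notation dQ := (dQ b p).

Lemma lowest_chi U d (f : F U) : lowest b d f ->
  exists (x : midx n d) (t : wtT n), forall p', Psym b p' f = chi (tomi x) b p' (wd t) *: f.
Proof.
move=> [Lf fi f0 eig _]; have [x _ [fx _ fD]] := inv_eigen b (Lg_hom Lf) fi f0; exists x.
have : f (tomi x) \in (\sum_(t : wtT n) Ew U (wd t))%VS by rewrite Ew_sum memvf.
move=> /memv_sumP[w wE Ef].
have [t wt] : exists t, w t != 0.
  apply: contrapT => no; case/eqP: fx; rewrite Ef big1 // => t _; apply/eqP/negPn/negP => wt; apply: no; by exists t.
exists t => p'; have [c Ec] := eig p'; rewrite Ec; congr (_ *: _); symmetry.
have := fD p'; rewrite Ec FZ Ef => /esym Dw.
exact: (comp_eigen (fun t => wE t isT) (fun t => Dop_eigen _ _ _ (wE t isT)) Dw wt).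
Qed.

Lemma dQ_nz q U e : dQ q (@Lg U) e != 0%N -> exists f : F U, [/\ Lg e f, inv f & f != 0].
Proof.
rewrite /dQ dimv_eq0 -vpick0 => v0.
have /pspaceP := memv_pick (pspace (fun phi : G U e => exists2 f, Lg e f & emb phi = Qop b p q f)).
move=> /(_ (dQ_pred p q e (gsub_Lg b U)))[f Lf Ef]; exists (Qop b p q f); split.
- exact: (gsub_Qop p q (gsub_Lg b U)).
- by move=> g; apply: g_Qop.
- by apply: contra_neq v0 => E; rewrite -[vpick _]res_emb Ef E linear0.
Qed.

(** The invariants of lowest degree form the line of [f] by [lowest_line], on which the projector is
    1 or 0. *)
Lemma dQ_low om q U d (f : F U) c : qsel n b p D om q -> (d <= D)%N -> irr U -> lowest b d f -> Psym b p f = c *: f ->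
  dQ q (@Lg U) d = (c == om).
Proof.
move=> [Qi _ qE] dD iU lf Ec; have [x [t Ext]] := lowest_chi lf; have [Lf fi f0 _ _] := lf.
have cE : c = chi (tomi x) b p (wd t).
  by apply/eqP; rewrite -subr_eq0; have := Ext p; rewrite Ec => /eqP; rewrite -subr_eq0 -scalerBl scaler_eq0 (negPf f0) orbF.
have P0 : Psym b p (0 : F U) = 0.
  by have := Psym_linear b p (-1) (0 : F U) 0; rewrite scaler0 addr0 scaleN1r addNr.
have PZ k : Psym b p (k *: f) = c *: (k *: f).
  by have := Psym_linear b p k f 0; rewrite P0 !addr0 => ->; rewrite Ec !scalerA mulrC.
have Qf h : Lg d h -> exists k, Qop b p q h = (c == om)%:R *: (k *: f).
  move=> Lh; have [k Ek] : Kv f (eop h).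
    by apply: (lowest_line iU lf); [apply: (gsub_eop (gsub_Lg b U)) | move=> g; apply: g_eop].
  exists k; by rewrite /Qop Ek (opoly_eigen _ (Psym_linear b p) (PZ k)) cE qE.
have Pp := dQ_pred p q d (gsub_Lg b U).
rewrite /dQ; case: eqP Qf => [co|_] Qf /=.
  have -> : pspace (fun phi : G U d => exists2 f, Lg d f & emb phi = Qop b p q f) = <[res d f]>%VS.
    apply/vspaceP=> u; apply/idP/idP => [/(pspaceP _ Pp)[h Lh Eh]|/vlineP[k ->]].
      by have [k Ek] := Qf h Lh; rewrite -[u]res_emb Eh Ek scale1r linearZ; apply/memvZ/memv_line.
    apply/(pspaceP _ Pp); exists (k *: f); first exact: Lg_Z.
    rewrite linearZ /= emb_res; last exact: (Lg_hom Lf).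
    rewrite /Qop eop_id; last by move=> g; rewrite gZ fi.
    by rewrite (opoly_eigen _ (Psym_linear b p) (PZ k)) cE qE // -cE co eqxx scale1r.
  rewrite dim_vline; suff -> : res d f != 0 by [].
  by apply: contra_neq f0 => r0; rewrite -(emb_res (Lg_hom Lf)) r0 linear0.
apply/eqP; rewrite dimv_eq0 -subv0; apply/subvP=> u /(pspaceP _ Pp)[h Lh Eh].
by have [k Ek] := Qf h Lh; rewrite memv0 -[u]res_emb Eh Ek scale0r linear0.
Qed.

Definition csame U W := forall ka ka', (forall v : U, csum U v = ka *: v) -> (forall v : W, csum W v = ka' *: v) -> ka = ka'.

Lemma csame_sym U W : csame U W -> csame W U.
Proof. by move=> H ka ka' h h'; rewrite (H ka' ka). Qed.

Lemma lowest_csame U W d (f : F U) (h : F W) : lowest b d f -> lowest b d h ->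
  (forall p c, Psym b p f = c *: f -> Psym b p h = c *: h) -> csame U W.
Proof.
move=> lf lh same ka ka' kU kW; have [Lf _ f0 _ _] := lf; have [Lh _ h0 _ _] := lh.
have E (V : srep K n) (v : F V) k : hom d v -> (forall v : V, csum V v = k *: v) -> Psym b 'X v = (d%:R + b * k) *: v.
  move=> hv kV; apply/funext=> a; rewrite Euler FZ kV scalerA -scalerDl.
  by have [->//|ad] := eqVneq (mdg a) d; rewrite hv // !scaler0.
have := same 'X _ (E _ _ _ (Lg_hom Lf) kU); rewrite (E _ _ _ (Lg_hom Lh) kW) => /eqP.
rewrite -subr_eq0 -scalerBl scaler_eq0 (negPf h0) orbF subr_eq0 => /eqP /addrI /(mulfI b0) //.
Qed.

Definition Qsum q d s := (\sum_(x <- s | (x.1 <= d)%N) dQ q (@Lg x.2) (d - x.1))%N.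
Definition balanced s s' := forall om q, qsel n b p D om q -> forall d, (d <= D)%N -> Qsum q d s = Qsum q d s'.

Lemma Qsum_split q d s s' z : Qsum q d (s ++ z :: s') = ((if z.1 <= d then dQ q (@Lg z.2) (d - z.1) else 0) + Qsum q d (s ++ s'))%N.
Proof. by rewrite /Qsum !big_cat big_cons /=; case: ifP => _; rewrite ?add0n // addnCA. Qed.

Lemma Qsum_nz q d s : Qsum q d s != 0%N -> exists y, [/\ List.In y s, (y.1 <= d)%N & dQ q (@Lg y.2) (d - y.1) != 0%N].
Proof.
elim: s => [|x s IH]; first by rewrite /Qsum big_nil.
rewrite -[x :: s]cat0s Qsum_split cat0s addn_eq0 negb_and => /orP[|/IH[y [ys yd yq]]]; last by exists y; split=> //; right.
by case: leqP => // xd xq; exists x; split=> //; left.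
Qed.

Lemma match_one s s' z d (f : F z.2) : balanced s s' -> (forall x, List.In x (s ++ s') -> irr x.2) ->
  List.In z s -> lowest b d f -> (z.1 + d <= D)%N ->
  (forall y, List.In y s' -> forall e (h : F y.2), lowest b e h -> (z.1 + d <= y.1 + e)%N) ->
  exists2 y, List.In y s' & [/\ y.1 = z.1, csame z.2 y.2 &
    forall om q, qsel n b p D om q -> forall e, (e <= D)%N -> dQ q (@Lg y.2) e = dQ q (@Lg z.2) e].
Proof.
move=> bal irs zs lf zD zmin; have [Lf fi f0 eig _] := lf; have [c Ec] := eig p.
have iz : irr z.2 by apply: irs; apply/List.in_or_app; left.
have [q qs] := qsel_ex n b p D c.
have dD : (d <= D)%N by apply: leq_trans zD; apply: leq_addl.
have S1 : (0 < Qsum q (z.1 + d) s)%N.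
  have [s1 [s2 ->]] := List.in_split _ _ zs.
  by rewrite Qsum_split leq_addr addKn (dQ_low qs dD iz lf Ec) eqxx.
rewrite (bal c q qs _ zD) lt0n in S1.
have [y [ys yle ynz]] := Qsum_nz S1.
have iy : irr y.2 by apply: irs; apply/List.in_or_app; right.
have [h [Lh hi h0]] := dQ_nz ynz.
have [e [h' [ele lh]]] := lowest_ex Lh hi h0.
have ed : (z.1 + d - y.1)%N = e by have := zmin y ys e h' lh; lia.
have [Lh' hi' h0' eigh _] := lh; have [c' Ec'] := eigh p.
have eD : (e <= D)%N by lia.
have cc : c' = c.
  by move: ynz; rewrite ed (dQ_low qs eD iy lh Ec'); case: (c' =P c).
have [xf [tf Ef]] := lowest_chi lf; have [xh [th Eh]] := lowest_chi lh.
have uniqc (V : srep K n) (v : F V) (k k' : K) : v != 0 -> k *: v = k' *: v -> k = k'.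
  by move=> v0 /eqP; rewrite -subr_eq0 -scalerBl scaler_eq0 (negPf v0) orbF subr_eq0 => /eqP.
have chE : chi (tomi xf) b p (wd tf) = chi (tomi xh) b p (wd th).
  rewrite -(uniqc _ _ _ _ f0 (etrans (esym Ec) (Ef p))) -(uniqc _ _ _ _ h0' (etrans (esym Ec') (Eh p))).
  by rewrite cc.
have same r k : Psym b r f = k *: f -> Psym b r h' = k *: h'.
  by move=> Er; rewrite Eh -(sep dD eD chE) -(uniqc _ _ _ _ f0 (etrans (esym Er) (Ef r))).
have same' := same_sym h0' eig same.
have de : d = e by apply/eqP; rewrite eqn_leq (low_ge iz lh lf same') (low_ge iy lf lh same).
exists y => //; split; first by lia.
  have lh' : lowest b d h' by rewrite de.
  exact: lowest_csame lf lh' same.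
move=> om q' [Qi _ _] e' eD'; exact: (same_char iy iz lh lf same' Qi eD').
Qed.

(** The factor with the lowest invariant of both lists is matched first and the pair removed; the
    lists stay balanced, and the recursion ends when [x] is matched. *)
Lemma match_all s s' x d (f : F x.2) : balanced s s' -> (forall x, List.In x (s ++ s') -> irr x.2) ->
  List.In x s -> lowest b d f -> (x.1 + d <= D)%N -> exists2 y, List.In y s' & csame x.2 y.2.
Proof.
have [m] := ubnP (size s); elim: m s s' => // m IH s s' sm bal irs xs lf xD.
pose good a := `[< exists z, List.In z (s ++ s') /\ exists e (h : F z.2), lowest b e h /\ (z.1 + e)%N = a >].
have ex : exists a, good a by exists (x.1 + d)%N; apply/asboolP; exists x; split; [apply/List.in_or_app; left | exists d, f].
have [a /asboolP[z [zs [e [h [lh ea]]]]] amin] := ex_minnP ex.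
have aD : (a <= D)%N.
  by apply: leq_trans xD; apply: amin; apply/asboolP; exists x; split; [apply/List.in_or_app; left | exists d, f].
have zmin y : List.In y (s ++ s') -> forall e' (h' : F y.2), lowest b e' h' -> (z.1 + e <= y.1 + e')%N.
  by move=> ys e' h' lh'; rewrite ea; apply: amin; apply/asboolP; exists y; split=> //; exists e', h'.
have step u w : List.In u s -> List.In w s' -> u.1 = w.1 -> csame u.2 w.2 ->
    (forall om q, qsel n b p D om q -> forall e, (e <= D)%N -> dQ q (@Lg u.2) e = dQ q (@Lg w.2) e) ->
    exists2 y, List.In y s' & csame x.2 y.2.
  move=> us ws uw cuw dquw; have [xu|xu] := pselect (u = x); first by exists w; rewrite // -xu.
  have [u1 [u2 Eu]] := List.in_split _ _ us; have [w1 [w2 Ew]] := List.in_split _ _ ws.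
  have [||||y yr cy] := IH (u1 ++ u2) (w1 ++ w2) _ _ _ _ lf xD.
  - by move: sm; rewrite Eu !size_cat /= addnS ltnS.
  - move=> om q qs e' eD; have := bal om q qs e' eD; rewrite Eu Ew !Qsum_split uw.
    by case: leqP => // le; rewrite (dquw om q qs) ?(leq_trans (leq_subr _ _)) // => /addnI.
  - move=> y yin; case: (List.in_app_or _ _ _ yin) => [yu|yw]; apply: irs; apply/List.in_or_app; [left; rewrite Eu | right; rewrite Ew].
      by case: (List.in_app_or _ _ _ yu) => yu'; apply/List.in_or_app; [left | right; right].
    by case: (List.in_app_or _ _ _ yw) => yw'; apply/List.in_or_app; [left | right; right].
  - move: xs; rewrite Eu => xs'; case: (List.in_app_or _ _ _ xs') => [xu1|[ux|xu2]]; [by apply/List.in_or_app; left | by case: xu | by apply/List.in_or_app; right].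
  exists y => //; rewrite Ew; case: (List.in_app_or _ _ _ yr) => yr'; apply/List.in_or_app; [by left | by right; right].
case: (List.in_app_or _ _ _ zs) => {}zs.
  have [||y ys [y1 yc yd]] := match_one bal irs zs lh.
  - by rewrite ea.
  - by move=> y ys; apply: zmin; apply/List.in_or_app; right.
  by apply: (step z y) => // om q qs e' eD; rewrite (yd om q).
have bal' : balanced s' s by move=> om q qs e' eD; rewrite (bal om q).
have irs' y : List.In y (s' ++ s) -> irr y.2.
  by move=> ys0; case: (List.in_app_or _ _ _ ys0) => ys; apply: irs; apply/List.in_or_app; [right | left].
have [||y ys [y1 yc yd]] := match_one bal' irs' zs lh.
- by rewrite ea.
- by move=> y ys; apply: zmin; apply/List.in_or_app; left.
apply: (step y z ys zs y1 (csame_sym yc)) => om q qs e' eD; exact: (yd om q qs).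
Qed.
End Matching.

(** * From the abstract simple module to Lg *)

Section SimpleQuotient.
Variables (K : numClosedFieldType) (n : nat) (b : K) (W : srep K n).
Hypothesis n_gt0 : (0 < n)%N.
Implicit Types (f h : F W) (d : nat) (g : 'S_n) (i j k l : 'I_n).
Local Notation ni := (n%:R^-1 : K).
Local Notation X := (@Xop K n b W).
Local Notation Y := (@Yop K n W).

Definition XS f : F W := \sum_i X i f.
Definition YS f : F W := \sum_i Y i f.
(** Subtracting the mean passes from C^n to the reflection representation; the resulting operators
    commute with [YS]. *)
Definition XB j f : F W := X j f - ni *: XS f.
Definition YB k f : F W := Y k f - ni *: YS f.

Lemma nn0 : (n%:R : K) != 0. Proof. by rewrite pnatr_eq0 -lt0n. Qed.

Fact XS_lin : linear XS.
Proof. by move=> c f h; rewrite /XS scaler_sumr -big_split; apply: eq_bigr => i _; rewrite linearP. Qed.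
HB.instance Definition _ := GRing.isLinear.Build K (F W) (F W) *:%R XS XS_lin.
Fact YS_lin : linear YS.
Proof. by move=> c f h; rewrite /YS scaler_sumr -big_split; apply: eq_bigr => i _; rewrite linearP. Qed.
HB.instance Definition _ := GRing.isLinear.Build K (F W) (F W) *:%R YS YS_lin.
Fact XB_lin j : linear (XB j).
Proof. by move=> c f h; rewrite /XB [X j _]linearP [XS _]linearP scalerDr opprD addrACA scalerBr !scalerA mulrC. Qed.
HB.instance Definition _ j := GRing.isLinear.Build K (F W) (F W) *:%R (XB j) (XB_lin j).
Fact YB_lin k : linear (YB k).
Proof. by move=> c f h; rewrite /YB [Y k _]linearP [YS _]linearP scalerDr opprD addrACA scalerBr !scalerA mulrC. Qed.
HB.instance Definition _ k := GRing.isLinear.Build K (F W) (F W) *:%R (YB k) (YB_lin k).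

Lemma Cop_suml j f : \sum_k Cop b k j f = f.
Proof.
rewrite (bigD1 j) //= CopE eqxx -addrA -[RHS]addr0; congr (_ + _).
have -> : \sum_(k | k != j) Cop b k j f = - (b *: \sum_(k | k != j) gop (tperm j k) f).
  by rewrite scaler_sumr -sumrN; apply: eq_bigr => k kj; rewrite CopE (negPf kj) tpermC.
by rewrite subrr.
Qed.
Lemma Cop_sumr k f : \sum_j Cop b k j f = f.
Proof.
rewrite (bigD1 k) //= CopE eqxx -addrA -[RHS]addr0; congr (_ + _).
have -> : \sum_(j | j != k) Cop b k j f = - (b *: \sum_(j | j != k) gop (tperm k j) f).
  by rewrite scaler_sumr -sumrN; apply: eq_bigr => j jk; rewrite CopE eq_sym (negPf jk).
by rewrite subrr.
Qed.
Lemma YS_X j f : YS (X j f) = X j (YS f) + f.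
Proof.
rewrite /YS linear_sum -[X in _ + X](Cop_suml j) -big_split; apply: eq_bigr => k _; exact: YX.
Qed.
Lemma Y_XS k f : Y k (XS f) = XS (Y k f) + f.
Proof.
rewrite /XS linear_sum -[X in _ + X](Cop_sumr k) -big_split; apply: eq_bigr => j _; exact: YX.
Qed.
Lemma YS_XS f : YS (XS f) = XS (YS f) + n%:R *: f.
Proof.
rewrite {1}/YS (eq_bigr (fun k => XS (Y k f) + f)) => [|k _]; last exact: Y_XS.
by rewrite big_split -linear_sum sumr_const card_ord scaler_nat.
Qed.
Lemma YS_XB j f : YS (XB j f) = XB j (YS f).
Proof.
rewrite /XB linearB linearZ /= YS_X YS_XS scalerDr scalerA mulVf ?nn0 // scale1r.
by rewrite opprD addrACA subrr addr0.
Qed.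
Lemma YB_XB k j f : YB k (XB j f) = XB j (YB k f) + (Cop b k j f - ni *: f).
Proof.
have E1 : Y k (XB j f) = XB j (Y k f) + (Cop b k j f - ni *: f).
  by rewrite /XB linearB linearZ /= YX Y_XS scalerDr opprD addrACA.
have E2 : XB j (YB k f) = XB j (Y k f) - ni *: XB j (YS f) by rewrite /YB linearB linearZ.
by rewrite E2 [YB k (XB j f)]/YB YS_XB E1 addrAC.
Qed.
Lemma g_XS g f : gop g (XS f) = XS (gop g f).
Proof.
rewrite /XS linear_sum [RHS](reindex_perm (g^-1)%g); apply: eq_bigr => i _; exact: gopX.
Qed.
Lemma g_XB g j f : gop g (XB j f) = XB ((g^-1)%g j) (gop g f).
Proof. by rewrite /XB linearB linearZ /= g_XS gopX. Qed.
Lemma hom_XS d f : hom d f -> hom d.+1 (XS f).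
Proof. by move=> hf; apply: hom_sum => i _; apply: hom_X. Qed.
Lemma hom_YS d f : hom d.+1 f -> hom d (YS f).
Proof. by move=> hf; apply: hom_sum => i _; apply: hom_Y. Qed.

(** Since [YS, XS] = n, the product XS YS is n times a number operator. A negative eigenvalue would
    drop by n under each YS, which also lowers the degree, until YS acts by zero. *)
Lemma XSYS_neg d (k : nat) f : hom d f -> XS (YS f) = - (n * k.+1)%:R *: f -> f = 0.
Proof.
elim: d k f => [|d IH] k f hf E; last have Y0 : YS f = 0.
- have YS0 : YS f = 0 by rewrite /YS big1 // => i _; apply: hom_Y0.
  move: E; rewrite YS0 linear0 => /esym/eqP; rewrite scaler_eq0 oppr_eq0 pnatr_eq0 muln_eq0 /=.
  by rewrite -leqn0 leqNgt n_gt0 => /eqP.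
- apply: (IH k.+1); first exact: hom_YS.
  have E2 := YS_XS (YS f).
  have E3 : YS (- (n * k.+1)%:R *: f) = - (n * k.+1)%:R *: YS f by apply: linearZ.
  rewrite E E3 in E2; apply: (addIr (n%:R *: YS f)); rewrite -E2 -scalerDl; congr (_ *: _).
  by rewrite [(n * k.+2)%N]mulnS natrD opprD addrAC addNr add0r.
move: E; rewrite Y0 linear0 => /esym/eqP; rewrite scaler_eq0 oppr_eq0 pnatr_eq0 muln_eq0 /=.
by rewrite -leqn0 leqNgt n_gt0 => /eqP.
Qed.

Variable V : lmodType K.
Variables (gV : 'S_n -> V -> V) (xV yV : 'I_n -> V -> V) (iota : W -> V).
Hypothesis gV_lin : forall g, linear (gV g).
Hypothesis xV_lin : forall j, linear (xV j).
Hypothesis yV_lin : forall k, linear (yV k).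
Hypothesis iota_lin : linear iota.
Hypothesis gxV : forall g j v, gV g (xV j v) = xV ((g^-1)%g j) (gV g v).
Hypothesis xVC : forall i j v, xV i (xV j v) = xV j (xV i v).
Hypothesis xsum : forall v, \sum_j xV j v = 0.
Definition CV k j (v : V) : V := if k == j then v + b *: \sum_(l | l != k) gV (tperm k l) v else - (b *: gV (tperm k j) v).
Hypothesis yxV : forall k j v, yV k (xV j v) = xV j (yV k v) + (CV k j v - ni *: v).
Hypothesis iota_g : forall g w, gV g (iota w) = iota (sact W g w).
Hypothesis iota_y : forall k w, yV k (iota w) = 0.
Hypothesis iota_inj : forall w, iota w = 0 -> w = 0.
Hypothesis V_simple : forall P : V -> Prop, P 0 -> (forall c u v, P u -> P v -> P (c *: u + v)) ->
  (forall g v, P v -> P (gV g v)) -> (forall j v, P v -> P (xV j v)) -> (forall k v, P v -> P (yV k v)) ->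
  (forall v, P v -> v = 0) \/ (forall v, P v).
Hypothesis irrW : irr W.

HB.instance Definition _ g := GRing.isLinear.Build K V V *:%R (gV g) (gV_lin g).
HB.instance Definition _ j := GRing.isLinear.Build K V V *:%R (xV j) (xV_lin j).
HB.instance Definition _ k := GRing.isLinear.Build K V V *:%R (yV k) (yV_lin k).
HB.instance Definition _ := GRing.isLinear.Build K W V *:%R iota iota_lin.

(** The graph of the correspondence between the model and the abstract module: the same expression
    in the x_j, applied to a constant on one side and to its image under [iota] on the other. It is
    a relation because independence of the expression is only shown later, by [Rel_zero] and
    [Ker_trivial]. *)
Inductive Rel : nat -> F W -> V -> Prop :=
| Rel_cst w : Rel 0 (cst w) (iota w)
| Rel_0 d : Rel d 0 0
| Rel_lin d c f u f' u' : Rel d f u -> Rel d f' u' -> Rel d (c *: f + f') (c *: u + u')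
| Rel_X d j f u : Rel d f u -> Rel d.+1 (XB j f) (xV j u).

Lemma Rel_D d f u f' u' : Rel d f u -> Rel d f' u' -> Rel d (f + f') (u + u').
Proof. by move=> R R'; rewrite -[f]scale1r -[u]scale1r; apply: Rel_lin. Qed.
Lemma Rel_Z d c f u : Rel d f u -> Rel d (c *: f) (c *: u).
Proof. by move=> R; rewrite -[c *: f]addr0 -[c *: u]addr0; apply: Rel_lin => //; apply: Rel_0. Qed.
Lemma Rel_N d f u : Rel d f u -> Rel d (- f) (- u).
Proof. by move=> R; rewrite -scaleN1r -[- u]scaleN1r; apply: Rel_Z. Qed.
Lemma Rel_sum d (I : Type) (r : seq I) (P : pred I) (f : I -> F W) (u : I -> V) :
  (forall x, P x -> Rel d (f x) (u x)) -> Rel d (\sum_(x <- r | P x) f x) (\sum_(x <- r | P x) u x).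
Proof. by move=> R; apply: (big_ind2 (Rel d)) => //; [apply: Rel_0 | move=> x1 x2 y1 y2; apply: Rel_D]. Qed.
Lemma Rel_g d g f u : Rel d f u -> Rel d (gop g f) (gV g u).
Proof.
elim=> {d f u} [w|d|d c f u f' u' _ IH _ IH'|d j f u _ IH].
- by rewrite cst_g iota_g; apply: Rel_cst.
- by rewrite !linear0; apply: Rel_0.
- by rewrite !linearP; apply: Rel_lin.
- by rewrite g_XB gxV; apply: Rel_X.
Qed.
Lemma Rel_C d k j f u : Rel d f u -> Rel d (Cop b k j f) (CV k j u).
Proof.
move=> R; rewrite CopE /CV; case: ifP => _; last by apply/Rel_N/Rel_Z/Rel_g.
by apply: Rel_D => //; apply/Rel_Z/Rel_sum => l _; apply: Rel_g.
Qed.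
Lemma Rel_Y0 f u k : Rel 0 f u -> yV k u = 0 /\ exists w, f = cst w /\ u = iota w.
Proof.
move=> R; suff gen d f' u' : Rel d f' u' -> d = 0%N -> yV k u' = 0 /\ exists w, f' = cst w /\ u' = iota w by apply: gen R _.
elim=> {d f' u' R} [w|d|d c f1 u1 f2 u2 _ IH _ IH'|d j f1 u1 _ IH] // d0.
- by split=> //; exists w.
- split; first exact: linear0.
  by exists 0; rewrite linear0; split=> //; apply/funext=> a; rewrite /cst; case: ifP.
- have [y1 [w1 [-> ->]]] := IH d0; have [y2 [w2 [-> ->]]] := IH' d0.
  by split; [rewrite linearP /= !iota_y scaler0 addr0 | exists (c *: w1 + w2); rewrite cst_lin linearP].
Qed.
Lemma Rel_hom d f u : Rel d f u -> hom d f.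
Proof.
elim=> {d f u} [w|d|d c f u f' u' _ IH _ IH'|d j f u _ IH]; [exact: cst_hom | exact: hom0 | exact: homP |].
apply: homD; first exact: hom_X.
by rewrite -scaleNr; apply/homZ/hom_XS.
Qed.
Lemma Rel_Y d k f u : Rel d.+1 f u -> Rel d (YB k f) (yV k u).
Proof.
move=> R; suff gen e f' u' : Rel e f' u' -> forall d, e = d.+1 -> Rel d (YB k f') (yV k u') by apply: gen R _ _.
elim=> {d f u R e f' u'} [//|e|e c f u f' u' _ IH _ IH'|e j f u R IH] d ed.
- by rewrite !linear0; apply: Rel_0.
- by rewrite !linearP; apply: Rel_lin; [apply: IH | apply: IH'].
- case: ed => <-; rewrite YB_XB yxV; apply: Rel_D; last first.
    by apply: Rel_D; [apply: Rel_C | rewrite -!scaleNr; apply: Rel_Z].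
  case: e R IH => [|e] R IH; last by apply: Rel_X; apply: IH.
  have [-> _] := Rel_Y0 k R; have hf := Rel_hom R.
  have -> : YB k f = 0 by rewrite /YB hom_Y0 // sub0r /YS big1 ?scaler0 ?oppr0 // => i _; apply: hom_Y0.
  by rewrite !linear0; apply: Rel_0.
Qed.
Lemma Rel_YS d f u : Rel d f u -> YS f = 0.
Proof.
elim=> {d f u} [w|d|d c f u f' u' _ IH _ IH'|d j f u _ IH].
- by rewrite /YS big1 // => i _; apply/hom_Y0/cst_hom.
- exact: linear0.
- by rewrite YS_lin IH IH' scaler0 addr0.
- by rewrite YS_XB IH linear0.
Qed.
Lemma Lg_XS d f : Lg b d f -> Lg b d.+1 (XS f).
Proof. by move=> Lf; apply: Lg_sum => i _; apply: Lg_X. Qed.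
Lemma Rel_Lg d f u : Rel d f u -> Lg b d f.
Proof.
elim=> {d f u} [w|d|d c f u f' u' _ IH _ IH'|d j f u _ IH]; [exact/Lg_const/cst_hom | exact: Lg_0 | exact: Lg_lin |].
apply: Lg_D; first exact: Lg_X.
by rewrite -scaleNr; apply/Lg_Z/Lg_XS.
Qed.

(** Each X_j is [XB j] plus XS/n, and XS commutes with the X_j, so all occurrences of XS can be
    collected on the left. *)
Lemma Lg_split d f : Lg b d f -> exists f1 u f2, [/\ Rel d f1 u, (forall e, d = e.+1 -> Lg b e f2) ,
  (d = 0%N -> f2 = 0) & f = f1 + XS f2].
Proof.
elim=> {d f} [f hf|d|d c f h _ [f1 [u1 [g1 [R1 L1 Z1 ->]]]] _ [f2 [u2 [g2 [R2 L2 Z2 ->]]]]|d j f Lf [f1 [u1 [g1 [R1 L1 Z1 E]]]]].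
- exists f, (iota (f (mzero n))), 0; split=> //; last by rewrite linear0 addr0.
  by rewrite {1}(hom0_cst hf); apply: Rel_cst.
- by exists 0, 0, 0; split=> //; [apply: Rel_0 | move=> e _; apply: Lg_0 | rewrite linear0 addr0].
- exists (c *: f1 + f2), (c *: u1 + u2), (c *: g1 + g2); split.
  + exact: Rel_lin.
  + by move=> e de; apply: Lg_lin; [apply: L1 | apply: L2].
  + by move=> d0; rewrite Z1 // Z2 // scaler0 addr0.
  + by rewrite linearP scalerDr addrACA.
- have XC : X j (XS g1) = XS (X j g1) by rewrite /XS linear_sum; apply: eq_bigr => i _; apply: XopC.
  exists (XB j f1), (xV j u1), (ni *: f1 + X j g1); split=> //.
  + exact: Rel_X.
  + move=> e [<-]; apply: Lg_D; first exact/Lg_Z/(Rel_Lg R1).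
    by case: d Lf R1 L1 Z1 E => [|d] Lf R1 L1 Z1 E; [rewrite Z1 // X0; apply: Lg_0 | apply/Lg_X/L1].
  + have E1 : X j f = X j f1 + XS (X j g1) by rewrite E linearD /= XC.
    by rewrite E1 XS_lin /XB addrA subrK.
Qed.

Lemma Lg_YS0 d f : Lg b d f -> YS f = 0 -> exists u, Rel d f u.
Proof.
move=> Lf Yf; have [f1 [u [f2 [R L2 Z2 E]]]] := Lg_split Lf.
suff f20 : f2 = 0 by exists u; rewrite E f20 linear0 addr0.
case: d Lf R L2 Z2 => [|d] Lf R L2 Z2; first exact: Z2.
have := Yf; rewrite E linearD /= (Rel_YS R) add0r YS_XS => /eqP; rewrite addr_eq0 -scaleNr => /eqP E2.
by apply: (@XSYS_neg d 0 _ (Lg_hom (L2 d erefl))); rewrite muln1.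
Qed.

(** The Euler element of [V]. It stands in for a grading: by [Rel_eu] its eigenvalue reveals the
    degree. *)
Definition eu (v : V) : V := \sum_i xV i (yV i v) + b *: \sum_(i : 'I_n) \sum_(j : 'I_n | (j < i)%N) gV (tperm i j) v.
Fact eu_lin : linear eu.
Proof.
have Al : linear (fun v => \sum_i xV i (yV i v)).
  by move=> c u v; rewrite scaler_sumr -big_split; apply: eq_bigr => i _; rewrite yV_lin xV_lin.
have Bl : linear (fun v => \sum_(i : 'I_n) \sum_(j : 'I_n | (j < i)%N) gV (tperm i j) v).
  move=> c u v; rewrite scaler_sumr -big_split; apply: eq_bigr => i _.
  by rewrite scaler_sumr -big_split; apply: eq_bigr => j _; rewrite gV_lin.
by move=> c u v; rewrite /eu Al Bl !scalerDr !scalerA (mulrC b) addrACA.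
Qed.

Lemma eu_x j v : eu (xV j v) = xV j (eu v) + xV j v.
Proof.
have two0 : (2%:R : K) != 0 by rewrite pnatr_eq0.
have sumx : \sum_i xV i (yV i (xV j v)) = \sum_i xV i (xV j (yV i v)) + (xV j v + b *: \sum_(l | l != j) (xV j (gV (tperm j l) v) - xV l (gV (tperm j l) v))).
  rewrite (eq_bigr (fun i => xV i (xV j (yV i v)) + (xV i (CV i j v) - ni *: xV i v))) => [|i _]; last first.
    by rewrite yxV linearD linearB linearZ.
  rewrite big_split sumrB -scaler_sumr xsum scaler0 subr0; congr (_ + _).
  rewrite (bigD1 j) //= {1}/CV eqxx linearD linearZ linear_sum -addrA sumrB scalerBr; congr (_ + (_ + _)).
  rewrite -scalerN -sumrN scaler_sumr; apply: eq_bigr => l lj; rewrite /CV (negPf lj).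
  by rewrite linearN linearZ /= tpermC scalerN.
pose T v := \sum_(i : 'I_n) \sum_(l : 'I_n | (l < i)%N) gV (tperm i l) v.
have xT : T (xV j v) = xV j (T v) + \sum_(l | l != j) (xV l (gV (tperm j l) v) - xV j (gV (tperm j l) v)).
  have -> : T (xV j v) = \sum_(i : 'I_n) \sum_(l : 'I_n | (l < i)%N) xV (tperm i l j) (gV (tperm i l) v).
    by apply: eq_bigr => i _; apply: eq_bigr => l _; rewrite gxV tpermV.
  have -> : xV j (T v) = \sum_(i : 'I_n) \sum_(l : 'I_n | (l < i)%N) xV j (gV (tperm i l) v).
    by rewrite linear_sum; apply: eq_bigr => i _; rewrite linear_sum.
  apply: (scalerI two0); rewrite scalerDr !scaler_nat.
  rewrite -[LHS]pairsum_sym => [|i l]; last by rewrite tpermC.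
  rewrite -[X in X + _]pairsum_sym => [|i l]; last by rewrite tpermC.
  apply/eqP; rewrite addrC -subr_eq; apply/eqP.
  rewrite -sumrB (eq_bigr (fun i => \sum_(l | l != i) (xV (tperm i l j) (gV (tperm i l) v) - xV j (gV (tperm i l) v)))).
    rewrite (bigD1 j) //= mulr2n; congr (_ + _).
      by apply: eq_bigr => l lj; rewrite tpermL.
    rewrite [RHS](eq_bigl (fun i => true && (i != j))) //; apply: eq_bigr => i ij.
    rewrite (bigD1 j) 1?eq_sym //= big1 ?addr0 => [|l /andP[li lj]]; first by rewrite tpermR tpermC.
    by rewrite tpermD ?subrr // eq_sym.
  by move=> i _; rewrite sumrB.
have E1 : xV j (eu v) = \sum_i xV i (xV j (yV i v)) + b *: xV j (T v).
  by rewrite /eu linearD linearZ linear_sum; congr (_ + _); apply: eq_bigr => i _; rewrite /= xVC.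
rewrite E1 /eu -/(T _) xT sumx [b *: (_ + _)]scalerDr.
have opp : b *: \sum_(l | l != j) (xV j (gV (tperm j l) v) - xV l (gV (tperm j l) v))
   = - (b *: \sum_(l | l != j) (xV l (gV (tperm j l) v) - xV j (gV (tperm j l) v))).
  by rewrite -scalerN -sumrN; congr (_ *: _); apply: eq_bigr => l _; rewrite opprB.
rewrite opp -!addrA; congr (_ + _).
by rewrite (addrCA (- _)) addNr addr0 addrC.
Qed.

Lemma Rel_eu ka d f u : (forall w : W, csum W w = ka *: w) -> Rel d f u -> eu u = (d%:R + b * ka) *: u.
Proof.
move=> kW; elim=> {d f u} [w|d|d c f u f' u' _ IH _ IH'|d j f u _ IH].
- rewrite /eu big1 ?add0r => [|i _]; last by rewrite iota_y linear0.
  have Ei : ka *: iota w = \sum_(i : 'I_n) \sum_(j : 'I_n | (j < i)%N) gV (tperm i j) (iota w).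
    transitivity (iota (csum W w)); first by rewrite kW linearZ.
    rewrite csumE linear_sum; apply: eq_bigr => i _.
    by rewrite linear_sum; apply: eq_bigr => j _; rewrite iota_g.
  by rewrite -scalerA Ei.
- by have := eu_lin (-1) 0 0; rewrite !scaler0 addr0 scaleN1r addNr.
- by rewrite eu_lin IH IH' !scalerDr !scalerA (mulrC c).
- by rewrite eu_x IH linearZ /= -natr1 addrAC !scalerDl scale1r.
Qed.

Inductive Ker : V -> Prop :=
| Ker_rel d u : Rel d 0 u -> Ker u
| Ker_lin c u v : Ker u -> Ker v -> Ker (c *: u + v).
Inductive Tot : V -> Prop :=
| Tot_rel d f u : Rel d f u -> Tot u
| Tot_lin c u v : Tot u -> Tot v -> Tot (c *: u + v).

Lemma Ker0 : Ker 0. Proof. exact/(@Ker_rel 0)/Rel_0. Qed.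
Lemma Ker_op (T : V -> V) : linear T -> (forall d u, Rel d 0 u -> Ker (T u)) -> forall u, Ker u -> Ker (T u).
Proof. by move=> Tl TR u; elim=> {u} [d u|c u v _ IH _ IH']; [apply: TR | rewrite Tl; apply: Ker_lin]. Qed.
Lemma Tot_op (T : V -> V) : linear T -> (forall d f u, Rel d f u -> Tot (T u)) -> forall u, Tot u -> Tot (T u).
Proof. by move=> Tl TR u; elim=> {u} [d f u|c u v _ IH _ IH']; [apply: TR | rewrite Tl; apply: Tot_lin]. Qed.

Lemma W_csum : exists ka, forall w : W, csum W w = ka *: w.
Proof. by have [t vt [v vE v0]] := irr_weight irrW; exists (\sum_(x <- wd t) x)%:~R => w; apply: (irr_csum _ irrW (size_wd t) vE v0). Qed.

Lemma W_nz : exists w : W, w != 0.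
Proof. by have [t vt [v vE v0]] := irr_weight irrW; exists v. Qed.

(** [Ker] is a submodule. If it were everything, [iota w] would be a combination of vectors related
    to 0. Such vectors vanish in degree 0 and have Euler eigenvalues d + b ka with d > 0 otherwise,
    so a polynomial not vanishing at b ka would annihilate [iota w]. *)
Lemma Ker_trivial u : Ker u -> u = 0.
Proof.
move: u; have Ky k u : Ker u -> Ker (yV k u).
  apply: Ker_op => // d {}u R.
  case: d R => [|d] R; first by have [-> _] := Rel_Y0 k R; apply: Ker0.
  by apply: (@Ker_rel d); have := Rel_Y k R; rewrite linear0.
case: (V_simple (P := Ker)) => //; first exact: Ker0.
- by move=> c u v; apply: Ker_lin.
- move=> g; apply: Ker_op => [|d u R]; first exact: gV_lin.
  by apply: (@Ker_rel d); have := Rel_g g R; rewrite linear0.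
- move=> j; apply: Ker_op => [|d u R]; first exact: xV_lin.
  by apply: (@Ker_rel d.+1); have := Rel_X j R; rewrite linear0.
move=> all; have [w w0] := W_nz; have [ka kW] := W_csum.
have o0 r : opoly eu r 0 = 0 by have := opoly_is_linear r eu_lin (-1) 0 0; rewrite scaler0 addr0 scaleN1r addNr.
have H u : Ker u -> exists p : {poly K}, p.[b * ka] != 0 /\ opoly eu p u = 0.
  elim=> {u} [d u R|c u v _ [p [p0 pu]] _ [q [q0 qv]]].
    case: d R => [|d] R.
      exists 1; rewrite hornerE oner_neq0 -polyC1 opolyC; split=> //.
      have [_ [w' [/(congr1 (fun x : F W => x (mzero n))) E ->]]] := Rel_Y0 (Ordinal n_gt0) R.
      by move: E; rewrite /cst eqxx => <-; rewrite linear0 scaler0.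
    exists ('X - (d.+1%:R + b * ka)%:P); rewrite !hornerE opprD addrCA subrr addr0 oppr_eq0 pnatr_eq0; split=> //.
    by rewrite (opoly_eigen _ eu_lin (Rel_eu kW R)) !hornerE subrr scale0r.
  exists (p * q); rewrite hornerM mulf_neq0 //; split=> //.
  rewrite (opoly_is_linear _ eu_lin) [X in _ + X]opolyM ?qv ?o0 ?addr0; last exact: eu_lin.
  by rewrite (mulrC p) opolyM ?pu ?o0 ?scaler0 //; apply: eu_lin.
have [p [p0 pw]] := H _ (all (iota w)).
move: pw; rewrite (opoly_eigen _ eu_lin (Rel_eu kW (Rel_cst w))) add0r => /eqP.
rewrite scaler_eq0 (negPf p0) /= => /eqP /iota_inj w00; by rewrite w00 eqxx in w0.
Qed.

Lemma Rel_zero d f : Rel d f 0 -> f = 0.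
Proof.
elim: d f => [|d IH] f R.
  have [_ [w [-> /esym /iota_inj ->]]] := Rel_Y0 (Ordinal n_gt0) R.
  by apply/funext=> a; rewrite /cst; case: ifP.
apply: (Y_detect (Rel_hom R)) => k.
have := Rel_Y k R; rewrite linear0 => /IH; rewrite /YB (Rel_YS R) scaler0 subr0 //.
Qed.

Lemma Tot_all u : Tot u.
Proof.
have [w w0] := W_nz.
case: (@V_simple Tot) => //.
- exact: Tot_rel (Rel_0 0).
- by move=> c x y; apply: Tot_lin.
- by move=> g; apply: Tot_op => [|d f v R]; [apply: gV_lin | apply: Tot_rel (Rel_g g R)].
- by move=> j; apply: Tot_op => [|d f v R]; [apply: xV_lin | apply: Tot_rel (Rel_X j R)].
- move=> k; apply: Tot_op => [|d f v R]; first exact: yV_lin.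
  case: d R => [|d] R; first by have [-> _] := Rel_Y0 k R; apply: Tot_rel (Rel_0 0).
  by apply: Tot_rel (Rel_Y k R).
move=> all0; case/eqP: w0; apply/iota_inj/all0/Tot_rel/Rel_cst.
Qed.

Lemma Rel_sym d f u : Rel d f u -> Rel d (n`!%:R *: eop f) (\sum_(g : 'S_n) gV g u).
Proof.
move=> R; rewrite /eop scalerA mulfV ?scale1r ?pnatr_eq0 -?lt0n ?fact_gt0 //.
by apply: Rel_sum => g _; apply: Rel_g.
Qed.

(** For an invariant h of the model, [YS h] is an invariant of smaller degree, zero by induction;
    [Lg_YS0] then relates h to a vector of [V], whose symmetrization decides. Conversely [V]
    consists of sums of related vectors. *)
Theorem no_invariants : (forall v, \sum_(g : 'S_n) gV g v = 0) <-> (forall d h, Lg b d h -> inv h -> h = 0).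
Proof.
split=> [asph d h Lh hi|noinv v]; last first.
  elim: (Tot_all v) => {v} [d f u R|c u v _ IH _ IH'].
    have := Rel_sym R; rewrite (noinv d (eop f)) ?scaler0 => [/(@Ker_rel d)/Ker_trivial//||].
      exact: (gsub_eop (gsub_Lg b W)) (Rel_Lg R).
    by move=> g; apply: g_eop.
  rewrite (eq_bigr (fun g => c *: gV g u + gV g v)) => [|g _]; last exact: linearP.
  by rewrite big_split /= -scaler_sumr IH IH' scaler0 addr0.
have YSi d' x : inv x -> inv (YS x : F W).
  move=> xi g; rewrite /YS linear_sum [RHS](reindex_perm (g^-1)%g); apply: eq_bigr => i _.
  by rewrite /= gYop xi.
elim: d h Lh hi => [|d IH] h Lh hi; have Yh : YS h = 0.
- by rewrite /YS big1 // => i _; apply/hom_Y0/(Lg_hom Lh).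
- have [u R] := Lg_YS0 Lh Yh; have := Rel_sym R; rewrite asph => /Rel_zero/eqP.
  by rewrite scaler_eq0 pnatr_eq0 -leqn0 leqNgt fact_gt0 /= eop_id // => /eqP.
- apply: IH; last exact: YSi.
  by apply: Lg_sum => i _; apply: Lg_Y.
have [u R] := Lg_YS0 Lh Yh; have := Rel_sym R; rewrite asph => /Rel_zero/eqP.
by rewrite scaler_eq0 pnatr_eq0 -leqn0 leqNgt fact_gt0 /= eop_id // => /eqP.
Qed.
End SimpleQuotient.

(** * The algebra of the statement acting on its simple quotient *)

Section CherednikModules.
Variables (K : numClosedFieldType) (n : nat) (b : K) (lam : seq nat).
Hypothesis n_gt0 : (0 < n)%N.
Local Notation H := (cherednik n (- b)).
Local Notation act := (@hsum_act K n).
Local Notation rel := (@cherednik_rel K n (- b)).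
Local Notation ni := (n%:R^-1 : K).
Implicit Types (g : 'S_n) (i j k l : 'I_n) (a : K).

Definition hS a : H := sscal act rel a.
Definition hG g : H := sgrp act rel g.
Definition hV (z : hsum K n) : H := svec act rel z.

Definition xb_fun j (y : hh K n) : K^o := vsval y j ord0.
Fact xb_fun_lin j : linear (xb_fun j).
Proof. by move=> a y z; rewrite /xb_fun linearP !mxE. Qed.
HB.instance Definition _ j := GRing.isLinear.Build K (hh K n) K^o *:%R (xb_fun j) (xb_fun_lin j).
Definition xb j : hdual K n := linfun (xb_fun j).
Lemma xbE j y : xb j y = vsval y j ord0. Proof. by rewrite lfunE. Qed.
Definition yb k : hh K n := vsproj (sum_zero K n) (delta_mx k ord0 - const_mx ni).

Lemma nK : (n%:R : K) != 0. Proof. by rewrite pnatr_eq0 -lt0n. Qed.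

Lemma ybE k i : vsval (yb k) i ord0 = (i == k)%:R - ni.
Proof.
rewrite vsprojK ?mxE ?andbT // sum_zeroP.
rewrite (eq_bigr (fun i => (i == k)%:R - ni)) => [|l _]; last by rewrite !mxE andbT.
rewrite sumrB (bigD1 k) //= eqxx big1 ?addr0 => [|l /negPf-> //].
by rewrite sumr_const card_ord -[_ *+ n]mulr_natl mulfV ?nK // subrr.
Qed.

Lemma hh_ext (y z : hh K n) : (forall i, vsval y i ord0 = vsval z i ord0) -> y = z.
Proof. by move=> E; apply: val_inj; apply/matrixP=> i j; rewrite (ord1 j) E. Qed.

Lemma hh_sum0 (y : hh K n) : \sum_i vsval y i ord0 = 0.
Proof. by apply/eqP; rewrite -sum_zeroP subvsP. Qed.

Lemma hh_val_sum (I : Type) (r : seq I) (y : I -> hh K n) i : vsval (\sum_(x <- r) y x) i ord0 = \sum_(x <- r) vsval (y x) i ord0.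
Proof. by rewrite linear_sum summxE. Qed.

Lemma hh_dec (y : hh K n) : y = \sum_k vsval y k ord0 *: yb k.
Proof.
apply: hh_ext => i; rewrite hh_val_sum.
rewrite (eq_bigr (fun k => vsval y k ord0 * (i == k)%:R - vsval y k ord0 * ni)) => [|k _]; last by rewrite linearZ !mxE ybE mulrBr.
rewrite sumrB -mulr_suml hh_sum0 mul0r subr0 (bigD1 i) //= eqxx mulr1 big1 ?addr0 // => k ki.
by rewrite eq_sym (negPf ki) mulr0.
Qed.

Lemma hdual_dec (x : hdual K n) : x = \sum_j x (yb j) *: xb j.
Proof.
apply/lfunP=> y; rewrite {1}(hh_dec y) linear_sum sum_lfunE; apply: eq_bigr => j _.
by rewrite linearZ scale_lfunE xbE /GRing.scale /= mulrC.
Qed.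

Lemma hdual_act_xb g j : hdual_act g (xb j) = xb ((g^-1)%g j).
Proof. by apply/lfunP=> y; rewrite comp_lfunE !xbE hactE. Qed.

Lemma hSD a a' : hS (a + a') = hS a + hS a'.
Proof. by rewrite /hS /sscal -clsD; apply/clsP/cong_scalD. Qed.
Lemma hSM a a' : hS (a * a') = hS a * hS a'.
Proof. by rewrite /hS /sscal -clsM; apply/clsP/cong_scalM. Qed.
Lemma hS1 : hS 1 = 1. Proof. by []. Qed.
Lemma hSC a (z : H) : hS a * z = z * hS a.
Proof. by rewrite -(repK z) /hS /sscal -!clsM; apply/clsP/cong_scalC. Qed.
Lemma hVP a u v : hV (a *: u + v) = hS a * hV u + hV v.
Proof. by rewrite /hV /svec /hS /sscal -clsM -clsD; apply/clsP/cong_vec. Qed.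
Lemma hGV g v : hG g * hV v = hV (act g v) * hG g.
Proof. by rewrite /hG /hV /sgrp /svec -!clsM; apply/clsP/cong_smash. Qed.
Lemma cls_tcomm s t : cls act rel (tcomm s t) = (cls act rel s : H) * cls act rel t - cls act rel t * cls act rel s.
Proof. by rewrite /tcomm clsD clsM -[X in _ + X]cls_opp clsM. Qed.

Variable L : lmodType H.
(** A second name for the type [L], carrying the K-linear structure given by the scalars inside the
    algebra. *)
Definition LK : Type := L.
HB.instance Definition _ := GRing.Zmodule.on LK.
Definition kscale a (v : LK) : LK := hS a *: (v : L).
Fact kscaleA a a' v : kscale a (kscale a' v) = kscale (a * a') v.
Proof. by rewrite /kscale scalerA hSM. Qed.
Fact kscale1 : left_id 1 kscale. Proof. by move=> v; rewrite /kscale hS1 scale1r. Qed.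
Fact kscaleDr : right_distributive kscale +%R. Proof. by move=> a u v; apply: scalerDr. Qed.
Fact kscaleDl v : {morph kscale^~ v : a a' / a + a'}.
Proof. by move=> a a'; rewrite /kscale hSD scalerDl. Qed.
HB.instance Definition _ := GRing.Zmodule_isLmodule.Build K LK kscaleA kscale1 kscaleDr kscaleDl.

Definition opL (z : H) (v : LK) : LK := z *: (v : L).
Lemma opL_lin z : linear (opL z).
Proof.
move=> a u v; rewrite /opL [LHS]scalerDr; congr (_ + _).
change (z *: (hS a *: (u : L)) = hS a *: (z *: (u : L))); by rewrite !scalerA hSC.
Qed.
Lemma opLM z z' v : opL (z * z') v = opL z (opL z' v). Proof. by rewrite /opL scalerA. Qed.
Lemma opLD z z' v : opL (z + z') v = opL z v + opL z' v. Proof. exact: (@scalerDl _ L). Qed.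
Lemma opLS a v : opL (hS a) v = a *: v. Proof. by []. Qed.
Lemma opLN z v : opL (- z) v = - opL z v. Proof. exact: (@scaleNr _ L). Qed.
Lemma opL_sum (I : Type) (r : seq I) (P : pred I) (z : I -> H) v : opL (\sum_(x <- r | P x) z x) v = \sum_(x <- r | P x) opL (z x) v.
Proof. exact: (@scaler_suml _ L). Qed.

Definition gL g := opL (hG g).
Definition xL j := opL (hV (0, xb j)).
Definition yL k := opL (hV (yb k, 0)).

Lemma hV0 : hV 0 = 0.
Proof.
have := hVP 1 0 0; rewrite scaler0 addr0 hS1 mul1r => /eqP.
by rewrite -subr_eq subrr eq_sym => /eqP.
Qed.

Lemma gxL g j v : gL g (xL j v) = xL ((g^-1)%g j) (gL g v).
Proof.
rewrite /gL /xL -opLM hGV opLM; congr (opL (hV _) _).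
by rewrite /hsum_act /= linear0 hdual_act_xb.
Qed.
Lemma xLC i j v : xL i (xL j v) = xL j (xL i v).
Proof.
rewrite /xL -!opLM; congr (opL _ v); apply/eqP; rewrite -subr_eq0; apply/eqP.
have := cls_tcomm (xgen (xb i)) (xgen (xb j)); rewrite /hV /svec => <-.
by apply/clsP/cong_extra/rel_xx.
Qed.
Lemma hV_sum (z : 'I_n -> hsum K n) : hV (\sum_j z j) = \sum_j hV (z j).
Proof.
apply: (big_morph hV) => [u v|]; last exact: hV0.
by have := hVP 1 u v; rewrite scale1r hS1 mul1r.
Qed.
Lemma xLsum v : \sum_j xL j v = 0.
Proof.
rewrite /xL -opL_sum -hV_sum (_ : \sum_j _ = 0 :> hsum K n) ?hV0; first exact: scale0r.
apply/eqP; rewrite -pair_eqE /= /pair_eq; apply/andP; split; apply/eqP.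
  by rewrite (big_morph (fst : hsum K n -> hh K n) (fun _ _ => erefl) erefl) big1.
rewrite (big_morph (snd : hsum K n -> hdual K n) (fun _ _ => erefl) erefl) /=; apply/lfunP=> y.
by rewrite sum_lfunE zero_lfunE -[RHS](hh_sum0 y); apply: eq_bigr => j _; rewrite xbE.
Qed.

Lemma cls_bigAdd (I : finType) (P : pred I) (t : I -> term K 'S_n (hsum K n)) :
  cls act rel (\big[@Add _ _ _/Scal 0]_(x | P x) t x) = \sum_(x | P x) (cls act rel (t x) : H).
Proof. exact: (big_morph (cls act rel : _ -> H) (fun s t => clsD act rel s t) erefl). Qed.

(** Turns the sum over reflections in the defining relation into the commutators of coordinates.
    Doubling makes the sum run over ordered pairs, of which only those meeting both k and j
    contribute. *)
Lemma pair_sum (V : lmodType K) k j (G : 'I_n -> 'I_n -> V) : (forall i l, G i l = G l i) ->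
  \sum_(p : 'I_n * 'I_n | (p.1 < p.2)%N) (((p.1 == k)%:R - (p.2 == k)%:R) * ((p.1 == j)%:R - (p.2 == j)%:R)) *: G p.1 p.2
  = if k == j then \sum_(l | l != k) G k l else - G k j.
Proof.
move=> Gs; pose c i l : K := ((i == k)%:R - (l == k)%:R) * ((i == j)%:R - (l == j)%:R).
have cs i l : c i l *: G i l = c l i *: G l i.
  by rewrite Gs /c -[(i == k)%:R - _]opprB -[(i == j)%:R - _]opprB mulrNN.
have two0 : (2%:R : K) != 0 by rewrite pnatr_eq0.
apply: (scalerI two0); rewrite !scaler_nat.
rewrite -(pair_big_dep xpredT (fun i l => (i < l)%N) (fun i l => c i l *: G i l)) /=.
rewrite (exchange_big_dep predT) //=.
rewrite (eq_bigr (fun i => \sum_(l : 'I_n | (l < i)%N) c i l *: G i l)) => [|i _]; last first.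
  by apply: eq_bigr => l _; rewrite cs.
rewrite -(pairsum_sym cs) (bigD1 k) //= mulr2n.
have [jk|kj] := eqVneq k j; [subst j|]; congr (_ + _).
- by apply: eq_bigr => l lk; rewrite /c eqxx (negPf lk) subr0 mulr1 scale1r.
- rewrite [RHS](eq_bigl (fun i => true && (i != k))) //; apply: eq_bigr => i ik.
  rewrite (bigD1 k) 1?eq_sym //= big1 ?addr0 => [|l /andP[li lk]].
    by rewrite /c eqxx (negPf ik) sub0r mulrNN mulr1 scale1r Gs.
  by rewrite /c (negPf ik) (negPf lk) subrr mul0r scale0r.
- rewrite (bigD1 j) 1?eq_sym //= big1 ?addr0 => [|l /andP[lk lj]].
    by rewrite /c !eqxx (negPf kj) eq_sym (negPf kj) subr0 sub0r mul1r scaleN1r.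
  by rewrite /c (negPf kj) (negPf lj) subrr mulr0 scale0r.
- rewrite (bigD1 j) 1?eq_sym //= [X in _ + X]big1 ?addr0 => [|i /andP[ik ij]].
    rewrite (bigD1 k) //= big1 ?addr0 => [|l /andP[lj lk]].
      by rewrite /c !eqxx (negPf kj) eq_sym (negPf kj) subr0 sub0r mulr1 scaleN1r Gs.
    by rewrite /c eq_sym (negPf kj) (negPf lk) subrr mul0r scale0r.
  rewrite big1 // => l li; rewrite /c (negPf ik) (negPf ij) !sub0r mulrNN.
  have [->|lk] := eqVneq l k; first by rewrite (negPf kj) mulr0 scale0r.
  by rewrite mul0r scale0r.
Qed.

Lemma yxL k j v : yL k (xL j v) = xL j (yL k v) + (CV b gL k j v - ni *: v).
Proof.
have R : hV (yb k, 0) * hV (0, xb j) - hV (0, xb j) * hV (yb k, 0) =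
   hS (xb j (yb k)) + hS b * \sum_(p : 'I_n * 'I_n | (p.1 < p.2)%N)
     hS (Defs.root p.1 p.2 (yb k) * xb j (coroot p.1 p.2)) * hG (tperm p.1 p.2).
  have := cls_tcomm (ygen (yb k)) (xgen (xb j)); rewrite /hV /svec => <-.
  transitivity (cls act rel (Add (Scal (xb j (yb k)))
      (Mul (Scal (- - b))
        (\big[@Add _ _ _/Scal 0]_(ij : 'I_n * 'I_n | (ij.1 < ij.2)%N)
           Mul (Scal (Defs.root ij.1 ij.2 (yb k) * xb j (coroot ij.1 ij.2)))
               (Grp (tperm ij.1 ij.2))))) : H).
    by apply/clsP/cong_extra/rel_yx.
  rewrite clsD clsM cls_bigAdd opprK; congr (_ + _ * _); apply: eq_bigr => p _; exact: clsM.
have -> : yL k (xL j v) = xL j (yL k v) + opL (hV (yb k, 0) * hV (0, xb j) - hV (0, xb j) * hV (yb k, 0)) v.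
  by rewrite opLD opLN !opLM addrC subrK.
rewrite R opLD opLS opLM opLS opL_sum; congr (_ + _).
rewrite (eq_bigr (fun p : 'I_n * 'I_n => (((p.1 == k)%:R - (p.2 == k)%:R) * ((p.1 == j)%:R - (p.2 == j)%:R)) *: gL (tperm p.1 p.2) v)) => [|p _]; last first.
  rewrite opLM opLS Defs.rootE xbE corootE !ybE !mxE !andbT opprB addrA subrK; congr ((_ * _) *: _).
  by rewrite ![j == _]eq_sym.
rewrite (@pair_sum _ k j (fun i l => gL (tperm i l) v)) => [|i l]; last by rewrite tpermC.
rewrite xbE ybE /CV eq_sym; case: eqP => _; last by rewrite sub0r scalerN scaleNr addrC.
by rewrite scalerBl scale1r addrAC.
Qed.

Hypothesis L_irr : irreducible_module L.

(** The vectors [yb k] and [xb j] span h and its dual, so stability under their actions is stability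
    under the whole algebra. *)
Lemma LK_simple (P : LK -> Prop) : P 0 -> (forall c u v, P u -> P v -> P (c *: u + v)) ->
  (forall g v, P v -> P (gL g v)) -> (forall j v, P v -> P (xL j v)) -> (forall k v, P v -> P (yL k v)) ->
  (forall v, P v -> v = 0) \/ (forall v, P v).
Proof.
move=> P0 Plin Pg Px Py; have [_ irrL] := L_irr.
have PZ c v : P v -> P (c *: v) by move=> Pv; rewrite -[c *: v]addr0; apply: Plin.
have PD u v : P u -> P v -> P (u + v) by move=> Pu Pv; rewrite -[u]scale1r; apply: Plin.
have Psum (z : 'I_n -> LK) : (forall i, P (z i)) -> P (\sum_i z i) by move=> Pz; apply: big_ind.
have Pop z v : P v -> P (opL z v).
  move=> Pv; rewrite -(repK z); elim: (rep z) v Pv => [a|g|[y x]|s IHs t IHt|s IHs t IHt] v Pv.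
  - exact: PZ.
  - exact: Pg.
  - have -> : cls act rel (Vec (y, x)) = \sum_k hS (vsval y k ord0) * hV (yb k, 0) + \sum_j hS (x (yb j)) * hV (0, xb j).
      have e1 c u : hS c * hV u = hV (c *: u) by have := hVP c u 0; rewrite hV0 !addr0.
      rewrite (eq_bigr (fun k => hV (vsval y k ord0 *: (yb k, 0)))) => [|k _]; last exact: e1.
      rewrite [X in _ + X](eq_bigr (fun j => hV (x (yb j) *: (0, xb j)))) => [|k _]; last exact: e1.
      rewrite -!hV_sum; have := hVP 1 (\sum_k vsval y k ord0 *: (yb k, 0 : hdual K n)) (\sum_j x (yb j) *: (0 : hh K n, xb j)).
      rewrite scale1r hS1 mul1r => <-; rewrite /hV /svec; congr (cls _ _ (Vec _)).
      apply: injective_projections => /=.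
        rewrite !(big_morph (fst : hsum K n -> hh K n) (fun _ _ => erefl) erefl) /= [X in _ + X]big1 ?addr0 => [|i _]; last exact: scaler0.
        exact: hh_dec.
      rewrite !(big_morph (snd : hsum K n -> hdual K n) (fun _ _ => erefl) erefl) /= big1 ?add0r => [|i _]; last exact: scaler0.
      exact: hdual_dec.
    by rewrite opLD !opL_sum; apply: PD; apply: Psum => i; rewrite opLM; apply: PZ; [apply: Py | apply: Px].
  - by rewrite clsD opLD; apply: PD; [apply: IHs | apply: IHt].
  - by rewrite clsM opLM; apply/IHs/IHt.
pose S : {pred L} := [pred v | `[< P v >]].
have S_sub : submod_closed S.
  split; first by rewrite inE; apply/asboolP.
  move=> z u v; rewrite !inE => /asboolP Pu /asboolP Pv; apply/asboolP; apply: PD => //; exact: Pop.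
case: (irrL S S_sub) => E; [left => v Pv | right => v].
  by have := E v; rewrite !inE asboolT // => /esym/eqP.
by have := E v; rewrite !inE => /asboolP.
Qed.

Variable f : {linear standard_module n lam (- b) -> L}.
Hypothesis f_surj : forall v, exists u, f u = v.
Local Notation SM := (standard_module n lam (- b)).
Local Notation pr := (pi_rep K n lam).

Definition iota0 (w : pr) : LK := f (tcls _ (TPure 1 w)).

Lemma tpure_bal (z : borel K n) (w : pr) : tcls (@borel_incl K n (- b)) (TPure (borel_incl (- b) z) w) = tcls (@borel_incl K n (- b)) (TPure (1 : H) (z *: w)) :> SM.
Proof. by rewrite -[borel_incl _ z]mul1r; apply/tclsP/tcong_bal. Qed.

Lemma iota0_op (t : term K 'S_n (hh K n)) (w : pr) :
  iota0 (pi_eval t w) = opL (cls act rel (term_map (fun y : hh K n => (y, 0) : hsum K n) t)) (iota0 w).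
Proof.
rewrite /opL /iota0 -linearZ; congr (f _).
have -> : (cls act rel (term_map (fun y : hh K n => (y, 0) : hsum K n) t) : H) *: (tcls _ (TPure 1 w) : SM)
  = tcls _ (TPure (cls act rel (term_map (fun y : hh K n => (y, 0) : hsum K n) t) * 1) w) by exact: tcls_scal.
by rewrite mulr1 -borel_inclE tpure_bal; congr (tcls _ (TPure _ _)); rewrite -pi_actE.
Qed.
Lemma iota0D u w : iota0 (u + w) = iota0 u + iota0 w.
Proof.
rewrite /iota0 -linearD; congr (f _).
have -> : tcls _ (TPure (1 : H) (u + w)) = tcls _ (TAdd (TPure 1 u) (TPure 1 w)) :> SM by apply/tclsP/tcong_pureDr.
by symmetry; apply: tcls_add.
Qed.
Lemma iota0_lin a (u w : subvs_of (specht K n lam)) : iota0 (a *: u + w : subvs_of _) = a *: iota0 u + iota0 w.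
Proof. by rewrite [LHS]iota0D; congr (_ + _); exact: (iota0_op (Scal a) u). Qed.
Lemma iota0_g g w : iota0 (pi_grp g w) = gL g (iota0 w).
Proof. exact: (iota0_op (Grp g) w). Qed.
Lemma iota00 : iota0 0 = 0.
Proof. by have := iota0D 0 0; rewrite addr0 => /eqP; rewrite -subr_eq subrr => /eqP. Qed.
Lemma iota0_y k w : yL k (iota0 w) = 0.
Proof. by rewrite -[RHS]iota00; symmetry; exact: (iota0_op (Vec (yb k)) w). Qed.

Lemma iota0_nz : exists w, iota0 w != 0.
Proof.
apply: contrapT => no; have z w : iota0 w = 0 by apply/eqP/negPn/negP => nz; apply: no; exists w.
have [[v v0] _] := L_irr; case/eqP: v0; have [u <-] := f_surj v; rewrite -(trepK u).
elim: (trep u) => [|t IH|s IHs t IHt|a w].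
- exact: (linear0 f).
- by have -> : tcls _ (TOpp t) = - (tcls _ t : SM) by [symmetry; apply: tcls_opp]; rewrite linearN IH oppr0.
- by have -> : tcls _ (TAdd s t) = (tcls _ s : SM) + tcls _ t by [symmetry; apply: tcls_add]; rewrite linearD IHs IHt addr0.
have -> : tcls _ (TPure a w) = (a : H) *: (tcls _ (TPure 1 w) : SM).
  by apply: etrans (esym (tcls_scal _ _ _)); rewrite /= mulr1.
by rewrite linearZ /= -/(iota0 w) z scaler0.
Qed.

Lemma asphE : aspherical L <-> forall v : LK, \sum_(g : 'S_n) gL g v = 0.
Proof.
have fa0 : (n`!%:R : K) != 0 by rewrite pnatr_eq0 -lt0n fact_gt0.
have E (v : L) : sym_idem n (- b) *: v = (n`!%:R)^-1 *: (\sum_(g : 'S_n) gL g v) :> LK.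
  by rewrite /sym_idem -scalerA scaler_suml.
split=> [[_ H0] v|H0].
  have E2 : (n`!%:R)^-1 *: (\sum_(g : 'S_n) gL g v) = 0 :> LK by rewrite -E; apply: H0.
  by apply: (scalerI (invr_neq0 fa0)); rewrite scaler0.
by split=> [|v]; [case: L_irr | rewrite E H0; exact: scaler0].
Qed.

(** The map from the Specht space to [L] is nonzero, because its image generates [L]. An irreducible
    [T] is taken in a stable complement of its kernel, so that it embeds in [L] as a space of
    vectors killed by h. *)
Theorem link : exists (T : {vspace (reg K n)}) (st : @stable K n (reg K n) T),
  [/\ ((T : {vspace {ffun 'S_n -> K^o}}) <= specht K n lam)%VS, T != 0%VS, irr (subrep st) &
   aspherical L <-> forall d (h : F (subrep st)), Lg b d h -> inv h -> h = 0].
Proof.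
pose S : {vspace (reg K n)} := specht K n lam.
have stS : stable S := @stable_specht K n lam.
pose io (x : reg K n) : LK := iota0 (vsproj (specht K n lam) x).
have io_lin : linear io.
  by move=> a x y; rewrite /io linearP; apply: iota0_lin.
have io_g g x : x \in S -> io (sact (reg K n) g x) = gL g (io x).
  move=> xS; rewrite /io -iota0_g; congr iota0; rewrite /pi_grp regE vsprojK //.
have io0 : io 0 = 0 by have := io_lin (-1) 0 0; rewrite !scaler0 addr0 scaleN1r addNr.
pose ZP x := x \in S /\ io x = 0.
have Zl : linpred ZP.
  split; first by split; [apply: mem0v | ].
  by move=> a x y [xS x0] [yS y0]; split; [apply: memvD => //; apply: memvZ | rewrite io_lin x0 y0 scaler0 addr0].
have Zp x := pspaceP x Zl; set Z := pspace ZP in Zp.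
have stZ : @stable K n (reg K n) Z.
  move=> g x /Zp[xS x0]; apply/Zp; split; first exact: stS.
  by rewrite io_g // x0; apply: (linear0 (HB.pack (gL g) (GRing.isLinear.Build K LK LK *:%R (gL g) (opL_lin _)) : {linear LK -> LK})).
have [P [Pg PZ PId]] := maschke stZ.
pose Cm := (S :&: lker P)%VS.
have stC : @stable K n (reg K n) Cm.
  by move=> g x; rewrite !memv_cap !memv_ker => /andP[xS /eqP x0]; rewrite stS //= -Pg x0 linear0.
have C0 : Cm != 0%VS.
  have [w w0] := iota0_nz; pose x : reg K n := vsval (w : subvs_of (specht K n lam)).
  have xS : x \in S by apply: subvsP.
  have xw : io x = iota0 w by rewrite /io vsvalK.
  apply: contraNneq w0 => E; have : x - P x \in Cm.
    rewrite memv_cap memv_ker linearB /= (PId (P x)) ?subrr ?eqxx // andbT rpredB //.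
    by have /Zp[] := PZ x.
  by rewrite E memv0 subr_eq0 => /eqP xP; have /Zp[_] := PZ x; rewrite -xP xw => ->.
have [T [stT T0 TC Tmin]] := minimal_stable stC C0.
have TS x : x \in T -> x \in S by move=> xT; have := subvP TC _ xT; rewrite memv_cap => /andP[].
exists T, stT; split=> //; first by apply/subvP.
  exact: subrep_irr.
pose iota (w : subrep stT) : LK := io (vsval w).
have iota_lin : linear iota by move=> a u w; rewrite /iota linearP io_lin.
have iota_inj w : iota w = 0 -> w = 0.
  move=> w0; apply: val_inj; rewrite linear0.
  have wT : vsval w \in T := subvsP w; have := subvP TC _ wT; rewrite memv_cap memv_ker => /andP[wS /eqP <-].
  by apply/esym/PId/Zp.
have iota_g g w : gL g (iota w) = iota (sact (subrep stT) g w).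
  by rewrite /iota -io_g; [congr io; rewrite subrepE | apply/TS/subvsP].
have iota_y k w : yL k (iota w) = 0 by apply: iota0_y.
rewrite asphE.
refine (@no_invariants K n b (subrep stT) n_gt0 LK gL xL yL iota _ _ _ iota_lin gxL xLC xLsum yxL iota_g iota_y iota_inj LK_simple _).
- by move=> g; apply: opL_lin.
- by move=> g; apply: opL_lin.
- by move=> g; apply: opL_lin.
- exact: subrep_irr.
Qed.
End CherednikModules.

(** * Codes *)

(** A multiset of at most n exponents is read off from the digits in base n + 1: no digit exceeds n,
    so nothing is carried. *)
Lemma digits_inj n (s s' : seq nat) : (size s <= n)%N -> (size s' <= n)%N ->
  (\sum_(e <- s) n.+1 ^ e = \sum_(e <- s') n.+1 ^ e)%N -> perm_eq s s'.
Proof.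
have [E] := ubnPleq (\max_(e <- s ++ s') e.+1)%N.
elim: E s s' => [|E IH] s s'.
  have nil (t : seq nat) : (\max_(e <- t) e.+1 <= 0)%N -> t = [::] by case: t => // x t; rewrite big_cons geq_max.
  by move=> /nil; case: s => // ; case: s'.
move=> mx ns ns' Es.
have split0 (t : seq nat) : (\sum_(e <- t) n.+1 ^ e = count_mem 0%N t + n.+1 * \sum_(e <- map predn (filter (leq 1) t)) n.+1 ^ e)%N.
  elim: t => [|x t IHt] /=; first by rewrite !big_nil muln0.
  rewrite big_cons IHt; case: x => [|x] /=; first by rewrite expn0 addnA.
  by rewrite add0n big_cons mulnDr expnS; lia.
have c0 : count_mem 0%N s = count_mem 0%N s'.
  have := congr1 (fun x => x %% n.+1)%N Es; rewrite /= (split0 s) (split0 s') !(mulnC n.+1) ![(count_mem _ _ + _)%N]addnC !modnMDl !modn_small //.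
    exact: leq_ltn_trans (count_size _ _) _.
  exact: leq_ltn_trans (count_size _ _) _.
have szp (t : seq nat) : (size t <= n)%N -> (size (map predn (filter (leq 1) t)) <= n)%N.
  by move=> tn; rewrite size_map size_filter; apply: leq_trans (count_size _ _) tn.
have Ep : perm_eq (map predn (filter (leq 1) s)) (map predn (filter (leq 1) s')).
  apply: IH; try exact: szp; last first.
    move: Es; rewrite (split0 s) (split0 s') c0 => /addnI/eqP; rewrite eqn_pmul2l // => /eqP//.
  apply/bigmax_leqP_seq => x; rewrite mem_cat => xin _.
  have xs : x.+1 \in s ++ s'.
    by rewrite mem_cat; case/orP: xin => /mapP[y]; rewrite mem_filter => /andP[y1 yt] ->; rewrite prednK // yt ?orbT.
  by move/bigmax_leqP_seq: mx => /(_ _ xs isT); rewrite ltnS.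
have sK (t : seq nat) : map succn (map predn (filter (leq 1) t)) = filter (leq 1) t.
  by rewrite -map_comp map_id_in // => x; rewrite mem_filter => /andP[x1 _] /=; rewrite prednK.
have := perm_map succn Ep; rewrite !sK => Ef.
apply/seq.permP => P.
have cnt1 (t : seq nat) : count P t = (P 0%N * count_mem 0%N t + count P (filter (leq 1) t))%N.
  elim: t => [|x t IHt] /=; first by rewrite muln0.
  by case: x => [|x] /=; rewrite IHt; [rewrite mulnDr muln1 addnA | rewrite add0n addnCA].
by rewrite (cnt1 s) (cnt1 s') c0 (seq.permP Ef).
Qed.

Section Codes.
Variables (K : numClosedFieldType) (n m r : nat).
Hypothesis m0 : (0 < m)%N.
Local Notation b := (r%:R / m%:R : K).
Implicit Types (x : mi n) (w : seq int).

Definition code x w : seq nat := [seq (m * x i + r * `|(w`_i + n%:Z)%R|)%N | i <- enum 'I_n].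
(** Recovers the eigenvalue a_i + b w_i from the code m a_i + r (w_i + n), where the shift by n
    keeps codes nonnegative. *)
Definition zeta (e : nat) : K := (e%:R - (r * n)%:R) / m%:R.

Lemma mK : (m%:R : K) != 0. Proof. by rewrite pnatr_eq0 -lt0n. Qed.

Lemma zeta_code (be : nat) (a : int) : `|a| <= n%:Z ->
  be%:R + b * a%:~R = zeta (m * be + r * `|(a + n%:Z)%R|)%N.
Proof.
move=> an; rewrite /zeta; have aE : a = (`|(a + n%:Z)%R|%N)%:Z - n%:Z by lia.
rewrite {1}aE rmorphB /= !natrD !natrM !pmulrn; field; exact: mK.
Qed.

Lemma chi_zeta x w p : size w = n -> all (fun e => `|e| <= n%:Z) w -> chi x b p w = \sum_(e <- code x w) p.[zeta e].
Proof.
move=> sw /allP wb; rewrite /chi /code big_map big_enum; apply: eq_bigr => i _.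
by rewrite zeta_code //; apply: wb; apply: mem_nth; rewrite sw.
Qed.

Lemma code_poly E : exists p : {poly K}, forall e, (e < E)%N -> p.[zeta e] = (n.+1 ^ e)%:R.
Proof.
have zi : injective zeta.
  move=> e e' /(mulIf (invr_neq0 mK))/addIr/eqP; by rewrite eqr_nat => /eqP.
have ex (e : 'I_E) := sep_poly (zeta e) [seq zeta e' | e' <- iota 0 E].
pose P e := sval (cid (ex e)).
have PP e : (P e).[zeta e] = 1 /\ forall z, z \in [seq zeta e' | e' <- iota 0 E] -> z != zeta e -> (P e).[z] = 0 by rewrite /P; case: cid.
exists (\sum_(e < E) (n.+1 ^ e)%:R *: P e) => e eE.
rewrite horner_sum (bigD1 (Ordinal eE)) //= hornerZ (proj1 (PP (Ordinal eE))) mulr1 big1 ?addr0 // => e' ne.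
rewrite hornerZ (proj2 (PP e')) ?mulr0 //; first by apply/mapP; exists e; rewrite ?mem_iota.
by apply: contra_neq ne => /zi E'; apply: val_inj.
Qed.

(** Interpolating the values (n+1)^e at the points [zeta e], for e up to the bound m D + 2 r n on
    codes in degree D, makes the power sum of [p] an integer whose digits list the codes. *)
Lemma code_sep D : exists p : {poly K}, forall d d' (x : midx n d) (x' : midx n d') (t t' : wtT n), (d <= D)%N -> (d' <= D)%N ->
  chi (tomi x) b p (wd t) = chi (tomi x') b p (wd t') -> perm_eq (code (tomi x) (wd t)) (code (tomi x') (wd t')).
Proof.
have [p pE] := code_poly (m * D + r * n.*2).+1.
exists p => d d' x x' t t' dD d'D; rewrite !chi_zeta ?size_wd ?wd_bound //.
have E d1 (y : midx n d1) (u : wtT n) : (d1 <= D)%N ->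
    \sum_(e <- code (tomi y) (wd u)) p.[zeta e] = (\sum_(e <- code (tomi y) (wd u)) n.+1 ^ e)%:R.
  move=> d1D; rewrite natr_sum; apply: eq_big_seq => _ /mapP[i _ ->]; apply: pE; rewrite ltnS; apply: leq_add.
    rewrite leq_mul2l; apply/orP; right; apply: leq_trans d1D.
    by apply: leq_trans (_ : mdg (tomi y) <= _)%N; [rewrite /mdg (bigD1 i) //= leq_addr | rewrite mdg_tomi].
  rewrite leq_mul2l; apply/orP; right.
  have : `|(wd u)`_i| <= n%:Z by apply: (allP (wd_bound u)); apply: mem_nth; rewrite size_wd.
  by move: ((wd u)`_i) => a; lia.
rewrite !E // => /eqP; rewrite eqr_nat => /eqP; apply: digits_inj; by rewrite size_map size_enum_ord.
Qed.

Lemma code_chi x x' w w' p : size w = n -> size w' = n -> all (fun e => `|e| <= n%:Z) w -> all (fun e => `|e| <= n%:Z) w' ->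
  perm_eq (code x w) (code x' w') -> chi x b p w = chi x' b p w'.
Proof. by move=> sw sw' wb wb' E; rewrite !chi_zeta // (perm_big _ E). Qed.
End Codes.

(** The conditions make [A] an interval with upper end t. Removing t from [A], and t or else any
    element from [B], lowers the bound to t - 1. *)
Lemma top_sum (A B : seq int) (t : int) : uniq A -> uniq B -> size A = size B ->
  all (fun c => c <= t) A -> all (fun c => c <= t) B -> (forall c, c \in A -> c < t -> c + 1 \in A) ->
  \sum_(c <- B) c <= \sum_(c <- A) c.
Proof.
have [k] := ubnP (size A); elim: k A B t => // k IH A B t kA uA uB AB At Bt up.
have [A0|A0] := eqVneq A [::]; first by case: B AB {uB Bt} => [|//]; rewrite A0.
have tA : t \in A.
  have [c cA] : exists c, c \in A by case: A A0 {kA uA AB At up} => // c A _; exists c; rewrite inE eqxx.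
  have [d] := ubnP `|(t - c)%R|%N; elim: d c cA => // d IHd c cA cd.
  have ct := allP At c cA; have [<-//|ne] := eqVneq c t.
  have lt : c < t by rewrite lt_neqAle ne.
  by apply: (IHd (c + 1)); [apply: up | move: cd lt; clear; lia].
have [y [yB yt Byt]] : exists y, [/\ y \in B, y <= t & all (fun c => c <= t - 1) (rem y B)].
  have [tB|tB] := boolP (t \in B).
    exists t; split=> //; apply/allP=> c; rewrite mem_rem_uniq // inE => /andP[ct cB].
    have := allP Bt c cB; move: ct; clear; lia.
  case: B AB uB Bt tB => [|y B] AB uB Bt tB; first by case: A A0 AB {kA uA At up tA}.
  exists y; rewrite inE eqxx; split=> //; first by case/andP: Bt.
  apply/allP=> c /mem_rem cB; have := allP Bt c cB; have : c != t by apply: contraNneq tB => <-.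
  clear; lia.
rewrite (big_rem t tA) (big_rem y yB) /=; apply: lerD => //.
apply: (IH _ _ (t - 1)); rewrite ?rem_uniq ?size_rem ?AB //.
- by have : (0 < size A)%N by [case: A A0 {uA At up tA kA AB}]; move: kA; rewrite AB; lia.
- apply/allP=> c; rewrite mem_rem_uniq // inE => /andP[ct cA]; have := allP At c cA; move: ct; clear; lia.
- move=> c; rewrite !mem_rem_uniq // !inE => /andP[ct cA] lt; rewrite up ?andbT //; move: lt; clear; lia.
Qed.

Section ValidWords.
Variables (n : nat) (w : seq int).
Hypothesis (sw : size w = n) (vw : valid w).
Implicit Types (i j l : 'I_n).

Lemma valid_at j : addable (take j w) w`_j.
Proof. by have := allP vw j; rewrite mem_iota sw add0n /= ltn_ord; apply. Qed.

Lemma take_mem j (a : int) : a \in take j w -> exists i, (i < j)%N /\ w`_i = a.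
Proof.
have jw : (j < size w)%N by rewrite sw.
move=> /(nthP 0)[x]; rewrite size_takel ?(ltnW jw) // => xj; rewrite nth_take // => wx.
by exists (Ordinal (ltn_trans xj (ltn_ord j))).
Qed.

Lemma valid_pos j : 0 < w`_j -> exists i, (i < j)%N /\ w`_i = w`_j - 1.
Proof.
move=> pos; apply: take_mem; have /andP[_ /eqP E] := valid_at j.
by rewrite -has_pred1 has_count -/(cnt _ _) E pos addn1.
Qed.

Lemma valid_twice i j : (i < j)%N -> w`_i = w`_j -> exists l, [/\ (i <= l)%N, (l < j)%N & w`_l = w`_j + 1].
Proof.
move=> ij E; have /andP[/eqP Ej _] := valid_at j; have /andP[/eqP Ei _] := valid_at i.
have jw : (j < size w)%N by rewrite sw.
set D := drop i (take j w).
have tk : take j w = take i w ++ D by rewrite -[LHS](cat_take_drop i) take_takel // ltnW.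
have dr : D = w`_j :: drop i.+1 (take j w).
  by rewrite /D (drop_nth 0) ?nth_take ?E // size_takel // ltnW.
have : w`_j + 1 \in D.
  rewrite -has_pred1 has_count -/(cnt D _); rewrite E in Ei; move: Ej; rewrite tk !cnt_cat Ei.
  have : (0 < cnt D w`_j)%N by rewrite dr /cnt /= eqxx.
  move: (cnt D _) (cnt D _) (cnt (take i w) _) => x y z; lia.
rewrite /D => /(nthP 0)[x]; rewrite size_drop size_takel ?(ltnW jw) // => xj; rewrite nth_drop nth_take; last by lia.
have ln : (i + x < n)%N by have := ltn_ord j; lia.
by move=> wx; exists (Ordinal ln); split=> //=; lia.
Qed.
End ValidWords.

(* Moving the letter of smallest key to the front only crosses far letters. *)
Lemma insertion_sort (T : eqType) (P : seq int -> Prop) (ct : T -> int) (key : T -> nat) (s : seq T) (w : seq int) :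
  swap_closed P -> pairwise (fun x y => (key y < key x)%N ==> far (ct x) (ct y)) s -> P (w ++ map ct s) ->
  exists s', [/\ perm_eq s' s, sorted (fun x y => (key x <= key y)%N) s' & P (w ++ map ct s')].
Proof.
move=> sw; elim: s w => [|x s IH] w; first by exists [::].
rewrite pairwise_cons => /andP[/allP xs ps] /= Pw.
have [|s' [s's srt Ps']] := IH (rcons w (ct x)) ps; first by rewrite cat_rcons.
pose u := [seq y <- s' | (key y < key x)%N]; pose u' := [seq y <- s' | (key x <= key y)%N].
have trn : transitive (fun x y => (key x <= key y)%N) by move=> b a c; apply: leq_trans.
have Eu : s' = u ++ u'.
  move: srt; rewrite /u /u' {u u' s's Ps'}; elim: s' => //= y s' IHs srt.
  have srt' := path_sorted srt; rewrite {1}(IHs srt'); have [lt|ge] := ltnP (key y) (key x); first by rewrite cat_cons.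
  rewrite (_ : [seq y0 <- s' | (key y0 < key x)%N] = [::]) //.
  apply/eqP; rewrite -(filter_pred0 s'); apply/eqP/eq_in_filter => z zs /=.
  by apply/negbTE; rewrite -leqNgt; apply: leq_trans ge _; apply: (allP (order_path_min trn srt)).
exists (u ++ x :: u'); split.
- by rewrite perm_catC /= perm_cons perm_catC -Eu.
- have su : sorted (fun x y => (key x <= key y)%N) u by apply: sorted_filter.
  have su' : sorted (fun x y => (key x <= key y)%N) u' by apply: sorted_filter.
  rewrite sorted_pairwise // pairwise_cat pairwise_cons -!sorted_pairwise // su su' /= andbT; apply/andP; split.
    apply/allrelP=> y z; rewrite mem_filter => /andP[yx _]; rewrite inE => /orP[/eqP->|]; first exact: ltnW.
    by rewrite mem_filter => /andP[xz _]; apply: leq_trans xz; apply: ltnW.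
  by apply/allP=> z; rewrite mem_filter => /andP[].
- move: Ps'; rewrite cat_rcons Eu !map_cat /=; apply: swap_move => //.
  apply/allP=> _ /mapP[y yu ->]; rewrite mem_filter in yu; case/andP: yu => yx ys'.
  by have := xs y; rewrite -(perm_mem s's) ys' yx; apply.
Qed.

(** * The regular case *)

Section LadderSums.
Variables (n m : nat) (lam : seq nat).
Hypothesis (lamP : is_partition n lam) (m2 : (2 <= m)%N) (lamR : m_regular m lam).
Local Notation ri := (reshape_index lam).
Local Notation ro := (reshape_offset lam).
Implicit Types (i j k l : 'I_n).

Definition lad (k : 'I_n) : nat := (ri k + m.-1 * ro k)%N.
Definition ct (k : 'I_n) : int := (ro k)%:Z - (ri k)%:Z.

Lemma ct_lad k : ct k = m%:Z * (ro k)%:Z - (lad k)%:Z.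
Proof. by rewrite /ct /lad; have := ltn_predK m2; move: m.-1 => y <-; rewrite PoszD PoszM intS; ring. Qed.

Lemma lad_inj k l : lad k = lad l -> ro k = ro l -> k = l.
Proof. by rewrite /lad => E1 E2; apply: (@box_inj n lam) => //; move: E1; rewrite E2 => /addIn. Qed.

(** The box m - 1 rows higher and one column to the right is the next one on the ladder. Were it
    outside the diagram, the m rows in between would all have the same length, against
    m-regularity. *)
Lemma regular_up k : (m.-1 <= ri k)%N -> exists l, ri l = (ri k - m.-1)%N /\ ro l = (ro k).+1.
Proof.
move=> mk; apply: (box_ex lamP); rewrite ltnNge; apply/negP => le.
have kk := ro_lt lamP k; set q := nth 0%N lam (ri k) in kk.
have qe r : (ri k - m.-1 <= r)%N -> (r <= ri k)%N -> nth 0%N lam r = q.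
  move=> r1 r2; apply/eqP; rewrite eqn_leq (part_geq lamP r2) andbT.
  by apply: leq_trans (part_geq lamP r1) (leq_trans le kk).
have rs : (ri k < size lam)%N by rewrite ltnNge; apply/negP => h; move: kk; rewrite /q nth_default.
have qin : q \in lam by apply: mem_nth.
have := allP lamR q qin; rewrite -[q == _]negbK -lt0n (leq_ltn_trans _ kk) //= => lt.
move: lt; rewrite ltnNge => /negP; apply.
pose a := (ri k - m.-1)%N; have am : (a + m = (ri k).+1)%N by rewrite /a; lia.
rewrite -(cat_take_drop a lam) count_cat -(cat_take_drop m (drop a lam)) count_cat.
have st : size (take m (drop a lam)) = m by rewrite size_takel // size_drop; lia.
suff /eqP -> : count_mem q (take m (drop a lam)) == size (take m (drop a lam)) by rewrite st; lia.
rewrite -all_count; apply/(all_nthP 0%N) => i; rewrite st => im; rewrite nth_take // nth_drop /= qe //.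
  exact: leq_addr.
lia.
Qed.

Variables (w : seq int) (grp : 'I_n -> nat) (c : 'I_n -> int).
Hypothesis (sw : size w = n) (vw : valid w).
Hypothesis grp_mono : forall i j, (i < j)%N -> (grp i <= grp j)%N.
Hypothesis grp_c : forall j, w`_j = m%:Z * c j - (grp j)%:Z.
Hypothesis grp_count : forall l : nat, count (fun j => grp j == l) (enum 'I_n) = count (fun k => lad k == l) (enum 'I_n).

(** Before the content a > 0 there is a content a - 1. The two values of [c] then differ by a
    positive integer, so m times this difference is at least m, and [grp] has grown by at least m -
    1. *)
Lemma grp_bound (a : nat) j : w`_j = a%:Z -> (m.-1 * a <= grp j)%N.
Proof.
elim: a j => [|a IH] j wj; first by rewrite muln0.
have [i [ij wi]] : exists i, (i < j)%N /\ w`_i = w`_j - 1 by apply: (valid_pos sw vw); rewrite wj.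
have wi' : w`_i = a%:Z by rewrite wi wj; lia.
have h1 := IH i wi'; have h2 := grp_mono ij; have ci := grp_c i; have cj := grp_c j.
rewrite wi' in ci; rewrite wj in cj.
have dE : m%:Z * (c j - c i) = (grp j)%:Z - (grp i)%:Z + 1 by rewrite mulrBr; move: ci cj; clear; lia.
have d1 : 0 < c j - c i.
  rewrite ltNge; apply/negP => d0; have : m%:Z * (c j - c i) <= 0 by apply: mulr_ge0_le0.
  by rewrite dE; move: h2; clear; lia.
have : m%:Z * 1 <= m%:Z * (c j - c i) by apply: ler_wpM2l.
by rewrite dE mulr1 mulnS; move: h1 m2; clear; lia.
Qed.

Lemma c_top j : c j <= (grp j %/ m.-1)%N%:Z.
Proof.
have m1 : (0 < m.-1)%N by rewrite -subn1 subn_gt0.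
have [|cp] := lerP (c j) 0; first by move=> h; apply: le_trans h _.
have [x cx] : exists x : nat, c j = x%:Z by exists `|c j|%N; move: cp; clear; lia.
rewrite cx lez_nat leq_divRL // mulnC; have cj := grp_c j; rewrite cx in cj.
have [wn|wp] := ltrP (w`_j) 0.
  have : m%:Z * x%:Z < (grp j)%:Z by rewrite -subr_lt0 -cj.
  rewrite -PoszM ltz_nat => h; apply: ltnW; apply: leq_ltn_trans h; rewrite leq_mul2r leq_pred orbT //.
have [a wa] : exists a : nat, w`_j = a%:Z by exists (absz (w`_j)); move: wp; clear; lia.
have h := grp_bound wa; rewrite wa in cj.
have E : (m * x = a + grp j)%N by move: cj; rewrite -PoszM; clear; lia.
have : (m * (m.-1 * x) <= m * grp j)%N.
  by rewrite mulnCA E mulnDr; apply: leq_trans (leq_add h (leqnn _)) _; rewrite -mulSn (ltn_predK m2).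
by rewrite leq_pmul2l // (ltn_trans _ m2).
Qed.

Lemma c_inj i j : grp i = grp j -> c i = c j -> i = j.
Proof.
have lt i' j' : (i' < j')%N -> grp i' = grp j' -> c i' = c j' -> False.
  move=> ij Eg Ec; have Ew : w`_i' = w`_j' by rewrite !grp_c Eg Ec.
  have [l [il lj wl]] := valid_twice sw vw ij Ew.
  have gl : grp l = grp j'.
    apply/eqP; rewrite eqn_leq grp_mono //= -Eg; move: il; rewrite leq_eqVlt => /orP[/eqP/val_inj->//|]; exact: grp_mono.
  have : m%:Z * (c l - c j') = 1 by move: wl; rewrite !grp_c gl mulrBr; clear; lia.
  by move=> /(congr1 absz); rewrite abszM /= => /eqP; rewrite muln_eq1 gtn_eqF.
move=> Eg Ec; apply: val_inj; case: (ltngtP i j) => // [ij|ji]; first by case: (lt i j).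
by case: (lt j i).
Qed.

(** Group by group: the numbers [c] of one group l are distinct by [c_inj] and at most l/(m - 1) by
    [c_top], whereas the columns met by the ladder l form an interval ending at that bound by
    [regular_up]. Then [top_sum] applies. *)
Lemma ladder_sum : \sum_(j : 'I_n) w`_j <= \sum_(k : 'I_n) ct k.
Proof.
pose B := (\sum_j grp j + \sum_k lad k)%N.
have gB j : (grp j <= B)%N by rewrite /B (bigD1 j) //= -addnA leq_addr.
have lB k : (lad k <= B)%N by rewrite /B addnC (bigD1 k) //= -addnA leq_addr.
rewrite (partition_big (fun j => inord (grp j) : 'I_B.+1) xpredT) //=.
rewrite [leRHS](partition_big (fun k => inord (lad k) : 'I_B.+1) xpredT) //=.
apply: ler_sum => l _.
have gl j : (inord (grp j) == l :> 'I_B.+1) = (grp j == l) by rewrite -val_eqE /= inordK // ltnS.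
have ll k : (inord (lad k) == l :> 'I_B.+1) = (lad k == l) by rewrite -val_eqE /= inordK // ltnS.
rewrite (eq_bigl _ _ gl) (eq_bigl _ _ ll).
rewrite (eq_bigr (fun j => m%:Z * c j - l%:Z)) => [|j /eqP <-]; last exact: grp_c.
rewrite [leRHS](eq_bigr (fun k => m%:Z * (ro k)%:Z - l%:Z)) => [|k /eqP <-]; last exact: ct_lad.
have toseq (P : pred 'I_n) (h : 'I_n -> int) : \sum_(j | P j) h j = \sum_(x <- map h (filter P (enum 'I_n))) x.
  by rewrite big_map big_filter big_enum_cond.
have sum_cst (P : pred 'I_n) : \sum_(j | P j) (l : nat)%:Z = (l : nat)%:Z *+ seq.count P (enum 'I_n).
  by rewrite toseq big_map big_filter big_const_seq iter_addr_0.
have sum_l : \sum_(j | grp j == l) (l : nat)%:Z = \sum_(j | lad j == l) (l : nat)%:Z.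
  by rewrite !sum_cst; congr (_ *+ _); apply: grp_count.
rewrite !sumrB -!mulr_sumr sum_l lerD2r; apply: ler_wpM2l => //; rewrite !toseq.
have m1 : (0 < m.-1)%N by rewrite -subn1 subn_gt0.
apply: (@top_sum _ _ (l %/ m.-1)%N%:Z).
- rewrite map_inj_in_uniq => [|i j]; first exact/filter_uniq/enum_uniq.
  rewrite !mem_filter => /andP[/eqP il _] /andP[/eqP jl _] [E].
  by apply: lad_inj; rewrite ?il ?jl.
- rewrite map_inj_in_uniq => [|i j]; first exact/filter_uniq/enum_uniq.
  rewrite !mem_filter => /andP[/eqP il _] /andP[/eqP jl _] E.
  by apply: c_inj; rewrite ?il ?jl.
- by rewrite !size_map !size_filter grp_count.
- apply/allP=> z /mapP[k kin ->]; move: kin; rewrite mem_filter => /andP[/eqP <- _]; rewrite lez_nat leq_divRL // mulnC; exact: leq_addl.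
- apply/allP=> z /mapP[k kin ->]; move: kin; rewrite mem_filter => /andP[/eqP <- _]; exact: c_top.
- move=> x0 /mapP[k kin ->] lt; move: kin; rewrite mem_filter => /andP[/eqP kl _].
  have lt' : (m.-1 * (ro k).+1 <= lad k)%N by rewrite kl mulnC -leq_divRL.
  have [k' [r1 r2]] : exists k', ri k' = (ri k - m.-1)%N /\ ro k' = (ro k).+1.
    by apply: regular_up; move: lt'; rewrite /lad mulnS; move: (m.-1 * ro k)%N => z; lia.
  apply/mapP; exists k'; last by rewrite r2; lia.
  rewrite mem_filter mem_enum andbT; apply/eqP; rewrite -kl /lad r1 r2 mulnS.
  by move: lt'; rewrite /lad mulnS; move: (m.-1 * ro k)%N => z; lia.
Qed.
End LadderSums.

Lemma slot_gap (m n r : nat) : (0 < m)%N -> (r < m)%N -> (4 * (r * n) < m * (4 * n).+1)%N.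
Proof. by move=> m0 rm; have := leq_mul (ltnW rm) (leqnn n); nia. Qed.

Lemma shift_absz_le (r n : nat) (z : int) : `|z| <= n%:Z -> (r * `|(z + n%:Z)%R| <= 2 * (r * n))%N.
Proof. by move=> h; rewrite mulnCA leq_mul //; lia. Qed.

Lemma slot_sep (L0 a b x y z : nat) : (L0 * a.+1 <= L0 * b)%N -> (x <= y)%N -> (4 * z < L0)%N ->
  forall u v : nat, (u <= 2 * z)%N -> (v <= 2 * z)%N -> forall s t : nat, (x + s = L0 * b + u)%N -> (y + t = L0 * a + v)%N ->
  (s <= 2 * z)%N -> (t <= 2 * z)%N -> False.
Proof. by rewrite mulnS; move: (L0 * a)%N (L0 * b)%N => p q; lia. Qed.

(** * A nonzero invariant for an m-regular partition *)

Section RegularCase.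
Variables (K : numClosedFieldType) (n m r : nat) (lam : seq nat).
Hypothesis (lamP : is_partition n lam) (m2 : (2 <= m)%N) (r1 : (0 < r)%N) (rm : (r < m)%N) (co : coprime r m).
Hypothesis (n0 : (0 < n)%N) (lamR : m_regular m lam).
Local Notation b := (r%:R / m%:R : K).
Local Notation ri := (reshape_index lam).
Local Notation ro := (reshape_offset lam).
Local Notation lad := (@lad n m lam).
Local Notation ct := (@ct n lam).
Variables (T : {vspace (reg K n)}) (st : @stable K n (reg K n) T).
Hypothesis (T0 : T != 0%VS) (TS : ((T : {vspace {ffun 'S_n -> K^o}}) <= specht K n lam)%VS) (irrW : irr (subrep st)).
Local Notation W := (subrep st).
Implicit Types (i j k l : 'I_n).

Lemma ct_bound k : `|ct k| < n%:Z.
Proof.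
have kn := ltn_ord k; have := rk_sum lam k.
have ge (rr : nat) : (rr <= ri k)%N -> (rr <= sumn (take rr lam))%N.
  elim: rr => // rr IH rk; rewrite sumn_takeS; have := IH (ltnW rk).
  have := ro_lt lamP k; have := part_geq lamP (ltnW rk); lia.
have := ge _ (leqnn _); rewrite /ct; lia.
Qed.

(** Ladder first, content second: contents shifted by n stay below 2n + 1, so this is a two-digit
    number in that base. *)
Definition key k : nat := (lad k * n.*2.+1 + `|(ct k + n%:Z)%R|)%N.

Lemma key_lad k l : (key k <= key l)%N -> (lad k <= lad l)%N.
Proof.
apply: contraTT; rewrite -!ltnNge => lt; rewrite /key.
have := ct_bound k; have := ct_bound l; have := leq_mul lt (leqnn n.*2.+1); rewrite mulSn; lia.
Qed.

Lemma key_ct k l : (key k <= key l)%N -> lad k = lad l -> ct k <= ct l.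
Proof. by rewrite /key => le E; move: le; rewrite E leq_add2l; have := ct_bound k; have := ct_bound l; lia. Qed.

(** If two boxes in reading order have contents at distance at most one, the later one lies on a
    strictly later ladder, so the keys are not inverted. *)
Lemma inversion_far k l : (k < l)%N -> (key l < key k)%N -> far (ct k) (ct l).
Proof.
move=> kl lt; have rkl := ri_mono lamP (ltnW kl); have Ek := rk_sum lam k; have El := rk_sum lam l.
apply/negPn/negP => nf; move: lt; rewrite ltnNge => /negP; apply; apply: ltnW.
have lt : (lad k < lad l)%N.
  rewrite /lad; have [x mE] : exists x, m = x.+2 by exists (m - 2)%N; lia.
  rewrite mE /=; move: nf; rewrite /far /ct => nf.
  have [rE|rN] := eqVneq (ri k) (ri l).
    have : (ro k < ro l)%N by rewrite rE in Ek; lia.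
    by rewrite rE ltn_add2l ltn_pmul2l.
  have ro_le : (ro k <= ro l)%N by lia.
  have := leq_mul (leqnn x.+1) ro_le; lia.
have := leq_mul lt (leqnn n.*2.+1); rewrite /key mulSn; have := ct_bound k; have := ct_bound l; lia.
Qed.

Lemma cword_ct : cword n lam = map ct (enum 'I_n).
Proof. by rewrite /cword /mkseq -val_enum_ord -map_comp. Qed.

Lemma ladder_word : exists s : seq 'I_n, [/\ perm_eq s (enum 'I_n), sorted (fun x y => (key x <= key y)%N) s & valid (map ct s)].
Proof.
have [v vE v0] := specht_weight lamP st T0 TS.
have vc : valid (cword n lam) := Ew_valid (size_cword n lam) vE v0.
have [||s [s1 s2 s3]] := @insertion_sort _ (fun w => valid w) ct key (enum 'I_n) [::] valid_swap; last by exists s.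
  have : pairwise ltn (map val (enum 'I_n)).
    rewrite val_enum_ord -sorted_pairwise ?iota_ltn_sorted //; exact: ltn_trans.
  rewrite pairwise_map; apply: sub_pairwise => k l kl; apply/implyP => lt; exact: inversion_far.
by rewrite cat0s -cword_ct.
Qed.

Theorem regular_nonzero : ~ (forall d (h : F W), Lg b d h -> inv h -> h = 0).
Proof.
move=> noinv; have m0 : (0 < m)%N by apply: ltnW.
have [s [sE srt vw]] := ladder_word; pose i0 := Ordinal n0.
have us : uniq s by rewrite (perm_uniq sE) enum_uniq.
have ss : size s = n by rewrite (perm_size sE) size_enum_ord.
pose w := map ct s; have sw : size w = n by rewrite size_map.
(* The exponents spread the ladders: as r < m, the spacing m M exceeds 4 r n, twice the range of the
   content part of a code. Division by it recovers the ladder, and [mono] needs the factor 4 because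
   two such parts are compared on each side. *)
pose M := (4 * n).+1; pose be : mi n := [ffun i : 'I_n => (M * lad (nth i0 s i))%N].
have trn : transitive (fun x y => (key x <= key y)%N) by move=> b0 a c; apply: leq_trans.
have keyle i j : (i <= j)%N -> (key (nth i0 s i) <= key (nth i0 s j))%N.
  move=> ij; apply: (sorted_leq_nth trn (fun x => leqnn (key x)) i0 srt) => //; rewrite inE ss; exact: ltn_ord.
have wE i : w`_i = ct (nth i0 s i) by rewrite (nth_map i0) // ss.
have beinc : mincr be by move=> i j ij; rewrite !ffunE leq_mul2l key_lad ?orbT // keyle.
have besort : bsorted be w.
  apply/bsortedP => i j ij; rewrite !ffunE => /eqP; rewrite eqn_pmul2l // => /eqP El.
  rewrite !wE lt_neqAle key_ct ?keyle 1?ltnW // andbT; apply/eqP => Ec.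
  have : nth i0 s i = nth i0 s j.
    apply: (lad_inj El); move: Ec; rewrite !(ct_lad lam m2) El => /addIr /mulfI h.
    have mz : m%:Z != 0 by rewrite eqz_nat -lt0n.
    by case: (h mz).
  by move=> /eqP; rewrite nth_uniq ?ss // => /eqP E; rewrite E ltnn in ij.
pose d := mdg be; have [x xE] : exists x : midx n d, tomi x = be by apply: tomi_onto.
have [t tE] := wd_onto vw sw.
have [p pE] := code_sep K n r m0 d.
pose om := chi (tomi x) b p (wd t).
have [q qs] := qsel_ex n b p d om; have [Qi _ _] := qs.
have cnz : (0 < wcount b p W d om)%N.
  have xi : incrb (tomi x) by apply/incrP; rewrite xE.
  rewrite /wcount (bigD1 x) //= (bigD1 t) ?addn_gt0; last by rewrite eqxx andbT xE tE.
  apply/orP; left; apply/orP; left; rewrite /wdim tE lt0n.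
  have [v vE v0] := specht_weight lamP st T0 TS.
  have vc : valid (cword n lam) := Ew_valid (size_cword n lam) vE v0.
  rewrite (@Ew_dim_eq _ _ W w (cword n lam) sw vw vc); last first.
    by move=> a; rewrite /cnt cword_ct; apply/seq.permP; apply: perm_map.
  by rewrite dimv_eq0; apply: contraNneq v0 => E; rewrite -memv0 -E.
have [fs [/List.Forall_forall fF fQ]] := JH p d (gsub_full b W) (gsub_Lg b W) (fun d f => @Lg_hom _ _ b W d f).
have := fQ q d Qi (leqnn d); rewrite (dQ_full W qs (leqnn d)).
have -> : dQ b p q (@Lg K n b W) d = 0%N.
  by apply/eqP/negPn/negP => /dQ_nz[h [Lh hi]]; rewrite (noinv d h Lh hi) eqxx.
rewrite add0n -/(Qsum b p q d fs) => cE; rewrite cE lt0n in cnz.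
have [y [/fF[iy yd [h hh nLh] yrel] _ ynz]] := Qsum_nz cnz.
(* In degree 0 all of the costandard module lies in [Lg], so every other factor starts higher and,
   by the Euler relation, has a larger content sum. *)
have y1 : (0 < y.1)%N by rewrite lt0n; apply/eqP => y0; apply: nLh; move: hh; rewrite y0; apply: Lg_const.
pose e := (d - y.1)%N; have ed : (e <= d)%N by apply: leq_subr.
have : (wcount b p y.2 e om != 0)%N.
  rewrite -(dQ_full y.2 qs ed) -lt0n; apply: leq_trans (_ : 0 < dQ b p q (@Lg K n b y.2) e)%N _; first by rewrite lt0n.
  apply: dimvS; apply/subvP=> u /(pspaceP _ (dQ_pred p q e (gsub_Lg b y.2)))[f Lf Ef].
  by apply/(pspaceP _ (dQ_pred p q e (gsub_full b y.2))); exists f => //; apply: Lg_hom Lf.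
have [|no] := pselect (exists (x' : midx n e) (t' : wtT n), [/\ incrb (tomi x'), chi (tomi x') b p (wd t') = om & wdim y.2 (wd t') != 0%N]); last first.
  rewrite /wcount big1 // => x' x'i; rewrite big1 // => t' /andP[_ /eqP ct']; apply/eqP/negPn/negP => nz.
  by apply: no; exists x', t'.
move=> [x' [t' [/incrP x'i chE wnz]]] _.
have [v' v'E v'0] : exists2 v, v \in Ew y.2 (wd t') & v != 0.
  by exists (vpick (Ew y.2 (wd t'))); [apply: memv_pick | rewrite vpick0 -dimv_eq0].
have vw' := Ew_valid (size_wd t') v'E v'0; set w' := wd t' in vw' v'E.
have sw' : size w' = n by apply: size_wd.
have permC := pE _ _ x' x t' t ed (leqnn d) chE.
have [v vE v0] : exists2 v, v \in Ew W w & v != 0.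
  have [v vE v0] := specht_weight lamP st T0 TS.
  have vc : valid (cword n lam) := Ew_valid (size_cword n lam) vE v0.
  have cw : cnt w =1 cnt (cword n lam) by move=> a; rewrite /cnt cword_ct; apply/seq.permP; apply: perm_map.
  have D := @Ew_dim_eq _ _ W w (cword n lam) sw vw vc cw.
  exists (vpick (Ew W w)); first exact: memv_pick.
  by rewrite vpick0 -dimv_eq0 D dimv_eq0; apply: contraNneq v0 => E; rewrite -memv0 -E.
have rel := yrel _ _ (fun u => irr_csum u irrW sw vE v0) (fun u => irr_csum u iy sw' v'E v'0).
have lt : \sum_(a <- w) a < \sum_(a <- w') a.
  have b0 : 0 < b by rewrite divr_gt0 ?ltr0n.
  rewrite -(ltr_int K) -(ltr_pM2l b0) -rel ltrDr ltr0n //.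
pose L0 := (m * M)%N; pose g k := (L0 * lad k + r * `|(ct k + n%:Z)%R|)%N.
pose cd j := (m * tomi x' j + r * `|(w'`_j + n%:Z)%R|)%N.
have permG : perm_eq (map cd (enum 'I_n)) (map g (enum 'I_n)).
  apply: perm_trans permC _; rewrite xE tE -/w.
  have -> : code m r be w = map g s; last exact: perm_map.
  rewrite /code -[s in RHS](mkseq_nth i0) /mkseq ss -val_enum_ord -!map_comp; apply: eq_map => i /=.
  by rewrite ffunE wE /g /L0 mulnA.
have L0_gt : (4 * (r * n) < L0)%N.
  exact: slot_gap.
have rho k : (r * `|(ct k + n%:Z)%R| <= 2 * (r * n))%N.
  exact/shift_absz_le/ltW/ct_bound.
have wb j : `|w'`_j| <= n%:Z by apply: (allP (wd_bound t')); apply: mem_nth; rewrite size_wd.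
have rho' j : (r * `|(w'`_j + n%:Z)%R| <= 2 * (r * n))%N.
  exact/shift_absz_le/wb.
have gdiv k : (g k %/ L0)%N = lad k.
  rewrite /g mulnC divnMDl ?divn_small ?addn0 //.
    by apply: leq_ltn_trans (rho k) _; apply: leq_ltn_trans L0_gt; rewrite leq_mul2r orbT.
  exact: leq_ltn_trans L0_gt.
have cdE j : exists k, cd j = g k.
  have : cd j \in map g (enum 'I_n) by rewrite -(perm_mem permG); apply/map_f; rewrite mem_enum.
  by move=> /mapP[k _ ->]; exists k.
pose grp j := (cd j %/ L0)%N.
have grpE j : exists k, grp j = lad k /\ cd j = g k by have [k E] := cdE j; exists k; rewrite /grp E gdiv.
(* Equality of codes makes r times the difference of contents divisible by m; coprimality removes r.
   The content is thus congruent to minus the ladder index modulo m. *)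
have dv j : exists c : int, w'`_j = m%:Z * c - (grp j)%:Z.
  have [k [gk ck]] := grpE j; rewrite gk.
  have E : r%:Z * (w'`_j - ct k) = m%:Z * (M%:Z * (lad k)%:Z - (tomi x' j)%:Z).
    have e1 : (`|(w'`_j + n%:Z)%R|)%N%:Z = w'`_j + n%:Z by move: (wb j); move: (w'`_j) => z; clear; lia.
    have e2 : (`|(ct k + n%:Z)%R|)%N%:Z = ct k + n%:Z by move: (ct_bound k); move: (ct k) => z; clear; lia.
    move: ck; rewrite /cd /g /L0; move: (lad k) => l /(congr1 Posz); rewrite !PoszD !PoszM e1 e2.
    move: (w'`_j) (ct k) => z z'; clear=> H.
    have -> : r%:Z * (z - z') = r%:Z * (z + n%:Z) - r%:Z * (z' + n%:Z) by ring.
    by rewrite mulrBr mulrA; apply/eqP; rewrite subr_eq addrAC -H addrAC subrr add0r.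
  have /dvdzP[z zE] : (m%:Z %| w'`_j - ct k)%Z.
    have : (m%:Z %| r%:Z * (w'`_j - ct k))%Z by rewrite E dvdz_mulr.
    by rewrite Gauss_dvdzr // coprimezE coprime_sym.
  exists ((ro k)%:Z + z); rewrite mulrDr addrAC -(ct_lad lam m2) addrC [m%:Z * z]mulrC -zE subrK //.
pose c j := sval (cid (dv j)).
have cP j : w'`_j = m%:Z * c j - (grp j)%:Z by rewrite /c; case: cid.
have mono i j : (i < j)%N -> (grp i <= grp j)%N.
  move=> ij; rewrite leqNgt; apply/negP => gt.
  have [k [gk ck]] := grpE j; have [k' [gk' ck']] := grpE i.
  rewrite gk gk' in gt; have xij := leq_mul (leqnn m) (x'i i j (ltnW ij)).
  have gt' := leq_mul (leqnn L0) gt; move: ck ck'; rewrite /cd /g => e1 e2.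
  exact: (slot_sep gt' xij L0_gt (rho k') (rho k) e2 e1 (rho' i) (rho' j)).
have cnts (l : nat) : count (fun j => grp j == l) (enum 'I_n) = count (fun k => lad k == l) (enum 'I_n).
  have := seq.permP permG (fun e => (e %/ L0)%N == l); rewrite !count_map => E.
  by rewrite -[LHS]/(count (preim cd (fun e => (e %/ L0)%N == l)) _) E; apply: eq_count => k /=; rewrite gdiv.
have := ladder_sum lamP m2 lamR sw' vw' mono cP cnts.
have -> : \sum_(j : 'I_n) w'`_j = \sum_(a <- w') a by rewrite [RHS](big_nth 0) sw' big_mkord.
have -> : \sum_(k : 'I_n) ct k = \sum_(a <- w) a by rewrite big_map (perm_big _ sE) big_enum.
by rewrite leNgt lt.
Qed.
End RegularCase.

(** * The non-regular case *)

Lemma sort_ex N (ga : 'I_N -> nat) : injective ga -> exists f : 'S_N, sdecr (fun i => ga (f i)).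
Proof.
move=> inj; pose a : mi N := [ffun i => ga i]; have [g ginc] := incr_ex a.
have rinj : injective (@rev_ord N) := @rev_ord_inj N.
exists (perm rinj * g^-1)%g => i j ij; rewrite !permM ![perm rinj _]permE ltn_neqAle; apply/andP; split.
  apply/negP => /eqP/inj/perm_inj/rinj E'; by rewrite E' ltnn in ij.
have := ginc (rev_ord j) (rev_ord i); rewrite !ffunE; apply; rewrite /=; have := ltn_ord j; lia.
Qed.

(** * The shift relation for slots with bounded codes *)

Section SlotRelation.
Variables (n m r N P E : nat).
Hypothesis (rm : (r < m)%N) (r0 : (0 < r)%N) (EN : (E < r * N)%N) (N0 : (0 < N)%N).
Implicit Types (x : nat * int) (s : seq (nat * int)) (ga : 'I_N -> nat) (S : {set 'I_N}) (c p : nat).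

Definition slotcode x : int := m%:Z * x.1%:Z + r%:Z * (x.2 + n%:Z).
Definition okc x := 0 <= slotcode x <= E%:Z.
(** The exponent (n+1)^code lets a monomial record the multiset of codes of a word. Codes outside
    0..E get weight 0, which produces both the wall and the final freezing. *)
Definition tw x : {poly int} := if okc x then 'X^(n.+1 ^ `|slotcode x|) else 0.
Definition tau c p := tw (c, N%:Z - 1 - p%:Z).
Definition slotrow c (q k : nat) : seq (nat * int) := [seq (c, N%:Z - 1 - q'%:Z) | q' <- iota q k].
Fixpoint Lst c := if c is c'.+1 then slotrow c' 0 P ++ Lst c' else [::].

(** Within one time the slots are ordered so that a particle moves at most once, which makes the row
    of slots a single transfer matrix. *)
Lemma Msl_row c q k L p (j : 'I_N) : Msl tw (slotrow c q k ++ L) p j =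
  Msl tw L p j + (if (q < p <= q + k)%N then tau c p.-1 * Msl tw L p.-1 j else 0).
Proof.
elim: k q p => [|k IH] q p; first by rewrite addn0 ltnNge andNb addr0.
rewrite /slotrow /= -/(slotrow c q.+1 k) !IH.
have -> : (p%:Z == N%:Z - (N%:Z - 1 - q%:Z)) = (p == q.+1).
  by rewrite (_ : N%:Z - (N%:Z - 1 - q%:Z) = q.+1%:Z) ?eqz_nat //; lia.
have [->|ne] := eqVneq p q.+1.
  rewrite ltnn /= addr0 ltnSn (_ : (q.+1 <= q + k.+1)%N); last by lia.
  by rewrite /= ltnNge leqnSn /= addr0.
rewrite addr0; congr (_ + _); rewrite addSnnS; congr (if _ then _ else _); lia.
Qed.

Lemma Msl_Mev c p (j : 'I_N) : (p <= P)%N -> Msl tw (Lst c) p j = Mev tau c p (N - 1 - j).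
Proof.
elim: c p => [//|c IH] p pP; rewrite /= Msl_row add0n pP andbT IH //.
by case: p pP => [|p] pP //=; rewrite IH // ltnW.
Qed.

Lemma tau_shift c p : tau (c + r) (p + m) = tau c p.
Proof.
rewrite /tau /tw /okc (_ : slotcode (c + r, _)%N = slotcode (c, N%:Z - 1 - p%:Z)) // /slotcode /=.
by rewrite !PoszD; ring.
Qed.

(** The step from m - 1 adds the content N - m, and at time c + r its code is m c + r (N + n), which
    exceeds E by the choice of N. *)
Lemma tau_wall c : tau (c + r) m.-1 = 0.
Proof.
rewrite /tau /tw /okc (_ : slotcode (c + r, _)%N = (m * c + r * (N + n))%N%:Z).
  by rewrite lez_nat [(_ <= E)%N](_ : _ = false) ?andbF //; apply/negbTE; rewrite -ltnNge mulnDr; lia.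
rewrite /slotcode /=; have -> : (m.-1)%:Z = m%:Z - 1 by lia.
by rewrite !PoszD !PoszM !PoszD; ring.
Qed.

Lemma tau_frozen c p : (E + r * P < c)%N -> (p < P)%N -> tau c p = 0.
Proof.
move=> cc pP; rewrite /tau /tw /okc; case: ifP => // /andP[_]; rewrite /slotcode /=.
have : (c <= m * c)%N by rewrite leq_pmull //; lia.
have : (r * p <= r * P)%N by rewrite leq_mul2l ltnW ?orbT.
have -> : m%:Z * c%:Z + r%:Z * (N%:Z - 1 - p%:Z + n%:Z) = (m * c)%N%:Z + (r * (N.-1 + n))%N%:Z - (r * p)%N%:Z.
  by rewrite !PoszM PoszD (_ : N.-1%:Z = N%:Z - 1) ?(ltn_predK N0); [ring | lia].
move: (m * c)%N (r * p)%N (r * P)%N (r * (N.-1 + n))%N cc => x y z u; clear => h1 h2 h3 h4; exfalso; lia.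
Qed.

Definition gS ga S i := (ga i + (if i \in S then m else 0))%N.

Lemma shift_gen ga k (f : {set 'I_N} -> 'S_N) : (0 < k)%N -> (forall i, ga i + m <= P)%N ->
  (forall S, injective (gS ga S) -> sdecr (fun i => gS ga S (f S i))) ->
  \sum_(S : {set 'I_N} | (#|S| == k) && injectiveb (gS ga S))
    (-1) ^+ (f S) * Gen tw (Lst (E + r * P).+1) (gcnt (fun i => gS ga S (f S i))) = 0.
Proof.
move=> k0 gP fP; set C := (E + r * P).+1.
have rel := @det_shift_rel _ tau m r rm tau_shift tau_wall N P C C ga k k0 _ (leqnn C) gP.
pose rho : 'S_N := perm (@rev_ord_inj N).
pose D S := \det (\matrix_(i, j < N) Mev tau C (gS ga S i) j).
have DE S : injective (gS ga S) -> (-1) ^+ (f S) * Gen tw (Lst C) (gcnt (fun i => gS ga S (f S i))) = (-1) ^+ rho * D S.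
  move=> inj; rewrite Gen_det; [|exact: fP|]; last first.
    by elim: (C) => //= c IH; rewrite all_cat IH andbT; apply/allP=> _ /mapP[q _ ->] /=; lia.
  have -> : \matrix_(i, j < N) Msl tw (Lst C) (gS ga S (f S i)) j = row_perm (f S) (col_perm rho (\matrix_(i, j < N) Mev tau C (gS ga S i) j)).
    apply/matrixP=> i j; rewrite !mxE permE Msl_Mev; last by rewrite /gS; have := gP (f S i); case: ifP => _; lia.
    by congr Mev; rewrite /=; lia.
  rewrite row_permE col_permE !det_mulmx !det_perm odd_permV.
  have sq : (-1) ^+ f S * (-1) ^+ f S = 1 :> {poly int} by rewrite -signr_addb addbb.
  by rewrite (mulrA ((-1) ^+ f S)) sq mul1r mulrC.
rewrite (eq_bigr (fun S => (-1) ^+ rho * D S)) => [|S /andP[_ /injectiveP inj]]; last exact: DE.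
rewrite -mulr_sumr; apply/eqP; rewrite mulf_eq0 signr_eq0 /=; apply/eqP; rewrite -[RHS]rel; last first.
  by move=> c p cC pP; apply: tau_frozen.
rewrite big_mkcondr; apply: eq_bigr => S _; case: ifP => // /injectiveP ninj.
have [i [j [ij E']]] : exists i j, i != j /\ gS ga S i = gS ga S j.
  apply: contrapT => no; apply: ninj => i j E'; apply/eqP/negPn/negP => ij; by apply: no; exists i, j.
by apply/esym/(determinant_alternate ij) => l; rewrite !mxE -!/(gS _ _ _) E'.
Qed.

Lemma Gen_coef L (kap : int -> nat) (om : nat) : (Gen tw L kap)`_om =
  (count (fun s => [&& goodw kap s, all okc s & (\sum_(x <- s) n.+1 ^ `|slotcode x| == om)%N]) (subsr L))%:Z.
Proof.
rewrite /Gen coef_sum -[(count _ _)%:Z]natz -sum1_count natr_sum [RHS]big_mkcond /= [LHS]big_mkcond; apply: eq_bigr => s _.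
case: (goodw kap s) => //=.
have -> : \prod_(x <- s) tw x = if all okc s then 'X^(\sum_(x <- s) n.+1 ^ `|slotcode x|) else 0.
  elim: s => [|x s IH] /=; first by rewrite !big_nil.
  rewrite !big_cons IH /tw; case: ifP => _ /=; last by rewrite mul0r.
  by case: ifP => _; rewrite ?mulr0 // exprD.
by case: ifP => _ /=; [rewrite coefXn eq_sym; case: eqP | rewrite coef0].
Qed.

Lemma good_nil ga : sdecr ga -> goodw (gcnt ga) [::] -> forall i, ga i = (N - 1 - i)%N.
Proof.
move=> sd; rewrite /goodw /= => /asboolP E' i.
have := E' 0; rewrite /gcnt subn0 subr0 /gcount => /esym/eqP; rewrite cards_eq0 => /eqP/setP S0.
apply/eqP; rewrite eqn_leq sdecr_ge // andbT.
have [d] := ubnP i; elim: d i => // d IHd i id.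
case: (posnP i) => [i0|ipos]; first by have := S0 i; rewrite !inE; lia.
have i'n : (i.-1 < N)%N by have := ltn_ord i; lia.
have := IHd (Ordinal i'n); have := sd (Ordinal i'n) i; rewrite /=; lia.
Qed.

(** A box of content a moves one beta-number from N - a - 1 to N - a, so the sums telescope. With f
    the identity this counts boxes; with the square it yields the content sum. *)
Lemma good_fsum (f : int -> int) ga s : sdecr ga -> all (fun x => x.2 < N%:Z) s -> goodw (gcnt ga) s ->
  \sum_i f (ga i)%:Z = \sum_(i < N) f (N - 1 - i)%N%:Z + \sum_(x <- s) (f (N%:Z - x.2) - f (N%:Z - x.2 - 1)).
Proof.
elim/last_ind: s ga => [|s x IH] ga sd.
  by move=> _ g; rewrite big_nil addr0; apply: eq_bigr => i _; rewrite (good_nil sd g).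
rewrite all_rcons => /andP[xN sN] g.
have [i gi nj] := goodw_rcons sd xN g.
rewrite (goodw_move s sd xN gi nj) in g.
set ga' := fun j => _ in g.
have sd' : sdecr ga'.
  move=> k l kl; have := sd _ _ kl; rewrite /ga'; case: eqP => [->|_]; case: eqP => [->|_] //; try lia.
  by have := nj k; have := nj l; lia.
rewrite -cats1 big_cat big_seq1 /= addrA -(IH ga') // (bigD1 i) //= [in RHS](bigD1 i) //=.
rewrite [in RHS](eq_bigr (fun j => f (ga j)%:Z)); last by move=> j /negPf ji; rewrite /ga' ji.
have -> : (ga' i)%:Z = N%:Z - x.2 - 1 by rewrite /ga' eqxx; lia.
by rewrite gi; ring.
Qed.
End SlotRelation.

Section OrdinalCounts.
Variable N : nat.

Lemma card_ord_lt k : (k <= N)%N -> #|[set i : 'I_N | (i < k)%N]| = k.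
Proof.
move=> kN; rewrite -sum1_card (eq_bigl (fun i : 'I_N => (i < k)%N)) => [|i]; last by rewrite inE.
by rewrite -(big_ord_widen N (fun=> 1%N) kN) sum1_card card_ord.
Qed.

Lemma down_closed (A : {set 'I_N}) : (forall i j : 'I_N, (i < j)%N -> j \in A -> i \in A) ->
  forall i : 'I_N, (i \in A) = (i < #|A|)%N.
Proof.
move=> dc i; apply/idP/idP => [iA|].
  rewrite -[X in (X <= _)%N](@card_ord_lt i.+1) //; apply/subset_leq_card/subsetP => j; rewrite inE ltnS leq_eqVlt.
  by case/orP => [/eqP/val_inj-> // | ji]; apply: dc ji iA.
apply: contraLR => iA; rewrite -leqNgt -[X in (_ <= X)%N](card_ord_lt (ltnW (ltn_ord i))).
apply/subset_leq_card/subsetP => j jA; rewrite inE ltnNge leq_eqVlt; apply/negP => /orP[/eqP/val_inj E|ij].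
  by rewrite E jA in iA.
by rewrite (dc i j ij jA) in iA.
Qed.

Lemma gcount_split (ga : 'I_N -> nat) (a : int) : (forall i : 'I_N, (N - 1 - i <= ga i)%N) -> a <= N%:Z ->
  gcnt ga a = #|[set i : 'I_N | (a <= i%:Z) && (N%:Z - a <= (ga i)%:Z)]|.
Proof.
move=> gaN aN; rewrite /gcnt /gcount -(cardsID [set i : 'I_N | (i < pospart a)%N]).
have pP := pospartP a.
have -> : #|[set i : 'I_N | N%:Z - a <= (ga i)%:Z] :&: [set i : 'I_N | (i < pospart a)%N]| = pospart a.
  rewrite -[RHS]card_ord_lt; last by lia.
  apply: eq_card => i; rewrite !inE; case: ltnP => [ia|]; rewrite ?andbF ?andbT //.
  by have := gaN i; have := ltn_ord i; lia.
by rewrite addKn; apply: eq_card => i; rewrite !inE; congr (_ && _); lia.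
Qed.
End OrdinalCounts.

Section PartitionSlots.
Variables (N n : nat) (mu : seq nat) (ga : 'I_N -> nat).
Hypothesis (muP : is_partition n mu) (gaN : forall i : 'I_N, (N - 1 - i <= ga i)%N).
Hypothesis gaE : forall (i : 'I_N) r, (i < nth 0 mu r)%N = (r + (N - 1 - i) < ga i)%N.
Hypothesis muN : forall r, (nth 0 mu r <= N)%N.
Local Notation ri := (reshape_index mu).
Local Notation ro := (reshape_offset mu).

Lemma cnt_cword_gcnt (a : int) : cnt (cword n mu) a = gcnt ga a.
Proof.
have cE : cnt (cword n mu) a = #|[set k : 'I_n | (ro k)%:Z - (ri k)%:Z == a]|.
  rewrite /cnt -sum1_count -sum1_card (big_nth 0) size_cword big_mkord.
  by apply: eq_bigl => k; rewrite inE nth_cword.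
have roN (k : 'I_n) : (ro k < N)%N by apply: leq_trans (ro_lt muP k) (muN _).
rewrite cE; have [aN|aN] := lerP a N%:Z; last first.
  rewrite /gcnt (_ : (gcount _ _ - _)%N = 0%N).
    by apply/eqP; rewrite cards_eq0; apply/eqP/setP=> k; rewrite !inE; apply/negbTE/eqP; have := roN k; lia.
  by apply/eqP; rewrite subn_eq0; apply: leq_trans (max_card _) _; rewrite card_ord; have := pospartP a; lia.
rewrite gcount_split // -(card_in_imset (f := fun k => Ordinal (roN k))); last first.
  move=> k l; rewrite !inE => /eqP ka /eqP la [E]; apply: (@box_inj n mu) => //; lia.
apply: eq_card => i; rewrite inE; apply/imsetP/andP => [[k]|[ai aga]].
  rewrite inE => /eqP ka -> /=; have := ro_lt muP k; rewrite (gaE (Ordinal (roN k))) /= => h; split; first lia.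
  by have := roN k; lia.
have ri : (i < nth 0 mu (absz (i%:Z - a)))%N by rewrite gaE; have := ltn_ord i; lia.
have [k [k1 k2]] := box_ex muP ri.
by exists k; [rewrite inE k1 k2; lia | apply: val_inj].
Qed.
End PartitionSlots.

Lemma sorted_count (s : seq nat) i r : sorted geq s -> (i < nth 0 s r)%N = (r < count (fun x => i < x)%N s)%N.
Proof.
elim: s r => [|x s IH] r; first by rewrite nth_nil.
rewrite /= (path_sortedE (fun a b c => fun h1 h2 => leq_trans h2 h1)) => /andP[/allP le srt].
have [ix|xi] := ltnP i x; first by case: r => //= r; rewrite IH // add1n ltnS.
have c0 : count (fun x => i < x)%N s = 0%N.
  by apply/eqP; rewrite eqn0Ngt -has_count; apply/hasPn => y /le yx; rewrite -leqNgt (leq_trans yx xi).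
by case: r => [|r]; rewrite /= c0; [rewrite ltnNge xi | rewrite IH // c0].
Qed.

Section GammaPartition.
Variables (N n : nat) (ga : 'I_N -> nat).
Hypothesis (N0 : (0 < N)%N) (sd : sdecr ga) (sumE : (\sum_i ga i = \sum_(i < N) (N - 1 - i) + n)%N).

Lemma gamma_gap (i j : 'I_N) : (i <= j)%N -> (ga j + (j - i) <= ga i)%N.
Proof.
have [d] := ubnP (j - i)%N; elim: d j => // d IH j jd; rewrite leq_eqVlt => /orP[/eqP/val_inj-> |ij].
  by rewrite subnn addn0.
have jN : (j.-1 < N)%N by have := ltn_ord j; lia.
have := IH (Ordinal jN); have := sd (i := Ordinal jN) (j := j); rewrite /=; lia.
Qed.

(** The r-th row length counts the columns whose beta-number exceeds its value for the empty shape
    by more than r. *)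
Lemma gamma_partition : exists2 mu, is_partition n mu & forall a, cnt (cword n mu) a = gcnt ga a.
Proof.
pose i0 := Ordinal N0; have gaN := fun i => sdecr_ge i sd.
pose A r := [set i : 'I_N | (r + (N - 1 - i) < ga i)%N].
pose R := (ga i0 - (N - 1))%N; pose mu := mkseq (fun r => #|A r|) R.
have dcA r i : (i \in A r) = (i < #|A r|)%N.
  apply: down_closed => {}i j ij; rewrite !inE; have := gamma_gap (ltnW ij); have := ltn_ord j; lia.
have A0 r : (R <= r)%N -> #|A r| = 0%N.
  move=> Rr; apply/eqP; rewrite cards_eq0; apply/eqP/setP=> i; rewrite !inE; apply/negbTE; rewrite -leqNgt; have := @gamma_gap i0 i (leq0n _); have := ltn_ord i; rewrite /R /= in Rr *; lia.
have nmu r : nth 0%N mu r = #|A r|.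
  by have [lt|ge] := ltnP r R; [rewrite nth_mkseq | rewrite nth_default ?size_mkseq // A0].
have muP : is_partition n mu.
  apply/and3P; split.
  - apply/(sortedP 0%N) => r; rewrite size_mkseq => rR; rewrite !nmu /geq /=.
    by apply/subset_leq_card/subsetP => i; rewrite !inE; apply: leq_ltn_trans; rewrite leq_add2r.
  - apply/negP => /(nthP 0%N)[r]; rewrite size_mkseq nmu => rR.
    by apply/eqP; rewrite -lt0n -(dcA r i0) inE /= subn0; rewrite /R in rR; lia.
  rewrite sumnE /mu /mkseq big_map -[in iota _ R](subn0 R) big_mkord.
  have -> : (\sum_(r < R) #|A r| = \sum_(i < N) (ga i - (N - 1 - i)))%N.
    under eq_bigr do rewrite -sum1_card big_mkcond /=.
    rewrite exchange_big /=; apply: eq_bigr => i _; rewrite -big_mkcond /=.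
    have le : (ga i - (N - 1 - i) <= R)%N by have := @gamma_gap i0 i (leq0n _); rewrite /R /=; have := ltn_ord i; lia.
    rewrite -[RHS](card_ord_lt le) -sum1_card; apply: eq_bigl => r; rewrite !inE; lia.
  apply/eqP/(@addnI (\sum_(i < N) (N - 1 - i))%N); rewrite -sumE -big_split /=; apply: eq_bigr => i _.
  exact: subnKC.
exists mu => // a; apply: cnt_cword_gcnt => // [i r|r].
  by rewrite nmu -dcA inE.
by rewrite nmu -[X in (_ <= X)%N]card_ord max_card.
Qed.
End GammaPartition.

Lemma irr_with_cword (K : numClosedFieldType) (n : nat) mu : (0 < n)%N -> is_partition n mu ->
  exists U : srep K n, irr U /\ exists2 v, v \in Ew U (cword n mu) & v != 0.
Proof.
move=> n0 muP.
have [T [st T0 TS Tm]] := minimal_stable (@stable_specht K n mu) ltac:(by apply: specht_neq0).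
exists (subrep st); split; first exact: subrep_irr.
exact: (specht_weight muP st T0 TS).
Qed.

Section NonRegular.
Variables (n m N : nat) (lam : seq nat) (q : nat).

Definition lgam (i : 'I_N) : nat := (count (fun x => i < x)%N lam + (N - 1 - i))%N.
Definition ngam (i : 'I_N) : nat := (lgam i - (if (i < q)%N then m else 0))%N.

Lemma count_gt_leq (i j : nat) : (i <= j)%N -> (count (fun x => j < x)%N lam <= count (fun x => i < x)%N lam)%N.
Proof. by move=> ij; apply: sub_count => x /=; apply: leq_ltn_trans. Qed.

Lemma lgam_sdecr : sdecr lgam.
Proof. by move=> i j ij; rewrite /lgam; have := count_gt_leq (ltnW ij); have := ltn_ord j; lia. Qed.

Lemma cnt_lgam (lamP : is_partition n lam) (lamN : forall r, (nth 0 lam r <= N)%N) a : cnt (cword n lam) a = gcnt lgam a.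
Proof.
have /and3P[srt _ _] := lamP.
apply: cnt_cword_gcnt => // [i|i r]; first exact: leq_addl.
by rewrite sorted_count // /lgam ltn_add2r.
Qed.

Hypothesis mq : (m <= count_mem q lam)%N.

Lemma count_ge_q (i j : nat) : (i < q)%N -> (q <= j)%N ->
  (count (fun x => j < x)%N lam + m <= count (fun x => i < x)%N lam)%N.
Proof.
move=> iq qj; apply: leq_trans (leq_add (count_gt_leq qj) mq) _.
rewrite -count_predUI [X in (_ + X)%N](_ : _ = 0%N) ?addn0.
  by apply: sub_count => x /= /orP[|/eqP->//]; apply: ltn_trans.
by apply/eqP; rewrite eqn0Ngt -has_count; apply/hasPn => x _ /=; apply/negP => /andP[h /eqP E]; rewrite E ltnn in h.
Qed.

Lemma m_le_count (i : nat) : (i < q)%N -> (m <= count (fun x => i < x)%N lam)%N.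
Proof. by move=> iq; have := count_ge_q iq (leqnn q); lia. Qed.

(** The m rows of length q make each of the first q columns longer by at least m than every later
    one, so lowering them by m keeps the order strict. *)
Lemma ngam_sdecr : sdecr ngam.
Proof.
move=> i j ij; have := lgam_sdecr ij; rewrite /ngam; have [iq|qi] := ltnP i q; have [jq|qj] := ltnP j q; rewrite ?subn0 //; try lia.
- by have := m_le_count jq; rewrite /lgam; lia.
- by have := count_ge_q iq qj; rewrite /lgam; have := ltn_ord j; lia.
Qed.

Lemma gS_ngam : gS m ngam [set i : 'I_N | (i < q)%N] = lgam.
Proof.
apply: boolp.funext => i; rewrite /gS /ngam inE; case: ifP => [iq|]; last by rewrite subn0 addn0.
by have := m_le_count iq; rewrite /lgam; lia.
Qed.
End NonRegular.

Definition ltx (x y : nat * int) : bool := (x.1 < y.1)%N || (x.1 == y.1) && (x.2 < y.2).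

Lemma ltx_trans : transitive ltx.
Proof.
move=> [c a] [d e] [f g]; rewrite /ltx /= => /orP[h|/andP[/eqP-> h]] /orP[h'|/andP[/eqP<- h']].
- by rewrite (ltn_trans h h').
- by rewrite h.
- by rewrite h'.
- by rewrite eqxx (lt_trans h h') orbT.
Qed.
Lemma ltx_irr : irreflexive ltx. Proof. by case=> c a; rewrite /ltx ltnn ltxx andbF. Qed.

Lemma mem_subsr L s : (s \in subsr L) = subseq (rev s) L.
Proof.
elim: L s => [|x L IH] s; first by rewrite inE subseq0; case/lastP: s => // s y; rewrite rev_rcons -cats1; case: s.
rewrite mem_cat IH; case/lastP: s => [|s y].
  by rewrite sub0seq.
rewrite rev_rcons [RHS]/=.
have -> : (rcons s y \in [seq rcons s' x | s' <- subsr L]) = (y == x) && subseq (rev s) L.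
  apply/mapP/andP => [[s' s'L /rcons_inj[-> ->]]|[/eqP-> sL]]; first by rewrite -IH.
  by exists s; rewrite ?IH.
case: eqP => _ /=; last by rewrite orbF.
by apply/orP/idP => [[/cons_subseq|]|] //; right.
Qed.

Lemma uniq_subsr L : uniq L -> uniq (subsr L).
Proof.
elim: L => //= x L IH /andP[xL /IH uL]; rewrite cat_uniq uL map_inj_uniq ?uL ?andbT; last exact: rcons_injl.
apply/hasPn => _ /mapP[s _ ->]; rewrite mem_subsr rev_rcons; apply/negP => /mem_subseq/(_ x).
by rewrite mem_head (negPf xL) => /(_ isT).
Qed.

Section SlotLists.
Variables N P : nat.
Local Notation Lst := (Lst N P).

Lemma mem_slotrow c (x : nat * int) : (x \in slotrow N c 0 P) = (x.1 == c) && (N%:Z - P%:Z <= x.2 < N%:Z).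
Proof.
apply/mapP/andP => [[k]|[/eqP c1 h]].
  by rewrite mem_iota add0n => /andP[_ kP] -> /=; rewrite eqxx; split=> //; lia.
exists (`|(N%:Z - 1 - x.2)%R|)%N; first by rewrite mem_iota; lia.
by move: h; case: x c1 => c' a /= -> h; congr pair; lia.
Qed.

Lemma mem_Lst c (x : nat * int) : (x \in Lst c) = (x.1 < c)%N && (N%:Z - P%:Z <= x.2 < N%:Z).
Proof.
elim: c => [|c IH] //=; rewrite mem_cat IH mem_slotrow -andb_orl; congr (_ && _).
by rewrite [RHS]ltnS [RHS]leq_eqVlt.
Qed.

Lemma Lst_pairwise c : pairwise (fun x y => ltx y x) (Lst c).
Proof.
elim: c => //= c IH; rewrite pairwise_cat IH andbT; apply/andP; split.
  apply/allrelP => x y; rewrite mem_slotrow mem_Lst => /andP[/eqP x1 _] /andP[y1 _].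
  by rewrite /ltx x1 y1.
rewrite pairwise_map; apply: (sub_pairwise (r := ltn)); last first.
  by rewrite -sorted_pairwise ?iota_ltn_sorted //; apply: ltn_trans.
move=> k l kl /=; rewrite /ltx ltnn eqxx /=; move: kl; rewrite /=; lia.
Qed.

Lemma subsr_Lst c s : (s \in subsr (Lst c)) = pairwise ltx s && all (mem (Lst c)) s.
Proof.
have tr' : transitive (fun x y => ltx y x) by move=> y x z h1 h2; apply: ltx_trans h2 h1.
have irr' : irreflexive (fun x y => ltx y x) by move=> x; apply: ltx_irr.
have sL : sorted (fun x y => ltx y x) (Lst c) by rewrite (sorted_pairwise tr') Lst_pairwise.
rewrite mem_subsr -(sorted_pairwise ltx_trans) -[X in sorted _ X]revK rev_sorted.
apply/idP/andP => [sub|[ss /allP sub]].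
  split; first exact: (subseq_sorted tr' sub sL).
  by apply/allP => x xs; apply: (mem_subseq sub); rewrite mem_rev.
suff -> : rev s = filter (mem s) (Lst c) by apply: filter_subseq.
apply: (irr_sorted_eq tr' irr') => //; first exact: sorted_filter.
by move=> x; rewrite mem_rev mem_filter /=; case: (boolP (x \in s)) => //= xs; apply/esym/sub.
Qed.
End SlotLists.

Lemma pairwise_ord (n : nat) (T : Type) (lt : rel T) (f : 'I_n -> T) : (0 < n)%N ->
  pairwise lt (map f (enum 'I_n)) <-> forall i j : 'I_n, (i < j)%N -> lt (f i) (f j).
Proof.
move=> n0; pose i0 := Ordinal n0.
have nE (i : 'I_n) : nth (f i0) (map f (enum 'I_n)) i = f i by rewrite (nth_map i0) ?size_enum_ord // nth_ord_enum.
have memi k : (k < n)%N -> k \in gtn (size (map f (enum 'I_n))).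
  by move=> kn; rewrite -[_ \in _]/(k < size _)%N size_map size_enum_ord.
split=> [/(pairwiseP (f i0)) h i j ij|h].
  by rewrite -[f i]nE -[f j]nE; apply: h => //; apply: memi.
apply/(pairwiseP (f i0)) => i j; rewrite !inE size_map size_enum_ord => iN jN ij.
by rewrite (nE (Ordinal iN)) (nE (Ordinal jN)); apply: h.
Qed.

Section SlotWords.
Variables (n m r : nat).
Local Notation slot := (slotcode n m r).

Definition phi (be : mi n) (w : seq int) : seq (nat * int) := [seq (be i, w`_i) | i <- enum 'I_n].

Lemma slot_abs (x : nat) (a : int) : `|a| <= n%:Z -> slot (x, a) = (m * x + r * `|(a + n%:Z)%R|)%N%:Z.
Proof. by move=> an; rewrite /slotcode /= PoszD !PoszM; congr (_ + _ * _); lia. Qed.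

Lemma phi_code be w : all (fun a => `|a| <= n%:Z) w -> size w = n ->
  [seq `|slot x|%N | x <- phi be w] = code m r be w.
Proof.
move=> wb sw; rewrite /phi /code -map_comp; apply: eq_map => i /=; rewrite slot_abs //.
by apply: (allP wb); rewrite mem_nth // sw.
Qed.

Lemma phi_sorted be w : (0 < n)%N -> pairwise ltx (phi be w) <-> mincr be /\ bsorted be w.
Proof.
move=> n0; rewrite /phi pairwise_ord //; split=> [h|[h1 /bsortedP h2] i j ij].
  split=> [i j|]; first by rewrite leq_eqVlt => /orP[/eqP/val_inj->//|/h/orP[/ltnW//|/andP[/eqP/= -> _]]].
  by apply/bsortedP => i j /h; rewrite /ltx /= => /orP[h' E'|/andP[_]//]; rewrite E' ltnn in h'.
rewrite /ltx /=; have := h1 i j (ltnW ij); rewrite leq_eqVlt => /orP[/eqP E'|->//].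
by rewrite E' eqxx /= h2 ?orbT.
Qed.
End SlotWords.

Section PairCount.
Variables (K : numClosedFieldType) (n m r N P E C D : nat) (p : {poly K}) (om : K) (code0 : seq nat) (kap : int -> nat) (e : nat).
Hypothesis (n0 : (0 < n)%N) (size0 : size code0 = n) (eD : (e <= D)%N).
Hypothesis (DE : (m * D + r * n.*2 <= E)%N) (EC : (D < C)%N) (nN : (n < N)%N) (NP : (N + n <= P)%N).
Local Notation b := (r%:R / m%:R : K).
Local Notation om0 := (\sum_(x <- code0) n.+1 ^ x)%N.
Local Notation slot := (slotcode n m r).
Hypothesis hcode : forall d (x : midx n d) (t : wtT n), (d <= D)%N ->
  (chi (tomi x) b p (wd t) == om) = perm_eq (code m r (tomi x) (wd t)) code0.
Hypothesis hgood : forall s, all (fun x => x.2 < N%:Z) s -> all (okc n m r E) s -> goodw kap s ->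
  (\sum_(x <- s) n.+1 ^ `|slot x|)%N = om0 -> size s = n /\ (\sum_(x <- s) x.1)%N = e.

(** The map [phi] identifies block-sorted pairs of an increasing index and a valid word with good
    sublists of slots. The hypothesis [hgood] recovers the length and the degree from the code
    sum. *)
Lemma pair_count : #|[set xt : midx n e * wtT n | [&& incrb (tomi xt.1),
      bsorted (tomi xt.1) (wd xt.2) && (chi (tomi xt.1) b p (wd xt.2) == om),
      valid (wd xt.2) & `[< cnt (wd xt.2) =1 kap >]]]| =
  count (fun s => [&& goodw kap s, all (okc n m r E) s & (\sum_(x <- s) n.+1 ^ `|slot x| == om0)%N]) (subsr (Lst N P C)).
Proof.
rewrite cardE -(size_map (fun xt : midx n e * wtT n => phi (tomi xt.1) (wd xt.2))) -size_filter.
have sndphi (be : mi n) w : size w = n -> map snd (phi be w) = w.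
  move=> sw; rewrite -map_comp; apply: (@eq_from_nth _ 0) => [|i]; rewrite size_map size_enum_ord // => iN.
  by rewrite (nth_map (Ordinal n0)) ?size_enum_ord //= nth_enum_ord.
apply/perm_size/uniq_perm.
- rewrite map_inj_in_uniq ?enum_uniq // => -[x t] [x' t'] _ _ /= eqp.
  have wE : wd t = wd t' by rewrite -(sndphi (tomi x) (wd t)) ?size_wd // eqp sndphi ?size_wd.
  congr pair; last exact: wd_inj.
  apply/tomi_inj/ffunP => i; have /eq_in_map/(_ i) := eqp; rewrite mem_enum => /(_ isT) [E' _]; exact: E'.
- exact/filter_uniq/uniq_subsr/(pairwise_uniq _ (Lst_pairwise N P C))/ltx_irr.
move=> s; rewrite mem_filter subsr_Lst; apply/mapP/idP => [[[x t]]|].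
  rewrite mem_enum inE /= => /and4P[/incrP xi /andP[bs ch] vt /asboolP ct] ->; rewrite hcode // in ch.
  have wb := wd_bound t; have sw := size_wd t; have xd := mdg_tomi x.
  have xD i : (tomi x i <= D)%N.
    by apply: leq_trans eD; rewrite -[X in (_ <= X)%N]xd /mdg (bigD1 i) //= leq_addr.
  have wi (i : 'I_n) : `|(wd t)`_i| <= n%:Z by apply: (allP wb); rewrite mem_nth // sw.
  apply/andP; split; [apply/and3P; split|apply/andP; split].
  + by rewrite /goodw sndphi // vt; apply/asboolP.
  + apply/allP=> _ /mapP[i _ ->]; rewrite /okc slot_abs //= lez_nat; apply: leq_trans DE.
    by apply: leq_add; rewrite leq_mul //; have := wi i; move: (wd t)`_i => z; clear; lia.
  + rewrite -(big_map (fun y => `|slot y|%N) xpredT (fun y => (n.+1 ^ y)%N)) phi_code //.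
    by apply/eqP/perm_big.
  + by apply/(phi_sorted _ _ n0).
  + apply/allP=> _ /mapP[i _ ->]; rewrite /= mem_Lst /= (leq_ltn_trans (xD i) EC) /=.
    by have := wi i; move: (wd t)`_i => z; lia.
move=> /andP[/and3P[gs oks /eqP sumE] /andP[ps /allP sL]].
have sN : all (fun x => x.2 < N%:Z) s by apply/allP => x /sL; rewrite /= mem_Lst => /and3P[].
have [ss se] := hgood sN oks gs sumE.
have /andP[vs cs] := gs.
pose be : mi n := [ffun i => (nth (0%N, 0) s (i : 'I_n)).1].
have phE : phi be (map snd s) = s.
  apply: (@eq_from_nth _ (0%N, 0)) => [|i]; rewrite size_map size_enum_ord ?ss // => iN.
  rewrite (nth_map (Ordinal iN)) ?size_enum_ord // ffunE (nth_map (0%N, 0)) ?nth_enum_ord ?ss //.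
  by rewrite -surjective_pairing.
have [x xE] : exists x : midx n e, tomi x = be.
  apply: tomi_onto; rewrite -se /mdg (big_nth (0%N, 0)) ss big_mkord; apply: eq_bigr => i _.
  by rewrite ffunE.
have [t tE] : exists t : wtT n, wd t = map snd s by apply: wd_onto; rewrite ?size_map.
exists (x, t); last by rewrite /= xE tE phE.
have [mi bs] : mincr be /\ bsorted be (map snd s) by apply/(phi_sorted _ _ n0); rewrite phE.
rewrite mem_enum inE /= xE tE bs vs cs (introT (incrP _) mi) /=; rewrite andbT -xE -tE.
rewrite hcode //; have sc : size (code m r (tomi x) (wd t)) = n by rewrite size_map size_enum_ord.
apply: (@digits_inj n); [by rewrite sc | by rewrite size0 |].
rewrite -phi_code ?wd_bound ?size_wd // xE tE phE big_map; exact: sumE.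
Qed.
End PairCount.

Lemma top_subset (N q : nat) (g : 'I_N -> nat) (S : {set 'I_N}) : sdecr g -> (0 < q <= N)%N -> #|S| = q ->
  S != [set i : 'I_N | (i < q)%N] -> (\sum_(i in S) g i < \sum_(i in [set i : 'I_N | (i < q)%N]) g i)%N.
Proof.
move=> sd /andP[q0 qN] Sq; set S0 := [set i : 'I_N | _] => ne.
have qN' : (q.-1 < N)%N by lia.
pose G := g (Ordinal qN').
have c0 : #|S0| = q by apply: card_ord_lt.
have cD : #|S :\: S0| = #|S0 :\: S|.
  by apply: (@addnI #|S :&: S0|); rewrite cardsID setIC cardsID c0.
have D0 : (0 < #|S :\: S0|)%N.
  rewrite card_gt0; apply: contraNneq ne => /eqP; rewrite setD_eq0 => sub.
  by rewrite eqEcard; apply/andP; split=> //; rewrite c0 Sq.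
rewrite (big_setID S0) [X in (_ < X)%N](big_setID S) /= setIC ltn_add2l.
apply: (@leq_trans (\sum_(i in S0 :\: S) G)%N); last first.
  apply: leq_sum => i; rewrite !inE => /andP[_ iq]; rewrite /G.
  case: (ltngtP i q.-1) => [lt|gt|E]; [exact/ltnW/sd | lia|].
  by rewrite (_ : Ordinal qN' = i) //; apply: val_inj.
rewrite sum_nat_const -cD -sum_nat_const -add1n; apply: leq_trans (leq_add D0 (leqnn _)) _.
rewrite -sum1_card -big_split /=; apply: leq_sum => i; rewrite !inE -leqNgt => /andP[qi _].
by rewrite add1n; apply: sd; rewrite /=; lia.
Qed.

Lemma sum_gS (N m : nat) (g : 'I_N -> nat) (S : {set 'I_N}) :
  (\sum_i gS m g S i = \sum_i g i + m * #|S|)%N.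
Proof. by rewrite big_split -big_mkcond /= sum_nat_const mulnC. Qed.

Lemma sumsq_gS (N m : nat) (g : 'I_N -> nat) (S : {set 'I_N}) :
  \sum_i (gS m g S i)%:Z ^+ 2 =
  \sum_i (g i)%:Z ^+ 2 + (2 * m)%:Z * (\sum_(i in S) g i)%N%:Z + (m ^ 2 * #|S|)%N%:Z.
Proof.
rewrite -addrA (_ : _ * _ + _ = \sum_(i in S) ((2 * m * g i)%N%:Z + (m ^ 2)%N%:Z)); last first.
  rewrite big_split /= sumr_const -[_ *+ #|S|]mulr_natr natz -PoszM; congr (_ + _).
  by rewrite big_distrr /= -[LHS]natz natr_sum; apply: eq_bigr => i _; rewrite natz.
rewrite [X in _ + X]big_mkcond -big_split /=; apply: eq_bigr => i _; rewrite /gS; case: ifP => _.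
  by rewrite PoszD !PoszM; ring.
by rewrite addn0 addr0.
Qed.

Lemma gcnt_perm (N : nat) (g : 'I_N -> nat) (f : 'S_N) a : gcnt (fun i => g (f i)) a = gcnt g a.
Proof.
rewrite /gcnt /gcount; congr (_ - _)%N; rewrite -[RHS](card_preimset _ (@perm_inj _ f)).
by apply: eq_card => i; rewrite !inE.
Qed.

Lemma leq_sumn (lam : seq nat) r : (nth 0 lam r <= sumn lam)%N.
Proof. by elim: lam r => [|x s IH] [|r] //=; [apply: leq_addr | apply: leq_trans (IH r) (leq_addl _ _)]. Qed.

Lemma sum_count_lt (N : nat) (lam : seq nat) : (forall r, (nth 0 lam r <= N)%N) ->
  (\sum_(i < N) count (fun x => i < x)%N lam = sumn lam)%N.
Proof.
elim: lam => [_|x s IH h]; first by rewrite big1.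
rewrite /= big_split /= IH => [|r]; last exact: (h r.+1).
by congr (_ + _)%N; rewrite -[RHS](card_ord_lt (h 0%N)) -sum1_card big_mkcond /=; rewrite [RHS]big_mkcond; apply: eq_bigr => i _; rewrite inE; case: (_ < _)%N.
Qed.

Lemma count_leq_sumn (i : nat) (lam : seq nat) : (count (fun x => i < x)%N lam <= sumn lam)%N.
Proof. by elim: lam => //= x s IH; apply: leq_add => //; case: ltnP => // /(leq_ltn_trans (leq0n i)). Qed.

Section WeightCounts.
Variables (K : numClosedFieldType) (n : nat).

(** All weights of an irreducible module have the same content multiset, and those of one multiset
    have equal multiplicity, so the count factors. *)
Lemma wcount_irr (b : K) p (U : srep K n) w v (kap : int -> nat) e om : irr U -> size w = n -> v \in Ew U w -> v != 0 -> cnt w =1 kap ->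
  wcount b p U e om = (\dim (Ew U w) * #|[set xt : midx n e * wtT n | [&& incrb (tomi xt.1),
      bsorted (tomi xt.1) (wd xt.2) && (chi (tomi xt.1) b p (wd xt.2) == om),
      valid (wd xt.2) & `[< cnt (wd xt.2) =1 kap >]]]|)%N.
Proof.
move=> iU sw vw v0 ck; have vaw := Ew_valid sw vw v0.
rewrite /wcount pair_big_dep /= mulnC -sum_nat_const big_mkcond [RHS]big_mkcond /=; apply: eq_bigr => -[x t] _.
rewrite inE /=; case: (incrb _) => //=; case: (_ && _) => //=.
rewrite /wdim; case: ifP => [/andP[vt /asboolP ct]|nvt].
  by apply: Ew_dim_eq => //; [exact: size_wd | move=> a; rewrite ct ck].
apply/eqP; rewrite dimv_eq0 -vpick0; apply/negPn/negP => h.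
have vm := memv_pick (Ew U (wd t)); move/negP: nvt; apply; rewrite (Ew_valid (size_wd t) vm h).
by apply/asboolP => a; rewrite -ck; apply: (irr_cnt iU (size_wd t) sw vm h vw v0).
Qed.
End WeightCounts.

Lemma Qsum_cat (K : numClosedFieldType) (n : nat) (b : K) p q d (s s' : seq (nat * srep K n)) :
  Qsum b p q d (s ++ s') = (Qsum b p q d s + Qsum b p q d s')%N.
Proof. by rewrite /Qsum big_cat. Qed.

Section SlotSums.
Variables (n m r : nat).
Local Notation slot := (slotcode n m r).

Lemma slot_sum (s : seq (nat * int)) : (forall x, x \in s -> 0 <= slot x) ->
  \sum_(e <- [seq `|slot x|%N | x <- s]) e%:Z =
  m%:Z * (\sum_(x <- s) x.1)%N%:Z + r%:Z * (\sum_(x <- s) x.2 + n%:Z * (size s)%:Z).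
Proof.
elim: s => [_|x s IH h]; first by rewrite /= !big_nil; ring.
rewrite /= !big_cons IH => [|y ys]; last by apply: h; rewrite inE ys orbT.
have := h x (mem_head _ _); rewrite PoszD intS /slotcode => h0.
by rewrite gez0_abs //; ring.
Qed.
End SlotSums.

Lemma Qsum_shift (K : numClosedFieldType) (n : nat) (b : K) p q d (a : nat) (s : seq (nat * srep K n)) :
  Qsum b p q d [seq ((a + x.1)%N, x.2) | x <- s] = if (a <= d)%N then Qsum b p q (d - a) s else 0%N.
Proof.
rewrite /Qsum big_map /=; case: leqP => [ad|da]; last by apply: big_pred0 => x; lia.
by apply: eq_big => [x|x _]; [lia | rewrite subnDA].
Qed.

Lemma Qsum_nseq (K : numClosedFieldType) (n : nat) (b : K) p q d k (s : seq (nat * srep K n)) :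
  Qsum b p q d (flatten (nseq k s)) = (k * Qsum b p q d s)%N.
Proof. by elim: k => [|k IH]; [rewrite /Qsum big_nil | rewrite /= Qsum_cat IH mulSn]. Qed.

Lemma In_nseq (A : Type) (y : A) k s : List.In y (flatten (nseq k s)) -> List.In y s.
Proof. by elim: k => //= k IH h; case: (List.in_app_or _ _ _ h). Qed.

Lemma In_map (A B : Type) (f : A -> B) y s : List.In y (map f s) -> exists2 x, List.In x s & y = f x.
Proof. by elim: s => //= a s IH [<-|/IH[x xs ->]]; [exists a; [left|] | exists x; [right|]]. Qed.

(** * Characters of the shapes in the shift relation *)

Section NonRegularCase.
Variables (K : numClosedFieldType) (n m r : nat) (lam : seq nat) (q : nat).
Hypothesis (lamP : is_partition n lam) (m0 : (0 < m)%N) (r1 : (0 < r)%N) (rm : (r < m)%N).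
Hypothesis (n0 : (0 < n)%N) (q0 : (0 < q)%N) (mq : (m <= count_mem q lam)%N).
Variables (T : {vspace (reg K n)}) (st : @stable K n (reg K n) T).
Hypothesis (T0 : T != 0%VS) (TS : ((T : {vspace {ffun 'S_n -> K^o}}) <= specht K n lam)%VS) (irrW : irr (subrep st)).
Local Notation W := (subrep st).
Local Notation b := (r%:R / m%:R : K).
Variables (D : nat) (p : {poly K}).
(** E bounds every code met in degrees up to D; N exceeds E, so that E < r N gives the wall; P
    bounds the positions reached after raising by m; from time C on all weights vanish. *)
Local Notation E := (m * D + r * n.*2)%N.
Local Notation N := (E + n + m).+1.
Local Notation P := (N + n + m)%N.
Local Notation C := (E + r * P).+1.
Local Notation slot := (slotcode n m r).
Local Notation ga := (fun i : 'I_N => ngam m lam q i).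
Local Notation S0 := [set i : 'I_N | (i < q)%N].
Variable fS : {set 'I_N} -> 'S_N.
Hypothesis fP : forall S, injective (gS m ga S) -> sdecr (fun i => gS m ga S (fS S i)).
Implicit Types S : {set 'I_N}.
Hypothesis sep : forall d d' (x : midx n d) (x' : midx n d') (t t' : wtT n), (d <= D)%N -> (d' <= D)%N ->
  chi (tomi x) b p (wd t) = chi (tomi x') b p (wd t') -> perm_eq (code m r (tomi x) (wd t)) (code m r (tomi x') (wd t')).

Definition okS S := (#|S| == q) && injectiveb (gS m ga S).
Definition kap S := gcnt (fun i => gS m ga S (fS S i)).
Definition ctl : int := \sum_(x <- cword n lam) x.
(** Measures how far S is from the top set S0, which gives back [lam]: the shape of S has content
    sum larger by m times this number. It is positive for S different from S0, as the beta-numbers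
    decrease. *)
Definition dl S : nat := (\sum_(i in S0) ga i - \sum_(i in S) ga i)%N.

Lemma sumn_lam : sumn lam = n. Proof. by have /and3P[_ _ /eqP] := lamP. Qed.

Lemma lamN k : (nth 0 lam k <= N)%N.
Proof. by apply: leq_trans (leq_sumn lam k) _; rewrite sumn_lam; lia. Qed.

Lemma qN : (q <= N)%N.
Proof.
have qlam : q \in lam by rewrite -has_pred1 has_count; apply: leq_trans mq.
by rewrite -(nth_index 0%N qlam); apply: lamN.
Qed.

Lemma EN : (E < r * N)%N.
Proof. by have := leq_mul r1 (leqnn N); move: (r * N)%N => z; lia. Qed.

Lemma gaP (i : 'I_N) : (ga i + m <= P)%N.
Proof. by have := count_leq_sumn i lam; rewrite sumn_lam /ngam /lgam; lia. Qed.

Lemma okS0 : okS S0.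
Proof.
rewrite /okS card_ord_lt ?qN // eqxx; apply/injectiveP; rewrite (gS_ngam N mq).
exact/sdecr_inj/lgam_sdecr.
Qed.

Lemma dlP S : okS S -> (\sum_(i in S0) ga i = \sum_(i in S) ga i + dl S)%N /\ (S != S0 -> (0 < dl S)%N).
Proof.
move=> /andP[/eqP cS _]; have [->|ne] := eqVneq S S0; first by rewrite /dl subnn addn0.
have h := top_subset (ngam_sdecr mq) (introT andP (conj q0 qN)) cS ne.
by rewrite /dl; split=> [|_]; [rewrite subnKC // ltnW | rewrite subn_gt0].
Qed.

Lemma sum_fS (f : nat -> int) S : \sum_i f (gS m ga S (fS S i)) = \sum_i f (gS m ga S i).
Proof. by rewrite [RHS](reindex_inj (@perm_inj _ (fS S))). Qed.

Lemma sum_lg : (\sum_(i : 'I_N) lgam lam i = \sum_(i < N) (N - 1 - i) + n)%N.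
Proof. by rewrite /lgam big_split /= addnC sum_count_lt ?sumn_lam //; apply: lamN. Qed.

Lemma sum_gSE S : okS S -> (\sum_i gS m ga S i = \sum_(i < N) (N - 1 - i) + n)%N.
Proof.
move=> /andP[/eqP cS _]; rewrite sum_gS cS -sum_lg -(gS_ngam N mq) sum_gS.
by rewrite card_ord_lt ?qN.
Qed.

Lemma kap0 : kap S0 =1 cnt (cword n lam).
Proof. by move=> a; rewrite /kap gcnt_perm (gS_ngam N mq) (cnt_lgam lamP lamN). Qed.

Lemma good_sq S s : okS S -> all (fun x => x.2 < N%:Z) s -> goodw (kap S) s -> size s = n /\
  2 * \sum_(x <- s) x.2 + 2 * m%:Z * (\sum_(i in S) ga i)%N%:Z =
  (2 * N%:Z - 1) * n%:Z + \sum_(i < N) (N - 1 - i)%N%:Z ^+ 2 - \sum_i (ga i)%:Z ^+ 2 - (m ^ 2 * q)%N%:Z.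
Proof.
move=> oS sN g; have /andP[/eqP cS /injectiveP inj] := oS; have sd := fP inj.
have h1 := good_fsum rm r1 EN (ltn0Sn _) id sd sN g.
have h2 := good_fsum rm r1 EN (ltn0Sn _) (fun z => z ^+ 2) sd sN g.
rewrite /= (sum_fS Posz) in h1; rewrite /= (sum_fS (fun z : nat => z%:Z ^+ 2)) sumsq_gS cS in h2.
have e1 : \sum_i (gS m ga S i)%:Z = \sum_(i < N) (N - 1 - i)%N%:Z + n%:Z.
  have toZ (I : finType) (f : I -> nat) : (\sum_i f i)%N%:Z = \sum_i (f i)%:Z.
    by rewrite -[LHS]natz natr_sum; apply: eq_bigr => i _; rewrite natz.
  by rewrite -!toZ sum_gSE.
have ss : size s = n.
  have : \sum_(x <- s) (N%:Z - x.2 - (N%:Z - x.2 - 1)) = (size s)%:Z.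
    by rewrite (eq_bigr (fun=> 1)) => [|x _]; [rewrite big_const_seq iter_addr_0 count_predT natz | ring].
  by move: h1; rewrite e1 => /addrI <- => /eqP; rewrite eqz_nat => /eqP.
split=> //; have e2 : \sum_(x <- s) ((N%:Z - x.2) ^+ 2 - (N%:Z - x.2 - 1) ^+ 2) = (2 * N%:Z - 1) * n%:Z - 2 * \sum_(x <- s) x.2.
  rewrite -[in n%:Z]ss; move: (N%:Z) => M; elim: s {sN g h1 h2 ss} => [|x s' IH]; first by rewrite /= !big_nil; ring.
  by rewrite !big_cons IH /= intS; ring.
rewrite e2 in h2; move: h2; rewrite PoszM; move: (\sum_(x <- s) x.2) (\sum_i _) (\sum_(i < N) _) (\sum_(i in S) _)%N%:Z ((m ^ 2 * q)%N%:Z) ((2 * N%:Z - 1) * n%:Z); clear=> u v w y z a; lia.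
Qed.

Lemma valid_lam : valid (cword n lam).
Proof.
have [v vE v0] := specht_weight lamP st T0 TS.
exact: Ew_valid (size_cword n lam) vE v0.
Qed.

Lemma valid_ltN w : size w = n -> valid w -> all (fun x => x.2 < N%:Z) [seq (0%N, a) | a <- w].
Proof.
move=> sw /wd_onto/(_ sw)[t <-]; rewrite all_map; apply: sub_all (wd_bound t) => a /=; lia.
Qed.

Lemma goodw_map k w : valid w -> cnt w =1 k -> goodw k [seq (0%N, a) | a <- w].
Proof. by move=> vw ck; rewrite /goodw -map_comp map_id vw; apply/asboolP. Qed.

(** The squares of the beta-numbers determine the content sum by [good_sq]; raising the entries of S
    by m changes them by 2 m times their sum plus a constant. *)
Lemma good_ct S s : okS S -> all (fun x => x.2 < N%:Z) s -> goodw (kap S) s -> size s = n /\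
  \sum_(x <- s) x.2 = ctl + m%:Z * (dl S)%:Z.
Proof.
move=> oS sN g; have [ss h] := good_sq oS sN g; split=> //.
have [_] := good_sq okS0 (valid_ltN (size_cword n lam) valid_lam) (goodw_map valid_lam (fun a => esym (kap0 a))).
rewrite big_map /= -/ctl -h; have [-> _] := dlP oS; rewrite PoszD.
move: (\sum_(x <- s) x.2) ctl (\sum_(i in S) _)%N%:Z (dl S)%:Z m%:Z; clear=> u c y d mm; lia.
Qed.

(** Equal codes fix m times the degree plus r times the content sum. A content sum larger by m
    [dl S] therefore appears r [dl S] degrees lower. *)
Definition nu S d om : nat := if (r * dl S <= d)%N then #|[set xt : midx n (d - r * dl S) * wtT n | [&& incrb (tomi xt.1),
      bsorted (tomi xt.1) (wd xt.2) && (chi (tomi xt.1) b p (wd xt.2) == om),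
      valid (wd xt.2) & `[< cnt (wd xt.2) =1 kap S >]]]| else 0%N.

Lemma degree_rel S S1 s s1 d : okS S -> okS S1 ->
  all (fun x => x.2 < N%:Z) s -> all (fun x => x.2 < N%:Z) s1 -> goodw (kap S) s -> goodw (kap S1) s1 ->
  (forall x, x \in s -> 0 <= slot x) -> (forall x, x \in s1 -> 0 <= slot x) ->
  (\sum_(x <- s) n.+1 ^ `|slot x| = \sum_(x <- s1) n.+1 ^ `|slot x|)%N ->
  (\sum_(x <- s1) x.1 + r * dl S1 = d)%N -> size s = n /\ (\sum_(x <- s) x.1 + r * dl S = d)%N.
Proof.
move=> oS oS1 sN sN1 g g1 p0 p1 sumE dE.
have [ss cs] := good_ct oS sN g; have [ss1 cs1] := good_ct oS1 sN1 g1; split=> //.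
have pe : perm_eq [seq `|slot x|%N | x <- s] [seq `|slot x|%N | x <- s1].
  by apply: (@digits_inj n); rewrite ?size_map ?ss ?ss1 // !big_map.
have := slot_sum p0; rewrite (perm_big _ pe) (slot_sum p1) cs cs1 ss ss1 -dE.
set x1 := (\sum_(x <- s1) x.1)%N; set x := (\sum_(x <- s) x.1)%N => H.
have : m%:Z * (x1 + r * dl S1)%N%:Z = m%:Z * (x + r * dl S)%N%:Z.
  rewrite !PoszD !PoszM; apply/eqP; rewrite -subr_eq0; apply/eqP.
  move/eqP: H; rewrite -subr_eq0 => /eqP <-; ring.
by move/mulfI => h; apply/eqP; rewrite -eqz_nat; apply/eqP/esym/h; rewrite eqz_nat -lt0n.
Qed.

(** Compare, in [shift_gen], the coefficients of the monomial attached to one multiset of codes. By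
    [degree_rel] the codes fix the degree belonging to each S, so each coefficient is one of the
    counts. *)
Lemma nu_rel d om : (d <= D)%N -> \sum_(S | okS S) (-1) ^+ fS S * (nu S d om)%:Z = 0.
Proof.
move=> dD.
have [ex|no] := pselect (exists S1, okS S1 /\ (0 < nu S1 d om)%N); last first.
  rewrite big1 // => S oS; rewrite (_ : nu S d om = 0%N) ?mulr0 //.
  by apply/eqP; rewrite -leqn0 leqNgt; apply/negP => h; apply: no; exists S.
have [S1 [oS1]] := ex; rewrite /nu; case: ifP => // r1d; rewrite card_gt0 => /set0Pn[[x1 t1]].
rewrite inE /= => /and4P[_ /andP[_ /eqP ch1] v1 /asboolP c1].
have e1D : (d - r * dl S1 <= D)%N by apply: leq_trans dD; apply: leq_subr.
pose code0 := code m r (tomi x1) (wd t1); pose s1 := phi (tomi x1) (wd t1).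
have sc0 : size code0 = n by rewrite size_map size_enum_ord.
have wi1 (i : 'I_n) : `|(wd t1)`_i| <= n%:Z by apply: (allP (wd_bound t1)); rewrite mem_nth // size_wd.
have snd1 : map snd s1 = wd t1.
  rewrite -map_comp; apply: (@eq_from_nth _ 0) => [|i]; rewrite size_map size_enum_ord ?size_wd // => iN.
  by rewrite (nth_map (Ordinal n0)) ?size_enum_ord //= nth_enum_ord.
have sN1 : all (fun x => x.2 < N%:Z) s1.
  by apply/allP=> _ /mapP[i _ ->] /=; have := wi1 i; move: (wd t1)`_i => z; lia.
have g1 : goodw (kap S1) s1 by rewrite /goodw snd1 v1; apply/asboolP.
have p1 x : x \in s1 -> 0 <= slot x by move=> /mapP[i _ ->]; rewrite slot_abs.
have d1 : (\sum_(x <- s1) x.1 + r * dl S1 = d)%N.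
  rewrite big_map big_enum /=; have := mdg_tomi x1; rewrite /mdg => ->; exact: subnK.
have om0E : (\sum_(x <- s1) n.+1 ^ `|slot x| = \sum_(e <- code0) n.+1 ^ e)%N.
  by rewrite /code0 -phi_code ?wd_bound ?size_wd // big_map.
have hgood S s : okS S -> all (fun x => x.2 < N%:Z) s -> all (okc n m r E) s -> goodw (kap S) s ->
    (\sum_(x <- s) n.+1 ^ `|slot x|)%N = (\sum_(e <- code0) n.+1 ^ e)%N -> size s = n /\ (\sum_(x <- s) x.1 + r * dl S = d)%N.
  move=> oS sN /allP oks g sumE; apply: (degree_rel oS oS1 sN sN1 g g1 _ p1 _ d1); last by rewrite sumE.
  by move=> x /oks/andP[].
have hcode d' (x : midx n d') (t : wtT n) : (d' <= D)%N ->
    (chi (tomi x) b p (wd t) == om) = perm_eq (code m r (tomi x) (wd t)) code0.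
  move=> d'D; apply/eqP/idP => [h|h]; first by apply: sep; rewrite ?h ?ch1.
  by rewrite -ch1; apply: code_chi h; rewrite ?size_wd ?wd_bound.
have key S : okS S -> nu S d om = count (fun s => [&& goodw (kap S) s, all (okc n m r E) s &
    (\sum_(x <- s) n.+1 ^ `|slot x| == \sum_(e <- code0) n.+1 ^ e)%N]) (subsr (Lst N P C)).
  move=> oS; rewrite /nu; case: ifP => [rd|/negP nrd].
    apply: (pair_count n0 sc0 (D := D)) => //; rewrite ?leq_subr //.
    - exact: leq_trans (leq_subr _ _) dD.
    - by have := leq_mul m0 (leqnn D); move: (r * P)%N (r * n.*2)%N => u v; lia.
    - by lia.
    - by lia.
    - move=> s sN oks g sumE; have [ss <-] := hgood S s oS sN oks g sumE.
      by rewrite addnK.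
  apply/esym/eqP; rewrite -leqn0 leqNgt -has_count; apply/hasPn => s; rewrite subsr_Lst => /andP[_ /allP sL].
  apply/negP => /and3P[g oks /eqP sumE].
  have sN : all (fun x => x.2 < N%:Z) s by apply/allP => x /sL h; have := h : x \in Lst N P C; rewrite mem_Lst => /and3P[].
  by have [_ h] := hgood S s oS sN oks g sumE; apply: nrd; rewrite -h leq_addl.
have rel := @shift_gen n m r N P E rm r1 EN (ltn0Sn _) ga q fS q0 gaP fP.
have := congr1 (fun R : {poly int} => R`_(\sum_(e <- code0) n.+1 ^ e)%N) rel; rewrite coef_sum coef0 => relc.
rewrite -[RHS]relc; apply: eq_bigr => S oS; rewrite -[(-1) ^+ _ in RHS](rmorph_sign polyC) coefCM; congr (_ * _).
by rewrite Gen_coef -key.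
Qed.

Definition above (y : nat * srep K n) S := irr y.2 /\ exists w v, [/\ size w = n, v \in Ew y.2 w, v != 0 &
  ctl + m%:Z * (dl S)%:Z <= \sum_(x <- w) x].

(** The list holds the composition factors of the costandard module of the shape, shifted by r
    [dl S] degrees; f is the dimension of its weight space. Further factors only have larger content
    sums, by the Euler relation. *)
Lemma shape_list S : okS S -> exists f, (0 < f)%N /\ exists J, [/\ S = S0 -> List.In (0%N, W) J,
  forall y, List.In y J -> above y S &
  forall om q', qsel n b p D om q' -> forall d, (d <= D)%N -> Qsum b p q' d J = (f * nu S d om)%N].
Proof.
move=> oS; have /andP[_ /injectiveP inj] := oS.
have [U [w [v [iU sw vE [v0 cw US]]]]] : exists (U : srep K n) w (v : U),
    [/\ irr U, size w = n, v \in Ew U w & [/\ v != 0, cnt w =1 kap S & S = S0 -> List.In (0%N, W) [:: (0%N, U)]]].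
  have [->|ne] := eqVneq S S0.
    have [v vE v0] := specht_weight lamP st T0 TS.
    exists W, (cword n lam), v; split=> //; first exact: size_cword.
    by split=> //; [move=> a; rewrite kap0 | left].
  have sE : (\sum_i gS m ga S (fS S i) = \sum_(i < N) (N - 1 - i) + n)%N.
    by rewrite -(sum_gSE oS) [RHS](reindex_inj (@perm_inj _ (fS S))).
  have [mu muP muE] := gamma_partition (ltn0Sn _) (fP inj) sE.
  have [U [iU [v vE v0]]] := irr_with_cword K n0 muP.
  exists U, (cword n mu), v; split=> //; first exact: size_cword.
  by split=> // E'; rewrite E' eqxx in ne.
have vw := Ew_valid sw vE v0.
have [_] := good_ct oS (valid_ltN sw vw) (goodw_map vw cw); rewrite big_map /= => ctE.
exists (\dim (Ew U w)); split; first by rewrite lt0n dimv_eq0; apply: contraNneq v0 => E'; rewrite -memv0 -E'.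
have [fs [/List.Forall_forall fF fQ]] := JH p D (gsub_full b U) (gsub_Lg b U) (fun d f => @Lg_hom _ _ b U d f).
exists [seq ((r * dl S + x.1)%N, x.2) | x <- (0%N, U) :: fs]; split.
- move=> SE; have [[<-]|[]] := US SE; left; congr pair.
  by rewrite /= addn0 SE /dl subnn muln0.
- move=> y h; have [x [<-|/fF[ix _ _ xrel]] ->] := In_map h; rewrite /above /=.
    by split=> //; exists w, v; split=> //; rewrite ctE.
  split=> //; have [t _ [v' vE' v'0]] := irr_weight ix.
  exists (wd t), v'; split=> //; first exact: size_wd.
  have rel := xrel _ _ (fun u => irr_csum u iU sw vE v0) (fun u => irr_csum u ix (size_wd t) vE' v'0).
  have b0 : 0 < b by rewrite divr_gt0 ?ltr0n.
  by rewrite -ctE -(ler_int K) -(ler_pM2l b0) -rel lerDr ler0n.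
move=> om q' qs d dD; rewrite Qsum_shift /nu; case: ifP => [rd|_]; last by rewrite muln0.
have ed : (d - r * dl S <= D)%N by apply: leq_trans (leq_subr _ _) dD.
have [Qi _ _] := qs.
rewrite /Qsum big_cons /= subn0 -(fQ q' _ Qi ed) (dQ_full U qs ed).
exact: (wcount_irr b p _ om iU sw vE v0 cw).
Qed.
End NonRegularCase.

Section NonRegularZero.
Variables (K : numClosedFieldType) (n m r : nat) (lam : seq nat) (q : nat).
Hypothesis (lamP : is_partition n lam) (m0 : (0 < m)%N) (r1 : (0 < r)%N) (rm : (r < m)%N).
Hypothesis (n0 : (0 < n)%N) (q0 : (0 < q)%N) (mq : (m <= count_mem q lam)%N).
Variables (T : {vspace (reg K n)}) (st : @stable K n (reg K n) T).
Hypothesis (T0 : T != 0%VS) (TS : ((T : {vspace {ffun 'S_n -> K^o}}) <= specht K n lam)%VS) (irrW : irr (subrep st)).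
Local Notation W := (subrep st).
Local Notation b := (r%:R / m%:R : K).

Theorem nonregular_zero d (h : F W) : Lg b d h -> inv h -> h = 0.
Proof.
move=> Lh hi; apply/eqP/negPn/negP => h0.
(* The truncation degree is that of a supposed lowest invariant, so a single invariant has to be
   excluded. *)
have [D [g [_ lg]]] := lowest_ex Lh hi h0.
have [p sep] := code_sep K n r m0 D.
pose E := (m * D + r * n.*2)%N; pose N := (E + n + m).+1.
pose ga (i : 'I_N) := ngam m lam q i; pose S0 := [set i : 'I_N | (i < q)%N].
have /choice[fS fP] : forall S : {set 'I_N}, exists f : 'S_N, injective (gS m ga S) -> sdecr (fun i => gS m ga S (f i)).
  move=> S; have [inj|ninj] := pselect (injective (gS m ga S)); last by exists 1%g.
  by have [f fs] := sort_ex inj; exists f.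
pose ok S := @okS n m r lam q D S.
have fex S : exists f, ok S -> (0 < f)%N /\ exists J, [/\ S = S0 -> List.In (0%N, W) J,
    forall y, List.In y J -> @above K n m r lam q D y S &
    forall om q', qsel n b p D om q' -> forall d, (d <= D)%N -> Qsum b p q' d J = (f * @nu K n m r lam q D p fS S d om)%N].
  case: (boolP (ok S)) => [oS|_]; last by exists 0%N.
  by have [f fJ] := shape_list lamP m0 r1 rm n0 q0 mq T0 TS irrW p fP oS; exists f.
have {fex} /choice[f fE] := fex.
(* A common multiple of the weight-space dimensions: repeating the list of S by Fm / f S times gives
   every shape the same weight. *)
pose Fm := (\prod_(S | ok S) f S)%N.
have F0 : (0 < Fm)%N by rewrite prodn_cond_gt0 // => S /fE[].
have dvF S : ok S -> (f S %| Fm)%N by move=> oS; rewrite /Fm (bigD1 S) //= dvdn_mulr.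
have list_ex (l : seq {set 'I_N}) : (forall S, S \in l -> ok S) -> exists s : seq (nat * srep K n),
    [/\ S0 \in l -> List.In (0%N, W) s,
        forall y, List.In y s -> exists2 S, S \in l & @above K n m r lam q D y S &
        forall om q', qsel n b p D om q' -> forall d, (d <= D)%N ->
          Qsum b p q' d s = (Fm * \sum_(S <- l) @nu K n m r lam q D p fS S d om)%N].
  elim: l => [_|S l IH okl].
    by exists [::]; split=> // om q' _ d' _; rewrite /Qsum !big_nil muln0.
  have [s [s1 s2 s3]] := IH (fun S' Sl => okl S' (mem_behead (s := S :: l) Sl)).
  have oS := okl S (mem_head _ _); have [f0 [J [J1 J2 J3]]] := fE S oS.
  have [k kE] : exists k, (Fm %/ f S)%N = k.+1.
    by exists (Fm %/ f S).-1; rewrite prednK // divn_gt0 // dvdn_leq // dvF.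
  exists (flatten (nseq k.+1 J) ++ s); split.
  - rewrite inE => /orP[/eqP SE|/s1 h1]; apply: List.in_or_app; [left | by right].
    by apply: List.in_or_app; left; apply: J1.
  - move=> y h1; case: (List.in_app_or _ _ _ h1) => [h2|/s2[S' S'l yS]].
      by exists S; [apply: mem_head | apply: J2 (In_nseq h2)].
    by exists S'; rewrite // inE S'l orbT.
  move=> om q' qs d' d'D; rewrite Qsum_cat Qsum_nseq (J3 _ _ qs _ d'D) (s3 _ _ qs _ d'D) big_cons mulnDr.
  by rewrite mulnA -kE divnK ?dvF.
(* Signs are taken relative to S0, so [W] falls into the positive list; the signed relation then
   says that the two lists are balanced. *)
pose sg S := odd_perm (fS S) (+) odd_perm (fS S0).
have [s [s1 s2 s3]] := list_ex (enum [pred S | ok S && ~~ sg S]) (fun S => ltac:(by rewrite mem_enum => /andP[])).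
have [s' [_ s'2 s'3]] := list_ex (enum [pred S | ok S && sg S]) (fun S => ltac:(by rewrite mem_enum => /andP[])).
have bal : balanced b p D s s'.
  move=> om q' qs d' d'D; rewrite (s3 _ _ qs _ d'D) (s'3 _ _ qs _ d'D); congr (_ * _)%N.
  have := nu_rel lamP m0 r1 rm n0 q0 mq st T0 TS fP sep om d'D; rewrite -/ok => rel.
  have : \sum_(S | ok S) (-1) ^+ sg S * (@nu K n m r lam q D p fS S d' om)%:Z = 0.
    have := congr1 (fun z : int => (-1) ^+ fS S0 * z) rel; rewrite mulr0 mulr_sumr => relS.
    rewrite -[RHS]relS; apply: eq_bigr => S _.
    by rewrite mulrA /sg signr_addb [_ * (-1) ^+ fS S0]mulrC.
  rewrite (bigID sg) /= addrC => /eqP; rewrite addr_eq0 => /eqP.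
  rewrite (eq_bigr (fun S => (@nu K n m r lam q D p fS S d' om)%:Z)) => [|S /andP[_ /negPf ->]]; last by rewrite mul1r.
  rewrite [X in _ = - X](eq_bigr (fun S => - (@nu K n m r lam q D p fS S d' om)%:Z)) => [|S /andP[_ ->]]; last by rewrite expr1 mulN1r.
  rewrite sumrN opprK => eqZ; rewrite ![in LHS]big_enum ![in RHS]big_enum /=; apply/eqP; rewrite -eqz_nat; apply/eqP.
  have toZ (I : finType) (Q : pred I) (g' : I -> nat) : (\sum_(i | Q i) g' i)%N%:Z = \sum_(i | Q i) (g' i)%:Z.
    by rewrite -[LHS]natz natr_sum; apply: eq_bigr => i _; rewrite natz.
  by rewrite !toZ.
have ok0 : ok S0 by exact: (okS0 lamP m0 r1 rm n0 q0 mq T0 TS).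
have x0s : List.In (0%N, W) s by apply: s1; rewrite mem_enum inE ok0 /= /sg addbb.
have b0 : 0 < b by rewrite divr_gt0 ?ltr0n.
have sepall d1 d2 (x : midx n d1) (x' : midx n d2) (t t' : wtT n) : (d1 <= D)%N -> (d2 <= D)%N ->
    chi (tomi x) b p (wd t) = chi (tomi x') b p (wd t') -> forall p', chi (tomi x) b p' (wd t) = chi (tomi x') b p' (wd t').
  by move=> d1D d2D E' p'; apply: code_chi (sep _ _ _ _ _ _ d1D d2D E'); rewrite ?size_wd ?wd_bound.
have irs y : List.In y (s ++ s') -> irr y.2.
  by move=> h1; case: (List.in_app_or _ _ _ h1) => [/s2[S _ []]|/s'2[S _ []]].
(* Matching gives [W] a partner of equal content sum in the negative list, but there S differs from
   S0 and the content sum is strictly larger. *)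
have [y /s'2[S Sl [iy [w [v [sw vE v0 le]]]]] cs] := match_all (x := (0%N, W)) (lt0r_neq0 b0) sepall bal irs x0s lg (leqnn D).
move: Sl; rewrite mem_enum inE => /andP[oS sS].
have SS0 : S != S0 by apply: contraTneq sS => ->; rewrite /sg addbb.
have [_ /(_ SS0) dl0] := dlP lamP m0 r1 rm n0 q0 mq T0 TS oS.
have [v' vE' v'0] := specht_weight lamP st T0 TS.
have := cs _ _ (fun u => irr_csum u irrW (size_cword n lam) vE' v'0) (fun u => irr_csum u iy sw vE v0).
move/eqP; rewrite eqr_int => /eqP ctE; move: le; rewrite -ctE /ctl gerDl leNgt => /negP; apply.
by rewrite -PoszM ltz_nat muln_gt0 m0.
Qed.
End NonRegularZero.

Theorem corollary4p7 (R : realType) (n m r : nat) (lam : seq nat)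
    (L : lmodType (cherednik n (- (r%:R / m%:R) : R[i]))) :
  (2 <= m <= n)%N -> (1 <= r <= m - 1)%N -> gcdn r m = 1%N ->
  is_partition n lam ->
  irreducible_quotient (standard_module n lam (- (r%:R / m%:R) : R[i])) L ->
  (aspherical L <-> ~~ m_regular m lam) /\
  (aspherical L <-> exists2 k : nat, (0 < k)%N & (m <= count_mem k lam)%N).
Proof.
move=> /andP[m2 mn] /andP[r1 rm'] co lamP [L_irr [f f_surj]].
have m0 : (0 < m)%N by apply: leq_trans m2.
have n0 : (0 < n)%N by apply: leq_trans mn.
have rm : (r < m)%N by rewrite -(subnK m0) addn1 ltnS.
have reg : ~~ m_regular m lam <-> exists2 k : nat, (0 < k)%N & (m <= count_mem k lam)%N.
  split=> [/allPn[k _]|[k k0 mk]].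
    by rewrite negb_or -lt0n -leqNgt => /andP[k0 mk]; exists k.
  apply/allPn; exists k; last by rewrite negb_or -lt0n k0 -leqNgt.
  by rewrite -has_pred1 has_count; apply: leq_trans mk.
have [T [st [TS T0 irrW asp]]] := link n0 L_irr f_surj.
suff main : aspherical L <-> ~~ m_regular m lam by split; [|rewrite main].
rewrite asp; split=> [zero|/reg[q q0 mq] d h].
  by apply/negP => lamR; apply: (regular_nonzero lamP m2 r1 rm (introT eqP co) n0 lamR T0 TS irrW zero).
exact: (nonregular_zero lamP m0 r1 rm n0 q0 mq T0 TS irrW).
Qed.
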